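(* Let $p>2$. Let $(\lambda_k)_k$ be a sequence of positive numbers $\lambda_k\le1$ such that $\lambda_k\to0$ as $k\to\infty$. Moreover, let $u_k\in H^+$ be a positive least energy solution of $$-\Delta u-\frac{1}{\lambda_k^2}[x_1\partial_{x_2}-x_2\partial_{x_1}]^2u+u=|u|^{p-2}u\ \text{ on }\mathbb{R}^2_+,\qquad u=0\ \text{ on }\partial\mathbb{R}^2_+,$$ and let $v_k\in H^+$ be defined by $v_k(x)=\lambda_k^{\frac{2}{p-2}}u_k(\lambda_kx)$. Then, after passing to a subsequence, we have $v_k\to v^*$ in $H^+$, where $v^*$ is a positive least energy solution of the problem $$-\Delta v^*-[x_1\partial_{x_2}-x_2\partial_{x_1}]^2v^*=|v^*|^{p-2}v^*\ \text{ on }\mathbb{R}^2_+,\qquad v^*=0\ \text{ on }\partial\mathbb{R}^2_+.$$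
   Context: All functions are real-valued. $\mathbb{R}^2_+:=\{x\in\mathbb{R}^2: x_1>0\}$, $\partial_\theta:=x_1\partial_{x_2}-x_2\partial_{x_1}$ (in the weak sense), and $$H^+:=\Big\{u\in H^1_0(\mathbb{R}^2_+):\ \int_{\mathbb{R}^2_+}|\partial_\theta u|^2\,dx<\infty\Big\}.$$ For $\lambda>0$ and $q\in\{0,1\}$, $H^+$ is endowed with the norm $\|u\|_{\lambda,q}$ given by $\|u\|_{\lambda,q}^2=\int_{\mathbb{R}^2_+}(|\nabla u|^2+\frac1{\lambda^2}|\partial_\theta u|^2+q\,u^2)\,dx$; all these norms are equivalent on $H^+$, and convergence in $H^+$ is with respect to any of them. (Weak) solutions $u\in H^+$ of $-\Delta u-\frac1{\lambda^2}\partial_\theta^2u+q\,u=|u|^{p-2}u$ on $\mathbb{R}^2_+$, $u=0$ on $\partial\mathbb{R}^2_+$, are the critical points of the $C^1$-functional $E^+_{\lambda}:H^+\to\mathbb{R}$, $E^+_{\lambda}(u):=\frac12\|u\|_{\lambda,q}^2-\frac1p\int_{\mathbb{R}^2_+}|u|^p\,dx$. A least energy solution is a minimizer of this functional within the class of nontrivial solutions of the problem. (The problem for $u_k$ is the case $q=1$, $\lambda=\lambda_k$; the problem for $v^*$ is the case $q=0$, $\lambda=1$.) *)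

(* Defs.v *)
From mathcomp Require Import all_boot all_order all_algebra.
From mathcomp Require Import all_classical all_reals all_analysis.

Set Implicit Arguments.
Unset Strict Implicit.
Unset Printing Implicit Defensive.

Import Order.TTheory GRing.Theory Num.Theory.
Import numFieldNormedType.Exports.

Local Open Scope classical_set_scope.
Local Open Scope ring_scope.

(* Sobolev functions on the half-plane are represented by Borel functions
   R * R -> R; only their values on the half-plane matter, up to null sets. *)

Notation lebesgue2 R := (@lebesgue_measure R \x @lebesgue_measure R)%E.

Definition half_plane (R : realType) : set (R * R) := [set x | 0 < x.1].

Definition e1 (R : realType) : R * R := (1, 0).
Definition e2 (R : realType) : R * R := (0, 1).
Arguments half_plane {R}.
Arguments e1 {R}.
Arguments e2 {R}.

Fixpoint class_C (R : realType) (n : nat) (f : R * R -> R) : Prop :=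
  continuous f /\
  if n is m.+1 then
    (forall x, derivable f x e1 /\ derivable f x e2) /\
    class_C m ('D_e1 f) /\ class_C m ('D_e2 f)
  else True.

Definition test_function (R : realType) (phi : R * R -> R) : Prop :=
  (forall n, class_C n phi) /\
  exists K : set (R * R),
    [/\ compact K, K `<=` half_plane & forall x, ~ K x -> phi x = 0].

Definition locally_integrable2 (R : realType) (f : R * R -> R) : Prop :=
  measurable_fun half_plane f /\
  forall K : set (R * R), compact K -> K `<=` half_plane ->
    (lebesgue2 R).-integrable K (EFin \o f).

Definition is_weak_derivative (R : realType) (v : R * R)
    (u g : R * R -> R) : Prop :=
  [/\ locally_integrable2 u, locally_integrable2 g &
   forall phi, test_function phi ->
     \int[lebesgue2 R]_(x in half_plane) (u x * 'D_v phi x) =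
     - \int[lebesgue2 R]_(x in half_plane) (g x * phi x)].

(* A chosen representative (0 if there is none); it is unique up to null
   sets. *)
Definition weak_derivative (R : realType) (v : R * R) (u : R * R -> R) :
    R * R -> R :=
  xget (cst 0) [set g | is_weak_derivative v u g].

Definition weakly_derivable (R : realType) (v : R * R)
    (u : R * R -> R) : Prop :=
  exists g, is_weak_derivative v u g.

Definition dtheta (R : realType) (u : R * R -> R) : R * R -> R :=
  fun x => x.1 * weak_derivative e2 u x - x.2 * weak_derivative e1 u x.

Definition square_integrable (R : realType) (f : R * R -> R) : Prop :=
  measurable_fun half_plane f /\
  (\int[lebesgue2 R]_(x in half_plane) (f x ^+ 2)%:E < +oo)%E.

Definition H1 (R : realType) : set (R * R -> R) :=
  [set u | [/\ square_integrable u,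
     weakly_derivable e1 u, weakly_derivable e2 u,
     square_integrable (weak_derivative e1 u) &
     square_integrable (weak_derivative e2 u)]].

Definition H1_norm (R : realType) (u : R * R -> R) : R :=
  Num.sqrt (\int[lebesgue2 R]_(x in half_plane)
    (u x ^+ 2 + weak_derivative e1 u x ^+ 2 + weak_derivative e2 u x ^+ 2)).

Definition H10 (R : realType) : set (R * R -> R) :=
  [set u | H1 u /\
     forall e : R, 0 < e ->
       exists2 phi, test_function phi & H1_norm (u \- phi) < e].

Definition Hplus (R : realType) : set (R * R -> R) :=
  [set u | H10 u /\
     (\int[lebesgue2 R]_(x in half_plane) (dtheta u x ^+ 2)%:E < +oo)%E].

(* The real-valued integrals below are meaningful for u in Hplus, where they
   are finite. *)

Definition Hplus_norm (R : realType) (lambda : R) (q : bool)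
    (u : R * R -> R) : R :=
  Num.sqrt (\int[lebesgue2 R]_(x in half_plane)
    (weak_derivative e1 u x ^+ 2 + weak_derivative e2 u x ^+ 2
     + (lambda ^+ 2)^-1 * dtheta u x ^+ 2 + q%:R * u x ^+ 2)).

Definition Hplus_cvg (R : realType) (w : nat -> R * R -> R)
    (v : R * R -> R) : Prop :=
  [/\ forall k, Hplus (w k), Hplus v &
   forall (lambda : R) (q : bool), 0 < lambda ->
     Hplus_norm lambda q (w k \- v) @[k --> \oo] --> (0 : R)].

Definition energy (R : realType) (p lambda : R) (q : bool)
    (u : R * R -> R) : R :=
  2^-1 * Hplus_norm lambda q u ^+ 2
  - p^-1 * \int[lebesgue2 R]_(x in half_plane) (`|u x| `^ p).

(* The Frechet derivative of the functional on Hplus exists at u and is 0. *)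
Definition critical_point (R : realType) (p lambda : R) (q : bool)
    (u : R * R -> R) : Prop :=
  forall e : R, 0 < e -> exists2 d : R, 0 < d &
    forall h, Hplus h -> Hplus_norm lambda q h < d ->
      `|energy p lambda q (u \+ h) - energy p lambda q u|
        <= e * Hplus_norm lambda q h.

(* Weak solutions of
   - Delta u - lambda^-2 dtheta^2 u + q u = |u|^(p-2) u, u = 0 on the boundary *)
Definition solution (R : realType) (p lambda : R) (q : bool)
    (u : R * R -> R) : Prop :=
  Hplus u /\ critical_point p lambda q u.

Definition nontrivial (R : realType) (u : R * R -> R) : Prop :=
  ~ {ae lebesgue2 R, forall x, half_plane x -> u x = 0}.

Definition least_energy_solution (R : realType) (p lambda : R) (q : bool)
    (u : R * R -> R) : Prop :=
  [/\ solution p lambda q u, nontrivial u &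
   forall w, solution p lambda q w -> nontrivial w ->
     energy p lambda q u <= energy p lambda q w].

Definition positive_ae (R : realType) (u : R * R -> R) : Prop :=
  {ae lebesgue2 R, forall x, half_plane x -> 0 < u x}.

Definition rescale (R : realType) (p lambda : R) (u : R * R -> R) :
    R * R -> R :=
  fun x => lambda `^ (2 / (p - 2)) * u (lambda * x.1, lambda * x.2).

(* Main.v *)
(* A least energy solution is, up to a factor, a minimizer of the quadratic part
   of the energy on the unit sphere of L^p: minimizers are solutions, and every
   solution lies on the Nehari set, where the energy is a function of the L^p
   norm.  The rescaling turns u_k into a minimizer, up to a factor, of the form
   int |grad w|^2 + |dtheta w|^2 + lambda_k^2 w^2.  Its infimum tends to the
   infimum of the form without the last term, so the normalized v_k are a
   minimizing sequence for the limit problem.  Rotation by pi maps the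
   half-plane off itself, whence the Poincare inequality
   |u|_2 <= pi |dtheta u|_2; rotations by small angles move a small square far
   from the origin through many disjoint positions, whence H^+ embeds compactly
   into L^p.  With the parallelogram identity this makes minimizing sequences
   converge strongly.  A nonnegative minimizer v satisfies
   <v, h> >= 0 for h >= 0; testing with h = eta^2 exp(-G(k v)), where G grows
   logarithmically, bounds the oscillation of G(k v) on squares uniformly in
   k, which is impossible if both {v = 0} and {v > 0} have positive measure. *)
Require Import Defs.
From HB Require Import structures.
From mathcomp Require Import all_boot all_order all_algebra.
From mathcomp Require Import all_classical all_reals all_analysis.
From mathcomp Require Import measurable_realfun zify ring lra.
Import Order.TTheory GRing.Theory Num.Theory.
Import numFieldNormedType.Exports.
Local Open Scope classical_set_scope.
Local Open Scope ring_scope.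

Set Implicit Arguments.
Unset Strict Implicit.
Unset Printing Implicit Defensive.

(** Three obstacles shape the development. First, [weak_derivative] is only a chosen representative
    and [dtheta] has unbounded coefficients, so neither linearity nor density of test functions in
    the norm of H^+ is immediate. Both follow from a closure principle: L^2 limits of the four
    components of test functions are the components of an element of H^+. Density comes from a
    cutoff depending on |x| alone, which commutes with the angular derivative. Estimates are then
    proved for test functions by one-variable calculus and passed to the limit. Second, a solution
    is defined by a vanishing Frechet derivative, yet the L^p norm is never differentiated:
    minimality bounds the energy from below to first order, and convexity of the p-th power bounds
    its second difference from above. Third, positivity concerns a mere element of H^+, for which
    neither continuity nor a strong maximum principle is at hand. The exponent p is any real number
    above 2, so Sobolev inequalities are proved for even integers and p is squeezed between 2 and
    one of them. *)

(* Sealed: conversion tests between such terms would otherwise unfold the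
   Lebesgue integral. *)
HB.lock Definition ip {d : measure_display} {T : measurableType d}
    {R : realType} (mu : {measure set T -> \bar R}) (D : set T) (f g : T -> R) : R :=
  \int[mu]_(x in D) (f x * g x).

(** * Inner product and seminorm of L^2 on a measurable set *)

Section L2.
Context {d : measure_display} {T : measurableType d} {R : realType}.
Variables (mu : {measure set T -> \bar R}) (D : set T).
Hypothesis mD : measurable D.
Implicit Types f g h : T -> R.

Definition L2 f := measurable_fun D f /\
  (\int[mu]_(x in D) ((f x) ^+ 2)%:E < +oo)%E.

Local Notation ip := (ip mu D).
Definition nsq f := ip f f.

Lemma ipE f g : ip f g = \int[mu]_(x in D) (f x * g x).
Proof. by rewrite ip.unlock. Qed.

Lemma L2_measurable f : L2 f -> measurable_fun D f. Proof. by case. Qed.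

Lemma L2_integrable2 f : L2 f -> mu.-integrable D (EFin \o (fun x => f x ^+ 2)).
Proof.
move=> [mf fi]; apply/integrableP; split.
  by apply/measurable_EFinP; exact: measurable_funX.
rewrite (eq_integral (fun x => ((f x) ^+ 2)%:E))// => x _ /=.
by rewrite ger0_norm// sqr_ge0.
Qed.

Lemma L2_integrable f g : L2 f -> L2 g ->
  mu.-integrable D (EFin \o (fun x => f x * g x)).
Proof.
move=> f2 g2.
have := integrableD mD (L2_integrable2 f2) (L2_integrable2 g2).
apply: le_integrable => //.
  apply/measurable_EFinP; apply: measurable_funM; exact: L2_measurable.
move=> x _ /=; rewrite lee_fin.
rewrite [leRHS]ger0_norm ?addr_ge0 ?sqr_ge0// normrM.
rewrite -(real_normK (num_real (f x))) -(real_normK (num_real (g x))).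
by have := sqr_ge0 (`|f x| - `|g x|); have := normr_ge0 (f x); have := normr_ge0 (g x); nra.
Qed.

Lemma L2_dom f (g : T -> R) : measurable_fun D g -> L2 f ->
  (forall x, D x -> `|g x| <= `|f x|) -> L2 g.
Proof.
move=> mg [mf fi] gf; split => //; apply: le_lt_trans fi.
apply: ge0_le_integral => //.
- by move=> x _; rewrite lee_fin sqr_ge0.
- by apply/measurable_EFinP; exact: measurable_funX.
- by apply/measurable_EFinP; exact: measurable_funX.
- move=> x Dx; rewrite lee_fin -(real_normK (num_real (f x))) -(real_normK (num_real (g x))).
  by rewrite ler_sqr ?nnegrE//; exact: gf.
Qed.

Lemma L2Z c f : L2 f -> L2 (fun x => c * f x).
Proof.
move=> f2; split; first by apply: measurable_funM => //; case: f2.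
have /integrableP[_] := integrableZl mD (c ^+ 2) (L2_integrable2 f2).
rewrite (eq_integral (fun x => ((c * f x) ^+ 2)%:E))// => x _ /=.
by rewrite ger0_norm ?exprMn// mulr_ge0 ?sqr_ge0.
Qed.

Lemma L2D f g : L2 f -> L2 g -> L2 (fun x => f x + g x).
Proof.
move=> f2 g2; split; first by apply: measurable_funD; exact: L2_measurable.
have /integrableP[_] := integrableD mD (L2_integrable2 (L2Z 2 f2)) (L2_integrable2 (L2Z 2 g2)).
apply: le_lt_trans; apply: ge0_le_integral => //.
- by move=> x _; rewrite lee_fin sqr_ge0.
- apply/measurable_EFinP/measurable_funX/measurable_funD; exact: L2_measurable.
- apply: measurableT_comp => //; apply/measurable_EFinP/measurable_funD;
  by apply/measurable_funX/measurable_funM => //; exact: L2_measurable.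
- move=> x _ /=; rewrite lee_fin ger0_norm ?addr_ge0 ?sqr_ge0//.
  by have := sqr_ge0 (f x - g x); nra.
Qed.

Lemma L2N f : L2 f -> L2 (fun x => - f x).
Proof. by move=> /(L2Z (-1)); under eq_fun do rewrite mulN1r. Qed.

Lemma L2B f g : L2 f -> L2 g -> L2 (fun x => f x - g x).
Proof. by move=> f2 g2; apply: L2D => //; exact: L2N. Qed.

Lemma L2_0 : L2 (fun=> 0).
Proof.
split; first exact: measurable_cst.
by rewrite integral0_eq// => x _; rewrite expr0n.
Qed.

Lemma ipC f g : ip f g = ip g f.
Proof. by rewrite !ipE; apply: eq_Rintegral => x _; rewrite mulrC. Qed.

Lemma ipDl f g h : L2 f -> L2 g -> L2 h ->
  ip (fun x => f x + g x) h = ip f h + ip g h.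
Proof.
move=> f2 g2 h2; rewrite !ipE -RintegralD//; try exact: L2_integrable.
by apply: eq_Rintegral => x _; rewrite mulrDl.
Qed.

Lemma ipDr f g h : L2 f -> L2 g -> L2 h ->
  ip h (fun x => f x + g x) = ip h f + ip h g.
Proof. by move=> *; rewrite ipC ipDl// ipC (ipC g). Qed.

Lemma ipZl c f h : L2 f -> L2 h -> ip (fun x => c * f x) h = c * ip f h.
Proof.
move=> f2 h2; rewrite !ipE -RintegralZl//; last exact: L2_integrable.
by apply: eq_Rintegral => x _; rewrite mulrA.
Qed.

Lemma ipZr c f h : L2 f -> L2 h -> ip h (fun x => c * f x) = c * ip h f.
Proof. by move=> *; rewrite ipC ipZl// ipC. Qed.

Lemma nsq_ge0 f : 0 <= nsq f.
Proof. by rewrite /nsq ipE; apply: Rintegral_ge0 => x _; rewrite -expr2 sqr_ge0. Qed.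

Lemma nsqE f : L2 f -> (nsq f)%:E = (\int[mu]_(x in D) ((f x) ^+ 2)%:E)%E.
Proof.
move=> f2; rewrite /nsq ipE /Rintegral fineK.
  by apply: eq_integral => x _; rewrite expr2.
exact: integrable_fin_num (L2_integrable f2 f2).
Qed.

Lemma nsqZ c f : L2 f -> nsq (fun x => c * f x) = c ^+ 2 * nsq f.
Proof. by move=> f2; rewrite /nsq ipZl ?ipZr// ?mulrA//; exact: L2Z. Qed.

Lemma nsqD f g : L2 f -> L2 g ->
  nsq (fun x => f x + g x) = nsq f + 2 * ip f g + nsq g.
Proof.
move=> f2 g2; rewrite /nsq ipDl ?ipDr//; last exact: L2D.
by rewrite (ipC g f); lra.
Qed.

Lemma nsqB f g : L2 f -> L2 g ->
  nsq (fun x => f x - g x) = nsq f - 2 * ip f g + nsq g.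
Proof.
move=> f2 g2; have g2N := L2Z (-1) g2.
transitivity (nsq (fun x => f x + (-1) * g x)).
  by congr nsq; apply/funext => x; lra.
by rewrite nsqD// ipZr// nsqZ//; lra.
Qed.

Lemma nsqD_le f g : L2 f -> L2 g ->
  nsq (fun x => f x + g x) <= 2 * nsq f + 2 * nsq g.
Proof.
move=> f2 g2; have := nsq_ge0 (fun x => f x - g x).
by rewrite (nsqD f2 g2) (nsqB f2 g2); lra.
Qed.

Lemma nsq_le f g : L2 f -> L2 g -> (forall x, D x -> `|f x| <= `|g x|) ->
  nsq f <= nsq g.
Proof.
move=> f2 g2 fg; rewrite /nsq !ipE; apply: le_Rintegral => //; try exact: L2_integrable.
move=> x Dx; rewrite -!expr2 -(real_normK (num_real (f x))) -(real_normK (num_real (g x))).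
by rewrite ler_sqr ?nnegrE//; exact: fg.
Qed.

Lemma ip_CS f g : L2 f -> L2 g -> ip f g ^+ 2 <= nsq f * nsq g.
Proof.
move=> f2 g2.
have H t : 0 <= nsq f + 2 * t * ip f g + t ^+ 2 * nsq g.
  have := nsq_ge0 (fun x => f x + t * g x).
  by rewrite nsqD ?ipZr ?nsqZ//; [lra|exact: L2Z].
have [g0|g0] := eqVneq (nsq g) 0.
  rewrite g0 mulr0; have [->|i0] := eqVneq (ip f g) 0; first by rewrite expr0n.
  (* With [nsq g = 0] the quadratic is affine in [t]; this [t] gives it the value -1. *)
  have := H (- (nsq f + 1) / (2 * ip f g)); rewrite g0 mulr0 addr0.
  suff -> : 2 * (- (nsq f + 1) / (2 * ip f g)) * ip f g = - (nsq f + 1) by lra.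
  by field.
have gp : 0 < nsq g by rewrite lt0r g0 nsq_ge0.
have := H (- ip f g / nsq g).
suff -> : nsq f + 2 * (- ip f g / nsq g) * ip f g + (- ip f g / nsq g) ^+ 2 * nsq g =
  (nsq f * nsq g - ip f g ^+ 2) / nsq g by rewrite pmulr_lge0 ?invr_gt0// subr_ge0.
by field.
Qed.

Lemma ip_le f g : L2 f -> L2 g -> `|ip f g| <= Num.sqrt (nsq f) * Num.sqrt (nsq g).
Proof.
move=> f2 g2; rewrite -sqrtrM ?nsq_ge0// -sqrtr_sqr ler_sqrt//.
  exact: ip_CS.
by rewrite mulr_ge0// nsq_ge0.
Qed.

Lemma ae_eq_ip f f' g g' : L2 f -> L2 f' -> L2 g -> L2 g' ->
  {ae mu, forall x, D x -> f x = f' x} -> {ae mu, forall x, D x -> g x = g' x} ->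
  ip f g = ip f' g'.
Proof.
move=> f2 f2' g2 g2' ff' gg'; rewrite !ipE /Rintegral; congr fine.
apply: ae_eq_integral => //.
- by apply/measurable_EFinP/measurable_funM; exact: L2_measurable.
- by apply/measurable_EFinP/measurable_funM; exact: L2_measurable.
- move: ff' gg'; apply: filterS2 => x ff' gg' Dx /=.
  by rewrite ff' ?gg'.
Qed.

Lemma ae0_nsq f : L2 f -> {ae mu, forall x, D x -> f x = 0} -> nsq f = 0.
Proof.
move=> f2 f0; rewrite /nsq (@ae_eq_ip _ (fun=> 0) _ (fun=> 0))//; try exact: L2_0.
by rewrite ipE; under eq_Rintegral do rewrite mul0r; rewrite /Rintegral integral0.
Qed.

Lemma Rintegral_sqr f : \int[mu]_(x in D) (f x ^+ 2) = nsq f.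
Proof. by rewrite /nsq ipE; apply: eq_Rintegral => x _; rewrite expr2. Qed.

Lemma Rintegral_add_sqr (h : T -> R) f c : mu.-integrable D (EFin \o h) -> L2 f ->
  mu.-integrable D (EFin \o (fun x => h x + c * f x ^+ 2)) /\
  \int[mu]_(x in D) (h x + c * f x ^+ 2) = \int[mu]_(x in D) h x + c * nsq f.
Proof.
move=> ih f2; have i2 := L2_integrable2 f2; have ic := integrableZl mD c i2.
split; first exact: (integrableD mD ih ic).
rewrite (RintegralD mD ih ic); congr (_ + _).
by rewrite RintegralZl// Rintegral_sqr.
Qed.

Lemma Rintegral_sqr3 f1 f2 f3 : L2 f1 -> L2 f2 -> L2 f3 ->
  \int[mu]_(x in D) (f1 x ^+ 2 + f2 x ^+ 2 + f3 x ^+ 2) = nsq f1 + nsq f2 + nsq f3.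
Proof.
move=> l1 l2 l3; have [i2 e2] := Rintegral_add_sqr 1 (L2_integrable2 l1) l2.
have [i3 e3] := Rintegral_add_sqr 1 i2 l3.
rewrite Rintegral_sqr mul1r in e2; rewrite e2 mul1r in e3.
by rewrite -e3; apply: eq_Rintegral => x _; rewrite !mul1r.
Qed.

Lemma nsqBC f g : nsq (fun x => f x - g x) = nsq (fun x => g x - f x).
Proof. by rewrite /nsq !ipE; apply: eq_Rintegral => x _; ring. Qed.

Lemma Rintegral_sqr4 f1 f2 f3 f4 b c : L2 f1 -> L2 f2 -> L2 f3 -> L2 f4 ->
  \int[mu]_(x in D) (f1 x ^+ 2 + f2 x ^+ 2 + b * f3 x ^+ 2 + c * f4 x ^+ 2) =
  nsq f1 + nsq f2 + b * nsq f3 + c * nsq f4.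
Proof.
move=> l1 l2 l3 l4; have [i2 e2] := Rintegral_add_sqr 1 (L2_integrable2 l1) l2.
have [i3 e3] := Rintegral_add_sqr b i2 l3; have [i4 e4] := Rintegral_add_sqr c i3 l4.
rewrite Rintegral_sqr mul1r in e2; rewrite e2 in e3; rewrite e3 in e4.
by rewrite -e4; apply: eq_Rintegral => x _; rewrite mul1r.
Qed.

(** The series of [4 ^ n * h n ^ 2] has integral at most the sum of [4 ^ n * 8 ^- n], that is 2. Its
    sum is therefore finite almost everywhere, and the root of the sum serves as [C]. This turns
    fast L^2 convergence into pointwise convergence. *)
Lemma rapid_ae (h : nat -> T -> R) :
  (forall n, L2 (h n)) -> (forall n, nsq (h n) <= (8^-1) ^+ n) ->
  {ae mu, forall x, D x -> exists C, forall n, `|h n x| <= C * (2^-1) ^+ n}.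
Proof.
move=> h2 h8.
pose s n x := ((4 ^+ n * h n x ^+ 2)%:E : \bar R).
have ms n : measurable_fun D (s n).
  by apply/measurable_EFinP/measurable_funM => //; apply/measurable_funX/L2_measurable.
have s0 n x : D x -> (0 <= s n x)%E by move=> _; rewrite lee_fin mulr_ge0 ?sqr_ge0 ?exprn_ge0.
pose S x := (\big[+%E/0%R]_(0 <= n <oo) s n x)%E.
have mS : measurable_fun D S by apply: ge0_emeasurable_sum => // n x Dx _; exact: s0.
have iS : mu.-integrable D S.
  apply/integrableP; split => //.
  rewrite (eq_integral S); last first.
    move=> x /set_mem Dx; rewrite gee0_abs//; apply: nneseries_ge0 => n _ _; exact: s0.
  rewrite integral_nneseries//.
  apply: (@le_lt_trans _ _ (\big[+%E/0%R]_(0 <= n <oo) (((2^-1 : R) ^+ n)%:E))%E).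
    apply: lee_nneseries => [n _ _|n _].
      by apply: integral_ge0 => x Dx; exact: s0.
    rewrite /s; under eq_integral do rewrite EFinM.
    rewrite ge0_integralZl_EFin//; last 2 first.
      by move=> x _; rewrite lee_fin sqr_ge0.
      by apply/measurable_EFinP/measurable_funX/L2_measurable.
    rewrite -nsqE// -EFinM lee_fin.
    have -> : (2^-1 : R) ^+ n = 4 ^+ n * 8^-1 ^+ n by rewrite -exprMn; congr (_ ^+ _); lra.
    by apply: ler_pM => //; rewrite ?nsq_ge0// exprn_ge0.
  have -> : (\big[+%E/0%R]_(0 <= n <oo) (((2^-1 : R) ^+ n)%:E))%E = (2%:R)%:E.
    apply/cvg_lim => //.
    rewrite (_ : (fun n : nat => _) = EFin \o series (geometric 1 (2^-1 : R))); last first.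
      apply/funext => n /=; rewrite /series /= sumEFin; congr EFin.
      by apply: eq_bigr => i _; rewrite mul1r.
    apply/cvg_EFin; first by near=> n.
    have := @cvg_geometric_series R 1 2^-1; rewrite ger0_norm//.
    rewrite (_ : 1 - 2^-1 = 2^-1); last lra.
    by rewrite div1r invrK; apply; lra.
  by rewrite ltry.
have := integrable_ae mD iS; apply: filterS => x /= Sfin Dx.
exists (Num.sqrt (fine (S x))) => n.
have H : (s n x <= S x)%E.
  have := nneseries_lim_ge (u_ := s ^~ x) (P := xpredT) (m := 0) n.+1.
  rewrite big_nat_recr//= => H; apply: le_trans (H _); last by move=> *; exact: s0.
  by rewrite leeDr// sume_ge0// => i _; exact: s0.
have : 4 ^+ n * h n x ^+ 2 <= fine (S x) by rewrite -lee_fin fineK//; exact: Sfin.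
move=> H2.
have -> : `|h n x| = Num.sqrt (4 ^+ n * h n x ^+ 2) * 2^-1 ^+ n.
  rewrite sqrtrM ?exprn_ge0// sqrtr_sqr mulrAC.
  have -> : (4:R) ^+ n = (2 ^+ n) ^+ 2 by rewrite -exprM mulnC exprM; congr (_ ^+ _); rewrite expr2; lra.
  rewrite sqrtr_sqr [X in _ = X * _ * _]ger0_norm ?exprn_ge0// exprVn mulfV ?mul1r//.
by apply: ler_wpM2r; rewrite ?exprn_ge0 ?ler_wsqrtr.
Unshelve. all: by end_near. Qed.


End L2.

HB.lock Definition pnp {d : measure_display} {T : measurableType d}
    {R : realType} (mu : {measure set T -> \bar R}) (D : set T) (p : R) (f : T -> R) : R :=
  \int[mu]_(x in D) (`|f x| `^ p).

HB.lock Definition pn {d : measure_display} {T : measurableType d}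
    {R : realType} (mu : {measure set T -> \bar R}) (D : set T) (p : R) (f : T -> R) : R :=
  pnp mu D p f `^ p^-1.

(** * Completeness of L^2, almost everywhere limits, and L^p norms *)

Section L2Convergence.
Context {d : measure_display} {T : measurableType d} {R : realType}.
Variables (mu : {measure set T -> \bar R}) (D : set T).
Hypothesis mD : measurable D.
Implicit Types f g h : T -> R.

Local Notation L2 := (L2 mu D).
Local Notation ip := (ip mu D).
Local Notation nsq := (nsq mu D).

(** Almost everywhere the lower limit of [F n] is [G], so Fatou's lemma applies. The integral of [G]
    is extended-real: its finiteness is part of the conclusion. *)
Lemma fatou_le (F : nat -> T -> R) (G : T -> R) (C : R) :
  (forall n, measurable_fun D (F n)) -> measurable_fun D G ->
  (forall n x, D x -> 0 <= F n x) ->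
  {ae mu, forall x, D x -> F n x @[n --> \oo] --> G x} ->
  (forall n, (\int[mu]_(x in D) (F n x)%:E <= C%:E)%E) ->
  (\int[mu]_(x in D) (G x)%:E <= C%:E)%E.
Proof.
move=> mF mG F0 FG FC.
have mF' n : measurable_fun D (EFin \o F n) by apply/measurable_EFinP.
have mL : measurable_fun D (fun x => limn_einf (fun n => (F n x)%:E)).
  apply: (emeasurable_fun_cvg _ _ (measurable_fun_einfs mF')) => x _.
  rewrite limn_einf_lim; apply: ereal_nondecreasing_is_cvgn; exact: nondecreasing_einfs.
rewrite (ae_eq_integral (fun x => limn_einf (fun n => (F n x)%:E)))//.
- apply: (le_trans (fatou mu mD mF' _)); first by move=> n x Dx /=; rewrite lee_fin F0.
  rewrite limn_einf_lim; apply: lime_le.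
    apply: ereal_nondecreasing_is_cvgn; exact: nondecreasing_einfs.
  apply: nearW => n; apply: (le_trans _ (FC n)); apply: ereal_inf_lbound; exists n => //=.
- exact/measurable_EFinP.
- move: FG; apply: filterS => x /= H Dx.
  have /cvg_limn_einf_sup[-> _] : (F n x)%:E @[n --> \oo] --> (G x)%:E.
    by apply: cvg_EFin; [near=> n|exact: H].
  by [].
Unshelve. all: by end_near. Qed.

Lemma nsq_fatou (f : nat -> T -> R) g (C : R) :
  (forall n, L2 (f n)) -> measurable_fun D g ->
  {ae mu, forall x, D x -> f n x @[n --> \oo] --> g x} ->
  (forall n, nsq (f n) <= C) -> L2 g /\ nsq g <= C.
Proof.
move=> f2 mg fg fC.
have H : (\int[mu]_(x in D) (g x ^+ 2)%:E <= C%:E)%E.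
  apply: (@fatou_le (fun n x => f n x ^+ 2)).
  - by move=> n; apply/measurable_funX/L2_measurable.
  - exact: measurable_funX.
  - by move=> n x _; exact: sqr_ge0.
  - by move: fg; apply: filterS => x H Dx; under eq_fun do rewrite expr2; rewrite expr2; apply: cvgM; exact: H.
  - by move=> n; rewrite -nsqE// lee_fin.
have g2 : L2 g by split => //; apply: le_lt_trans H _; rewrite ltry.
by split => //; rewrite -lee_fin nsqE.
Qed.

(** Indices with squared error at most [8 ^- n] are selected so that [rapid_ae] applies. The bound
    [n <= s n] is what later carries other limits along [s], by [cvg_sub]. *)
Lemma L2_subseq_ae (f : nat -> T -> R) g : (forall n, L2 (f n)) -> L2 g ->
  nsq (fun x => f n x - g x) @[n --> \oo] --> (0 : R) ->
  exists2 s : nat -> nat, (forall n, (n <= s n)%N) &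
    {ae mu, forall x, D x -> f (s n) x @[n --> \oo] --> g x}.
Proof.
move=> f2 g2 fg.
have H n : exists m, (n <= m)%N /\ nsq (fun x => f m x - g x) <= (8^-1) ^+ n.
  have /cvgrPdist_le /(_ ((8^-1) ^+ n)) := fg.
  move=> /(_ (exprn_gt0 _ _)) []; first by rewrite invr_gt0.
  move=> N _ /(_ (maxn n N)) /=; rewrite leq_maxr => /(_ isT).
  by rewrite sub0r normrN ger0_norm ?nsq_ge0// => K; exists (maxn n N); rewrite leq_maxl.
have [s sP] := choice H.
exists s; first by move=> n; have [] := sP n.
have := @rapid_ae _ _ _ mu D mD (fun n x => f (s n) x - g x) (fun n => L2B mD (f2 _) g2) (fun n => (sP n).2).
apply: filterS => x K Dx; have [C CP] := K Dx.
apply/cvgrPdist_le => e e0.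
have : C * (2^-1) ^+ n @[n --> \oo] --> C * (0:R).
  by apply: cvgM; [exact: cvg_cst|apply: cvg_expr; rewrite ger0_norm//; lra].
rewrite mulr0 => /cvgrPdist_le /(_ e e0); apply: filterS => n.
rewrite sub0r normrN => Ce; rewrite distrC; apply: le_trans (CP n) _.
exact: le_trans (ler_norm _) Ce.
Qed.

Lemma L2_complete (f : nat -> T -> R) : (forall n, L2 (f n)) ->
  (forall e, 0 < e -> exists N, forall m n, (N <= m)%N -> (N <= n)%N ->
     nsq (fun x => f m x - f n x) <= e) ->
  exists2 g, L2 g & nsq (fun x => f n x - g x) @[n --> \oo] --> (0 : R).
Proof.
move=> f2 fC.
have H n : exists N, forall m k, (N <= m)%N -> (N <= k)%N ->
     nsq (fun x => f m x - f k x) <= (8^-1) ^+ n by apply: fC; rewrite exprn_gt0.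
have [N NP] := choice H.
(* The partial sums are nondecreasing and dominate every [N n]. *)
pose s n := (\sum_(i < n.+1) (N i).+1)%N.
have sN n : (N n <= s n)%N by rewrite /s big_ord_recr/= (leq_trans (leqnSn _))// leq_addl.
have sS n : (s n <= s n.+1)%N by rewrite /s [leqRHS]big_ord_recr leq_addr.
have sm : {homo s : n m / (n <= m)%N} by apply: homo_leq => // ? ? ?; exact: leq_trans.
have := @rapid_ae _ _ _ mu D mD (fun n x => f (s n.+1) x - f (s n) x) (fun n => L2B mD (f2 _) (f2 _))
  (fun n => NP n _ _ (leq_trans (sN n) (sS n)) (sN n)).
move=> [B [mB B0 subB]].
(* The value 0 on the null set [B] makes [g] an everywhere limit of measurable functions, hence
   measurable. *)
pose g x := if x \in B then 0 else limn (fun n => f (s n) x).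
have cg x : D x -> x \notin B -> f (s n) x @[n --> \oo] --> g x.
  move=> Dx xB; rewrite /g (negbTE xB).
  have [C CP] : exists C, forall n, `|f (s n.+1) x - f (s n) x| <= C * 2^-1 ^+ n.
    apply: contrapT => K; move/negP: xB; apply; apply/mem_set/subB => /= /(_ Dx).
    exact: K.
  have -> : (fun n => f (s n) x) = (fun n => f (s 0%N) x + series (fun k => f (s k.+1) x - f (s k) x) n).
    apply/funext => n; rewrite /series/=; elim: n => [|n IH]; first by rewrite big_geq// addr0.
    by rewrite big_nat_recr//= addrA -IH; lra.
  apply: is_cvgD; first exact: is_cvg_cst.
  apply: normed_cvg; apply: (series_le_cvg (v_ := geometric C 2^-1)) => //.
  - by move=> n /=; exact: normr_ge0.
  - by move=> n /=; apply: (le_trans _ (CP n)); exact: normr_ge0.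
  - by apply: is_cvg_geometric_series; rewrite ger0_norm//; lra.
have gm : measurable_fun D g.
  apply: (@measurable_fun_cvg _ _ _ _ (fun n x => f (s n) x * \1_(~` B) x)).
  - move=> n; apply: measurable_funM; first exact: L2_measurable.
    by apply: measurable_indic; exact: measurableC.
  - move=> x Dx; have [xB|xB] := boolP (x \in B).
      rewrite /g xB; under eq_fun do rewrite indicE in_setC xB mulr0.
      exact: cvg_cst.
    by under eq_fun do rewrite indicE in_setC xB mulr1; exact: cg.
have gae : {ae mu, forall x, D x -> f (s n) x @[n --> \oo] --> g x}.
  exists B; split => // x /= K; apply/set_mem; apply: contrapT => /negP xB; apply: K => Dx.
  exact: cg.
(* Fatou along the subsequence, with [m] fixed, turns the Cauchy bound on [f m - f (s n)] into a
   bound on [f m - g] for the whole sequence. *)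
have K e : 0 < e -> exists N0, forall m, (N0 <= m)%N -> L2 (fun x => f m x - g x) /\
    nsq (fun x => f m x - g x) <= e.
  move=> e0; have [N0 N0P] := fC _ e0; exists N0 => m N0m.
  have [n0 n0P] : exists n0, forall n, (N0 <= s (n + n0))%N.
    have sn n : (n <= s n)%N.
      elim: n => // n IH; rewrite /s big_ord_recr /= -[leqLHS]addn1; exact: leq_add.
    exists N0 => n; apply: (leq_trans (sn N0)); apply: sm; exact: leq_addl.
  apply: (@nsq_fatou (fun n x => f m x - f (s (n + n0)%N) x)).
  - by move=> n; exact: L2B.
  - by apply: measurable_funB => //; exact: L2_measurable.
  - move: gae; apply: filterS => x H1 Dx; apply: cvgB; first exact: cvg_cst.
    by rewrite (cvg_shiftn n0 (fun n => f (s n) x)); exact: H1.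
  - by move=> n; exact: N0P.
have [N1 N1P] := K 1 ltr01.
have g2 : L2 g.
  have [h2 _] := N1P _ (leqnn N1).
  have := L2B mD (f2 N1) h2; congr L2; apply/funext => x; lra.
exists g => //; apply/cvgrPdist_le => e e0.
have [N0 N0P] := K e e0; exists N0 => // n /= Nn.
by rewrite sub0r normrN ger0_norm ?nsq_ge0//; have [] := N0P n Nn.
Qed.

Local Notation pnp := (pnp mu D).
Local Notation pn := (pn mu D).

Definition Lp (p : R) f := measurable_fun D f /\
  (\int[mu]_(x in D) (`|f x| `^ p)%:E < +oo)%E.

Lemma pnpI p f : pnp p f = \int[mu]_(x in D) (`|f x| `^ p).
Proof. by rewrite pnp.unlock. Qed.

Lemma pnE p f : pn p f = pnp p f `^ p^-1.
Proof. by rewrite pn.unlock. Qed.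

Lemma measurable_normpow p f : measurable_fun D f ->
  measurable_fun D (fun x => `|f x| `^ p).
Proof.
move=> mf; apply: (measurableT_comp (measurable_powR p)).
exact: measurableT_comp.
Qed.

Lemma pnp_ge0 p f : 0 <= pnp p f.
Proof. by rewrite pnpI; apply: Rintegral_ge0 => x _; exact: powR_ge0. Qed.

Lemma pn_ge0 p f : 0 <= pn p f. Proof. rewrite pnE; exact: powR_ge0. Qed.

Lemma pn_pow p f : p != 0 -> pn p f `^ p = pnp p f.
Proof. by move=> p0; rewrite pnE -powRrM mulVf// powRr1// pnp_ge0. Qed.

Lemma Lp_integrable p f : Lp p f -> mu.-integrable D (EFin \o (fun x => `|f x| `^ p)).
Proof.
move=> [mf fi]; apply/integrableP; split; first by apply/measurable_EFinP/measurable_normpow.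
rewrite (eq_integral (fun x => (`|f x| `^ p)%:E))// => x _ /=.
by rewrite ger0_norm// powR_ge0.
Qed.

Lemma pnpE p f : Lp p f -> (pnp p f)%:E = (\int[mu]_(x in D) (`|f x| `^ p)%:E)%E.
Proof. by move=> fp; rewrite pnpI /Rintegral fineK//; exact: integrable_fin_num (Lp_integrable fp). Qed.

(** Extension by zero turns the integral over [D] into a norm over the whole space, to which
    Minkowski's inequality applies. *)
Lemma pnp_Lnorm p f : 0 < p ->
  ('N[mu]_p%:E[EFin \o (f \_ D)] = (\int[mu]_(x in D) (`|f x| `^ p)%:E) `^ p^-1)%E.
Proof.
move=> p0; rewrite unlock.
set A := integral _ _ _; set B := integral _ _ _; suff -> : A = B by [].
rewrite [RHS]integral_mkcond; apply: eq_integral => x _; rewrite /= /patch; case: ifP => //= _.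
by rewrite normr0 powR0// gt_eqF.
Qed.

Lemma pn_Lnorm p f : 0 < p -> Lp p f -> ('N[mu]_p%:E[EFin \o (f \_ D)])%E = (pn p f)%:E.
Proof. by move=> p0 fp; rewrite pnp_Lnorm// -(pnpE fp) pnE poweR_EFin. Qed.

Lemma LpD p f g : 1 <= p -> Lp p f -> Lp p g -> Lp p (fun x => f x + g x) /\
  pn p (fun x => f x + g x) <= pn p f + pn p g.
Proof.
move=> p1 fp gp; have p0 : 0 < p by lra.
have mfg : measurable_fun D (fun x => f x + g x) by apply: measurable_funD; [case: fp|case: gp].
have mr h : measurable_fun D h -> measurable_fun setT (h \_ D).
  by move=> mh; apply/(measurable_restrictT h mD).
have := minkowski_EFin mu (mr _ fp.1) (mr _ gp.1) p1.
rewrite (_ : (f \_ D) \+ (g \_ D) = (fun x => f x + g x) \_ D); last first.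
  by apply/funext => x /=; rewrite /patch; case: ifP => // _; rewrite addr0.
rewrite (pn_Lnorm p0 fp) (pn_Lnorm p0 gp) => H.
have fgp : Lp p (fun x => f x + g x).
  split => //; move: H; rewrite pnp_Lnorm// => /le_lt_trans /(_ (ltry _)).
  by apply: lty_poweRy; rewrite invr_neq0// gt_eqF.
by move: H; rewrite (pn_Lnorm p0 fgp) -EFinD lee_fin; split.
Qed.

Lemma LpZ p c f : Lp p f -> Lp p (fun x => c * f x) /\
  pnp p (fun x => c * f x) = `|c| `^ p * pnp p f.
Proof.
move=> fp.
have e x : `|c * f x| `^ p = `|c| `^ p * `|f x| `^ p by rewrite normrM powRM.
have cfp : Lp p (fun x => c * f x).
  split; first by apply: measurable_funM => //; case: fp.
  under eq_integral do rewrite e EFinM.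
  rewrite ge0_integralZl_EFin ?powR_ge0//.
  - by rewrite -(pnpE fp) -EFinM ltry.
  - by apply/measurable_EFinP/measurable_normpow; case: fp.
split => //; rewrite !pnpI; under eq_Rintegral do rewrite e.
by rewrite RintegralZl//; exact: Lp_integrable.
Qed.

Lemma pnZ p c f : 0 < p -> Lp p f -> pn p (fun x => c * f x) = `|c| * pn p f.
Proof.
move=> p0 fp; rewrite !pnE (LpZ c fp).2 powRM ?powR_ge0 ?pnp_ge0//.
by rewrite -powRrM mulfV ?gt_eqF// powRr1.
Qed.

Lemma pnB_ge p f g : 1 <= p -> Lp p f -> Lp p g ->
  Lp p (fun x => f x - g x) /\ pn p f - pn p g <= pn p (fun x => f x - g x).
Proof.
move=> p1 fp gp; have p0 : 0 < p by lra.
have [gNp _] := LpZ (-1) gp.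
have [h1 _] := LpD p1 fp gNp.
have h2 : Lp p (fun x => f x - g x).
  by move: h1; congr (Lp p _); apply/funext => x; rewrite mulN1r.
split => //; have [_] := LpD p1 h2 gp.
rewrite [X in X <= _ -> _](_ : _ = pn p f) ?lerBlDr//.
by apply: (f_equal (pn p)); apply/funext => x; rewrite subrK.
Qed.

Lemma pnBC p f g : pn p (fun x => f x - g x) = pn p (fun x => g x - f x).
Proof.
by rewrite !pnE !pnpI; under eq_Rintegral do rewrite distrC.
Qed.

Lemma ae_eq_pnp p f g : Lp p f -> Lp p g ->
  {ae mu, forall x, D x -> f x = g x} -> pnp p f = pnp p g.
Proof.
move=> fp gp fg; apply/EFin_inj; rewrite (pnpE fp) (pnpE gp).
apply: ae_eq_integral => //.
- by apply/measurable_EFinP/measurable_normpow; case: fp.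
- by apply/measurable_EFinP/measurable_normpow; case: gp.
- by move: fg; apply: filterS => x H Dx /=; rewrite H.
Qed.

End L2Convergence.

(** * Smooth functions and test functions *)

Section Derivatives.
Context {R : realType}.

(** Reduces directional derivatives to derivatives in one real variable, where the chain rule is at
    hand. *)
Lemma is_derive_along (V : normedModType R) (f : V -> R) (x v : V) (d : R) :
  is_derive x v f d <-> is_derive (0 : R) 1 (fun t : R => f (t *: v + x)) d.
Proof.
have E : (fun h : R => h^-1 *: ((f \o shift x) (h *: v) - f x)) =
  (fun h : R => h^-1 *: (((fun t : R => f (t *: v + x)) \o shift (0:R)) (h *: (1:R)) - (fun t : R => f (t *: v + x)) 0)).
  apply/funext => h /=; congr (_ *: (f _ - f _)); last by rewrite scale0r add0r.
  by rewrite addr0 /GRing.scale /= mulr1.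
split => -[]; rewrite /derivable /derive.
  by rewrite E => H1 H2; split.
by rewrite -E => H1 H2; split.
Qed.

Lemma is_derive_comp1 (V : normedModType R) (f : R -> R) (u : V -> R)
    (x v : V) (a b : R) :
  is_derive (u x) 1 f a -> is_derive x v u b -> is_derive x v (f \o u) (a * b).
Proof.
move=> fa /is_derive_along ub; apply/is_derive_along.
apply: (@is_derive1_comp _ f (fun t : R => u (t *: v + x))) => //.
by rewrite scale0r add0r.
Qed.

Lemma is_derive_mul (V : normedModType R) (f g : V -> R) (x v : V) (df dg : R) :
  is_derive x v f df -> is_derive x v g dg ->
  is_derive x v (fun y => f y * g y) (df * g x + f x * dg).
Proof.
move=> h1 h2; have := is_deriveM h1 h2; move/is_derive_eq; apply.
by rewrite /GRing.scale /= addrC (mulrC (g x)).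
Qed.

Lemma is_derive_continuous (f : R -> R) (x d : R) : is_derive x 1 f d ->
  {for x, continuous f}.
Proof. by move=> [H _]; apply: differentiable_continuous; apply/derivable1_diffP. Qed.

(** Handles points where a definition by cases changes branch: a quadratic remainder bound is all
    that has to be checked there. *)
Lemma is_derive_lip (f : R -> R) (x d : R) (K : R) : 0 <= K ->
  (forall h, `|f (h + x) - f x - h * d| <= K * `|h| ^+ 2) -> is_derive x 1 f d.
Proof.
move=> K0 H.
suff L : (h^-1 *: ((f \o shift x) (h *: (1:R)) - f x)) @[h --> 0^'] --> d.
  have D : derivable f x 1 by apply/cvg_ex; exists d.
  by split => //; exact: cvg_lim.
apply/cvgrPdist_le => e e0; near=> h.
have h0 : h != 0 by near: h; exact: nbhs_dnbhs_neq.
rewrite /= /GRing.scale /= mulr1.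
have -> : d - h^-1 * (f (h + x) - f x) = - (h^-1 * (f (h + x) - f x - h * d)) by field.
rewrite normrN normrM normfV ler_pdivrMl ?normr_gt0//.
apply: (le_trans (H h)); rewrite expr2 mulrA mulrAC mulrC ler_wpM2l//.
have : `|h| <= e / (K + 1) by near: h; apply: dnbhs0_le; rewrite divr_gt0//; lra.
by rewrite ler_pdivlMr; have := normr_ge0 h; nra.
Unshelve. all: by end_near. Qed.

Lemma is_derive_pow (V : normedModType R) (f : V -> R) (x v : V) (a : R) k :
  is_derive x v f a ->
  is_derive x v (fun y => f y ^+ k) (k%:R * f x ^+ k.-1 * a).
Proof.
move=> fa; elim: k => [|k IH].
  rewrite !mul0r (_ : (fun y => _) = cst 1); first exact: is_derive_cst.
  by apply/funext => y; rewrite expr0.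
rewrite (_ : (fun y => _) = (fun y => f y * f y ^+ k)); last first.
  by apply/funext => y; rewrite exprS.
have := is_derive_mul fa IH; move/is_derive_eq; apply.
case: k {IH} => [|k]/=; first by rewrite !expr0; ring.
by rewrite exprS -[k.+2%:R]natr1; ring.
Qed.

Lemma is_derive_affine (a b t : R) : is_derive t 1 (fun s : R => s * a + b) a.
Proof.
apply: (@is_derive_lip _ _ _ 0) => // h.
by rewrite (_ : _ - h * a = 0) ?normr0 ?mul0r//; ring.
Qed.

End Derivatives.

Section FlatExp.
Context {R : realType}.

Implicit Types (k : nat) (t : R).

(** The family generated by [expR (- t^-1)] under differentiation: the derivative of member [k]
    combines members [k + 2] and [k + 1], so smoothness of all members follows by one induction. *)
Definition flat_exp (k : nat) (t : R) : R :=
  if 0 < t then t^-1 ^+ k * expR (- t^-1) else 0.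

Lemma flat_exp_ge0 k t : 0 <= flat_exp k t.
Proof.
rewrite /flat_exp; case: ifP => // t0.
by rewrite mulr_ge0 ?expR_ge0// exprn_ge0// invr_ge0 ltW.
Qed.

(** With [s = t^-1] this says that [s ^ (k + 2)] is at most [(k + 2) ^ (k + 2) * expR s], which is
    the bound of [s / (k + 2)] by its exponential, raised to the power [k + 2]. It is the quadratic
    flatness at 0 that [is_derive_lip] asks for. *)
Lemma flat_exp_le k t : flat_exp k t <= (k.+2%:R) ^+ k.+2 * `|t| ^+ 2.
Proof.
have [t0|t0] := ltP 0 t; last first.
  rewrite /flat_exp ltNge t0 /= mulr_ge0 ?exprn_ge0 ?normr_ge0//.
rewrite /flat_exp t0; set s := t^-1.
have s0 : 0 < s by rewrite invr_gt0.
have H : s ^+ k.+2 <= k.+2%:R ^+ k.+2 * expR s.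
  have -> : s = k.+2%:R * (s / k.+2%:R) by rewrite mulrC divfK.
  rewrite expRM_natl exprMn ler_wpM2l ?exprn_ge0//.
  apply: lerXn2r; rewrite ?nnegrE ?expR_ge0 ?divr_ge0 ?ltW//.
  by apply: lt_le_trans (expR_ge1Dx _); rewrite ltrDr.
rewrite expRN (ger0_norm (ltW t0)) -[t]invrK -/s.
clearbody s.
rewrite exprVn ler_pdivlMr ?exprn_gt0// mulrAC ler_pdivrMr ?expR_gt0//.
by apply: le_trans H; rewrite -exprD addn2.
Qed.

Lemma is_derive_flat_exp k t :
  is_derive t (1 : R) (flat_exp k) (flat_exp k.+2 t - k%:R * flat_exp k.+1 t).
Proof.
have [t0|t0|->] := ltgtP t 0.
- rewrite /flat_exp ltNge ltW//= mulr0 subr0.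
  apply: (@near_eq_is_derive _ _ _ (cst 0)).
  near=> s; rewrite /= ltNge ltW//=; near: s; exact: lt_nbhsl.
- rewrite /flat_exp t0.
  pose F (s : R) : R := s^-1 ^+ k * expR (- s^-1).
  apply: (@near_eq_is_derive _ _ _ F).
    by near=> s; have -> // : 0 < s; near: s; exact: lt_nbhsr.
    have i : is_derive t 1 (fun s : R => s^-1) (- (t ^- 2)).
      have := @is_deriveV R id t 1 1; rewrite /= => /(_ (lt0r_neq0 t0) (is_derive_id _ _)).
      by move/is_derive_eq; apply; rewrite /GRing.scale /= mulr1.
    have i2 : is_derive t 1 (fun s : R => expR (- s^-1)) (expR (- t^-1) * (t ^- 2)).
      have iN : is_derive t 1 (fun s : R => - s^-1) (t ^- 2).
        by have := is_deriveN i; rewrite opprK.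
      exact: (@is_derive1_comp _ expR (fun s : R => - s^-1) t _ _ (is_derive_expR (- t^-1)) iN).
    have i3 : is_derive t 1 (fun s : R => s^-1 ^+ k) ((k%:R * t^-1 ^+ k.-1) * (- (t ^- 2))).
      exact: is_derive_pow.
    have := is_derive_mul i3 i2; move/is_derive_eq; apply.
    have -> : t ^- 2 = t^-1 * t^-1 by rewrite -exprVn expr2.
    case: k {F i3} => [|k] /=; first by rewrite !mul0r subr0 !exprS !expr0; ring.
    by rewrite !exprS; ring.
- have -> : flat_exp k.+2 0 - k%:R * flat_exp k.+1 0 = (0 : R) by rewrite /flat_exp ltxx mulr0 subr0.
  apply: (@is_derive_lip _ _ _ _ ((k.+2%:R) ^+ k.+2)); first by rewrite exprn_ge0.
  move=> h; rewrite mulr0 addr0 subr0 {2}/flat_exp ltxx subr0 ger0_norm ?flat_exp_ge0//.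
  exact: flat_exp_le.
Unshelve. all: by end_near. Qed.

Lemma flat_exp0_le1 t : flat_exp 0 t <= 1.
Proof.
rewrite /flat_exp; case: ifP => // t0; rewrite expr0 mul1r -expR0 ler_expR.
by rewrite oppr_le0 invr_ge0 ltW.
Qed.

Lemma flat_exp0_gt0 t : 0 < t -> 0 < flat_exp 0 t.
Proof. by move=> t0; rewrite /flat_exp t0 expr0 mul1r expR_gt0. Qed.

Lemma flat_exp0_homo t s : t <= s -> flat_exp 0 t <= flat_exp 0 s.
Proof.
move=> ts; rewrite /flat_exp !expr0 !mul1r; case: ifP => t0; last by case: ifP => // _; exact: expR_ge0.
by rewrite (lt_le_trans t0 ts) ler_expR lerN2 lef_pV2// posrE// (lt_le_trans t0 ts).
Qed.

End FlatExp.

Section ClassC.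
Context {R : realType}.
Implicit Types (f g u : R * R -> R) (n : nat) (x : R * R).

Definition smooth f := forall n, class_C n f.

Lemma class_C_continuous n f : class_C n f -> continuous f.
Proof. by case: n => [|n] []. Qed.

Lemma class_CS n f : class_C n.+1 f -> class_C n f.
Proof.
elim: n f => [|n IH] f; first by case.
move=> [cf [df [d1 d2]]]; split; first exact: cf.
by split; [exact: df|split; [exact: IH d1|exact: IH d2]].
Qed.

Lemma class_C_is_derive n f x : class_C n.+1 f ->
  is_derive x e1 f ('D_e1 f x) /\ is_derive x e2 f ('D_e2 f x).
Proof. by move=> [_ [df _]]; have [d1 d2] := df x; split; exact/derivableP. Qed.

(** Lets the partial derivatives be supplied as explicit expressions, so that closure properties of
    [class_C] go by induction on [n]. *)
Lemma class_C_step n f g1 g2 : continuous f ->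
  (forall x, is_derive x e1 f (g1 x)) -> (forall x, is_derive x e2 f (g2 x)) ->
  class_C n g1 -> class_C n g2 -> class_C n.+1 f.
Proof.
move=> cf d1 d2 c1 c2; split => //.
have E1 : 'D_e1 f = g1 by apply/funext => x; apply: derive_val.
have E2 : 'D_e2 f = g2 by apply/funext => x; apply: derive_val.
split; last by rewrite E1 E2.
by move=> x; have [? _] := d1 x; have [? _] := d2 x.
Qed.

Lemma is_derive_add (V : normedModType R) (f g : V -> R) (x v : V) (a b : R) :
  is_derive x v f a -> is_derive x v g b -> is_derive x v (fun y => f y + g y) (a + b).
Proof. exact: is_deriveD. Qed.

Lemma is_derive_opp (V : normedModType R) (f : V -> R) (x v : V) (a : R) :
  is_derive x v f a -> is_derive x v (fun y => - f y) (- a).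
Proof. exact: is_deriveN. Qed.

Lemma is_derive_scale (V : normedModType R) (f : V -> R) (x v : V) (c a : R) :
  is_derive x v f a -> is_derive x v (fun y => c * f y) (c * a).
Proof. exact: is_deriveZ. Qed.

Lemma is_derive_inv (V : normedModType R) (f : V -> R) (x v : V) (a : R) :
  f x != 0 -> is_derive x v f a ->
  is_derive x v (fun y => (f y)^-1) (- a * ((f x)^-1 * (f x)^-1)).
Proof.
move=> fx [df dv]; split; first exact: derivableV.
rewrite deriveV// dv /GRing.scale /= -exprVn expr2; ring.
Qed.

Lemma class_C_cst n (c : R) : class_C n (fun=> c).
Proof.
elim: n c => [|n IH] c; first by split => // x; exact: cst_continuous.
apply: class_C_step (IH 0) (IH 0); first by move=> x; exact: cst_continuous.
Qed.

Lemma class_C_add n f g : class_C n f -> class_C n g -> class_C n (fun x => f x + g x).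
Proof.
elim: n f g => [|n IH] f g cf cg.
  by split => // x; apply: cvgD; [apply: (class_C_continuous cf)|apply: (class_C_continuous cg)].
have [_ [_ [f1 f2]]] := cf; have [_ [_ [g1 g2]]] := cg.
apply: class_C_step (IH _ _ f1 g1) (IH _ _ f2 g2).
- by move=> x; apply: cvgD; [apply: (class_C_continuous cf)|apply: (class_C_continuous cg)].
- by move=> x; apply: is_derive_add; [exact: (class_C_is_derive x cf).1|exact: (class_C_is_derive x cg).1].
- by move=> x; apply: is_derive_add; [exact: (class_C_is_derive x cf).2|exact: (class_C_is_derive x cg).2].
Qed.

Lemma class_C_mul n f g : class_C n f -> class_C n g -> class_C n (fun x => f x * g x).
Proof.
elim: n f g => [|n IH] f g cf cg.
  by split => // x; apply: cvgM; [apply: (class_C_continuous cf)|apply: (class_C_continuous cg)].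
have [_ [_ [f1 f2]]] := cf; have [_ [_ [g1 g2]]] := cg.
have [cf' cg'] := (class_CS cf, class_CS cg).
apply: (class_C_step _ _ _ (class_C_add (IH _ _ f1 cg') (IH _ _ cf' g1))
                           (class_C_add (IH _ _ f2 cg') (IH _ _ cf' g2))).
- by move=> x; apply: cvgM; [apply: (class_C_continuous cf)|apply: (class_C_continuous cg)].
- by move=> x; apply: is_derive_mul; [exact: (class_C_is_derive x cf).1|exact: (class_C_is_derive x cg).1].
- by move=> x; apply: is_derive_mul; [exact: (class_C_is_derive x cf).2|exact: (class_C_is_derive x cg).2].
Qed.

Lemma class_C_opp n f : class_C n f -> class_C n (fun x => - f x).
Proof.
move=> cf; rewrite (_ : (fun x => - f x) = (fun x => -1 * f x)).
  by apply: class_C_mul => //; exact: class_C_cst.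
by apply/funext => x; rewrite mulN1r.
Qed.

Lemma class_C_inv n f : (forall x, f x != 0) -> class_C n f -> class_C n (fun x => (f x)^-1).
Proof.
move=> f0; elim: n => [|n IH] cf.
  by split => // x; apply: cvgV => //; apply: (class_C_continuous cf).
have [_ [_ [f1 f2]]] := cf; have IH' := IH (class_CS cf).
apply: (class_C_step _ _ _ (class_C_mul (class_C_opp f1) (class_C_mul IH' IH'))
                           (class_C_mul (class_C_opp f2) (class_C_mul IH' IH'))).
- by move=> x; apply: cvgV => //; apply: (class_C_continuous cf).
- by move=> x; apply: is_derive_inv => //; exact: (class_C_is_derive x cf).1.
- by move=> x; apply: is_derive_inv => //; exact: (class_C_is_derive x cf).2.
Qed.

Lemma comp_continuous (F : R -> R) u : (forall x, {for u x, continuous F}) ->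
  continuous u -> continuous (F \o u).
Proof. by move=> cF cu x; apply: continuous_comp; [exact: cu|exact: cF]. Qed.

Lemma class_C_expR n f : class_C n f -> class_C n (fun x => expR (f x)).
Proof.
elim: n => [|n IH] cf.
  by split => //; apply: comp_continuous => [x|]; [exact: continuous_expR|apply: (class_C_continuous cf)].
have [_ [_ [f1 f2]]] := cf; have IH' := IH (class_CS cf).
apply: (class_C_step _ _ _ (class_C_mul IH' f1) (class_C_mul IH' f2)).
- by apply: comp_continuous => [x|]; [exact: continuous_expR|apply: (class_C_continuous cf)].
- by move=> x; apply: (@is_derive_comp1 _ _ expR f); exact: (class_C_is_derive x cf).1.
- by move=> x; apply: (@is_derive_comp1 _ _ expR f); exact: (class_C_is_derive x cf).2.
Qed.

Lemma class_C_ln n f : (forall x, 0 < f x) -> class_C n f -> class_C n (fun x => ln (f x)).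
Proof.
move=> f0; have f0' x : f x != 0 by rewrite gt_eqF.
case: n => [|n] cf.
  by split => //; apply: comp_continuous => [x|]; [exact: continuous_ln|apply: (class_C_continuous cf)].
have [_ [_ [f1 f2]]] := cf; have cV := class_C_inv f0' (class_CS cf).
apply: (class_C_step _ _ _ (class_C_mul cV f1) (class_C_mul cV f2)).
- by apply: comp_continuous => [x|]; [exact: continuous_ln|apply: (class_C_continuous cf)].
- move=> x; apply: (@is_derive_comp1 _ _ (@ln R) f); first exact: is_derive1_ln.
  exact: (class_C_is_derive x cf).1.
- move=> x; apply: (@is_derive_comp1 _ _ (@ln R) f); first exact: is_derive1_ln.
  exact: (class_C_is_derive x cf).2.
Qed.

Lemma class_C_flat_exp n k f : class_C n f -> class_C n (fun x => flat_exp k (f x)).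
Proof.
have cF j : continuous (@flat_exp R j) by move=> t; exact: is_derive_continuous (is_derive_flat_exp j t).
elim: n k f => [|n IH] k f cf.
  by split => //; apply: comp_continuous => [x|]; [exact: cF|apply: (class_C_continuous cf)].
have [_ [_ [f1 f2]]] := cf.
have H := class_C_add (IH k.+2 f (class_CS cf)) (class_C_opp (class_C_mul (class_C_cst n k%:R) (IH k.+1 f (class_CS cf)))).
apply: (class_C_step _ _ _ (class_C_mul H f1) (class_C_mul H f2)).
- by apply: comp_continuous => [x|]; [exact: cF|apply: (class_C_continuous cf)].
- by move=> x; apply: (@is_derive_comp1 _ _ (flat_exp k) f); [exact: is_derive_flat_exp|exact: (class_C_is_derive x cf).1].
- by move=> x; apply: (@is_derive_comp1 _ _ (flat_exp k) f); [exact: is_derive_flat_exp|exact: (class_C_is_derive x cf).2].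
Qed.

Lemma is_derive_fst (x v : R * R) : is_derive x v (fst : R * R -> R) v.1.
Proof.
apply/is_derive_along => /=.
exact: is_derive_affine.
Qed.

Lemma is_derive_snd (x v : R * R) : is_derive x v (snd : R * R -> R) v.2.
Proof.
apply/is_derive_along => /=.
exact: is_derive_affine.
Qed.

Lemma class_C_fst n : class_C n (fst : R * R -> R).
Proof.
case: n => [|n]; first by split => // x; exact: cvg_fst.
apply: (class_C_step _ _ _ (class_C_cst n 1) (class_C_cst n 0)).
- by move=> x; exact: cvg_fst.
- by move=> x; exact: (is_derive_fst x e1).
- by move=> x; exact: (is_derive_fst x e2).
Qed.

Lemma class_C_snd n : class_C n (snd : R * R -> R).
Proof.
case: n => [|n]; first by split => // x; exact: cvg_snd.
apply: (class_C_step _ _ _ (class_C_cst n 0) (class_C_cst n 1)).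
- by move=> x; exact: cvg_snd.
- by move=> x; exact: (is_derive_snd x e1).
- by move=> x; exact: (is_derive_snd x e2).
Qed.

Lemma is_derive_dilate f (l : R) (x v : R * R) (a : R) :
  is_derive (l * x.1, l * x.2) v f a ->
  is_derive x v (fun y => f (l * y.1, l * y.2)) (l * a).
Proof.
move=> /is_derive_along H; apply/is_derive_along.
have := @is_derive1_comp _ (fun t : R => f (t *: v + (l * x.1, l * x.2))) (fun t : R => l * t) 0 a l.
rewrite mulr0 => /(_ H); rewrite (mulrC a).
have i : is_derive (0:R) 1 (fun t : R => l * t) l.
  have := is_derive_affine l 0 0; congr is_derive; apply/funext => t; rewrite addr0 mulrC; done.
move=> /(_ i); congr is_derive; apply/funext => t /=; congr f; congr pair => /=;
  by rewrite /GRing.scale/=; ring.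
Qed.

Lemma class_C_dilate n (l : R) f : class_C n f -> class_C n (fun x => f (l * x.1, l * x.2)).
Proof.
have cl g : continuous g -> continuous (fun x : R * R => g (l * x.1, l * x.2)).
  move=> cg x; apply: (continuous_comp _ (cg _)) => /=.
  have a1 : (l * y.1) @[y --> x] --> l * x.1 by apply: cvgM; [exact: cvg_cst|exact: cvg_fst].
  have a2 : (l * y.2) @[y --> x] --> l * x.2 by apply: cvgM; [exact: cvg_cst|exact: cvg_snd].
  exact: (cvg_pair a1 a2).
elim: n f => [|n IH] f cf; first by split => //; apply: cl; apply: (class_C_continuous cf).
have [_ [_ [f1 f2]]] := cf.
apply: (class_C_step _ _ _ (class_C_mul (class_C_cst n l) (IH _ f1)) (class_C_mul (class_C_cst n l) (IH _ f2))).
- by apply: cl; apply: (class_C_continuous cf).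
- by move=> x; apply: is_derive_dilate; exact: (class_C_is_derive _ cf).1.
- by move=> x; apply: is_derive_dilate; exact: (class_C_is_derive _ cf).2.
Qed.

End ClassC.

Section TestFunctions.
Context {R : realType}.
Implicit Types (f g u phi psi chi : R * R -> R) (n : nat) (x : R * R).

Lemma test_smooth phi : test_function phi -> smooth phi. Proof. by case. Qed.

Lemma test_mul phi chi : test_function phi -> smooth chi ->
  test_function (fun x => chi x * phi x).
Proof.
move=> [sp [K [cK KH K0]]] sc; split.
  by move=> n; apply: class_C_mul; [exact: sc|exact: sp].
by exists K; split => // x /K0 ->; rewrite mulr0.
Qed.

Lemma test_add phi psi : test_function phi -> test_function psi ->
  test_function (fun x => phi x + psi x).
Proof.
move=> [sp [K [cK KH K0]]] [sq [L [cL LH L0]]]; split.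
  by move=> n; apply: class_C_add.
exists (K `|` L); split.
- exact: compactU.
- by move=> x [/KH|/LH].
- by move=> x /not_orP[/K0 -> /L0 ->]; rewrite addr0.
Qed.

Lemma test_scale (c : R) phi : test_function phi -> test_function (fun x => c * phi x).
Proof. by move=> tp; apply: test_mul => // n; exact: class_C_cst. Qed.

Lemma test_opp phi : test_function phi -> test_function (fun x => - phi x).
Proof.
move=> /(test_scale (-1)); rewrite (_ : (fun x => -1 * phi x) = (fun x => - phi x))//.
by apply/funext => x; rewrite mulN1r.
Qed.

Lemma test_sub phi psi : test_function phi -> test_function psi ->
  test_function (fun x => phi x - psi x).
Proof. by move=> tp tq; apply: test_add => //; exact: test_opp. Qed.

Lemma dilate_continuous (l : R) : continuous (fun x : R * R => (l * x.1, l * x.2)).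
Proof.
move=> x.
have a1 : (l * y.1) @[y --> x] --> l * x.1 by apply: cvgM; [exact: cvg_cst|exact: cvg_fst].
have a2 : (l * y.2) @[y --> x] --> l * x.2 by apply: cvgM; [exact: cvg_cst|exact: cvg_snd].
exact: (cvg_pair a1 a2).
Qed.

Lemma test_dilate (l : R) phi : 0 < l -> test_function phi ->
  test_function (fun x => phi (l * x.1, l * x.2)).
Proof.
move=> l0 [sp [K [cK KH K0]]]; split.
  by move=> n; apply: class_C_dilate.
exists ((fun x => (l^-1 * x.1, l^-1 * x.2)) @` K); split.
- by apply: continuous_compact => //; apply: continuous_subspaceT; exact: dilate_continuous.
- by move=> _ [x /KH Hx <-]; rewrite /half_plane /= mulr_gt0// invr_gt0.
- move=> x xK; apply: K0 => Kx; apply: xK; exists (l * x.1, l * x.2) => //=.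
  by rewrite !mulKf ?gt_eqF//; case: x {Kx}.
Qed.

Lemma test_deriv phi : test_function phi ->
  test_function ('D_e1 phi) /\ test_function ('D_e2 phi).
Proof.
move=> [sp [K [cK KH K0]]].
have nK x : ~ K x -> \forall y \near x, phi y = 0.
  move=> nKx; have /closed_openC oK : closed K by apply: compact_closed => //; exact: norm_hausdorff.
  have : nbhs x (~` K) by apply: open_nbhs_nbhs; split.
  by apply: filterS => y /K0.
have z e x : ~ K x -> 'D_e phi x = 0.
  move=> /nK H; have : is_derive x e phi 0.
    apply: (@near_eq_is_derive _ _ _ (cst 0)).
    by apply: filterS H => y ->.
  by move=> h; exact: derive_val.
split; split.
- by move=> n; have [_ [_ []]] := sp n.+1.
- by exists K; split => // x; exact: z.
- by move=> n; have [_ [_ []]] := sp n.+1.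
- by exists K; split => // x; exact: z.
Qed.

Lemma test_continuous phi : test_function phi -> continuous phi.
Proof. by move=> [/(_ 0%N) []]. Qed.

Lemma test_is_derive phi x : test_function phi ->
  is_derive x e1 phi ('D_e1 phi x) /\ is_derive x e2 phi ('D_e2 phi x).
Proof. by move=> [/(_ 1%N) H _]; exact: (class_C_is_derive x H). Qed.

Lemma test_half phi x : test_function phi -> x.1 <= 0 -> phi x = 0.
Proof.
move=> [_ [K [_ KH K0]]] x0; apply: K0 => /KH; rewrite /half_plane /=.
by rewrite ltNge x0.
Qed.

Lemma test_box phi : test_function phi -> exists2 M, 0 < M &
  forall x, M <= `|x.1| \/ M <= `|x.2| -> phi x = 0.
Proof.
move=> [_ [K [cK KH K0]]].
have [M [Mr MP]] := compact_bounded cK.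
exists (`|M| + 2); first by rewrite ltr_wpDl// normr_ge0.
move=> x Mx; apply: K0 => Kx; have := MP (`|M| + 1) _ x Kx.
have -> : M < `|M| + 1 by apply: le_lt_trans (ler_norm _) _; rewrite ltrDl.
move=> /(_ isT) /=.
have -> : `|x| = Num.max `|x.1| `|x.2| by [].
rewrite ge_max => /andP[h1 h2].
by case: Mx => ?; lra.
Qed.

Lemma test_bounded phi : test_function phi -> exists2 C, 0 < C & forall x, `|phi x| <= C.
Proof.
move=> [sp [K [cK KH K0]]].
have cp : {within K, continuous phi} by apply: continuous_subspaceT; exact: (sp 0%N).1.
have [M [Mr MP]] := compact_bounded (continuous_compact cp cK).
exists (`|M| + 1); first by rewrite ltr_wpDl// normr_ge0.
move=> x; have [Kx|/K0 ->] := pselect (K x); last by rewrite normr0 addr_ge0// normr_ge0.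
apply: MP; last by exists x.
by apply: le_lt_trans (ler_norm _) _; rewrite ltrDl.
Qed.

Lemma MVT_any (f df : R -> R) (a b : R) : (forall t : R, is_derive t 1 f (df t)) ->
  exists c : R, `|c - a| <= `|b - a| /\ f b - f a = df c * (b - a).
Proof.
move=> D.
have cf : continuous f by move=> t; exact: is_derive_continuous (D t).
have W a' b' : {within `[a', b'], continuous f} by apply: continuous_subspaceT.
have [ab|ba] := leP a b.
  have [c + E] := MVT_segment ab (fun t _ => D t) (W a b).
  rewrite in_itv /= => /andP[ac cb]; exists c; split => //.
  by rewrite !ger0_norm ?subr_ge0// lerB.
have [c + E] := MVT_segment (ltW ba) (fun t _ => D t) (W b a).
rewrite in_itv /= => /andP[bc ca]; exists c; split; last by lra.
by rewrite !ler0_norm ?subr_le0 ?(ltW ba)// lerN2 lerB.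
Qed.

Lemma is_derive_slice1 f (s y : R) : class_C 1 f ->
  is_derive s 1 (fun r => f (r, y)) ('D_e1 f (s, y)).
Proof.
move=> cf; have /is_derive_along H := (class_C_is_derive (s, y) cf).1.
apply/is_derive_along; move: H; congr is_derive; apply/funext => r /=; congr f; congr pair => /=;
by rewrite /GRing.scale /= ?mulr0 ?mulr1 ?add0r.
Qed.

Lemma is_derive_slice2 f (y s : R) : class_C 1 f ->
  is_derive s 1 (fun r => f (y, r)) ('D_e2 f (y, s)).
Proof.
move=> cf; have /is_derive_along H := (class_C_is_derive (y, s) cf).2.
apply/is_derive_along; move: H; congr is_derive; apply/funext => r /=; congr f; congr pair => /=;
by rewrite /GRing.scale /= ?mulr0 ?mulr1 ?add0r.
Qed.

(* Chain rule along a curve, from continuity of the partial derivatives only. *)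
Lemma C1_curve f (a b : R -> R) (t a' b' : R) : class_C 1 f ->
  is_derive t 1 a a' -> is_derive t 1 b b' ->
  is_derive t 1 (fun s => f (a s, b s))
    ('D_e1 f (a t, b t) * a' + 'D_e2 f (a t, b t) * b').
Proof.
move=> cf da db.
have D1 y s := is_derive_slice1 s y cf.
have D2 y s := is_derive_slice2 y s cf.
have [xi xiP] := choice (fun s => MVT_any (a t) (a s) (D1 (b s))).
have [eta etaP] := choice (fun s => MVT_any (b t) (b s) (D2 (a t))).
have sq (c : R -> R) (c' : R) (z : R -> R) : is_derive t 1 c c' ->
    (forall s, `|z s - c t| <= `|c s - c t|) -> z (h + t) @[h --> 0^'] --> c t.
  move=> dc zc; have cc : c (h + t) @[h --> 0^'] --> c t.
    have := is_derive_continuous dc; rewrite /prop_for /continuous_at => H.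
    have H0 : (h + t) @[h --> (0:R)^'] --> t.
      rewrite -[X in _ --> X]add0r; apply: cvgD; last exact: cvg_cst.
      exact: cvg_within.
    exact: (cvg_comp _ _ H0 H).
  move/cvgrPdist_le in cc; apply/cvgrPdist_le => e e0; have := cc e e0.
  apply: filterS => h He; rewrite distrC; apply: (le_trans (zc _)).
  by rewrite distrC.
have qu (c : R -> R) (c' : R) : is_derive t 1 c c' ->
    (h^-1 * (c (h + t) - c t)) @[h --> 0^'] --> c'.
  move=> [dc <-]; have := dc; rewrite /derivable /derive => H; move: (H).
  rewrite (_ : (fun h : R => h^-1 *: ((c \o shift t) (h *: (1:R)) - c t)) =
    (fun h => h^-1 * (c (h + t) - c t)))//.
  by apply/funext => h /=; rewrite /GRing.scale /= mulr1.
have cD1 : continuous ('D_e1 f) by have [_ [_ [[]]]] := cf.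
have cD2 : continuous ('D_e2 f) by have [_ [_ [_ []]]] := cf.
have L1 : 'D_e1 f (xi (h + t), b (h + t)) @[h --> 0^'] --> 'D_e1 f (a t, b t).
  have P1 : xi (h + t) @[h --> 0^'] --> a t by apply: (sq a a') => // s; have [] := xiP s.
  have P2 : b (h + t) @[h --> 0^'] --> b t by apply: (sq b b').
  exact: (cvg_comp _ _ (cvg_pair P1 P2) (cD1 (a t, b t))).
have L2 : 'D_e2 f (a t, eta (h + t)) @[h --> 0^'] --> 'D_e2 f (a t, b t).
  have P1 : (fun=> a t) h @[h --> (0:R)^'] --> a t by exact: cvg_cst.
  have P2 : eta (h + t) @[h --> 0^'] --> b t by apply: (sq b b') => // s; have [] := etaP s.
  exact: (cvg_comp _ _ (cvg_pair P1 P2) (cD2 (a t, b t))).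
have L := cvgD (cvgM L1 (qu _ _ da)) (cvgM L2 (qu _ _ db)).
suff LL : h^-1 *: (((fun s => f (a s, b s)) \o shift t) (h *: (1:R)) - f (a t, b t)) @[h --> 0^'] -->
    'D_e1 f (a t, b t) * a' + 'D_e2 f (a t, b t) * b'.
  by split; [apply/cvg_ex; eexists; exact: LL|exact: cvg_lim].
set F := (X in (X @ _ --> _)); suff -> : F =
  (fun h => 'D_e1 f (xi (h + t), b (h + t)) * (h^-1 * (a (h + t) - a t)) +
            'D_e2 f (a t, eta (h + t)) * (h^-1 * (b (h + t) - b t))) by exact: L.
apply/funext => h; rewrite /F /=.
rewrite /GRing.scale /= mulr1.
have [_ E1] := xiP (h + t); have [_ E2] := etaP (h + t).
have -> : f (a (h + t), b (h + t)) - f (a t, b t) =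
  (f (a (h + t), b (h + t)) - f (a t, b (h + t))) + (f (a t, b (h + t)) - f (a t, b t)) by ring.
by rewrite E1 E2; ring.
Qed.

End TestFunctions.

(** * Lebesgue measure on the plane *)

Section PlaneMeasure.
Context {R : realType}.
Local Notation mu := (@lebesgue_measure R).
Local Notation mu2 := (lebesgue2 R).

(** An open set is the union of the countably many rational boxes that it contains. *)
Lemma open_measurable2 (U : set (R * R)) : open U -> measurable U.
Proof.
move=> oU.
pose box (a b c d : rat) : set (R * R) := `](ratr a : R), ratr b[%classic `*` `](ratr c : R), ratr d[%classic.
have -> : U = \bigcup_a \bigcup_b \bigcup_c \bigcup_d (if `[< box a b c d `<=` U >] then box a b c d else set0).
  apply/seteqP; split => [x Ux|x [a _ [b _ [c _ [d _]]]]]; last first.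
    by case: asboolP => // H; exact: H.
  have /nbhs_ballP[e /= e0 eU] : nbhs x U by apply: open_nbhs_nbhs; split.
  have [a] := @rat_in_itvoo R (x.1 - e) x.1 (ltac:(lra)).
  rewrite in_itv /= => /andP[a1 a2].
  have [b] := @rat_in_itvoo R x.1 (x.1 + e) (ltac:(lra)).
  rewrite in_itv /= => /andP[b1 b2].
  have [c] := @rat_in_itvoo R (x.2 - e) x.2 (ltac:(lra)).
  rewrite in_itv /= => /andP[c1 c2].
  have [d] := @rat_in_itvoo R x.2 (x.2 + e) (ltac:(lra)).
  rewrite in_itv /= => /andP[d1 d2].
  exists a => //; exists b => //; exists c => //; exists d => //.
  case: asboolP => [_|]; first by split; rewrite /= in_itv /=; apply/andP.
  case=> y [] /=; rewrite !in_itv /= => /andP[ya yb] /andP[yc yd]; apply: eU.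
  by split; rewrite /ball /= ltr_distlC; apply/andP; split; lra.
do 4 (apply: bigcupT_measurable_rat => ?).
by case: ifP => // _; apply: measurableX; exact: measurable_itv.
Qed.

Lemma continuous_measurable2 (f : R * R -> R) (D : set (R * R)) : continuous f -> measurable_fun D f.
Proof.
move=> /continuousP cf; apply: measurable_funTS.
apply: (measurability _ (RGenOpens.measurableE R)) => _ [_ [a [b ->]] <-].
rewrite setTI; apply: open_measurable2; apply: cf; exact: interval_open.
Qed.

Lemma measurable_half_plane :
  measurable (half_plane : set (measurableTypeR R * measurableTypeR R)).
Proof.
rewrite (_ : half_plane = `]0, +oo[%classic `*` setT); last first.
  by apply/seteqP; split => x /=; rewrite in_itv /= andbT; [split|case].
by apply: measurableX => //; exact: measurable_itv.
Qed.

Lemma measurable_shift (a : R) : measurable_fun setT ((fun x : R => x + a) : measurableTypeR R -> measurableTypeR R).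
Proof. exact: measurable_funD. Qed.

Lemma measurable_dilate (c : R) : measurable_fun setT ((fun x : R => c * x) : measurableTypeR R -> measurableTypeR R).
Proof. exact: measurable_funM. Qed.

Lemma lebesgue_measure_shift (a : R) (A : set R) : measurable A ->
  pushforward mu ((fun x : R => x + a) : measurableTypeR R -> measurableTypeR R) A = mu A.
Proof.
move=> mA; apply/esym/lebesgue_measure_unique => //; try exact: measurable_shift.
move=> mp _ [[x y]] _ <-.
change (mu `]x, y]%classic = mu ((fun z : R => z + a)%R @^-1` `]x, y]%classic)).
rewrite (_ : (fun z : R => z + a) @^-1` _ = `]x - a, y - a]%classic); last first.
  by apply/seteqP; split => z /=; rewrite !in_itv /= ltrBlDr lerBrDr.
by rewrite !lebesgue_measure_itv /= !lte_fin ltrD2r -!EFinB; congr (if _ then _%:E else _); ring.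
Qed.

Lemma ge0_integral_shift (f : R -> \bar R) (a : R) : measurable_fun setT f ->
  (forall x, (0 <= f x)%E) -> (\int[mu]_x f (x + a)%R = \int[mu]_x f x)%E.
Proof.
move=> mf f0.
have <- := @ge0_integral_pushforward _ _ _ _ _ _ (measurable_shift a) mu setT f measurableT mf (fun y _ => f0 y).
apply: eq_measure_integral; try exact: measurable_shift.
by move=> mp A mA _; exact: lebesgue_measure_shift.
Qed.

Lemma lebesgue_measure_dilate (c : R) (A : set R) : 0 < c -> measurable A ->
  (c%:E * pushforward mu ((fun x : R => (c * x)%R) : measurableTypeR R -> measurableTypeR R) A = mu A)%E.
Proof.
move=> c0 mA.
pose nu := mscale (NngNum (ltW c0)) (pushforward mu ((fun x : R => (c * x)%R) : measurableTypeR R -> measurableTypeR R)).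
rewrite -[LHS]/(nu (measurable_dilate c) A).
apply/esym/lebesgue_measure_unique => // _ [[x y]] _ <-.
change (mu `]x, y]%classic = (c%:E * mu ((fun z : R => c * z)%R @^-1` `]x, y]%classic))%E).
rewrite (_ : (fun z : R => c * z) @^-1` _ = `]c^-1 * x, c^-1 * y]%classic); last first.
  by apply/seteqP; split => z /=; rewrite !in_itv /= ltr_pdivrMl// ler_pdivlMl.
rewrite !lebesgue_measure_itv /= !lte_fin ltr_pM2l ?invr_gt0// -!EFinB.
case: ifP => _; last by rewrite mule0.
by rewrite -EFinM; congr EFin; field; rewrite gt_eqF.
Qed.

Lemma ge0_integral_dilate (f : R -> \bar R) (c : R) : 0 < c -> measurable_fun setT f ->
  (forall x, (0 <= f x)%E) -> (c%:E * \int[mu]_x f (c * x)%R = \int[mu]_x f x)%E.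
Proof.
move=> c0 mf f0.
have <- := @ge0_integral_pushforward _ _ _ _ _ _ (measurable_dilate c) mu setT f measurableT mf (fun y _ => f0 y).
pose m : {measure set (measurableTypeR R) -> \bar R} := pushforward mu ((fun x : R => (c * x)%R) : measurableTypeR R -> measurableTypeR R).
have := @ge0_integral_mscale _ _ _ (m (measurable_dilate c)) _ measurableT (NngNum (ltW c0)) _ mf (fun y _ => f0 y).
move=> /= <-.
apply: eq_measure_integral => A mA _; exact: lebesgue_measure_dilate.
Qed.

End PlaneMeasure.

Section PlaneInvariance.
Context {R : realType}.
Local Notation mu := (@lebesgue_measure R).
Local Notation mu2 := (lebesgue2 R).
Implicit Types (f : R * R -> \bar R) (a b c d s t : R).

Lemma tonelli1 f : measurable_fun setT f -> (forall x, (0 <= f x)%E) ->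
  (\int[mu2]_x f x = \int[mu]_x \int[mu]_y f (x, y))%E.
Proof.
by move=> mf f0; rewrite (@fubini_tonelli1 _ _ (measurableTypeR R) (measurableTypeR R) R mu mu f mf f0).
Qed.

Lemma tonelli2 f : measurable_fun setT f -> (forall x, (0 <= f x)%E) ->
  (\int[mu2]_x f x = \int[mu]_y \int[mu]_x f (x, y))%E.
Proof.
by move=> mf f0; rewrite (@fubini_tonelli2 _ _ (measurableTypeR R) (measurableTypeR R) R mu mu f mf f0).
Qed.

Lemma measurable_tonelli1 f : measurable_fun setT f -> (forall x, (0 <= f x)%E) ->
  measurable_fun setT (fun x => \int[mu]_y f (x, y))%E.
Proof.
by move=> mf f0; exact: (@measurable_fun_fubini_tonelli_F _ _ (measurableTypeR R) (measurableTypeR R) R mu f mf f0).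
Qed.

Lemma measurable_tonelli2 f : measurable_fun setT f -> (forall x, (0 <= f x)%E) ->
  measurable_fun setT (fun y => \int[mu]_x f (x, y))%E.
Proof.
by move=> mf f0; exact: (@measurable_fun_fubini_tonelli_G _ _ (measurableTypeR R) (measurableTypeR R) R mu f mf f0).
Qed.

Definition lin a b c d (x : R * R) : R * R := (a * x.1 + b * x.2, c * x.1 + d * x.2).

Lemma measurable_lin a b c d : measurable_fun setT (lin a b c d).
Proof.
apply: measurable_fun_pair; apply: measurable_funD; apply: measurable_funM => //;
  by [exact: measurable_fst|exact: measurable_snd].
Qed.

Lemma measurable_lin_comp f a b c d : measurable_fun setT f ->
  measurable_fun setT (fun x => f (lin a b c d x)).
Proof. by move=> mf; apply: (measurableT_comp mf); exact: measurable_lin. Qed.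

Lemma measurable_slice1 f (y : R) : measurable_fun setT f -> measurable_fun setT (fun x => f (x, y)).
Proof. by move=> mf; apply: (measurable_fun_pair1 y mf). Qed.

Lemma measurable_slice2 f (x : R) : measurable_fun setT f -> measurable_fun setT (fun y => f (x, y)).
Proof. by move=> mf; apply: (measurable_fun_pair2 x mf). Qed.

Lemma integral_shear1 f c : measurable_fun setT f -> (forall x, (0 <= f x)%E) ->
  (\int[mu2]_x f (lin 1 c 0 1 x) = \int[mu2]_x f x)%E.
Proof.
move=> mf f0.
rewrite (tonelli2 (measurable_lin_comp 1 c 0 1 mf) (fun x => f0 _)).
rewrite (tonelli2 mf f0); apply: eq_integral => y _.
rewrite -(ge0_integral_shift (c * y) (measurable_slice1 y mf) (fun x => f0 _)).
by apply: eq_integral => x _; rewrite /lin /= !mul1r mul0r add0r.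
Qed.

Lemma integral_shear2 f c : measurable_fun setT f -> (forall x, (0 <= f x)%E) ->
  (\int[mu2]_x f (lin 1 0 c 1 x) = \int[mu2]_x f x)%E.
Proof.
move=> mf f0.
rewrite (tonelli1 (measurable_lin_comp 1 0 c 1 mf) (fun x => f0 _)).
rewrite (tonelli1 mf f0); apply: eq_integral => x _.
rewrite -(ge0_integral_shift (c * x) (measurable_slice2 x mf) (fun y => f0 _)).
by apply: eq_integral => y _; rewrite /lin /= !mul1r mul0r addr0 addrC.
Qed.

Lemma integral_dilate2 f c : 0 < c -> measurable_fun setT f -> (forall x, (0 <= f x)%E) ->
  ((c ^+ 2)%:E * \int[mu2]_x f (c * x.1, c * x.2)%R = \int[mu2]_x f x)%E.
Proof.
move=> c0 mf f0.
have mg : measurable_fun setT (fun x : R * R => f (c * x.1, c * x.2)).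
  have := measurable_lin_comp c 0 0 c mf.
  by congr measurable_fun; apply/funext => x; rewrite /lin !mul0r addr0 add0r.
rewrite (tonelli1 mg (fun x => f0 _)) (tonelli1 mf f0).
have F0 x : (0 <= \int[mu]_y f (x, y))%E by apply: integral_ge0 => y _; exact: f0.
rewrite -(ge0_integral_dilate c0 (measurable_tonelli1 mf f0) F0) expr2 EFinM -muleA; congr (_ * _)%E.
rewrite -ge0_integralZl_EFin ?ltW//; last 2 first.
- by move=> x _; apply: integral_ge0 => y _; exact: f0.
- exact: (measurable_tonelli1 mg (fun x => f0 _)).
apply: eq_integral => x _ /=.
by rewrite -(ge0_integral_dilate c0 (measurable_slice2 (c * x) mf) (fun y => f0 _)).
Qed.

(** A rotation is a product of three shears, with parameters [a], [s], [a] where [a = - s / (1 + c)]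
    is minus the tangent of the half angle. On each line parallel to an axis a shear is a
    translation, so Tonelli reduces the claim to translation invariance. *)
Lemma integral_rot_aux f c s : c ^+ 2 + s ^+ 2 = 1 -> 1 + c != 0 ->
  measurable_fun setT f -> (forall x, (0 <= f x)%E) ->
  (\int[mu2]_x f (lin c (- s) s c x) = \int[mu2]_x f x)%E.
Proof.
move=> cs c1 mf f0; pose a := - s / (1 + c).
have m1 := measurable_lin_comp 1 a 0 1 mf.
have m2 := measurable_lin_comp 1 0 s 1 m1.
rewrite -(integral_shear1 a mf f0) -(integral_shear2 s m1 (fun x => f0 _)).
rewrite -(integral_shear1 a m2 (fun x => f0 _)); apply: eq_integral => x _.
have E1 : 1 + a * s = c.
  have : (1 + c) * (1 + a * s) = (1 + c) * c.
    by rewrite /a; transitivity (1 + c - s ^+ 2); [field|have := cs; nra].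
  by move/(mulfI c1).
have E2 : a + c * a = - s by rewrite /a; field.
congr f; rewrite /lin /=; congr pair.
  transitivity ((1 + a * s) * x.1 + (a + (1 + a * s) * a) * x.2); last by ring.
  by rewrite E1 E2.
transitivity (s * x.1 + (1 + a * s) * x.2); last by ring.
by rewrite E1.
Qed.

Lemma integral_rot f c s : c ^+ 2 + s ^+ 2 = 1 ->
  measurable_fun setT f -> (forall x, (0 <= f x)%E) ->
  (\int[mu2]_x f (lin c (- s) s c x) = \int[mu2]_x f x)%E.
Proof.
move=> cs mf f0; have [c1|c1] := eqVneq (1 + c) 0; last exact: integral_rot_aux.
(* The half turn, excluded from the shear factorization, is the square of a quarter turn. *)
have c1' : c = -1 by lra.
have s0 : s = 0 by apply/eqP; rewrite -(sqrf_eq0 s) -(subrr 1) -[X in _ == X - _]cs c1'; apply/eqP; lra.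
have h : (0:R) ^+ 2 + 1 ^+ 2 = 1 by rewrite expr0n expr1n add0r.
have h1 : 1 + 0 != 0 :> R by rewrite addr0 oner_neq0.
have m1 := measurable_lin_comp 0 (-1) 1 0 mf.
rewrite -(integral_rot_aux h h1 mf f0) -(integral_rot_aux h h1 m1 (fun x => f0 _)).
apply: eq_integral => x _; congr f; rewrite /lin /= c1' s0; congr pair; ring.
Qed.

End PlaneInvariance.

Section OneDim.
Context {R : realType}.
Local Notation mu := (@lebesgue_measure R).
Local Notation mu2 := (lebesgue2 R).
Implicit Types (f df g : R -> R) (a b t : R).

Lemma lebesgue_itv a b : a <= b -> mu `[a, b]%classic = (b - a)%:E.
Proof.
move=> ab; rewrite lebesgue_measure_itv /= lte_fin.
by move: ab; rewrite le_eqVlt => /predU1P[->|->]; rewrite ?ltxx ?subrr// -EFinB.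
Qed.

Lemma integral_indic_itvE a b : a <= b ->
  (\int[mu]_s (\1_(`[a, b]%classic : set R) s)%:E = (b - a)%:E)%E.
Proof.
move=> ab; rewrite -(lebesgue_itv ab).
rewrite (@integral_indic _ _ _ mu setT measurableT `[a, b]%classic) ?setIT//.
Qed.

Lemma continuous_integrable_itv g a b : continuous g ->
  mu.-integrable `[a, b]%classic (EFin \o g).
Proof.
move=> cg; apply: continuous_compact_integrable; first exact: segment_compact.
exact: continuous_subspaceT.
Qed.

Lemma FTC_itv f df a b : (forall t : R, is_derive t 1 f (df t)) -> continuous df ->
  a <= b -> f b - f a = \int[mu]_(t in `[a, b]) df t.
Proof.
move=> D cdf; rewrite le_eqVlt => /predU1P[<-|ab].
  by rewrite subrr set_itv1 Rintegral_set1.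
have cf : continuous f by move=> t; exact: is_derive_continuous (D t).
rewrite /Rintegral (@continuous_FTC2 _ df f)//=.
- exact: continuous_subspaceT.
- split.
  + by move=> t _; case: (D t).
  + by apply: cvg_at_right_filter; exact: cf.
  + by apply: cvg_at_left_filter; exact: cf.
- by move=> t _; rewrite derive1E; have [_] := D t.
Qed.

Lemma abs_FTC f df a b : (forall t : R, is_derive t 1 f (df t)) -> continuous df ->
  a <= b -> ((`|f b - f a|)%:E <= \int[mu]_(t in `[a, b]) (`|df t|)%:E)%E.
Proof.
move=> D cdf ab; rewrite (FTC_itv D cdf ab).
have i := @continuous_integrable_itv df a b cdf.
rewrite EFin_normr_Rintegral//; exact: le_abse_integral (measurable_int _ i).
Qed.

Lemma sq_FTC f df a b : (forall t : R, is_derive t 1 f (df t)) -> continuous df ->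
  a <= b -> ((((f b - f a) ^+ 2)%:E) <= (b - a)%:E * \int[mu]_(t in `[a, b]) ((df t) ^+ 2)%:E)%E.
Proof.
move=> D cdf ab.
have L g : continuous g -> L2 mu `[a, b]%classic g.
  move=> cg; split; first by apply: measurable_funTS; exact: continuous_measurable_fun.
  have cg2 : continuous (fun t => g t ^+ 2) by move=> t; under eq_fun do rewrite expr2; apply: cvgM; exact: cg.
  by apply: (integrable_lty _ (@continuous_integrable_itv _ a b cg2)); exact: measurable_itv.
have mab : measurable (`[a, b]%classic : set (measurableTypeR R)) by exact: measurable_itv.
have c1 : continuous (fun _ : R => 1 : R) by move=> ?; exact: cst_continuous.
have := ip_CS mab (L _ cdf) (L _ c1); rewrite -(nsqE mab (L _ cdf)) -EFinM lee_fin.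
have -> : ip mu `[a, b]%classic df (fun _ => 1) = f b - f a.
  by rewrite (FTC_itv D cdf ab) ipE; apply: eq_Rintegral => t _; rewrite mulr1.
suff -> : nsq mu `[a, b]%classic (fun _ : R => 1) = b - a by rewrite mulrC.
rewrite /nsq ipE mulr1 Rintegral_cst//= lebesgue_measure_itv /= lte_fin.
by move: ab; rewrite le_eqVlt => /predU1P[->|->]; rewrite ?ltxx ?subrr ?mulr0//= mul1r.
Qed.

(** For every [t] in the unit interval [f 0] is at most [f t] plus the integral of [|df|]; averaging
    over [t] gives the claim. *)
Lemma le_int_FTC f df : (forall t : R, is_derive t 1 f (df t)) -> continuous df ->
  (forall t, 0 <= f t) ->
  ((f 0)%:E <= \int[mu]_(t in `[0%R, 1%R]) (f t + `|df t|)%:E)%E.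
Proof.
move=> D cdf f0.
have cf : continuous f by move=> t; exact: is_derive_continuous (D t).
have m01 : measurable (`[0, 1]%classic : set R) by exact: measurable_itv.
have cadf : continuous (fun t => `|df t|) by move=> t; apply: cvg_norm; exact: cdf.
have iadf := @continuous_integrable_itv _ 0 1 cadf.
have if_ := @continuous_integrable_itv _ 0 1 cf.
pose I := \int[mu]_(t in `[0, 1]) `|df t|.
have IE : (I%:E = \int[mu]_(t in `[0%R, 1%R]) (`|df t|)%:E)%E.
  by rewrite /I /Rintegral fineK//; exact: integrable_fin_num iadf.
have H t : t \in `[0, 1]%classic -> f 0 <= f t + I.
  rewrite inE /= in_itv /= => /andP[t0 t1].
  rewrite -lerBlDl; apply: le_trans (ler_norm _) _; rewrite distrC -lee_fin.
  apply: le_trans (abs_FTC D cdf t0) _; rewrite IE.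
  apply: ge0_subset_integral => //; try exact: measurable_itv.
  - by apply/measurable_EFinP/measurable_funTS; exact: continuous_measurable_fun.
  - by apply: subset_itvl; rewrite bnd_simp.
rewrite (_ : (\int[mu]_(t in _) _)%E = (\int[mu]_(t in `[0%R, 1%R]) (f t + I)%:E)%E); last first.
  under eq_integral do rewrite EFinD. under [RHS]eq_integral do rewrite EFinD.
  rewrite integralD//; rewrite integralD//; last first.
    exact: (continuous_integrable_itv 0 1 (@cst_continuous _ _ I)).
  congr (_ + _)%E; rewrite -IE; transitivity (I%:E * mu `[0%R, 1%R]%classic)%E.
    by rewrite lebesgue_measure_itv /= lte_fin ltr01 -EFinB subr0 mule1.
  by apply/esym; exact: integral_cst.
apply: (@le_trans _ _ (\int[mu]_(t in `[0%R, 1%R]) (f 0)%:E)%E).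
  have -> : (\int[mu]_(t in `[0%R, 1%R]) (f 0)%:E)%E = ((f 0)%:E * mu `[0%R, 1%R]%classic)%E.
    exact: integral_cst.
  by rewrite lebesgue_measure_itv /= lte_fin ltr01 -EFinB subr0 mule1.
apply: ge0_le_integral => //.
- by move=> t _; rewrite lee_fin.
- apply/measurable_EFinP/measurable_funD => //.
  by apply: measurable_funTS; exact: continuous_measurable_fun.
- by move=> t tI; rewrite lee_fin H// inE.
Qed.

Lemma tonelli_rot (G : R * (R * R) -> \bar R) : measurable_fun setT G ->
  (forall x, (0 <= G x)%E) ->
  (\int[mu2]_x \int[mu]_s G (s, x) = \int[mu]_s \int[mu2]_x G (s, x))%E.
Proof.
move=> mG G0.
have swap (K : R * R -> \bar R) : measurable_fun setT K -> (forall x, (0 <= K x)%E) ->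
    (\int[mu]_a \int[mu]_s K (s, a) = \int[mu]_s \int[mu]_a K (s, a))%E.
  by move=> mK K0; rewrite -tonelli2// -tonelli1.
have int0 (g : R -> \bar R) : (forall t, (0 <= g t)%E) -> (0 <= \int[mu]_t g t)%E.
  by move=> g0; apply: integral_ge0 => t _; exact: g0.
have mGs : measurable_fun setT (fun x : R * R => \int[mu]_s G (s, x))%E.
  exact: (@measurable_fun_fubini_tonelli_G _ _ (measurableTypeR R) (measurableTypeR R * measurableTypeR R)%type R mu G mG G0).
rewrite tonelli1//; last by move=> x; exact: int0.
have mGa a : measurable_fun setT (fun y : R * R => G (y.1, (a, y.2))).
  apply: (measurableT_comp mG); apply: measurable_fun_pair; first exact: measurable_fst.
  by apply: measurable_fun_pair; [exact: measurable_cst|exact: measurable_snd].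
transitivity (\int[mu]_a \int[mu]_s \int[mu]_b G (s, (a, b)))%E.
  by apply: eq_integral => a _; rewrite (swap (fun y => G (y.1, (a, y.2)))).
have mK : measurable_fun setT (fun y : (R * R) * R => G (y.1.1, (y.1.2, y.2))).
  apply: (measurableT_comp mG); apply: measurable_fun_pair.
    by apply: (measurableT_comp measurable_fst); exact: measurable_fst.
  apply: measurable_fun_pair; last exact: measurable_snd.
  by apply: (measurableT_comp measurable_snd); exact: measurable_fst.
have mKF := @measurable_fun_fubini_tonelli_F _ _ (measurableTypeR R * measurableTypeR R)%type (measurableTypeR R) R mu _ mK (fun y => G0 _).
rewrite (swap (fun y => \int[mu]_b G (y.1, (y.2, b)))%E mKF); last by move=> x; exact: int0.
apply: eq_integral => s _; rewrite tonelli1//.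
apply: (measurableT_comp mG); apply: measurable_fun_pair => //; exact: measurable_cst.
Qed.

(** [1 - cos d] is twice the square of [sin (d / 2)], and by the mean value theorem [sin (d / 2)] is
    at least [cos 1 * (d / 2)]. The value [cos 1] merely serves as an explicit positive constant. *)
Lemma one_minus_cos_ge (d : R) : 0 <= d <= 1 -> cos 1 ^+ 2 * d ^+ 2 / 2 <= 1 - cos d.
Proof.
move=> /andP[d0 d1]; have c1 := @cos1_gt0 R.
have h0 : 0 <= d / 2 by lra.
have [c + E] := MVT_segment h0 (fun t _ => is_derive_sin t) (continuous_subspaceT (@continuous_sin R)).
rewrite in_itv /= => /andP[c0 ch].
have cc : cos 1 <= cos c.
  have p1 : 1 <= pi :> R by have := @pihalf_ge1 R; lra.
  by rewrite leNgt ltr_cos ?in_itv /= -?leNgt; [lra| |]; apply/andP; split; lra.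
have S : cos 1 * (d / 2) <= sin (d / 2).
  by move: E; rewrite sin0 !subr0 => ->; rewrite ler_wpM2r.
have -> : 1 - cos d = 2 * sin (d / 2) ^+ 2.
  have -> : d = d / 2 + d / 2 by lra.
  rewrite [in LHS]cosD -!expr2; have := cos2Dsin2 (d / 2).
  have -> : d / 2 + d / 2 = d by lra.
  lra.
have : (cos 1 * (d / 2)) ^+ 2 <= sin (d / 2) ^+ 2.
  by rewrite ler_sqr ?nnegrE ?mulr_ge0 ?(ltW c1)//; apply: le_trans S; rewrite mulr_ge0 ?(ltW c1).
by rewrite exprMn; lra.
Qed.

End OneDim.

(** * Inequalities for test functions *)

Section Rotations.
Context {R : realType}.
Local Notation mu := (@lebesgue_measure R).
Local Notation mu2 := (lebesgue2 R).
Implicit Types (phi : R * R -> R) (x y : R * R) (s t : R).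

Definition rot s x : R * R := lin (cos s) (- sin s) (sin s) (cos s) x.

Definition dth phi : R * R -> R := fun x => x.1 * 'D_e2 phi x - x.2 * 'D_e1 phi x.

Lemma rotK s x : rot (- s) (rot s x) = x.
Proof.
rewrite /rot /lin cosN sinN /= opprK; case: x => a b /=; have := cos2Dsin2 s => E.
congr pair.
  by transitivity ((cos s ^+ 2 + sin s ^+ 2) * a); [ring|rewrite E mul1r].
by transitivity ((cos s ^+ 2 + sin s ^+ 2) * b); [ring|rewrite E mul1r].
Qed.

Lemma rot0 x : rot 0 x = x.
Proof. by rewrite /rot /lin cos0 sin0 oppr0 !mul1r !mul0r addr0 add0r; case: x. Qed.

Lemma rot_pi x : rot pi x = (- x.1, - x.2).
Proof. by rewrite /rot /lin cospi sinpi oppr0 !mulN1r !mul0r addr0 add0r. Qed.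

(** [dth phi] is the derivative of [phi] along the rotation flow. All angular estimates become
    one-variable calculus through this. *)
Lemma is_derive_rot phi x t : class_C 1 phi ->
  is_derive t 1 (fun s => phi (rot s x)) (dth phi (rot t x)).
Proof.
move=> cp.
have da : is_derive t 1 (fun s : R => cos s * x.1 + - sin s * x.2) (- sin t * x.1 - cos t * x.2).
  have h1 := is_derive_mul (is_derive_cos t) (@is_derive_cst _ _ _ x.1 t (1:R)).
  have h2 := is_derive_mul (is_derive_opp (is_derive_sin t)) (@is_derive_cst _ _ _ x.2 t (1:R)).
  by have := is_derive_add h1 h2; move/is_derive_eq; apply; rewrite !mulr0; lra.
have db : is_derive t 1 (fun s : R => sin s * x.1 + cos s * x.2) (cos t * x.1 - sin t * x.2).
  have h1 := is_derive_mul (is_derive_sin t) (@is_derive_cst _ _ _ x.1 t (1:R)).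
  have h2 := is_derive_mul (is_derive_cos t) (@is_derive_cst _ _ _ x.2 t (1:R)).
  by have := is_derive_add h1 h2; move/is_derive_eq; apply; rewrite !mulr0; lra.
have := C1_curve cp da db; move/is_derive_eq; apply.
by rewrite /dth /rot /lin /=; ring.
Qed.

Lemma rot_continuous x : continuous (fun s => rot s x).
Proof.
move=> s.
have a1 : (cos t * x.1 + - sin t * x.2) @[t --> s] --> cos s * x.1 + - sin s * x.2.
  apply: cvgD; apply: cvgM; try exact: cvg_cst; first exact: continuous_cos.
  by apply: cvgN; exact: continuous_sin.
have a2 : (sin t * x.1 + cos t * x.2) @[t --> s] --> sin s * x.1 + cos s * x.2.
  by apply: cvgD; apply: cvgM; try exact: cvg_cst; [exact: continuous_sin|exact: continuous_cos].
exact: (cvg_pair a1 a2).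
Qed.

Lemma dth_continuous phi : class_C 1 phi -> continuous (dth phi).
Proof.
move=> [_ [_ [k1 k2]]] x.
have c1 := k1.1; have c2 := k2.1.
have h1 : (y.1 * 'D_e2 phi y) @[y --> x] --> x.1 * 'D_e2 phi x.
  by apply: cvgM; [exact: cvg_fst|exact: c2].
have h2 : (y.2 * 'D_e1 phi y) @[y --> x] --> x.2 * 'D_e1 phi x.
  by apply: cvgM; [exact: cvg_snd|exact: c1].
exact: (cvgB h1 h2).
Qed.

Lemma measurable_rot2 : measurable_fun setT (fun z : R * (R * R) => rot z.1 z.2).
Proof.
have mc : measurable_fun setT (fun z : R * (R * R) => cos z.1).
  apply: (measurableT_comp _ measurable_fst); exact: continuous_measurable_fun (@continuous_cos R).
have ms : measurable_fun setT (fun z : R * (R * R) => sin z.1).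
  apply: (measurableT_comp _ measurable_fst); exact: continuous_measurable_fun (@continuous_sin R).
have m1 : measurable_fun setT (fun z : R * (R * R) => z.2.1).
  by apply: (measurableT_comp measurable_fst); exact: measurable_snd.
have m2 : measurable_fun setT (fun z : R * (R * R) => z.2.2).
  by apply: (measurableT_comp measurable_snd); exact: measurable_snd.
apply: measurable_fun_pair; apply: measurable_funD; apply: measurable_funM => //.
exact: measurableT_comp.
Qed.

Lemma measurable_rotN2 : measurable_fun setT (fun z : R * (R * R) => rot (- z.1) z.2).
Proof.
have mN : measurable_fun setT (fun z : R * (R * R) => (- z.1, z.2)).
  apply: measurable_fun_pair; last exact: measurable_snd.
  by apply: measurableT_comp => //; exact: measurable_fst.
exact: (measurableT_comp measurable_rot2 mN).
Qed.

Lemma measurable_rot1 (F : R * R -> R) x : measurable_fun setT F ->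
  measurable_fun setT (fun s : R => F (rot s x)).
Proof.
move=> mF; apply: (measurableT_comp mF).
have mc : measurable_fun setT (@cos R) by exact: continuous_measurable_fun (@continuous_cos R).
have ms : measurable_fun setT (@sin R) by exact: continuous_measurable_fun (@continuous_sin R).
apply: measurable_fun_pair; apply: measurable_funD; apply: measurable_funM => //.
exact: measurableT_comp.
Qed.

Lemma measurable_rotN1 (F : R * R -> R) x : measurable_fun setT F ->
  measurable_fun setT (fun s : R => F (rot (- s) x)).
Proof.
move=> mF; rewrite (_ : (fun s => _) = (fun s => F (lin (cos s) (sin s) (- sin s) (cos s) x))); last first.
  by apply/funext => s; rewrite /rot cosN sinN opprK.
apply: (measurableT_comp mF).
have mc : measurable_fun setT (@cos R) by exact: continuous_measurable_fun (@continuous_cos R).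
have ms : measurable_fun setT (@sin R) by exact: continuous_measurable_fun (@continuous_sin R).
apply: measurable_fun_pair; apply: measurable_funD; apply: measurable_funM => //.
exact: measurableT_comp.
Qed.

Lemma integral_rotE (F : R * R -> \bar R) s : measurable_fun setT F -> (forall x, (0 <= F x)%E) ->
  (\int[mu2]_x F (rot s x) = \int[mu2]_x F x)%E.
Proof. by move=> mF F0; apply: integral_rot => //; exact: cos2Dsin2. Qed.

(** For fixed [s], substitute [y = rot s x]. The rotation moves from the integrand to the set, so
    that for fixed [y] only the set of angles bringing [y] into [Q] matters. *)
Lemma int_rot_swap (F : R * R -> R) (A : set R) (Q : set (R * R)) :
  measurable_fun setT F -> (forall x, 0 <= F x) -> measurable A -> measurable Q ->
  (\int[mu2]_x \int[mu]_s (\1_A s * (\1_Q x * F (rot s x)))%:E =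
   \int[mu2]_y \int[mu]_s (\1_A s * (\1_Q (rot (- s) y) * F y))%:E)%E.
Proof.
move=> mF F0 mA mQ.
have mA1 : measurable_fun setT (fun z : R * (R * R) => \1_A z.1 : R).
  by apply: (measurableT_comp _ measurable_fst); exact: measurable_indic.
rewrite (@tonelli_rot _ (fun z => (\1_A z.1 * (\1_Q z.2 * F (rot z.1 z.2)))%:E)); last 2 first.
- apply/measurable_EFinP/measurable_funM => //; apply: measurable_funM.
    by apply: (measurableT_comp _ measurable_snd); exact: measurable_indic.
  exact: (measurableT_comp mF measurable_rot2).
- by move=> z; rewrite lee_fin !mulr_ge0.
rewrite (@tonelli_rot _ (fun z => (\1_A z.1 * (\1_Q (rot (- z.1) z.2) * F z.2))%:E)); last 2 first.
- apply/measurable_EFinP/measurable_funM => //; apply: measurable_funM.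
    by apply: (measurableT_comp _ measurable_rotN2); exact: measurable_indic.
  exact: (measurableT_comp mF measurable_snd).
- by move=> z; rewrite lee_fin !mulr_ge0.
apply: eq_integral => s _ /=.
rewrite -(@integral_rotE (fun y => (\1_A s * (\1_Q (rot (- s) y) * F y))%:E) s); last 2 first.
- apply/measurable_EFinP/measurable_funM => //; apply: measurable_funM => //.
  apply: (measurableT_comp (measurable_indic mQ)); exact: measurable_lin.
- by move=> z; rewrite lee_fin !mulr_ge0.
by apply: eq_integral => x _; rewrite rotK.
Qed.

Lemma integral_indic_itv (g : R -> R) (A : set R) :
  (\int[mu]_(s in A) (g s)%:E = \int[mu]_s (\1_A s * g s)%:E)%E.
Proof.
rewrite integral_mkcond; apply: eq_integral => s _.
by rewrite /patch indicE; case: ifP => _; rewrite ?mul1r ?mul0r.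
Qed.

Lemma poincare_test phi : test_function phi ->
  (\int[mu2]_x (phi x ^+ 2)%:E <= (pi ^+ 2)%:E * \int[mu2]_x (dth phi x ^+ 2)%:E)%E.
Proof.
move=> tp; have c1 := test_smooth tp 1%N.
have cd := dth_continuous c1.
have md : measurable_fun setT (fun x => dth phi x ^+ 2) by apply: measurable_funX; exact: continuous_measurable2.
have p0 : 0 <= pi :> R by exact: pi_ge0.
pose A : set R := `[0, pi]%classic.
have mA : measurable A by exact: measurable_itv.
pose K x : \bar R := (\int[mu]_s (\1_A s * (\1_setT x * (dth phi (rot s x)) ^+ 2))%:E)%E.
have nn s x : 0 <= \1_A s * (\1_[set: R * R] x * dth phi (rot s x) ^+ 2).
  by apply: mulr_ge0 => //; apply: mulr_ge0 => //; exact: sqr_ge0.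
have key x : ((phi x ^+ 2)%:E <= pi%:E * K x)%E.
  have K0 : (0 <= K x)%E by apply: integral_ge0 => s _; rewrite lee_fin; exact: nn.
  have [x0|x0] := leP x.1 0.
    by rewrite (test_half tp x0) expr0n /= mule_ge0.
  have D s := is_derive_rot x s c1.
  have cds : continuous (fun s => dth phi (rot s x)).
    by move=> s; apply: (continuous_comp (@rot_continuous x s)); exact: cd.
  have := sq_FTC D cds p0; rewrite rot0 subr0 rot_pi (@test_half _ phi (- x.1, - x.2) tp) /=; last by rewrite oppr_le0 ltW.
  rewrite sub0r sqrrN integral_indic_itv; congr (_ <= _ * _)%E.
  by apply: eq_integral => s _; rewrite [\1_setT x]indicE in_setT mul1r.
apply: (@le_trans _ _ (\int[mu2]_x (pi%:E * K x))%E).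
  apply: ge0_le_integral => //.
  - by move=> x _; rewrite lee_fin sqr_ge0.
  - by apply/measurable_EFinP; apply: measurable_funX; apply: continuous_measurable2; exact: test_continuous.
  - apply: measurable_funeM.
    apply: (@measurable_fun_fubini_tonelli_G _ _ (measurableTypeR R) (measurableTypeR R * measurableTypeR R)%type R mu (fun z => (\1_A z.1 * (\1_setT z.2 * dth phi (rot z.1 z.2) ^+ 2))%:E)).
    + apply/measurable_EFinP/measurable_funM; last apply: measurable_funM.
      * by apply: (measurableT_comp _ measurable_fst); exact: measurable_indic.
      * by apply: (measurableT_comp _ measurable_snd); exact: measurable_indic.
      * exact: (measurableT_comp md measurable_rot2).
    + by move=> z; rewrite lee_fin; exact: nn.
rewrite ge0_integralZl_EFin//; last 2 first.
- by move=> x _; apply: integral_ge0 => s _; rewrite lee_fin; exact: nn.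
- apply: (@measurable_fun_fubini_tonelli_G _ _ (measurableTypeR R) (measurableTypeR R * measurableTypeR R)%type R mu (fun z => (\1_A z.1 * (\1_setT z.2 * dth phi (rot z.1 z.2) ^+ 2))%:E)).
  + apply/measurable_EFinP/measurable_funM; last apply: measurable_funM.
    * by apply: (measurableT_comp _ measurable_fst); exact: measurable_indic.
    * by apply: (measurableT_comp _ measurable_snd); exact: measurable_indic.
    * exact: (measurableT_comp md measurable_rot2).
  + by move=> z; rewrite lee_fin; exact: nn.
(* One factor [pi] came from Cauchy-Schwarz along the half turn; the other is the measure of the set
   of angles, since by rotation invariance each angle contributes the same integral. *)
rewrite expr2 EFinM -muleA lee_wpmul2l ?lee_fin//.
rewrite (int_rot_swap md (fun x => sqr_ge0 _) mA measurableT).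
rewrite -ge0_integralZl_EFin//; last 2 first.
- by move=> x _; rewrite lee_fin sqr_ge0.
- exact/measurable_EFinP.
rewrite le_eqVlt; apply/orP; left; apply/eqP; apply: eq_integral => x _.
transitivity (\int[mu]_s ((dth phi x ^+ 2)%:E * (\1_A s)%:E))%E.
  by apply: eq_integral => s _; rewrite [\1_setT _]indicE in_setT mul1r mulrC EFinM.
rewrite ge0_integralZl_EFin ?sqr_ge0//; last first.
  by apply/measurable_EFinP; exact: measurable_indic.
by rewrite integral_indic_itvE// subr0 muleC.
Qed.

Lemma measurable_int_rot (F : R * R -> R) (A : set R) (Q : set (R * R)) :
  measurable_fun setT F -> (forall x, 0 <= F x) -> measurable A -> measurable Q ->
  measurable_fun setT (fun x => \int[mu]_s (\1_A s * (\1_Q x * F (rot s x)))%:E)%E /\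
  measurable_fun setT (fun x => \int[mu]_s (\1_A s * (\1_Q (rot (- s) x) * F x))%:E)%E.
Proof.
move=> mF F0 mA mQ.
have mA1 : measurable_fun setT (fun z : R * (R * R) => \1_A z.1 : R).
  by apply: (measurableT_comp _ measurable_fst); exact: measurable_indic.
split.
  apply: (@measurable_fun_fubini_tonelli_G _ _ (measurableTypeR R) (measurableTypeR R * measurableTypeR R)%type R mu (fun z => (\1_A z.1 * (\1_Q z.2 * F (rot z.1 z.2)))%:E)).
    apply/measurable_EFinP/measurable_funM => //; apply: measurable_funM.
      by apply: (measurableT_comp _ measurable_snd); exact: measurable_indic.
    exact: (measurableT_comp mF measurable_rot2).
  by move=> z; rewrite lee_fin !mulr_ge0.
apply: (@measurable_fun_fubini_tonelli_G _ _ (measurableTypeR R) (measurableTypeR R * measurableTypeR R)%type R mu (fun z => (\1_A z.1 * (\1_Q (rot (- z.1) z.2) * F z.2))%:E)).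
  apply/measurable_EFinP/measurable_funM => //; apply: measurable_funM.
    by apply: (measurableT_comp _ measurable_rotN2); exact: measurable_indic.
  exact: (measurableT_comp mF measurable_snd).
by move=> z; rewrite lee_fin !mulr_ge0.
Qed.

Lemma rot_dist s t y : (rot s y).1 - (rot t y).1 = (cos s - cos t) * y.1 - (sin s - sin t) * y.2 /\
  (rot s y).2 - (rot t y).2 = (sin s - sin t) * y.1 + (cos s - cos t) * y.2.
Proof. by rewrite /rot /lin /=; split; ring. Qed.

(** The squared chord between two positions of [y] is [2 * |y| ^ 2 * (1 - cos (s - t))], to which
    [one_minus_cos_ge] applies. *)
Lemma rot_chord s t y : 0 <= s - t <= 1 ->
  (y.1 ^+ 2 + y.2 ^+ 2) * (cos 1 * (s - t)) ^+ 2 <=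
  ((rot (- s) y).1 - (rot (- t) y).1) ^+ 2 + ((rot (- s) y).2 - (rot (- t) y).2) ^+ 2.
Proof.
move=> st; have [-> ->] := rot_dist (- s) (- t) y; rewrite !cosN !sinN.
have -> : ((cos s - cos t) * y.1 - (- sin s - - sin t) * y.2) ^+ 2 +
  ((- sin s - - sin t) * y.1 + (cos s - cos t) * y.2) ^+ 2 =
  (y.1 ^+ 2 + y.2 ^+ 2) * ((cos s ^+ 2 + sin s ^+ 2) + (cos t ^+ 2 + sin t ^+ 2)
     - 2 * (cos s * cos t + sin s * sin t)) by ring.
rewrite !cos2Dsin2.
have -> : cos s * cos t + sin s * sin t = cos (s - t) by rewrite cosD cosN sinN; ring.
have := one_minus_cos_ge st; rewrite exprMn => H.
by apply: ler_wpM2l; [rewrite addr_ge0 ?sqr_ge0|lra].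
Qed.

(** Along the rotation, [le_int_FTC] bounds [phi ^ 2] at [x] by the integral over angles in [[0, 1]]
    of [2 * phi ^ 2 + dth phi ^ 2], the cross term [2 * |phi * dth phi|] being split. After
    integration over [Q] and [int_rot_swap], each [y] is weighted by the measure of the angles that
    bring it into [Q]. By [rot_chord] two such angles differ by at most [L = d / (rho * cos 1)]. *)
Lemma far_test phi (Q : set (R * R)) (d rho : R) : test_function phi -> measurable Q ->
  0 < d -> 0 < rho ->
  (forall x y, Q x -> Q y -> (x.1 - y.1) ^+ 2 + (x.2 - y.2) ^+ 2 <= d ^+ 2) ->
  (forall x, Q x -> rho ^+ 2 <= x.1 ^+ 2 + x.2 ^+ 2) ->
  (\int[mu2]_(x in Q) (phi x ^+ 2)%:E <=
   (2 * (d / (rho * cos 1)))%:E * \int[mu2]_x (2 * phi x ^+ 2 + dth phi x ^+ 2)%:E)%E.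
Proof.
move=> tp mQ d0 r0 Qd Qr; have c1 := test_smooth tp 1%N.
have cd := dth_continuous c1; have cp := test_continuous tp.
have k0 := @cos1_gt0 R.
set L := d / (rho * cos 1).
have L0 : 0 < L by rewrite divr_gt0// mulr_gt0.
pose F x := 2 * phi x ^+ 2 + dth phi x ^+ 2.
have F0 x : 0 <= F x.
  by rewrite /F; have := sqr_ge0 (phi x); have := sqr_ge0 (dth phi x); lra.
have mF : measurable_fun setT F.
  apply: measurable_funD; last by apply: measurable_funX; exact: continuous_measurable2.
  by apply: measurable_funM => //; apply: measurable_funX; exact: continuous_measurable2.
pose A : set R := `[0, 1]%classic.
have mA : measurable A by exact: measurable_itv.
have nn (B : set R) s x y : 0 <= \1_B s * (\1_Q x * F y) by rewrite !mulr_ge0.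
apply: (@le_trans _ _ (\int[mu2]_x \int[mu]_s (\1_A s * (\1_Q x * F (rot s x)))%:E)%E).
  rewrite integral_mkcond; apply: ge0_le_integral.
  - exact: measurableT.
  - by move=> x _; apply: erestrict_ge0 => z _; rewrite lee_fin sqr_ge0.
  - apply/(measurable_restrictT _ mQ); apply: measurable_funTS.
    by apply/measurable_EFinP; apply: measurable_funX; exact: continuous_measurable2.
  - exact: (measurable_int_rot mF F0 mA mQ).1.
  move=> x _; rewrite /patch; case: ifP => [xQ|_]; last first.
    by apply: integral_ge0 => s _; rewrite lee_fin; exact: nn.
  have D s := is_derive_rot x s c1.
  have D2 s : is_derive s 1 (fun s => phi (rot s x) ^+ 2) (2 * (phi (rot s x) * dth phi (rot s x))).
    by have := is_derive_pow 2 (D s); move/is_derive_eq; apply; rewrite /= expr1; ring.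
  have crot (g : R * R -> R) : continuous g -> continuous (fun s => g (rot s x)).
    by move=> cg s; apply: (continuous_comp (@rot_continuous x s)); exact: cg.
  have cds : continuous (fun s => 2 * (phi (rot s x) * dth phi (rot s x))).
    by move=> s; apply: cvgM; [exact: cvg_cst|apply: cvgM; apply: crot].
  apply: le_trans (le_trans (le_int_FTC D2 cds (fun s => sqr_ge0 _)) _).
    by rewrite rot0.
  rewrite integral_indic_itv; apply: ge0_le_integral => //.
  - by move=> s _; rewrite lee_fin mulr_ge0// addr_ge0 ?sqr_ge0.
  - apply/measurable_EFinP/measurable_funM; first exact: measurable_indic.
    apply: measurable_funD; first by apply: measurable_funX; apply: continuous_measurable_fun; exact: crot.
    by apply: measurableT_comp => //; exact: continuous_measurable_fun.
  - apply/measurable_EFinP/measurable_funM; first exact: measurable_indic.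
    apply: measurable_funM => //.
    exact: (measurable_rot1 x mF).
  - move=> s _; rewrite lee_fin; apply: ler_wpM2l => //.
    rewrite indicE xQ mul1r /F normrM ger0_norm// normrM.
    rewrite -(real_normK (num_real (phi (rot s x)))) -(real_normK (num_real (dth phi (rot s x)))).
    by have := sqr_ge0 (`|phi (rot s x)| - `|dth phi (rot s x)|); lra.
rewrite (int_rot_swap mF F0 mA mQ) -ge0_integralZl_EFin//; last 3 first.
- by move=> x _; rewrite lee_fin; exact: F0.
- exact/measurable_EFinP.
- by rewrite mulr_ge0// ltW.
apply: ge0_le_integral.
- exact: measurableT.
- by move=> x _; apply: integral_ge0 => s _; rewrite lee_fin; exact: nn.
- exact: (measurable_int_rot mF F0 mA mQ).2.
- by apply: measurable_funeM; exact/measurable_EFinP.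
move=> y _.
have [[s0 [As0 Qs0]]|nS] := pselect (exists s, A s /\ Q (rot (- s) y)); last first.
  rewrite integral0_eq; first by rewrite mule_ge0// lee_fin ?F0// mulr_ge0// ltW.
  move=> s _; rewrite !indicE; case: (boolP (s \in A)) => sA; last by rewrite mul0r.
  case: (boolP (_ \in Q)) => sQ; last by rewrite mul0r mulr0.
  by exfalso; apply: nS; exists s; rewrite inE in sA; rewrite inE in sQ.
(* All admissible angles lie within [L] of the one already found, whence the factor [2 * L]. *)
pose B : set R := `[s0 - L, s0 + L]%classic.
have mB : measurable B by exact: measurable_itv.
apply: (@le_trans _ _ (\int[mu]_s ((F y)%:E * (\1_B s)%:E))%E); last first.
  rewrite ge0_integralZl_EFin//; last by apply/measurable_EFinP; exact: measurable_indic.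
  rewrite integral_indic_itvE; last lra.
  rewrite -!EFinM lee_fin (_ : s0 + L - (s0 - L) = 2 * L); last lra.
  by rewrite mulrC.
apply: ge0_le_integral => //.
- by move=> s _; rewrite lee_fin; exact: nn.
- apply/measurable_EFinP/measurable_funM; first exact: measurable_indic.
  apply: measurable_funM => //.
  exact: (measurable_rotN1 y (measurable_indic mQ)).
- by apply: measurable_funeM; apply/measurable_EFinP; exact: measurable_indic.
move=> s _; rewrite -EFinM lee_fin !indicE.
case: (boolP (s \in A)) => sA; last by rewrite mul0r mulr_ge0.
case: (boolP (_ \in Q)) => sQ; last by rewrite mul0r mulr0 mulr_ge0.
rewrite !mul1r; suff -> : s \in B by rewrite mulr1.
rewrite inE in sA; rewrite inE in sQ.
have chord a b : A a -> A b -> Q (rot (- a) y) -> Q (rot (- b) y) -> b <= a -> a - b <= L.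
  rewrite /A /= !in_itv /= => /andP[a0 a1] /andP[b0 b1] Qa Qb ba.
  have ab01 : 0 <= a - b <= 1 by apply/andP; split; lra.
  have h := le_trans (rot_chord y ab01) (Qd _ _ Qa Qb).
  have yr : rho ^+ 2 <= y.1 ^+ 2 + y.2 ^+ 2.
    have := Qr _ Qa; rewrite /rot /lin /= cosN sinN opprK => h2; apply: le_trans h2 _.
    have -> : (cos a * y.1 + sin a * y.2) ^+ 2 + (- sin a * y.1 + cos a * y.2) ^+ 2 =
      (cos a ^+ 2 + sin a ^+ 2) * (y.1 ^+ 2 + y.2 ^+ 2) by ring.
    by rewrite cos2Dsin2 mul1r.
  have h3 : (rho * (cos 1 * (a - b))) ^+ 2 <= d ^+ 2.
    by rewrite exprMn; apply: le_trans h; apply: ler_wpM2r => //; exact: sqr_ge0.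
  have h4 : rho * (cos 1 * (a - b)) <= d.
    move: h3; rewrite ler_sqr// nnegrE; last exact: ltW.
    by rewrite !mulr_ge0 ?(ltW k0) ?(ltW r0)//; lra.
  by rewrite /L ler_pdivlMr ?mulr_gt0//; lra.
rewrite inE /B /= in_itv /=; have [le|le] := leP s0 s.
  by have := chord _ _ sA As0 sQ Qs0 le; lra.
by have := chord _ _ As0 sA Qs0 sQ (ltW le); lra.
Qed.

End Rotations.

Lemma ip_EFin {d : measure_display} {T : measurableType d} {R : realType}
    (mu : {measure set T -> \bar R}) (D : set T) (mD : measurable D) (f g : T -> R) :
  L2 mu D f -> L2 mu D g -> (ip mu D f g)%:E = (\int[mu]_(x in D) (f x * g x)%:E)%E.
Proof.
move=> f2 g2; rewrite ipE /Rintegral fineK//.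
by apply: integrable_fin_num => //; exact: (L2_integrable mD f2 g2).
Qed.

Section Slices.
Context {R : realType}.

Lemma slice1_continuous (g : R * R -> R) b : continuous g -> continuous (fun s => g (s, b)).
Proof.
move=> cg s; have a1 : t @[t --> s] --> s by exact: cvg_id.
have a2 : (fun=> b) t @[t --> s] --> b by exact: cvg_cst.
exact: (cvg_comp _ _ (cvg_pair a1 a2) (cg (s, b))).
Qed.

Lemma slice2_continuous (g : R * R -> R) b : continuous g -> continuous (fun s => g (b, s)).
Proof.
move=> cg s; have a1 : t @[t --> s] --> s by exact: cvg_id.
have a2 : (fun=> b) t @[t --> s] --> b by exact: cvg_cst.
exact: (cvg_comp _ _ (cvg_pair a2 a1) (cg (b, s))).
Qed.

Lemma swap_continuous (g : R * R -> R) : continuous g -> continuous (fun x => g (x.2, x.1)).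
Proof.
move=> cg x; have a1 : y.2 @[y --> x] --> x.2 by exact: cvg_snd.
have a2 : y.1 @[y --> x] --> x.1 by exact: cvg_fst.
exact: (cvg_comp _ _ (cvg_pair a1 a2) (cg (x.2, x.1))).
Qed.

End Slices.

(** * Poincare and Sobolev inequalities for test functions *)

Section TestEstimates.
Context {R : realType}.
Local Notation mu := (@lebesgue_measure R).
Local Notation mu2 := (lebesgue2 R).
Local Notation H := (@half_plane R).
Local Notation nsqH := (nsq mu2 H).
Local Notation ipH := (ip mu2 H).
Implicit Types (phi f : R * R -> R) (x y : R * R).

Let mH := @measurable_half_plane R.

Lemma int_half (g : R * R -> \bar R) : (forall x, x.1 <= 0 -> g x = 0%E) ->
  (\int[mu2]_(x in H) g x = \int[mu2]_x g x)%E.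
Proof.
move=> g0; rewrite integral_mkcond; apply: eq_integral => x _.
rewrite /patch; case: ifPn => // xH; rewrite g0// leNgt; apply/negP => h.
by move/negP: xH; apply; rewrite inE.
Qed.

Definition rect (a b c d : R) : set (R * R) := `[a, b]%classic `*` `[c, d]%classic.

Lemma measurable_rect a b c d :
  measurable (rect a b c d : set (measurableTypeR R * measurableTypeR R)).
Proof. by apply: measurableX; exact: measurable_itv. Qed.

Lemma lebesgue2_rect a b c d : a <= b -> c <= d ->
  mu2 (rect a b c d) = ((b - a) * (d - c))%:E.
Proof.
move=> ab cd; rewrite /rect product_measure1E; try exact: measurable_itv.
by rewrite EFinM; congr (_ * _)%E; [exact: lebesgue_itv ab|exact: lebesgue_itv cd].
Qed.

Lemma continuous_L2_rect f a b c d : a <= b -> c <= d -> continuous f ->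
  L2 mu2 (rect a b c d) f.
Proof.
move=> ab cd cf.
have mf : measurable_fun (rect a b c d) f by exact: continuous_measurable2.
split => //.
have cK : compact (rect a b c d) by apply: compact_setX; exact: segment_compact.
have [M [Mr MP]] := compact_bounded (continuous_compact (continuous_subspaceT cf) cK).
have MP' x : rect a b c d x -> `|f x| <= `|M| + 1.
  move=> Qx; apply: (MP (`|M| + 1)); last by exists x.
  by apply: le_lt_trans (ler_norm _) _; rewrite ltrDl.
apply: (@le_lt_trans _ _ (\int[mu2]_(x in rect a b c d) ((`|M| + 1) ^+ 2)%:E)%E).
  apply: ge0_le_integral => //.
  - exact: measurable_rect.
  - by move=> x _; rewrite lee_fin sqr_ge0.
  - by apply/measurable_EFinP; exact: measurable_funX.
  - move=> x Qx; rewrite lee_fin -(real_normK (num_real (f x))) ler_sqr ?nnegrE//.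
    exact: MP'.
rewrite integral_cst; last exact: measurable_rect.
by rewrite [X in (_ * X)%E](lebesgue2_rect ab cd) -EFinM ltry.
Qed.

Lemma test_L2 phi : test_function phi -> L2 mu2 H phi.
Proof.
move=> tp; have cp := test_continuous tp.
have [M M0 MP] := test_box tp.
have MM : - M <= M by lra.
have [mf li] := continuous_L2_rect MM MM cp.
split; first exact: continuous_measurable2.
apply: le_lt_trans li; rewrite integral_mkcond [leRHS]integral_mkcond.
apply: ge0_le_integral => //.
- by move=> x _; apply: erestrict_ge0 => z _; rewrite lee_fin sqr_ge0.
- apply/(measurable_restrictT _ mH); apply/measurable_EFinP; apply: measurable_funX; exact: continuous_measurable2.
- apply/(measurable_restrictT _ (measurable_rect _ _ _ _)); apply/measurable_EFinP; exact: measurable_funX.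
- move=> x _; rewrite /patch; case: ifPn => [xH|_]; case: ifPn => [xQ|xQ]//; last by rewrite lee_fin sqr_ge0.
  rewrite lee_fin MP ?expr0n//; apply: contrapT => /not_orP[h1 h2].
  move/negP: xQ; apply; rewrite inE; split; rewrite /= in_itv /= -ler_norml ltW// ltNge; exact/negP.
Qed.

Lemma nsq_test phi : test_function phi -> (nsqH phi)%:E = (\int[mu2]_x (phi x ^+ 2)%:E)%E.
Proof.
move=> tp; rewrite (nsqE mH (test_L2 tp)) int_half// => x x0.
by rewrite (test_half tp x0) expr0n.
Qed.

Lemma test_dth phi : test_function phi -> test_function (dth phi).
Proof.
move=> tp; have [t1 t2] := test_deriv tp.
by apply: test_sub; apply: test_mul => // n; [exact: class_C_fst|exact: class_C_snd].
Qed.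

Lemma poincare_nsq phi : test_function phi -> nsqH phi <= pi ^+ 2 * nsqH (dth phi).
Proof.
move=> tp; rewrite -lee_fin EFinM (nsq_test tp) (nsq_test (test_dth tp)).
exact: poincare_test.
Qed.

Lemma test_pow phi k : test_function phi -> test_function (fun x => phi x ^+ k.+1).
Proof.
move=> tp; elim: k => [|k IH]; first by under eq_fun do rewrite expr1.
by under eq_fun do rewrite exprS; apply: test_mul => //; exact: test_smooth.
Qed.

Lemma tonelli_sep (A B : R -> \bar R) : measurable_fun setT A -> measurable_fun setT B ->
  (forall t, (0 <= A t)%E) -> (forall t, (0 <= B t)%E) ->
  (\int[mu2]_x (A x.2 * B x.1) = (\int[mu]_t A t) * (\int[mu]_t B t))%E.
Proof.
move=> mA mB A0 B0.
have mAB : measurable_fun setT (fun x : R * R => A x.2 * B x.1)%E.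
  apply: emeasurable_funM; first exact: (measurableT_comp mA measurable_snd).
  exact: (measurableT_comp mB measurable_fst).
rewrite (tonelli1 mAB (fun x => mule_ge0 (A0 x.2) (B0 x.1))).
have iA : (0 <= \int[mu]_t A t)%E by exact: integral_ge0.
transitivity (\int[mu]_x ((\int[mu]_t A t) * B x))%E.
  by apply: eq_integral => a _ /=; rewrite ge0_integralZr.
by rewrite ge0_integralZl.
Qed.

(** [|f x|] is bounded by the integral of [|'D_e1 f|] along the horizontal line through [x], and by
    that of [|'D_e2 f|] along the vertical one. The product of these bounds is a function of [x.2]
    times a function of [x.1], so its integral factors. *)
Lemma gagliardo f : test_function f ->
  (\int[mu2]_x (f x ^+ 2)%:E <=
   (\int[mu2]_x (`|'D_e1 f x|)%:E) * (\int[mu2]_x (`|'D_e2 f x|)%:E))%E.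
Proof.
move=> tf; have c1 := test_smooth tf 1%N; have [t1 t2] := test_deriv tf.
have [M M0 MP] := test_box tf.
have mabs (g : R * R -> R) : continuous g -> measurable_fun setT (fun x => (`|g x|)%:E).
  by move=> cg; apply/measurable_EFinP; apply: measurableT_comp => //; exact: continuous_measurable2.
have m1 := mabs _ (test_continuous t1); have m2 := mabs _ (test_continuous t2).
pose A b := (\int[mu]_s (`|'D_e1 f (s, b)|)%:E)%E.
pose B a := (\int[mu]_s (`|'D_e2 f (a, s)|)%:E)%E.
have A0 b : (0 <= A b)%E by apply: integral_ge0 => s _; rewrite lee_fin.
have B0 a : (0 <= B a)%E by apply: integral_ge0 => s _; rewrite lee_fin.
have mA : measurable_fun setT A by exact: (measurable_tonelli2 m1 (fun x => normr_ge0 _)).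
have mB : measurable_fun setT B by exact: (measurable_tonelli1 m2 (fun x => normr_ge0 _)).
have slice (g dg : R -> R) (t : R) : (forall s : R, is_derive s 1 g (dg s)) -> continuous dg ->
    g (- M) = 0 -> (M <= `|t| -> g t = 0) -> ((`|g t|)%:E <= \int[mu]_s (`|dg s|)%:E)%E.
  move=> D cdg g0 gt.
  have [Mt|tM] := leP M `|t|.
    by rewrite gt// normr0; apply: integral_ge0 => s _; rewrite lee_fin.
  have Mt : - M <= t by move: tM; rewrite ltr_norml => /andP[/ltW].
  have := abs_FTC D cdg Mt; rewrite g0 subr0 => h; apply: (le_trans h).
  apply: ge0_subset_integral; [exact: measurable_itv|exact: measurableT| |by move=> ? _; rewrite lee_fin|by []].
  by apply/measurable_EFinP; apply: measurableT_comp => //; exact: continuous_measurable_fun.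
have NM : M <= `|- M| by rewrite normrN ger0_norm// ltW.
have key x : ((f x ^+ 2)%:E <= A x.2 * B x.1)%E.
  have h1 : ((`|f x|)%:E <= A x.2)%E.
    case: x => a b /=; apply: (slice (fun s => f (s, b)) _ a (fun s => is_derive_slice1 s b c1)).
    - exact: (@slice1_continuous R ('D_e1 f) b (test_continuous t1)).
    - by apply: MP; left.
    - by move=> h; apply: MP; left.
  have h2 : ((`|f x|)%:E <= B x.1)%E.
    case: x {h1} => a b /=; apply: (slice (fun s => f (a, s)) _ b (fun s => is_derive_slice2 a s c1)).
    - exact: (@slice2_continuous R ('D_e2 f) a (test_continuous t2)).
    - by apply: MP; right.
    - by move=> h; apply: MP; right.
  rewrite -(real_normK (num_real (f x))) expr2 EFinM.
  by apply: (lee_pmul _ _ h1 h2); rewrite lee_fin normr_ge0.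
apply: (@le_trans _ _ (\int[mu2]_x (A x.2 * B x.1))%E).
  apply: ge0_le_integral.
  - exact: measurableT.
  - by move=> x _; rewrite lee_fin sqr_ge0.
  - apply/measurable_EFinP; apply: measurable_funX; apply: continuous_measurable2; exact: test_continuous.
  - apply: emeasurable_funM; first exact: (measurableT_comp mA measurable_snd).
    exact: (measurableT_comp mB measurable_fst).
  - by move=> x _; exact: key.
rewrite (tonelli_sep mA mB A0 B0) (tonelli2 m1 (fun x => normr_ge0 _)) (tonelli1 m2 (fun x => normr_ge0 _)).
exact: lexx.
Qed.

Lemma L2_abs f : L2 mu2 H f -> L2 mu2 H (fun x => `|f x|).
Proof.
move=> f2; apply: (L2_dom mH _ f2); last by move=> x _; rewrite normr_id.
by apply: measurableT_comp => //; exact: (L2_measurable f2).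
Qed.

Lemma nsq_abs f : nsqH (fun x => `|f x|) = nsqH f.
Proof.
by rewrite /nsq !ipE; apply: eq_Rintegral => x _; rewrite -normrM ger0_norm// -expr2 sqr_ge0.
Qed.

Lemma int_abs_mul phi f : test_function phi -> test_function f ->
  (\int[mu2]_x (`|phi x * f x|)%:E <= (Num.sqrt (nsqH phi) * Num.sqrt (nsqH f))%:E)%E.
Proof.
move=> tp tf; have p2 := L2_abs (test_L2 tp); have f2 := L2_abs (test_L2 tf).
rewrite -(nsq_abs phi) -(nsq_abs f).
apply: (@le_trans _ _ (ipH (fun x => `|phi x|) (fun x => `|f x|))%:E).
  rewrite (ip_EFin mH p2 f2).
  rewrite -int_half; last by move=> x x0; rewrite (test_half tp x0) mul0r normr0.
  by rewrite le_eqVlt; apply/orP; left; apply/eqP; apply: eq_integral => x _; rewrite normrM.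
rewrite lee_fin; apply: le_trans (ler_norm _) _; exact: ip_le.
Qed.

Lemma deriv_pow phi k x : test_function phi ->
  'D_e1 (fun y => phi y ^+ k.+1) x = k.+1%:R * (phi x ^+ k * 'D_e1 phi x) /\
  'D_e2 (fun y => phi y ^+ k.+1) x = k.+1%:R * (phi x ^+ k * 'D_e2 phi x).
Proof.
move=> tp; have [d1 d2] := test_is_derive x tp.
have h1 := is_derive_pow k.+1 d1; have h2 := is_derive_pow k.+1 d2.
by split; [have -> := derive_val (is_derive := h1)|have -> := derive_val (is_derive := h2)]; rewrite /= mulrA.
Qed.

Lemma sobolev_aux (r P A B : R) : 0 <= P -> 0 <= A -> 0 <= B ->
  r * (Num.sqrt P * Num.sqrt A) * (r * (Num.sqrt P * Num.sqrt B)) <= r ^+ 2 * P * (A + B).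
Proof.
move=> P0 A0 B0; have s1 := sqr_sqrtr A0; have s2 := sqr_sqrtr B0; have sP := sqr_sqrtr P0.
move: (Num.sqrt P) (Num.sqrt A) (Num.sqrt B) s1 s2 sP => a b c s1 s2 sP.
have -> : r * (a * b) * (r * (a * c)) = r ^+ 2 * a ^+ 2 * (b * c) by ring.
rewrite sP; apply: ler_wpM2l; first by rewrite mulr_ge0 ?sqr_ge0.
by rewrite -s1 -s2; have := sqr_ge0 (b - c); have := sqr_ge0 (b + c); nra.
Qed.

(** [gagliardo] applied to [phi ^ (k + 2)], whose derivatives are [(k + 2) * phi ^ (k + 1)] times
    those of [phi]; Cauchy-Schwarz separates the two factors. *)
Lemma sobolev_step phi k : test_function phi ->
  nsqH (fun x => phi x ^+ k.+2) <=
  k.+2%:R ^+ 2 * nsqH (fun x => phi x ^+ k.+1) * (nsqH ('D_e1 phi) + nsqH ('D_e2 phi)).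
Proof.
move=> tp; have [t1 t2] := test_deriv tp.
have tk := test_pow k tp; have tk1 := test_pow k.+1 tp.
rewrite -lee_fin (nsq_test tk1); apply: le_trans (gagliardo tk1) _.
set P := nsqH (fun x => phi x ^+ k.+1).
have P0 : 0 <= P by exact: nsq_ge0.
have est (g : R * R -> R) : test_function g ->
    (\int[mu2]_x (`|(k.+2%:R * (phi x ^+ k.+1 * g x))%R|)%:E <= (k.+2%:R * (Num.sqrt P * Num.sqrt (nsqH g)))%:E)%E.
  move=> tg; under eq_integral do rewrite normrM EFinM.
  rewrite ge0_integralZl_EFin//; last first.
    apply/measurable_EFinP; apply: measurableT_comp => //; apply: continuous_measurable2.
    by move=> x; apply: cvgM; [exact: (test_continuous tk)|exact: (test_continuous tg)].
  by rewrite ger0_norm// EFinM lee_wpmul2l ?lee_fin// int_abs_mul.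
have E1 := est _ t1; have E2 := est _ t2.
under [X in (X * _)%E]eq_integral => x _ do rewrite (deriv_pow k.+1 x tp).1.
under [X in (_ * X)%E]eq_integral => x _ do rewrite (deriv_pow k.+1 x tp).2.
have i0 (g : R * R -> R) : (0 <= \int[mu2]_x (`|g x|)%:E)%E by apply: integral_ge0 => x _; rewrite lee_fin.
apply: le_trans (lee_pmul (i0 _) (i0 _) E1 E2) _.
clear E1 E2 est.
rewrite -EFinM lee_fin.
exact: sobolev_aux P0 (@nsq_ge0 _ _ _ mu2 H ('D_e1 phi)) (@nsq_ge0 _ _ _ mu2 H ('D_e2 phi)).
Qed.

(** The factorial collects the factors of [sobolev_step]. In this way every even Lebesgue exponent
    [2 * (k + 1)] is controlled by the H^1 norm in dimension two. *)
Lemma sobolev_test phi k : test_function phi ->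
  nsqH (fun x => phi x ^+ k.+1) <=
  (k.+1)`!%:R ^+ 2 * (nsqH ('D_e1 phi) + nsqH ('D_e2 phi)) ^+ k * nsqH phi.
Proof.
move=> tp; elim: k => [|k IH]; first by under eq_fun do rewrite expr1; rewrite expr1n expr0 !mul1r.
apply: (le_trans (sobolev_step k tp)); rewrite factS natrM exprMn [(_ + _) ^+ k.+1]exprS.
set G := nsqH ('D_e1 phi) + _; have G0 : 0 <= G by rewrite addr_ge0 ?nsq_ge0.
have K0 : 0 <= (k.+2%:R : R) ^+ 2 by rewrite sqr_ge0.
apply: (@le_trans _ _ (k.+2%:R ^+ 2 * ((k.+1)`!%:R ^+ 2 * G ^+ k * nsqH phi) * G)); last by rewrite le_eqVlt; apply/orP; left; apply/eqP; ring.
by apply: ler_wpM2r => //; apply: ler_wpM2l.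
Qed.

End TestEstimates.

(** Here [r] will be the integral of a squared derivative over one slice, which is handled as an
    extended real, hence the case [+oo]. *)
Lemma ereal_square_aux1 {R : realType} (h k : R) (r : \bar R) : 0 < h -> (0 <= r)%E ->
  (h%:E * (h%:E * ((2 * h)%:E * r) + (2 * h)%:E * k%:E) <=
   (2 * h ^+ 3)%:E * r + (2 * h ^+ 2 * k)%:E)%E.
Proof.
move=> h0; case: r => [r|_|]//.
  by rewrite lee_fin => _; rewrite -!EFinM -!EFinD lee_fin le_eqVlt; apply/orP; left; apply/eqP; ring.
have h3 : 0 < 2 * h ^+ 3 by rewrite mulr_gt0// exprn_gt0.
by rewrite [(_ * +oo)%E in leRHS]gt0_muley ?lte_fin// addye// leey.
Qed.

Lemma ereal_square_aux2 {R : realType} (h k l : R) :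
  (h%:E * ((2 * h ^+ 3)%:E * l%:E + h%:E * (2 * h ^+ 2 * k)%:E) =
   (h ^+ 2 * (2 * h ^+ 2 * (l + k)))%:E)%E.
Proof. by rewrite -!EFinM; congr EFin; ring. Qed.

(** * Poincare inequality on a square, for C^1 functions *)

Section SquarePoincare.
Context {R : realType}.
Local Notation mu := (@lebesgue_measure R).
Local Notation mu2 := (lebesgue2 R).
Implicit Types (f : R * R -> R) (x y : R * R).

Lemma tonelli_rect1 (g : R * R -> \bar R) a b c d :
  measurable_fun setT g -> (forall x, (0 <= g x)%E) ->
  (\int[mu2]_(x in rect a b c d) g x =
   \int[mu]_(s in `[a, b]) \int[mu]_(t in `[c, d]) g (s, t))%E.
Proof.
move=> mg g0; rewrite integral_mkcond tonelli1; last 2 first.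
- by apply/(measurable_restrictT _ (measurable_rect a b c d)); apply: measurable_funTS.
- by move=> x; apply: erestrict_ge0 => z _; exact: g0.
rewrite [RHS]integral_mkcond; apply: eq_integral => s _; rewrite /patch.
case: ifPn => sI.
  rewrite [RHS]integral_mkcond; apply: eq_integral => t _; rewrite /patch.
  by congr (if _ then _ else _); apply/idP/idP; rewrite !inE /rect => h;
    [case: h|split => //; move: sI; rewrite inE].
apply: integral0_eq => t _; case: ifPn => //; rewrite inE => -[/= sI' _].
by move/negP: sI; case; rewrite inE.
Qed.

Lemma tonelli_rect2 (g : R * R -> \bar R) a b c d :
  measurable_fun setT g -> (forall x, (0 <= g x)%E) ->
  (\int[mu2]_(x in rect a b c d) g x =
   \int[mu]_(t in `[c, d]) \int[mu]_(s in `[a, b]) g (s, t))%E.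
Proof.
move=> mg g0; rewrite integral_mkcond tonelli2; last 2 first.
- by apply/(measurable_restrictT _ (measurable_rect a b c d)); apply: measurable_funTS.
- by move=> x; apply: erestrict_ge0 => z _; exact: g0.
rewrite [RHS]integral_mkcond; apply: eq_integral => s _; rewrite /patch.
case: ifPn => sI.
  rewrite [RHS]integral_mkcond; apply: eq_integral => t _; rewrite /patch.
  by congr (if _ then _ else _); apply/idP/idP; rewrite !inE /rect => h;
    [case: h|split => //; move: sI; rewrite inE].
apply: integral0_eq => t _; case: ifPn => //; rewrite inE => -[/= _ sI'].
by move/negP: sI; case; rewrite inE.
Qed.

Lemma integral_cst_itv a b (r : \bar R) : a <= b -> (0 <= r)%E ->
  (\int[mu]_(s in `[a, b]) r = (b - a)%:E * r)%E.
Proof.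
move=> ab r0; rewrite muleC -(lebesgue_itv ab); apply: integral_cst; exact: measurable_itv.
Qed.

Lemma integralZl_itv a b (r : R) (B : R -> \bar R) : 0 <= r ->
  measurable_fun setT B -> (forall t, (0 <= B t)%E) ->
  (\int[mu]_(s in `[a, b]) (r%:E * B s) = r%:E * \int[mu]_(s in `[a, b]) B s)%E.
Proof.
move=> r0 mB B0; rewrite ge0_integralZl//.
by apply: measurable_funTS.
Qed.

Lemma measurable_slice_int2 (g : R * R -> R) a b : continuous g -> (forall x, 0 <= g x) ->
  measurable_fun setT (fun t => \int[mu]_(s in `[a, b]) (g (s, t))%:E)%E.
Proof.
move=> cg g0; under eq_fun do rewrite integral_mkcond.
have mg : measurable_fun setT (fun x : R * R => ((fun s => (g (s, x.2))%:E) \_ `[a, b]%classic) x.1).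
  rewrite (_ : (fun x => _) = ((EFin \o g) \_ (`[a, b]%classic `*` setT))); last first.
    apply/funext => -[s t]; rewrite /patch /=.
    congr (if _ then _ else _); apply/idP/idP; rewrite !inE; [by split|by case].
  have mD : measurable (`[a, b]%classic `*` setT : set (measurableTypeR R * measurableTypeR R)).
    by apply: measurableX; [exact: measurable_itv|exact: measurableT].
  apply/(measurable_restrictT _ mD).
  by apply/measurable_EFinP; exact: continuous_measurable2.
apply: (measurable_tonelli2 mg) => x; apply: erestrict_ge0 => s _; rewrite lee_fin; exact: g0.
Qed.

Lemma sq_FTC_itv (g dg : R -> R) (u v s t : R) : (forall r : R, is_derive r 1 g (dg r)) ->
  continuous dg -> u <= v -> s \in `[u, v] -> t \in `[u, v] ->
  (((g s - g t) ^+ 2)%:E <= (v - u)%:E * \int[mu]_(r in `[u, v]) (dg r ^+ 2)%:E)%E.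
Proof.
move=> D cdg uv.
wlog ts : s t / t <= s.
  move=> H sI tI; have [ts|/ltW st] := leP t s; first exact: H.
  by rewrite -(sqrrN (g s - g t)) opprB; exact: H.
move=> sI tI; apply: (le_trans (sq_FTC D cdg ts)).
move: sI tI; rewrite !in_itv /= => /andP[us sv] /andP[ut tv].
apply: lee_pmul.
- by rewrite lee_fin subr_ge0.
- by apply: integral_ge0 => r _; rewrite lee_fin sqr_ge0.
- by rewrite lee_fin; lra.
apply: ge0_subset_integral; [exact: measurable_itv|exact: measurable_itv| | |].
- apply/measurable_EFinP; apply: measurable_funTS; apply: measurable_funX.
  exact: continuous_measurable_fun.
- by move=> r _; rewrite lee_fin sqr_ge0.
- by apply: subset_itv; rewrite bnd_simp.
Qed.

Section Square.
Variables (f : R * R -> R) (a c h : R).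
Hypotheses (h0 : 0 < h) (cf : class_C 1 f).

Let Q := rect a (a + h) c (c + h).
Let one := (fun _ : R * R => 1 : R).

Definition average : R := (h ^+ 2)^-1 * ip mu2 Q f one.

Let ha : a <= a + h. Proof. by rewrite lerDl ltW. Qed.
Let hc : c <= c + h. Proof. by rewrite lerDl ltW. Qed.
Let mQ : measurable (Q : set (measurableTypeR R * measurableTypeR R)).
Proof. exact: measurable_rect. Qed.
Let L2Q g : continuous g -> L2 mu2 Q g.
Proof. exact: continuous_L2_rect. Qed.
Let cc (r : R) : continuous (fun _ : R * R => r).
Proof. by move=> ?; exact: cst_continuous. Qed.

Lemma nsq_rect_cst (r : R) : nsq mu2 Q (fun=> r) = r ^+ 2 * h ^+ 2.
Proof.
apply/EFin_inj; rewrite (nsqE mQ (L2Q (@cc r))) integral_cst//.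
rewrite [X in (_ * X)%E](lebesgue2_rect ha hc) -EFinM; congr EFin; ring.
Qed.

Let c0 : continuous f. Proof. exact: class_C_continuous cf. Qed.
Let c1 : continuous ('D_e1 f). Proof. by case: cf => _ [_ [[]]]. Qed.
Let c2 : continuous ('D_e2 f). Proof. by case: cf => _ [_ [_ []]]. Qed.

Let K1 := nsq mu2 Q ('D_e1 f).
Let K2 := nsq mu2 Q ('D_e2 f).

Let csq (g : R * R -> R) : continuous g -> continuous (fun x => g x ^+ 2).
Proof. by move=> cg x; under eq_fun do rewrite expr2; apply: cvgM; exact: cg. Qed.

Let msq (g : R * R -> R) : continuous g -> measurable_fun setT (fun x => (g x ^+ 2)%:E).
Proof. by move=> cg; apply/measurable_EFinP; apply: continuous_measurable2; exact: csq. Qed.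

Let sq0 (g : R * R -> R) x : (0 <= (g x ^+ 2)%:E)%E.
Proof. by rewrite lee_fin sqr_ge0. Qed.

(** [A t] is the integral of [('D_e1 f) ^ 2] over the horizontal slice at height [t]; only the four
    listed properties are used afterwards. *)
Let slice1 : exists A : R -> \bar R, [/\ measurable_fun setT A, forall t, (0 <= A t)%E,
  (\int[mu]_(t in `[c, (c + h)%R]) A t = K1%:E)%E &
  forall s u t, s \in `[a, a + h] -> u \in `[a, a + h] ->
    (((f (s, t) - f (u, t)) ^+ 2)%:E <= h%:E * A t)%E].
Proof.
exists (fun t => \int[mu]_(s in `[a, (a + h)%R]) (('D_e1 f (s, t)) ^+ 2)%:E)%E; split.
- exact: (@measurable_slice_int2 (fun x => 'D_e1 f x ^+ 2) a (a + h) (csq c1) (fun x => sqr_ge0 _)).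
- by move=> t; apply: integral_ge0 => s _; exact: sq0.
- by rewrite /K1 (nsqE mQ (L2Q c1)) (tonelli_rect2 _ _ _ _ (msq c1)).
- move=> s u t sI uI.
  have := sq_FTC_itv (fun r => is_derive_slice1 r t cf) (@slice1_continuous R ('D_e1 f) t c1) ha sI uI.
  by rewrite [X in X - a]addrC addrK.
Qed.

Let slice2 : exists B : R -> \bar R, [/\ measurable_fun setT B, forall t, (0 <= B t)%E,
  (\int[mu]_(t in `[a, (a + h)%R]) B t = K2%:E)%E &
  forall s u t, s \in `[c, c + h] -> u \in `[c, c + h] ->
    (((f (t, s) - f (t, u)) ^+ 2)%:E <= h%:E * B t)%E].
Proof.
exists (fun s => \int[mu]_(t in `[c, (c + h)%R]) (('D_e2 f (s, t)) ^+ 2)%:E)%E; split.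
- exact: (@measurable_slice_int2 (fun x => 'D_e2 f (x.2, x.1) ^+ 2) c (c + h)
    (csq (swap_continuous c2)) (fun x => sqr_ge0 _)).
- by move=> t; apply: integral_ge0 => s _; exact: sq0.
- by rewrite /K2 (nsqE mQ (L2Q c2)) (tonelli_rect1 _ _ _ _ (msq c2)).
- move=> s u t sI uI.
  have := sq_FTC_itv (fun r => is_derive_slice2 t r cf) (@slice2_continuous R ('D_e2 f) t c2) hc sI uI.
  by rewrite [X in X - c]addrC addrK.
Qed.

Section Core.
Variables A B : R -> \bar R.
Hypotheses (mA : measurable_fun setT A) (mB : measurable_fun setT B)
  (A0 : forall t, (0 <= A t)%E) (B0 : forall t, (0 <= B t)%E)
  (intA : (\int[mu]_(t in `[c, (c + h)%R]) A t = K1%:E)%E)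
  (intB : (\int[mu]_(t in `[a, (a + h)%R]) B t = K2%:E)%E)
  (bA : forall s u t, s \in `[a, a + h] -> u \in `[a, a + h] ->
    (((f (s, t) - f (u, t)) ^+ 2)%:E <= h%:E * A t)%E)
  (bB : forall s u t, s \in `[c, c + h] -> u \in `[c, c + h] ->
    (((f (t, s) - f (t, u)) ^+ 2)%:E <= h%:E * B t)%E).

(** Passes from [x] to [y] through the corner [(y.1, x.2)], so that only one coordinate changes at a
    time. *)
Let pt x y : Q x -> Q y -> (((f x - f y) ^+ 2)%:E <= (2 * h)%:E * A x.2 + (2 * h)%:E * B y.1)%E.
Proof.
move: x y => [x1 x2] [y1 y2] [/= x1I x2I] [/= y1I y2I].
apply: (@le_trans _ _ ((2 * (f (x1, x2) - f (y1, x2)) ^+ 2)%:E + (2 * (f (y1, x2) - f (y1, y2)) ^+ 2)%:E)%E).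
  rewrite -EFinD lee_fin.
  have := sqr_ge0 ((f (x1, x2) - f (y1, x2)) - (f (y1, x2) - f (y1, y2))); nra.
rewrite !(EFinM 2) -!muleA; apply: leeD; apply: lee_wpmul2l.
- by rewrite lee_fin.
- exact: bA.
- by rewrite lee_fin.
- exact: bB.
Qed.

(** [f x - average] is the mean over [y] of [f x - f y]. Cauchy-Schwarz against the constant 1
    bounds its square by the mean square, and [pt] is integrated over [y]; the [B] term then
    contributes [K2], while the [A] term is constant in [y]. *)
Let ptK x : Q x -> ((h ^+ 2 * (f x - average) ^+ 2)%:E <= (2 * h ^+ 3)%:E * A x.2 + (2 * h ^+ 2 * K2)%:E)%E.
Proof.
move=> Qx.
have l2x : L2 mu2 Q (fun y => f x - f y) by apply: L2B => //; apply: L2Q.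
have N : ((nsq mu2 Q (fun y => f x - f y))%:E <= (2 * h ^+ 3)%:E * A x.2 + (2 * h ^+ 2 * K2)%:E)%E.
  rewrite (nsqE mQ l2x).
  apply: (@le_trans _ _ (\int[mu2]_(y in Q) ((2 * h)%:E * A x.2 + (2 * h)%:E * B y.1))%E).
    apply: ge0_le_integral; [exact: mQ|by move=> y _; rewrite lee_fin sqr_ge0| | |].
    - by apply/measurable_EFinP; apply: measurable_funX; exact: L2_measurable l2x.
    - apply: measurable_funTS; apply: emeasurable_funD => //.
      by apply: emeasurable_funM => //; exact: (measurableT_comp mB measurable_fst).
    - by move=> y Qy; exact: pt.
  have mh : measurable_fun setT (fun y : R * R => (2 * h)%:E * A x.2 + (2 * h)%:E * B y.1)%E.
    apply: emeasurable_funD => //.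
    by apply: emeasurable_funM => //; exact: (measurableT_comp mB measurable_fst).
  have h20 : (0 <= (2 * h)%:E)%E by rewrite lee_fin mulr_ge0// ltW.
  have a0 : (0 <= (2 * h)%:E * A x.2)%E by exact: mule_ge0.
  have b0 s : (0 <= (2 * h)%:E * B s)%E by exact: mule_ge0.
  rewrite (tonelli_rect1 _ _ _ _ mh (fun y => adde_ge0 a0 (b0 y.1))).
  under eq_integral => s _ do rewrite (integral_cst_itv hc (adde_ge0 a0 (b0 s))).
  have mbB : measurable_fun setT (fun s => (2 * h)%:E * B s)%E by exact: emeasurable_funM.
  rewrite ge0_integralZl; last 4 first.
  - exact: measurable_itv.
  - by apply: measurable_funTS; exact: emeasurable_funD.
  - by move=> s _; exact: adde_ge0.
  - by rewrite lee_fin subr_ge0.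
  rewrite ge0_integralD; last 5 first.
  - exact: measurable_itv.
  - by [].
  - exact: measurable_cst.
  - by [].
  - exact: measurable_funTS.
  rewrite (integral_cst_itv ha a0).
  have h2 : 0 <= 2 * h by rewrite mulr_ge0// ltW.
  rewrite (integralZl_itv a (a + h) h2 mB B0).
  rewrite intB [a + h]addrC [c + h]addrC !addrK.
  exact: ereal_square_aux1.
apply: le_trans N; rewrite lee_fin.
have k := ip_CS mQ l2x (L2Q (@cc 1)).
rewrite -/one in k.
have i1 : ip mu2 Q one one = h ^+ 2 by rewrite -/(nsq mu2 Q one) nsq_rect_cst expr1n mul1r.
have e : ip mu2 Q (fun y => f x - f y) one = h ^+ 2 * (f x - average).
  have -> : (fun y => f x - f y) = (fun y => f x * one y + (-1) * f y) by apply/funext => y; rewrite /one; ring.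
  have L1 : L2 mu2 Q one by exact: (L2Q (@cc 1)).
  have Lf : L2 mu2 Q f by exact: L2Q.
  rewrite (ipDl mQ (L2Z mQ (f x) L1) (L2Z mQ (-1) Lf) L1) (ipZl mQ _ L1 L1) (ipZl mQ _ Lf L1) i1.
  by rewrite /average; field; rewrite gt_eqF.
rewrite e nsq_rect_cst expr1n mul1r in k.
rewrite -(ler_pM2r (exprn_gt0 2 h0)); apply: le_trans k.
by rewrite le_eqVlt; apply/orP; left; apply/eqP; ring.
Qed.

Lemma square_poincare_core : nsq mu2 Q (fun x => f x - average) <= 2 * h ^+ 2 * (K1 + K2).
Proof.
have l2 : L2 mu2 Q (fun x => f x - average) by apply: L2B => //; exact: L2Q.
have h20 : 0 < h ^+ 2 by exact: exprn_gt0.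
have h3 : 0 <= 2 * h ^+ 3 by rewrite mulr_ge0// exprn_ge0// ltW.
rewrite -(ler_pM2l h20) -lee_fin EFinM (nsqE mQ l2).
have mf : measurable_fun Q (fun x => ((f x - average) ^+ 2)%:E).
  by apply/measurable_EFinP; apply: measurable_funX; exact: L2_measurable l2.
rewrite -ge0_integralZl; last 4 first.
- exact: mQ.
- exact: mf.
- by move=> x _; rewrite lee_fin sqr_ge0.
- by rewrite lee_fin ltW.
have mA2 : measurable_fun setT (fun x : R * R => A x.2) by exact: (measurableT_comp mA measurable_snd).
have mR : measurable_fun setT (fun x : R * R => (2 * h ^+ 3)%:E * A x.2 + (2 * h ^+ 2 * K2)%:E)%E.
  by apply: emeasurable_funD => //; exact: emeasurable_funM.
have k0 : (0 <= (2 * h ^+ 2 * K2)%:E)%E by rewrite lee_fin !mulr_ge0 ?(ltW h0) ?(ltW h20)//; exact: (@nsq_ge0 _ _ _ mu2 Q ('D_e2 f)).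
have a0 t : (0 <= (2 * h ^+ 3)%:E * A t)%E by apply: mule_ge0; rewrite ?lee_fin.
apply: (@le_trans _ _ (\int[mu2]_(x in Q) ((2 * h ^+ 3)%:E * A x.2 + (2 * h ^+ 2 * K2)%:E))%E).
  apply: ge0_le_integral; [exact: mQ| | |exact: measurable_funTS|].
  - by move=> x _; rewrite -EFinM lee_fin mulr_ge0// sqr_ge0.
  - by apply: emeasurable_funM => //; exact: mf.
  - by move=> x Qx; exact: ptK.
rewrite (tonelli_rect2 _ _ _ _ mR (fun x => adde_ge0 (a0 x.2) k0)).
under eq_integral => t _ do rewrite (integral_cst_itv ha (adde_ge0 (a0 t) k0)).
have mbA : measurable_fun setT (fun s => (2 * h ^+ 3)%:E * A s)%E by exact: emeasurable_funM.
rewrite ge0_integralZl; last 4 first.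
- exact: measurable_itv.
- by apply: measurable_funTS; exact: emeasurable_funD.
- by move=> s _; exact: adde_ge0.
- by rewrite lee_fin subr_ge0.
rewrite ge0_integralD; last 5 first.
- exact: measurable_itv.
- by [].
- exact: measurable_funTS.
- by [].
- exact: measurable_cst.
rewrite (integral_cst_itv hc k0).
rewrite (integralZl_itv c (c + h) h3 mA A0).
rewrite intA [a + h]addrC [c + h]addrC !addrK.
by rewrite ereal_square_aux2.
Qed.

End Core.

Lemma square_poincare : nsq mu2 Q (fun x => f x - average) <= 2 * h ^+ 2 * (K1 + K2).
Proof.
have [A [mA A0 iA bA]] := slice1; have [B [mB B0 iB bB]] := slice2.
exact: square_poincare_core mA mB A0 B0 iA iB bA bB.
Qed.

End Square.
End SquarePoincare.

(** * Weak derivatives *)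

Section AlmostEverywhere.
Context {d : measure_display} {T : measurableType d} {R : realType}.
Variable mu : {measure set T -> \bar R}.
Implicit Types P Q S : T -> Prop.

Lemma ae_imp P Q : (forall x, P x -> Q x) ->
  {ae mu, forall x, P x} -> {ae mu, forall x, Q x}.
Proof. by move=> h; apply: filterS. Qed.

Lemma ae_imp2 P Q S : (forall x, P x -> Q x -> S x) ->
  {ae mu, forall x, P x} -> {ae mu, forall x, Q x} -> {ae mu, forall x, S x}.
Proof. by move=> h; apply: filterS2. Qed.

Lemma ae_conj P Q : {ae mu, forall x, P x} -> {ae mu, forall x, Q x} ->
  {ae mu, forall x, P x /\ Q x}.
Proof. exact: ae_imp2. Qed.

End AlmostEverywhere.

Section IntegralMeasure.
Context {d : measure_display} {T : measurableType d} {R : realType}.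
Variables (mu : {measure set T -> \bar R}) (f : T -> \bar R).
Hypotheses (mf : measurable_fun setT f) (f0 : forall x, (0 <= f x)%E).

(** The measure with density [f]. The hypotheses are arguments because its measure structure rests
    on them. *)
Definition density_measure of (measurable_fun setT f) & (forall x, (0 <= f x)%E) :=
  fun A : set T => (\int[mu]_(x in A) f x)%E.

Local Notation nu := (density_measure mf f0).

Let nu0 : nu set0 = 0%E. Proof. exact: integral_set0. Qed.
Let nu_ge0 A : (0 <= nu A)%E. Proof. by apply: integral_ge0 => x _; exact: f0. Qed.
Let nu_sigma : semi_sigma_additive nu.
Proof. exact: semi_sigma_additive_nng_induced. Qed.

HB.instance Definition _ := isMeasure.Build _ _ _ nu nu0 nu_ge0 nu_sigma.

Definition density : {measure set T -> \bar R} := nu.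

End IntegralMeasure.

Section PiSystem.
Context {d : measure_display} {T : measurableType d} {R : realType}.
Variables (mu : {measure set T -> \bar R}).

(** The positive and negative parts of [f] are densities of two measures that agree on the pi-system
    [G] and are finite on it, hence agree everywhere. So [f] has integral 0 over every measurable
    set. *)
Lemma integral_pi_system_ae0 (G : set (set T)) (g : nat -> set T) (f : T -> \bar R) :
  d.-measurable = <<s G >> -> setI_closed G -> (forall i, G (g i)) ->
  \bigcup_k g k = setT -> mu.-integrable setT f ->
  (forall A, G A -> (\int[mu]_(x in A) f x = 0)%E) ->
  ae_eq mu setT f (cst 0%E).
Proof.
move=> GE GI Gg gT fi fG.
have mf := measurable_int mu fi.
have mp : measurable_fun setT (f^\+)%E by exact: measurable_funepos.
have mn : measurable_fun setT (f^\-)%E by exact: measurable_funeneg.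
have ip : mu.-integrable setT (f^\+)%E by exact: integrable_funepos.
have in_ : mu.-integrable setT (f^\-)%E by exact: integrable_funeneg.
have fin (h : T -> \bar R) A : measurable A -> mu.-integrable setT h -> (\int[mu]_(x in A) h x)%E \is a fin_num.
  by move=> mA ih; apply: integrable_fin_num => //; exact: integrableS ih.
pose m1 := density mu mp (funepos_ge0 f); pose m2 := density mu mn (funeneg_ge0 f).
have GM A : G A -> measurable A by rewrite GE; exact: sub_sigma_algebra.
have E A : measurable A -> m1 A = m2 A.
  apply: (measure_unique G g) => //.
    move=> B GB; have mB := GM _ GB.
    have := fG _ GB; rewrite integralE => /eqP; rewrite sube_eq ?add0e; last 2 first.
    - exact: fin.
    - by rewrite fin_num_adde_defl// fin.
    by move/eqP.
  move=> k; apply: integrable_lty; first exact: GM.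
  by apply: (integrableS _ _ _ ip) => //; exact: GM.
apply: integral_ae_eq => // A _ mA; rewrite integral0.
rewrite integralE; apply/eqP; rewrite sube_eq ?add0e; last 2 first.
- exact: fin.
- by rewrite fin_num_adde_defl// fin.
by apply/eqP; exact: E mA.
Qed.

End PiSystem.

(** * Uniqueness of weak derivatives *)

Section WeakUniqueness.
Context {R : realType}.
Local Notation mu := (@lebesgue_measure R).
Local Notation mu2 := (lebesgue2 R).
Local Notation H := (@half_plane R).
Local Notation plane := (measurableTypeR R * measurableTypeR R)%type.
Implicit Types (f g u : R * R -> R) (x : R * R).
Let mH := @measurable_half_plane R.

Definition box (a b c e : R) : set plane := `]a, b[%classic `*` `]c, e[%classic.

Definition boxes : set (set plane) := [set A | exists a b c e, A = box a b c e].

Lemma measurable_box a b c e : measurable (box a b c e).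
Proof. by apply: measurableX; exact: measurable_itv. Qed.

Lemma itvooI (a b a' b' : R) :
  `]a, b[%classic `&` `]a', b'[%classic = `]Num.max a a', Num.min b b'[%classic :> set R.
Proof.
apply/seteqP; split => t /=; rewrite !in_itv /= gt_max lt_min.
  by move=> [/andP[-> ->] /andP[-> ->]].
by move=> /andP[/andP[-> ->] /andP[-> ->]].
Qed.

Lemma boxI a b c e a' b' c' e' :
  box a b c e `&` box a' b' c' e' =
  box (Num.max a a') (Num.min b b') (Num.max c c') (Num.min e e').
Proof.
rewrite /box -!itvooI; apply/seteqP; split => x /=.
  by move=> [[? ?] [? ?]].
by move=> [[? ?] [? ?]].
Qed.

Lemma setI_closed_boxes : setI_closed boxes.
Proof.
move=> A B [a [b [c [e ->]]]] [a' [b' [c' [e' ->]]]].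
by rewrite boxI; do 4 eexists.
Qed.

Lemma bigcup_box : \bigcup_(n : nat) box (- n.+1%:R) n.+1%:R (- n.+1%:R) n.+1%:R = setT.
Proof.
apply/seteqP; split => // x _.
have [n xn] : exists n : nat, `|x.1| + `|x.2| < n.+1%:R.
  exists (Num.truncn (`|x.1| + `|x.2|)); exact: truncnS_gt.
exists n => //; split => /=; rewrite in_itv /= -ltr_norml; apply: le_lt_trans xn.
  by rewrite lerDl.
by rewrite lerDr.
Qed.

(** Strips are countable unions of boxes, so both coordinates are measurable for the sigma-algebra
    generated by the boxes. Hence so is the identity into the product. *)
Lemma measurable_boxes : @measurable _ plane = <<s boxes >>.
Proof.
apply/seteqP; split; last first.
  apply: smallest_sub; first exact: sigma_algebra_measurable.
  by move=> _ [a [b [c [e ->]]]]; exact: measurable_box.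
pose T := g_sigma_algebraType boxes.
have bT A : boxes A -> measurable (A : set T) by move=> bA; exact: sub_sigma_algebra.
have strip1 a b : measurable (`]a, b[%classic `*` setT : set T).
  rewrite (_ : _ `*` _ = \bigcup_(n : nat) box a b (- n.+1%:R) n.+1%:R); last first.
    apply/seteqP; split => [x [x1 _]|x [n _ [x1 _]]]; last by split.
    have := bigcup_box; move/seteqP => [_ /(_ x I)] [n _ [_ x2]].
    by exists n => //; split.
  by apply: bigcupT_measurable => n; apply: bT; do 4 eexists.
have strip2 a b : measurable (setT `*` `]a, b[%classic : set T).
  rewrite (_ : _ `*` _ = \bigcup_(n : nat) box (- n.+1%:R) n.+1%:R a b); last first.
    apply/seteqP; split => [x [_ x2]|x [n _ [_ x2]]]; last by split.
    have := bigcup_box; move/seteqP => [_ /(_ x I)] [n _ [x1 _]].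
    by exists n => //; split.
  by apply: bigcupT_measurable => n; apply: bT; do 4 eexists.
have m1 : measurable_fun (setT : set T) ((fun x => x.1) : T -> measurableTypeR R).
  apply: (measurability _ (RGenOpens.measurableE R)) => _ [_ [a [b ->]] <-].
  rewrite setTI; have := strip1 a b; congr measurable.
  by apply/seteqP; split => [x []|x].
have m2 : measurable_fun (setT : set T) ((fun x => x.2) : T -> measurableTypeR R).
  apply: (measurability _ (RGenOpens.measurableE R)) => _ [_ [a [b ->]] <-].
  rewrite setTI; have := strip2 a b; congr measurable.
  by apply/seteqP; split => [x []|x].
have m12 := measurable_fun_pair m1 m2.
move=> A mA; have := m12 measurableT A mA; rewrite setTI.
by congr (<<s boxes >> _); apply/seteqP; split => -[].
Qed.


(** A smooth function with values between 0 and 1, vanishing outside the open box and tending to 1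
    at each of its points as [n] grows. *)
Definition bump (n : nat) (a b c e : R) (x : R * R) : R :=
  flat_exp 0 (n.+1%:R * (x.1 - a)) * flat_exp 0 (n.+1%:R * (b - x.1)) *
  (flat_exp 0 (n.+1%:R * (x.2 - c)) * flat_exp 0 (n.+1%:R * (e - x.2))).

Lemma flat_exp_le0 k (t : R) : t <= 0 -> flat_exp k t = 0.
Proof. by move=> t0; rewrite /flat_exp ltNge t0. Qed.

Lemma bump_out n a b c e x : ~ box a b c e x -> bump n a b c e x = 0.
Proof.
move=> nx; rewrite /bump.
have z t : t <= 0 -> flat_exp 0 (n.+1%:R * t) = 0 :> R.
  by move=> t0; rewrite flat_exp_le0// mulr_ge0_le0.
have [h|h] := leP x.1 a; first by rewrite (z (x.1 - a)) ?subr_le0// !mul0r.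
have [h'|h'] := leP b x.1; first by rewrite (z (b - x.1)) ?subr_le0// mulr0 mul0r.
have [k|k] := leP x.2 c; first by rewrite (z (x.2 - c)) ?subr_le0// mul0r mulr0.
have [k'|k'] := leP e x.2; first by rewrite (z (e - x.2)) ?subr_le0// !mulr0.
by exfalso; apply: nx; split; rewrite /= in_itv /=; apply/andP.
Qed.

Lemma bump_ge0 n a b c e x : 0 <= bump n a b c e x.
Proof. by rewrite /bump !mulr_ge0// flat_exp_ge0. Qed.

Lemma bump_le1 n a b c e x : bump n a b c e x <= 1.
Proof.
by rewrite /bump !mulr_ile1 ?mulr_ge0 ?flat_exp_ge0 ?flat_exp0_le1.
Qed.

Lemma flat_exp_cvg1 (t : R) : 0 < t -> flat_exp 0 (n.+1%:R * t) @[n --> \oo] --> (1 : R).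
Proof.
move=> t0.
have -> : (fun n : nat => flat_exp 0 (n.+1%:R * t)) = (fun n => expR (- (harmonic n * t^-1))).
  by apply/funext => n; rewrite /flat_exp mulr_gt0// expr0 mul1r /harmonic invfM.
rewrite -[X in _ --> X]expR0.
apply: (continuous_cvg _ (@continuous_expR R 0)).
rewrite -[X in _ --> X]oppr0; apply: cvgN; rewrite -[X in _ --> X](mul0r t^-1).
by apply: cvgMl; exact: cvg_harmonic.
Qed.

Lemma bump_cvg1 a b c e x : box a b c e x -> bump n a b c e x @[n --> \oo] --> (1 : R).
Proof.
case; rewrite /= !in_itv /= => /andP[x1 x2] /andP[x3 x4].
rewrite -[X in _ --> X](mulr1 1); apply: cvgM.
  by rewrite -[X in _ --> X](mulr1 1); apply: cvgM; apply: flat_exp_cvg1; rewrite subr_gt0.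
by rewrite -[X in _ --> X](mulr1 1); apply: cvgM; apply: flat_exp_cvg1; rewrite subr_gt0.
Qed.

Lemma smooth_bump n a b c e : smooth (bump n a b c e).
Proof.
move=> k; rewrite /bump.
have lin1 (s r : R) : class_C k (fun x : R * R => s * (x.1 - r)).
  by apply: class_C_mul; [exact: class_C_cst|apply: class_C_add; [exact: class_C_fst|exact: class_C_cst]].
have lin2 (s r : R) : class_C k (fun x : R * R => s * (x.2 - r)).
  by apply: class_C_mul; [exact: class_C_cst|apply: class_C_add; [exact: class_C_snd|exact: class_C_cst]].
have lin1' (s r : R) : class_C k (fun x : R * R => s * (r - x.1)).
  by apply: class_C_mul; [exact: class_C_cst|apply: class_C_add; [exact: class_C_cst|apply: class_C_opp; exact: class_C_fst]].
have lin2' (s r : R) : class_C k (fun x : R * R => s * (r - x.2)).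
  by apply: class_C_mul; [exact: class_C_cst|apply: class_C_add; [exact: class_C_cst|apply: class_C_opp; exact: class_C_snd]].
by apply: class_C_mul; apply: class_C_mul; apply: class_C_flat_exp.
Qed.

Lemma compact_rect (a b c e : R) : compact (rect a b c e).
Proof. by apply: compact_setX; exact: segment_compact. Qed.

Lemma box_sub_rect a b c e : box a b c e `<=` rect a b c e.
Proof.
move=> x [] /=; rewrite /rect !in_itv /= => /andP[/ltW ? /ltW ?] /andP[/ltW ? /ltW ?].
by split; rewrite /= in_itv /=; apply/andP.
Qed.

Lemma rect_half (a b c e : R) : 0 < a -> rect a b c e `<=` H.
Proof.
by move=> a0 x []; rewrite /= in_itv /= => /andP[h _] _; exact: lt_le_trans h.
Qed.

Lemma test_bump n a b c e : 0 < a -> test_function (bump n a b c e).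
Proof.
move=> a0; split; first exact: smooth_bump.
exists (rect a b c e); split; [exact: compact_rect|exact: rect_half|].
by move=> x nx; apply: bump_out => /box_sub_rect.
Qed.

(** The bumps are test functions tending to the indicator of the box; dominated convergence, with
    dominating function [|w|], transfers the vanishing from them. *)
Lemma int_box_eq0 w a b c e : 0 < a -> locally_integrable2 w ->
  (forall phi, test_function phi -> \int[mu2]_(x in H) (w x * phi x) = 0) ->
  (\int[mu2]_(x in box a b c e) (w x)%:E = 0)%E.
Proof.
move=> a0 [mw li] w0.
have bH : box a b c e `<=` H by move=> x /box_sub_rect; exact: rect_half.
have mb := measurable_box a b c e.
have iw : mu2.-integrable (box a b c e) (EFin \o w).
  apply: (integrableS (measurable_rect a b c e)) => //; first exact: box_sub_rect.
  by apply: li; [exact: compact_rect|exact: rect_half].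
have mwb : measurable_fun (box a b c e) w by exact: measurable_funS mw.
have mbump n : measurable_fun (box a b c e) (bump n a b c e).
  apply: continuous_measurable2; exact: test_continuous (test_bump n b c e a0).
pose f n x := (w x * bump n a b c e x)%:E.
have mf n : measurable_fun (box a b c e) (f n).
  by apply/measurable_EFinP; exact: measurable_funM.
have fw n x : (`|f n x| <= `|(w x)%:E|)%E.
  rewrite lee_fin normrM [X in _ * X]ger0_norm ?bump_ge0//.
  by rewrite ler_piMr// bump_le1.
have if_ n : mu2.-integrable (box a b c e) (f n).
  by apply: (le_integrable mb (mf n) _ iw) => x _; exact: fw.
have f0 n : (\int[mu2]_(x in box a b c e) f n x = 0)%E.
  rewrite -[LHS]fineK; last by apply: integrable_fin_num => //; exact: if_.
  congr EFin; rewrite -(w0 _ (test_bump n b c e a0)) /Rintegral; congr fine.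
  rewrite -{1}(setIidr bH) integral_mkcondr; apply: eq_integral => x _.
  rewrite /patch; case: ifPn => // nx; rewrite bump_out ?mulr0// => bx.
  by move/negP: nx; apply; rewrite inE.
have mw' : measurable_fun (box a b c e) (EFin \o w) by exact/measurable_EFinP.
have cv : \forall x \ae mu2, box a b c e x -> f n x @[n --> \oo] --> (EFin \o w) x.
  apply: aeW => x bx; apply: cvg_EFin; first by near=> n.
  rewrite -[X in _ --> X]mulr1; apply: cvgMr; exact: bump_cvg1.
have bd : \forall x \ae mu2, forall n, box a b c e x -> (`|f n x| <= (abse \o (EFin \o w)) x)%E.
  by apply: aeW => x n _; exact: fw.
have [_ _ K] := dominated_convergence mb mf mw' cv (integrable_abse iw) bd.
have E : [sequence (\int[mu2]_(x in box a b c e) f n x)%E]_n = cst 0%E.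
  by apply/funext => n; exact: f0.
by rewrite E in K; apply/esym; apply: (cvg_unique _ _ K) => //; exact: cvg_cst.
Unshelve. all: by end_near. Qed.

(** [w] is only locally integrable, so the half-plane is exhausted by boxes [P n] with compact
    closure inside it. On each, the restriction of [w] is integrable and has integral 0 over every
    box; boxes form a generating pi-system. *)
Lemma du_bois_reymond w : locally_integrable2 w ->
  (forall phi, test_function phi -> \int[mu2]_(x in H) (w x * phi x) = 0) ->
  {ae mu2, forall x, H x -> w x = 0}.
Proof.
move=> lw w0; have [mw li] := lw.
pose P n := box n.+1%:R^-1 n.+1%:R (- n.+1%:R) n.+1%:R.
have PH n : P n `<=` H by move=> x /box_sub_rect; apply: rect_half; rewrite invr_gt0.
have mP n : measurable (P n) by exact: measurable_box.
have : {ae mu2, forall x n, P n x -> w x = 0}.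
  apply/ae_foralln => n.
  have n0 : 0 < n.+1%:R^-1 :> R by rewrite invr_gt0.
  have i1 : mu2.-integrable (P n) (EFin \o w).
    apply: (integrableS (measurable_rect _ _ _ _)) => //; first exact: box_sub_rect.
    by apply: li; [exact: compact_rect|exact: rect_half].
  have i2 : mu2.-integrable setT ((EFin \o w) \_ (P n)).
    by apply/integrable_restrict; rewrite ?setTI.
  have := integral_pi_system_ae0 measurable_boxes setI_closed_boxes
    (g := fun n => box (- n.+1%:R) n.+1%:R (- n.+1%:R) n.+1%:R) _ bigcup_box i2.
  move=> K.
  have K1 := K (fun i => ex_intro _ _ (ex_intro _ _ (ex_intro _ _ (ex_intro _ _ erefl)))).
  have : ae_eq mu2 setT ((EFin \o w) \_ (P n)) (cst 0%E).
    apply: K1 => _ [a [b [c [e ->]]]].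
    (* The intersection with [P n] is again a box and its left end is positive, as [int_box_eq0]
       requires. *)
    rewrite -integral_mkcondr boxI; apply: int_box_eq0 => //.
    by rewrite lt_max n0 orbT.
  apply: ae_imp => x + Px; move=> /(_ I); rewrite /patch mem_set//= => -[].
  by [].
apply: ae_imp => x wx Hx.
have [n xn] : exists n : nat, x.1^-1 + `|x.1| + `|x.2| < n.+1%:R.
  exists (Num.truncn (x.1^-1 + `|x.1| + `|x.2|)); exact: truncnS_gt.
have x10 : 0 < x.1^-1 by rewrite invr_gt0.
apply: (wx n); have := normr_ge0 x.1; have := normr_ge0 x.2 => h1 h2.
split; rewrite /= in_itv /=; apply/andP; split.
- by rewrite invf_plt ?posrE//; lra.
- by have := ler_norm x.1; lra.
- by have := lerNnormlW (lexx `|x.2|); lra.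
- by have := ler_norm x.2; lra.
Qed.

End WeakUniqueness.

Section WeakDerivative.
Context {R : realType}.
Local Notation mu := (@lebesgue_measure R).
Local Notation mu2 := (lebesgue2 R).
Local Notation H := (@half_plane R).
Local Notation plane := (measurableTypeR R * measurableTypeR R)%type.
Local Notation nsqH := (nsq mu2 H).
Local Notation ipH := (ip mu2 H).
Implicit Types (f g u w phi psi : R * R -> R) (x v : R * R).
Let mH := @measurable_half_plane R.

Lemma compact_measurable2 (K : set (R * R)) : compact K -> measurable (K : set plane).
Proof.
move=> cK; have cl : closed K by apply: compact_closed => //; exact: norm_hausdorff.
rewrite -(setCK K); apply: measurableC; apply: open_measurable2; exact: closed_openC.
Qed.

Lemma compact_sub_rect (K : set (R * R)) : compact K ->
  exists2 M : R, 0 < M & K `<=` rect (- M) M (- M) M.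
Proof.
move=> cK; have [M [Mr MP]] := compact_bounded cK.
exists (`|M| + 1); first by rewrite ltr_pwDr.
move=> x Kx; have := MP (`|M| + 1) (le_lt_trans (ler_norm _) (ltr_pwDr ltr01 (lexx _))) x Kx.
rewrite /= prod_normE ge_max => /andP[h1 h2].
by split; rewrite /= in_itv /= -ler_norml.
Qed.

Lemma L2_rect_1 (M : R) : 0 < M -> L2 mu2 (rect (- M) M (- M) M) (fun=> 1 : R).
Proof.
move=> M0; apply: continuous_L2_rect; try lra.
by move=> ?; exact: cst_continuous.
Qed.

Lemma L2_sub (A B : set plane) f : measurable A -> measurable B -> A `<=` B -> L2 mu2 B f -> L2 mu2 A f.
Proof.
move=> mA mB AB [mf fi]; split; first exact: measurable_funS mf.
apply: le_lt_trans fi; apply: ge0_subset_integral => //.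
- by apply/measurable_EFinP; exact: measurable_funX.
- by move=> x _; rewrite lee_fin sqr_ge0.
Qed.

Lemma L2_locally_integrable f : L2 mu2 H f -> locally_integrable2 f.
Proof.
move=> f2; split; first exact: L2_measurable f2.
move=> K cK KH; have mK := compact_measurable2 cK.
have [M M0 KM] := compact_sub_rect cK.
have fK : L2 mu2 K f by exact: L2_sub KH f2.
have oK : L2 mu2 K (fun=> 1 : R) by apply: L2_sub KM (L2_rect_1 M0) => //; exact: measurable_rect.
have := L2_integrable mK fK oK.
by rewrite (_ : (fun x => f x * 1) = f)//; apply/funext => x; rewrite mulr1.
Qed.

Lemma locally_integrable_mul_test g phi : locally_integrable2 g -> test_function phi ->
  mu2.-integrable H (EFin \o (fun x => g x * phi x)).
Proof.
move=> [mg lg] tp; have [_ [K [cK KH K0]]] := tp.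
have mK := compact_measurable2 cK.
have [C C0 CP] := test_bounded tp.
have mgp : measurable_fun H (fun x => g x * phi x).
  by apply: measurable_funM => //; apply: continuous_measurable2; exact: test_continuous.
have iK : mu2.-integrable K (EFin \o (fun x => g x * phi x)).
  have := integrableZl mK C (lg K cK KH); apply: le_integrable => //.
    by apply/measurable_EFinP; exact: measurable_funS mgp.
  move=> x Kx; rewrite lee_fin !normrM mulrC (gtr0_norm C0).
  by apply: ler_wpM2r => //; exact: CP.
have : mu2.-integrable H ((EFin \o (fun x => g x * phi x)) \_ K).
  apply: (integrableS measurableT mH) => //.
  by apply/integrable_restrict; rewrite ?setTI.
congr (mu2.-integrable H); apply/funext => x; rewrite /patch; case: ifPn => // xK.
by rewrite /= K0 ?mulr0// => Kx; move/negP: xK; apply; rewrite inE.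
Qed.

Lemma test_integrable phi : test_function phi -> mu2.-integrable setT (EFin \o phi).
Proof.
move=> tp; have [_ [K [cK KH K0]]] := tp.
have [M M0 KM] := compact_sub_rect cK.
have MM : - M <= M by lra.
have mr := @measurable_rect R (- M) M (- M) M.
have iK := L2_integrable mr (continuous_L2_rect MM MM (test_continuous tp)) (L2_rect_1 M0).
have : mu2.-integrable setT ((EFin \o (fun x => phi x * 1)) \_ (rect (- M) M (- M) M)).
  by apply/integrable_restrict; rewrite ?setTI.
congr (mu2.-integrable _); apply/funext => x; rewrite /patch; case: ifPn => [|xK]; rewrite /= ?mulr1//.
by rewrite K0// => /KM Kx; move/negP: xK; apply; rewrite inE.
Qed.

Lemma integral_deriv_slice (g dg : R -> R) (M : R) : (forall s : R, is_derive s 1 g (dg s)) ->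
  continuous dg -> 0 < M -> (forall s, M <= `|s| -> g s = 0 /\ dg s = 0) ->
  (\int[mu]_s (dg s)%:E = 0)%E.
Proof.
move=> D cdg M0 g0; have MM : - M <= M by lra.
have F := FTC_itv D cdg MM.
have aM : M <= `|M| by exact: ler_norm.
have aN : M <= `|- M| by rewrite normrN.
rewrite (g0 M aM).1 (g0 (- M) aN).1 subrr in F.
have i := @continuous_integrable_itv R dg (- M) M cdg.
have e : (\int[mu]_(s in `[(- M)%R, M]) (dg s)%:E = 0)%E.
  rewrite -[LHS]fineK; last by apply: (integrable_fin_num _ i); exact: measurable_itv.
  by apply: (f_equal EFin); exact: esym F.
rewrite -e [RHS]integral_mkcond; apply: eq_integral => s _; rewrite /patch.
case: ifPn => // ns; rewrite (g0 s _).2// leNgt; apply/negP => h; move/negP: ns; apply.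
by rewrite inE /= in_itv /= -ler_norml ltW.
Qed.

Lemma integral_test_deriv phi : test_function phi ->
  \int[mu2]_(x in H) 'D_e1 phi x = 0 /\ \int[mu2]_(x in H) 'D_e2 phi x = 0.
Proof.
move=> tp; have [t1 t2] := test_deriv tp; have c1 := test_smooth tp 1%N.
have [M1 M10 MP1] := test_box t1; have [M2 M20 MP2] := test_box t2; have [M M0 MP] := test_box tp.
pose L := Num.max M (Num.max M1 M2).
have L0 : 0 < L by rewrite lt_max M0.
have LP t : L <= `|t| -> [/\ M <= `|t|, M1 <= `|t| & M2 <= `|t|].
  by rewrite !ge_max => /and3P[].
have toT psi : test_function psi -> (\int[mu2]_x (psi x)%:E = 0)%E -> \int[mu2]_(x in H) psi x = 0.
  move=> ts s0; rewrite /Rintegral (int_half (g := EFin \o psi)) ?s0// => x x0 /=.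
  by rewrite (test_half ts x0).
split; apply: toT => //.
- transitivity (\int[mu]_b \int[mu]_a (EFin \o 'D_e1 phi) (a, b))%E.
    rewrite -(Fubini (test_integrable t1)); apply/esym; exact: (integral12_prod_meas1 (test_integrable t1)).
  apply: integral0_eq => b _; apply: (integral_deriv_slice (fun s => is_derive_slice1 s b c1) _ L0).
    exact: (@slice1_continuous R ('D_e1 phi) b (test_continuous t1)).
  by move=> s /LP[h h1 h2]; split; [apply: MP; left|apply: MP1; left].
- transitivity (\int[mu]_a \int[mu]_b (EFin \o 'D_e2 phi) (a, b))%E.
    apply/esym; exact: (integral12_prod_meas1 (test_integrable t2)).
  apply: integral0_eq => a _; apply: (integral_deriv_slice (fun s => is_derive_slice2 a s c1) _ L0).
    exact: (@slice2_continuous R ('D_e2 phi) a (test_continuous t2)).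
  by move=> s /LP[h h1 h2]; split; [apply: MP; right|apply: MP2; right].
Qed.

Lemma deriv_mul_test phi psi x : test_function phi -> test_function psi ->
  'D_e1 (fun y => phi y * psi y) x = 'D_e1 phi x * psi x + phi x * 'D_e1 psi x /\
  'D_e2 (fun y => phi y * psi y) x = 'D_e2 phi x * psi x + phi x * 'D_e2 psi x.
Proof.
move=> tp ts; have [p1 p2] := test_is_derive x tp; have [s1 s2] := test_is_derive x ts.
have h1 := is_derive_mul p1 s1; have h2 := is_derive_mul p2 s2.
by split; [have -> := derive_val (is_derive := h1)|have -> := derive_val (is_derive := h2)].
Qed.

Lemma ip_parts phi psi : test_function phi -> test_function psi ->
  ipH phi ('D_e1 psi) = - ipH ('D_e1 phi) psi /\ ipH phi ('D_e2 psi) = - ipH ('D_e2 phi) psi.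
Proof.
move=> tp ts; have [p1 p2] := test_deriv tp; have [s1 s2] := test_deriv ts.
have tm : test_function (fun x => phi x * psi x) by apply: test_mul => //; exact: test_smooth.
have [I1 I2] := integral_test_deriv tm.
have add g1 g2 : test_function g1 -> test_function g2 ->
    ipH g1 psi + ipH phi g2 = \int[mu2]_(x in H) (g1 x * psi x + phi x * g2 x).
  by move=> t1 t2; rewrite !ipE -RintegralD//; apply: L2_integrable => //; exact: test_L2.
split; apply/eqP; rewrite -addr_eq0 addrC add//; apply/eqP.
- by rewrite -[RHS]I1; apply: eq_Rintegral => x _; rewrite (deriv_mul_test x tp ts).1.
- by rewrite -[RHS]I2; apply: eq_Rintegral => x _; rewrite (deriv_mul_test x tp ts).2.
Qed.

Definition admissible v := v = e1 \/ v = e2 :> R * R.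

Lemma test_deriv_adm v phi : admissible v -> test_function phi -> test_function ('D_v phi).
Proof. by case=> -> /test_deriv[]. Qed.

Lemma ip_parts_adm v phi psi : admissible v -> test_function phi -> test_function psi ->
  ipH phi ('D_v psi) = - ipH ('D_v phi) psi.
Proof. by case=> -> tp ts; have [] := ip_parts tp ts. Qed.

Lemma weakP v u g : admissible v -> L2 mu2 H u -> L2 mu2 H g ->
  (forall phi, test_function phi -> ipH u ('D_v phi) = - ipH g phi) <-> is_weak_derivative v u g.
Proof.
move=> _ u2 g2; split => [h|[_ _ h] phi tp].
  split; [exact: L2_locally_integrable|exact: L2_locally_integrable|].
  by move=> phi tp; have := h _ tp; rewrite !ipE.
by rewrite !ipE; exact: h.
Qed.

Lemma test_weak v phi : admissible v -> test_function phi -> is_weak_derivative v phi ('D_v phi).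
Proof.
move=> av tp; have tv := test_deriv_adm av tp.
apply/weakP => //; [exact: test_L2|exact: test_L2|].
by move=> psi ts; exact: ip_parts_adm.
Qed.

Lemma weak_unique v u g g' : is_weak_derivative v u g -> is_weak_derivative v u g' ->
  {ae mu2, forall x, H x -> g x = g' x}.
Proof.
move=> [_ lg Pg] [_ lg' Pg'].
have lw : locally_integrable2 (fun x => g x - g' x).
  split; first by apply: measurable_funB; [case: lg|case: lg'].
  move=> K cK KH; have mK := compact_measurable2 cK.
  have := integrableB mK (lg.2 K cK KH) (lg'.2 K cK KH); congr (mu2.-integrable K).
have : {ae mu2, forall x, H x -> g x - g' x = 0}.
  apply: du_bois_reymond => // phi tp.
  under eq_Rintegral do rewrite mulrBl.
  rewrite RintegralB//; try exact: locally_integrable_mul_test.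
  apply/eqP; rewrite subr_eq0 -eqr_opp -(Pg _ tp) -(Pg' _ tp); exact: eqxx.
by apply: ae_imp => x h Hx; apply/eqP; rewrite -subr_eq0 h.
Qed.

Lemma weak_derivativeP v u g : is_weak_derivative v u g ->
  is_weak_derivative v u (weak_derivative v u) /\
  {ae mu2, forall x, H x -> weak_derivative v u x = g x}.
Proof.
move=> h; have h' : is_weak_derivative v u (weak_derivative v u).
  by rewrite /weak_derivative; apply: (@xgetPex _ (cst 0) [set g | is_weak_derivative v u g]); exists g.
by split => //; exact: weak_unique h.
Qed.

Lemma L2_ae f g : L2 mu2 H f -> measurable_fun H g ->
  {ae mu2, forall x, H x -> f x = g x} -> L2 mu2 H g /\ nsqH g = nsqH f.
Proof.
move=> f2 mg fg; have mf := L2_measurable f2.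
have E : (\int[mu2]_(x in H) (g x ^+ 2)%:E = \int[mu2]_(x in H) (f x ^+ 2)%:E)%E.
  apply: ae_eq_integral => //.
  - by apply/measurable_EFinP; exact: measurable_funX.
  - by apply/measurable_EFinP; exact: measurable_funX.
  - by apply: ae_imp fg => x /[apply] /= ->.
have g2 : L2 mu2 H g by split => //; rewrite E; case: f2.
by split => //; apply/EFin_inj; rewrite !(nsqE mH).
Qed.

End WeakDerivative.

(** * The space H^+ *)

Inductive component_index := Ifun | Idx | Idy | Idth.

Section HplusSpace.
Context {R : realType}.
Local Notation mu := (@lebesgue_measure R).
Local Notation mu2 := (lebesgue2 R).
Local Notation H := (@half_plane R).
Local Notation plane := (measurableTypeR R * measurableTypeR R)%type.
Local Notation nsqH := (nsq mu2 H).
Local Notation ipH := (ip mu2 H).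
Local Notation L2H := (L2 mu2 H).
Implicit Types (f g u w phi psi : R * R -> R) (x v : R * R) (i : component_index).
Let mH := @measurable_half_plane R.

(** [n <= s n] already makes the indices tend to infinity. *)
Lemma cvg_sub (T : topologicalType) (a : nat -> T) (l : T) (s : nat -> nat) :
  (forall n, (n <= s n)%N) -> a n @[n --> \oo] --> l -> a (s n) @[n --> \oo] --> l.
Proof.
move=> hs; apply: cvg_trans => A [N _ HN]; exists N => // n Nn; apply: HN => /=.
exact: leq_trans Nn (hs n).
Qed.

Definition L2_null (a : nat -> R * R -> R) := nsqH (a n) @[n --> \oo] --> (0 : R).

Lemma L2_null_le (a : nat -> R * R -> R) (c : nat -> R) :
  (forall n, nsqH (a n) <= c n) -> c n @[n --> \oo] --> (0 : R) -> L2_null a.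
Proof.
move=> ac c0; apply: (@squeeze_cvgr _ _ _ _ (fun=> 0) c) => //; last exact: cvg_cst.
by near=> n; rewrite ac andbT; exact: (@nsq_ge0 _ _ _ mu2 H (a n)).
Unshelve. all: by end_near. Qed.

Lemma L2_nullD (a b : nat -> R * R -> R) : (forall n, L2H (a n)) -> (forall n, L2H (b n)) ->
  L2_null a -> L2_null b -> L2_null (fun n x => a n x + b n x).
Proof.
move=> a2 b2 a0 b0.
apply: (@L2_null_le _ (fun n => 2 * nsqH (a n) + 2 * nsqH (b n))).
  by move=> n; exact: nsqD_le.
rewrite -[X in _ --> X](addr0 0) -[X in _ --> X + X](mulr0 2).
by apply: cvgD; apply: cvgMr.
Qed.

Lemma L2_nullZ (c : R) (a : nat -> R * R -> R) : (forall n, L2H (a n)) ->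
  L2_null a -> L2_null (fun n x => c * a n x).
Proof.
move=> a2 a0; apply: (@L2_null_le _ (fun n => c ^+ 2 * nsqH (a n))).
  by move=> n; rewrite (nsqZ mH).
by rewrite -[X in _ --> X](mulr0 (c ^+ 2)); apply: cvgMr.
Qed.

Lemma L2_null_ip (a : nat -> R * R -> R) f : (forall n, L2H (a n)) -> L2H f ->
  L2_null a -> ipH (a n) f @[n --> \oo] --> (0 : R).
Proof.
move=> a2 f2 a0; apply/norm_cvg0P.
apply: (@squeeze_cvgr _ _ _ _ (fun=> 0) (fun n => Num.sqrt (nsqH (a n)) * Num.sqrt (nsqH f))).
- by near=> n; rewrite normr_ge0 /=; exact: ip_le.
- exact: cvg_cst.
- have e : (0 : R) = Num.sqrt 0 * Num.sqrt (nsqH f) by rewrite sqrtr0 mul0r.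
  rewrite [X in _ --> X]e.
  apply: cvgMl; apply: (continuous_cvg _ _ a0); exact: sqrt_continuous.
Unshelve. all: by end_near. Qed.

(** An H^1 function together with an explicit weak gradient. Computations use this form, and
    [sobolevP] returns to the chosen representatives. *)
Definition sobolev u g1 g2 :=
  [/\ L2H u, L2H g1, L2H g2, is_weak_derivative e1 u g1 & is_weak_derivative e2 u g2].

Lemma weak_lin v u g u' g' (c : R) : admissible v -> L2H u -> L2H g -> L2H u' -> L2H g' ->
  is_weak_derivative v u g -> is_weak_derivative v u' g' ->
  is_weak_derivative v (fun x => u x + c * u' x) (fun x => g x + c * g' x).
Proof.
move=> av u2 g2 u'2 g'2 /(weakP av u2 g2) h /(weakP av u'2 g'2) h'.
have cu := L2Z mH c u'2; have cg := L2Z mH c g'2.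
apply/(weakP av (L2D mH u2 cu) (L2D mH g2 cg)) => phi tp.
have tv := test_L2 (test_deriv_adm av tp); have t2 := test_L2 tp.
rewrite (ipDl mH u2 cu tv) (ipDl mH g2 cg t2) (ipZl mH c u'2 tv) (ipZl mH c g'2 t2) h// h'//.
by rewrite opprD mulrN.
Qed.

Lemma sobolev_lin u g1 g2 u' g1' g2' (c : R) : sobolev u g1 g2 -> sobolev u' g1' g2' ->
  sobolev (fun x => u x + c * u' x) (fun x => g1 x + c * g1' x) (fun x => g2 x + c * g2' x).
Proof.
move=> [a b e d f] [a' b' e' d' f']; split; try (apply: L2D => //; exact: L2Z).
- by apply: weak_lin => //; left.
- by apply: weak_lin => //; right.
Qed.

Lemma sobolev_sub u g1 g2 u' g1' g2' : sobolev u g1 g2 -> sobolev u' g1' g2' ->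
  sobolev (u \- u') (fun x => g1 x - g1' x) (fun x => g2 x - g2' x).
Proof.
move=> s s'; have := sobolev_lin (-1) s s'.
by congr sobolev; apply/funext => x; rewrite mulN1r.
Qed.

Lemma test_sobolev phi : test_function phi -> sobolev phi ('D_e1 phi) ('D_e2 phi).
Proof.
move=> tp; have [t1 t2] := test_deriv tp; split; try exact: test_L2.
- by apply: test_weak => //; left.
- by apply: test_weak => //; right.
Qed.

Lemma sobolevP u g1 g2 : sobolev u g1 g2 ->
  [/\ H1 u, {ae mu2, forall x, H x -> weak_derivative e1 u x = g1 x},
    {ae mu2, forall x, H x -> weak_derivative e2 u x = g2 x} &
    H1_norm u ^+ 2 = nsqH u + nsqH g1 + nsqH g2].
Proof.
move=> [u2 l1 l2 w1 w2].
have [W1 E1] := weak_derivativeP w1; have [W2 E2] := weak_derivativeP w2.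
have m1 : measurable_fun H (weak_derivative e1 u) by case: W1 => _ [].
have m2 : measurable_fun H (weak_derivative e2 u) by case: W2 => _ [].
have [K1 N1] := L2_ae l1 m1 (ae_eq_sym E1).
have [K2 N2] := L2_ae l2 m2 (ae_eq_sym E2).
split; [|exact: E1|exact: E2|].
  by split; [exact: u2|exists g1; exact: w1|exists g2; exact: w2|exact: K1|exact: K2].
rewrite sqr_sqrtr; last by apply: Rintegral_ge0 => x _; rewrite !addr_ge0// sqr_ge0.
rewrite -N1 -N2; exact: (Rintegral_sqr3 mH u2 K1 K2).
Qed.

Lemma H1_sobolev u : H1 u -> sobolev u (weak_derivative e1 u) (weak_derivative e2 u).
Proof.
move=> [u2 [h1 /weak_derivativeP[w1 _]] [h2 /weak_derivativeP[w2 _]] l1 l2].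
by split; [exact: u2|exact: l1|exact: l2|exact: w1|exact: w2].
Qed.

Definition component i u : R * R -> R :=
  match i with
  | Ifun => u
  | Idx => weak_derivative e1 u
  | Idy => weak_derivative e2 u
  | Idth => dtheta u
  end.

Definition test_component i phi : R * R -> R :=
  match i with Ifun => phi | Idx => 'D_e1 phi | Idy => 'D_e2 phi | Idth => dth phi end.

Lemma test_test_component i phi : test_function phi -> test_function (test_component i phi).
Proof. by move=> tp; have [t1 t2] := test_deriv tp; case: i => //=; exact: test_dth. Qed.

Lemma test_component_lin i phi psi (c : R) : test_function phi -> test_function psi ->
  test_component i (fun x => phi x + c * psi x) =
  (fun x => test_component i phi x + c * test_component i psi x).
Proof.
move=> tp ts; apply/funext => x.
have [p1 p2] := test_is_derive x tp; have [s1 s2] := test_is_derive x ts.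
have h1 := is_derive_add p1 (is_derive_scale c s1).
have h2 := is_derive_add p2 (is_derive_scale c s2).
have E1 : 'D_e1 (fun x => phi x + c * psi x) x = 'D_e1 phi x + c * 'D_e1 psi x.
  by have -> := derive_val (is_derive := h1).
have E2 : 'D_e2 (fun x => phi x + c * psi x) x = 'D_e2 phi x + c * 'D_e2 psi x.
  by have -> := derive_val (is_derive := h2).
case: i => /=; [by []|exact: E1|exact: E2|]; rewrite /dth E1 E2.
by move: ('D_e1 phi x) ('D_e1 psi x) ('D_e2 phi x) ('D_e2 psi x) => a1 a2 a3 a4; ring.
Qed.

Lemma measurable_dtheta u : measurable_fun H (weak_derivative e1 u) ->
  measurable_fun H (weak_derivative e2 u) -> measurable_fun H (dtheta u).
Proof.
move=> m1 m2; rewrite /dtheta; apply: measurable_funB; apply: measurable_funM.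
- by apply: measurable_funTS; exact: measurable_fst.
- exact: m2.
- by apply: measurable_funTS; exact: measurable_snd.
- exact: m1.
Qed.

Lemma Hplus_L2 i u : Hplus u -> L2H (component i u).
Proof.
move=> [[/H1_sobolev[u2 l1 l2 _ _] _] t]; case: i; [exact: u2|exact: l1|exact: l2|split; last exact: t].
by apply: measurable_dtheta; [case: l1|case: l2].
Qed.

(** The closure principle by which elements of H^+ are constructed and their components identified.
    The two partial derivatives pass to the limit in the identity that defines weak derivatives, and
    [sobolevP] gives the H^1 distances to the test functions. *)
Lemma Hplus_limit (phi : nat -> R * R -> R) (g : component_index -> R * R -> R) :
  (forall n, test_function (phi n)) -> (forall i, L2H (g i)) ->
  (forall i, L2_null (fun n x => test_component i (phi n) x - g i x)) ->
  Hplus (g Ifun) /\ forall i, {ae mu2, forall x, H x -> component i (g Ifun) x = g i x}.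
Proof.
move=> tp g2 lim.
have t2 i n : L2H (test_component i (phi n)) by apply: test_L2; exact: test_test_component.
have d2 i n : L2H (fun x => test_component i (phi n) x - g i x) by exact: L2B.
have ipcv i f : L2H f -> ipH (test_component i (phi n)) f @[n --> \oo] --> ipH (g i) f.
  move=> f2; have := L2_null_ip (d2 i) f2 (lim i).
  rewrite (_ : (fun n => ipH (fun x => _ - _) f) =
    (fun n => ipH (test_component i (phi n)) f - ipH (g i) f)); first by move/subr_cvg0.
  apply/funext => n; transitivity (ipH (fun x => test_component i (phi n) x + (-1) * g i x) f).
    by congr ip; apply/funext => x; rewrite mulN1r.
  by rewrite (ipDl mH (t2 i n) (L2Z mH _ (g2 i)) f2) (ipZl mH _ (g2 i) f2) mulN1r.
have weak i v : admissible v -> (forall n, test_component i (phi n) = 'D_v (phi n)) ->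
    is_weak_derivative v (g Ifun) (g i).
  move=> av E; apply/weakP => // psi ts.
  have tv := test_L2 (test_deriv_adm av ts).
  have c1 := ipcv Ifun _ tv.
  have c2 : - ipH (test_component i (phi n)) psi @[n --> \oo] --> - ipH (g i) psi.
    by apply: cvgN; apply: ipcv; exact: test_L2.
  apply: (cvg_unique (@Rhausdorff R) c1).
  rewrite (_ : (fun n => ipH (test_component Ifun (phi n)) ('D_v psi)) =
    (fun n => - ipH (test_component i (phi n)) psi)) //.
  by apply/funext => n; rewrite (ip_parts_adm av (tp n) ts) E.
have S : sobolev (g Ifun) (g Idx) (g Idy).
  by split => //; apply: weak => //; [left|right].
have [h1 E1 E2 _] := sobolevP S.
(* The coefficients of the angular derivative are unbounded, so its L^2 limit is identified
   pointwise, along a subsequence on which three components converge almost everywhere. *)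
have E3 : {ae mu2, forall x, H x -> g Idth x = dtheta (g Ifun) x}.
  have [s1 hs1 c1] := L2_subseq_ae mH (t2 Idx) (g2 Idx) (lim Idx).
  have [s2 hs2 c2] := L2_subseq_ae mH (fun n => t2 Idy (s1 n)) (g2 Idy) (cvg_sub hs1 (lim Idy)).
  have hs12 n : (n <= s1 (s2 n))%N by exact: leq_trans (hs2 n) (hs1 _).
  have [s3 hs3 c3] := L2_subseq_ae mH (fun n => t2 Idth (s1 (s2 n))) (g2 Idth) (cvg_sub hs12 (lim Idth)).
  have c12 := ae_conj c1 c2.
  have e12 := ae_conj E1 E2.
  have c123 := ae_conj c12 c3.
  apply: ae_imp2 c123 e12 => x [[k1 k2] k3] [j1 j2] Hx; move: (k1 Hx) (k2 Hx) (k3 Hx) => {}k1 {}k2 {}k3.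
  have k1' := cvg_sub hs3 (cvg_sub hs2 k1); have k2' := cvg_sub hs3 k2.
  apply: (cvg_unique (@Rhausdorff R) k3); rewrite /dtheta (j1 Hx) (j2 Hx).
  by apply: cvgB; apply: cvgMr.
have md : measurable_fun H (dtheta (g Ifun)).
  by have [_ _ _ l1 l2] := h1; apply: measurable_dtheta; [case: l1|case: l2].
have [L3 _] := L2_ae (g2 Idth) md E3.
split.
  split; last by case: L3.
  split => // e e0.
  have lm : nsqH (fun x => test_component Ifun (phi n) x - g Ifun x) +
      nsqH (fun x => test_component Idx (phi n) x - g Idx x) +
      nsqH (fun x => test_component Idy (phi n) x - g Idy x) @[n --> \oo] --> (0 : R).
    rewrite -[X in _ --> X](addr0 0); apply: cvgD; last exact: lim.
    by rewrite -[X in _ --> X](addr0 0); apply: cvgD; exact: lim.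
  have e20 : 0 < e ^+ 2 by exact: exprn_gt0.
  have [N _ /(_ N (leqnn N)) /= hN] := cvgr_lt _ lm _ e20.
  exists (phi N) => //.
  have [_ _ _ Nq] := sobolevP (sobolev_sub S (test_sobolev (tp N))).
  rewrite -(ltr_pXn2r (n := 2)) ?nnegrE ?sqrtr_ge0 ?(ltW e0)// Nq.
  have s0 : nsqH (g Ifun \- phi N) = nsqH (fun x => phi N x - g Ifun x) := nsqBC mu2 H _ _.
  have s1 : nsqH (fun x => g Idx x - 'D_e1 (phi N) x) = nsqH (fun x => 'D_e1 (phi N) x - g Idx x) := nsqBC mu2 H _ _.
  have s2 : nsqH (fun x => g Idy x - 'D_e2 (phi N) x) = nsqH (fun x => 'D_e2 (phi N) x - g Idy x) := nsqBC mu2 H _ _.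
  by rewrite s0 s1 s2.
case => //=; [exact: aeW|].
by apply: ae_imp E3 => x h Hx; rewrite h.
Unshelve. all: by end_near. Qed.

End HplusSpace.

(** * Density of test functions in H^+ *)

Section Density.
Context {R : realType}.
Local Notation mu := (@lebesgue_measure R).
Local Notation mu2 := (lebesgue2 R).
Local Notation H := (@half_plane R).
Local Notation nsqH := (nsq mu2 H).
Local Notation ipH := (ip mu2 H).
Local Notation L2H := (L2 mu2 H).
Implicit Types (f g u w phi psi : R * R -> R) (x v : R * R) (i : component_index).
Let mH := @measurable_half_plane R.

Lemma L2_mul_bounded (c f : R * R -> R) (K : R) : 0 <= K -> measurable_fun H c ->
  (forall x, H x -> `|c x| <= K) -> L2H f ->
  L2H (fun x => c x * f x) /\ nsqH (fun x => c x * f x) <= K ^+ 2 * nsqH f.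
Proof.
move=> K0 mc cK f2; have Kf := L2Z mH K f2.
have le x : H x -> `|c x * f x| <= `|K * f x|.
  by move=> Hx; rewrite !normrM (ger0_norm K0); apply: ler_wpM2r => //; exact: cK.
have cf : L2H (fun x => c x * f x).
  by apply: (L2_dom mH _ Kf le); apply: measurable_funM => //; case: f2.
by split => //; rewrite -(nsqZ mH K f2); exact: (nsq_le mH).
Qed.

Lemma L2_null_mul (c : nat -> R * R -> R) f : (forall n, measurable_fun H (c n)) ->
  (forall n x, `|c n x| <= 1) -> (forall x, c n x @[n --> \oo] --> (0 : R)) -> L2H f ->
  L2_null (fun n x => c n x * f x).
Proof.
move=> mc c1 c0 f2.
have cf n : L2H (fun x => c n x * f x).
  by have [] := L2_mul_bounded ler01 (mc n) (fun x _ => c1 n x) f2.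
have mn n : measurable_fun H (fun x => ((c n x * f x) ^+ 2)%:E).
  by apply/measurable_EFinP; apply: measurable_funX; case: (cf n).
have cv : \forall x \ae mu2, H x -> ((c n x * f x) ^+ 2)%:E @[n --> \oo] --> (cst 0%E) x.
  apply: aeW => x _; apply: cvg_EFin; first by near=> n.
  have e : (0 : R) = (0 * f x) ^+ 2 by rewrite mul0r expr0n.
  rewrite [X in _ --> X]e; under eq_fun do rewrite /= expr2.
  by rewrite expr2; apply: cvgM; apply: cvgMl; exact: c0.
have bd : \forall x \ae mu2, forall n, H x -> (`|((c n x * f x) ^+ 2)%:E| <= (f x ^+ 2)%:E)%E.
  apply: aeW => x n _; rewrite /= lee_fin ger0_norm ?sqr_ge0// exprMn ler_piMl ?sqr_ge0//.
  by rewrite -(real_normK (num_real (c n x))) expr_le1.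
have [_ _ K] := dominated_convergence mH mn (@measurable_cst _ _ _ _ _ _) cv (L2_integrable2 f2) bd.
rewrite integral0 in K; rewrite /L2_null.
rewrite (_ : (fun n => _) = (fun n => fine (\int[mu2]_(x in H) ((c n x * f x) ^+ 2)%:E)%E)); last first.
  by apply/funext => n; rewrite -(nsqE mH (cf n)).
by have /fine_cvgP[_] := K.
Unshelve. all: by end_near. Qed.

(** Radial, hence annihilated by the angular derivative. It decays just fast enough for
    [cut n * x.1] and [cut n * x.2] to be bounded by [n + 1], while its partial derivatives are at
    most [(n + 1)^-1]. Compact support is left to the test functions that it multiplies. *)
Definition cut (n : nat) x : R := (1 + (n.+1%:R^-1) ^+ 2 * (x.1 ^+ 2 + x.2 ^+ 2))^-1.

Section Cut.
Variable n : nat.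
Let r : R := n.+1%:R^-1.
Let r0 : 0 < r. Proof. by rewrite invr_gt0. Qed.
Let base x := 1 + r ^+ 2 * (x.1 ^+ 2 + x.2 ^+ 2).
Let base_ge1 x : 1 <= base x.
Proof. by rewrite lerDl mulr_ge0 ?addr_ge0 ?sqr_ge0. Qed.
Let base_gt0 x : 0 < base x. Proof. exact: lt_le_trans ltr01 (base_ge1 x). Qed.
Let base_neq0 x : base x != 0. Proof. exact: lt0r_neq0 (base_gt0 x). Qed.
Let cutE x : cut n x = (base x)^-1. Proof. by []. Qed.

Lemma cut_gt0 x : 0 < cut n x. Proof. by rewrite cutE invr_gt0. Qed.

Lemma cut_le1 x : cut n x <= 1. Proof. by rewrite cutE invf_le1. Qed.

Let smooth_base : smooth base.
Proof.
move=> k; rewrite /base; apply: class_C_add; first exact: class_C_cst.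
apply: class_C_mul; first exact: class_C_cst.
under eq_fun do rewrite !expr2.
by apply: class_C_add; apply: class_C_mul; [exact: class_C_fst..|exact: class_C_snd|exact: class_C_snd].
Qed.

Lemma smooth_cut : smooth (cut n).
Proof. by move=> k; exact: (class_C_inv base_neq0 (smooth_base k)). Qed.

Lemma is_derive_cut x v : is_derive x v (cut n)
  (- (r ^+ 2 * (2 * x.1 * v.1 + 2 * x.2 * v.2)) * (cut n x * cut n x)).
Proof.
have h1 := is_derive_pow 2 (is_derive_fst x v); have h2 := is_derive_pow 2 (is_derive_snd x v).
have h := is_derive_add (is_derive_cst (1 : R) x v) (is_derive_scale (r ^+ 2) (is_derive_add h1 h2)).
rewrite add0r !expr1 in h; exact: (is_derive_inv (base_neq0 x) h).
Qed.

Lemma deriv_cut x : 'D_e1 (cut n) x = - (r ^+ 2 * (2 * x.1)) * (cut n x * cut n x) /\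
  'D_e2 (cut n) x = - (r ^+ 2 * (2 * x.2)) * (cut n x * cut n x).
Proof.
have h1 := is_derive_cut x e1; have h2 := is_derive_cut x e2.
split; [have -> := derive_val (is_derive := h1)|have -> := derive_val (is_derive := h2)];
  by rewrite /e1 /e2 /= ?mulr1 ?mulr0 ?addr0 ?add0r.
Qed.

Let bound (t s : R) : r * (2 * `|t|) <= 1 + r ^+ 2 * (t ^+ 2 + s ^+ 2).
Proof.
have := sqr_ge0 (1 - r * `|t|); rewrite -(real_normK (num_real t)) => h.
have := sqr_ge0 (r * s) => h2; nra.
Qed.

Lemma cut_deriv_le x : `|'D_e1 (cut n) x| <= r /\ `|'D_e2 (cut n) x| <= r.
Proof.
have [-> ->] := deriv_cut x.
have c0 := cut_gt0 x; have c1 := cut_le1 x.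
have key t s : base x = 1 + r ^+ 2 * (t ^+ 2 + s ^+ 2) ->
    `|- (r ^+ 2 * (2 * t)) * (cut n x * cut n x)| <= r.
  move=> bx; rewrite normrM normrN (ger0_norm (ltW (mulr_gt0 c0 c0))) !normrM.
  rewrite (gtr0_norm r0) (ger0_norm (ler0n _ 2)).
  have k : r * (2 * `|t|) * cut n x <= 1.
    by rewrite cutE ler_pdivrMr// mul1r bx; exact: bound.
  have k2 : r * (2 * `|t|) * cut n x * cut n x <= 1.
    by rewrite -[X in _ <= X]mulr1; apply: ler_pM => //; rewrite ?(ltW c0)// !mulr_ge0 ?(ltW r0)// ltW.
  have -> : r * r * (2 * `|t|) * (cut n x * cut n x) = r * (r * (2 * `|t|) * cut n x * cut n x) by ring.
  by rewrite -[X in _ <= X]mulr1; apply: ler_wpM2l => //; exact: ltW.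
by split; [apply: (key _ x.2)|apply: (key _ x.1); rewrite /base (addrC (x.2 ^+ 2))].
Qed.

Lemma cut_coord_le x : `|cut n x * x.1| <= n.+1%:R /\ `|cut n x * x.2| <= n.+1%:R.
Proof.
have c0 := cut_gt0 x.
have key t s : base x = 1 + r ^+ 2 * (t ^+ 2 + s ^+ 2) -> `|cut n x * t| <= n.+1%:R.
  move=> bx; rewrite normrM (gtr0_norm c0) mulrC.
  rewrite -(ler_pM2l r0) {2}/r mulVf ?pnatr_eq0// mulrA cutE ler_pdivrMr// mul1r bx.
  by apply: le_trans (bound t s); have := normr_ge0 t; have := r0; nra.
by split; [apply: (key _ x.2)|apply: (key _ x.1); rewrite /base (addrC (x.2 ^+ 2))].
Qed.

Lemma test_component_cut phi : test_function phi -> [/\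
  'D_e1 (fun x => cut n x * phi x) = (fun x => 'D_e1 (cut n) x * phi x + cut n x * 'D_e1 phi x),
  'D_e2 (fun x => cut n x * phi x) = (fun x => 'D_e2 (cut n) x * phi x + cut n x * 'D_e2 phi x) &
  dth (fun x => cut n x * phi x) = (fun x => cut n x * dth phi x)].
Proof.
move=> tp.
have E x : 'D_e1 (fun x => cut n x * phi x) x = 'D_e1 (cut n) x * phi x + cut n x * 'D_e1 phi x /\
    'D_e2 (fun x => cut n x * phi x) x = 'D_e2 (cut n) x * phi x + cut n x * 'D_e2 phi x.
  have [p1 p2] := test_is_derive x tp; have [s1 s2] := class_C_is_derive x (smooth_cut 1%N).
  have h1 := is_derive_mul s1 p1; have h2 := is_derive_mul s2 p2.
  by split; [have -> := derive_val (is_derive := h1)|have -> := derive_val (is_derive := h2)].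
split; apply/funext => x; [exact: (E x).1|exact: (E x).2|].
rewrite /dth (E x).1 (E x).2 (deriv_cut x).1 (deriv_cut x).2.
by move: ('D_e1 phi x) ('D_e2 phi x) (cut n x) (phi x) => a b c e; ring.
Qed.

End Cut.

Lemma cut_cvg1 x : cut n x @[n --> \oo] --> (1 : R).
Proof.
have -> : (1 : R) = (1 + 0 ^+ 2 * (x.1 ^+ 2 + x.2 ^+ 2))^-1.
  by rewrite expr0n mul0r addr0 invr1.
apply: cvgV; first by rewrite expr0n mul0r addr0 oner_neq0.
apply: cvgD; first exact: cvg_cst.
apply: cvgMl; under eq_fun do rewrite expr2; rewrite expr2.
by apply: cvgM; exact: cvg_harmonic.
Qed.


Lemma harmonic_sq_cvg0 (K : R) : K * (n.+1%:R^-1) ^+ 2 @[n --> \oo] --> (0 : R).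
Proof.
have -> : (0 : R) = K * 0 ^+ 2 by rewrite expr0n mulr0.
apply: cvgMr; under eq_fun do rewrite expr2; rewrite expr2.
by apply: cvgM; exact: cvg_harmonic.
Qed.

Lemma measurable_deriv_cut n :
  measurable_fun H ('D_e1 (cut n)) /\ measurable_fun H ('D_e2 (cut n)).
Proof.
have [_ [_ [[c1 _] [c2 _]]]] := smooth_cut n 1%N.
by split; [exact: continuous_measurable2 c1|exact: continuous_measurable2 c2].
Qed.

Lemma component_le_sum (a : component_index -> R) i : (forall i, 0 <= a i) -> i <> Idth ->
  a i <= a Ifun + a Idx + a Idy.
Proof.
move=> a0; have := a0 Ifun; have := a0 Idx; have := a0 Idy.
by case: i => //; lra.
Qed.

(** H^1_0 supplies approximations in the H^1 norm only, with no control of the angular derivative.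
    After multiplication by [cut n] the angular error is [cut n * x.1] times an error in ['D_e2],
    minus [cut n * x.2] times an error in ['D_e1], plus [(cut n - 1) * dtheta u]. The last term
    tends to 0 because [dtheta u] is square integrable. *)
Lemma Hplus_dense u : Hplus u -> exists phi : nat -> R * R -> R,
  (forall n, test_function (phi n)) /\
  forall i, L2_null (fun n x => test_component i (phi n) x - component i u x).
Proof.
move=> Hu; have [[h1 dense] _] := Hu.
have su := H1_sobolev h1.
(* The squared rate leaves room for multiplying the error by a coefficient of size [n + 1]. *)
have /choice[phi phiP] : forall n : nat, exists phi, test_function phi /\
    H1_norm (u \- phi) < n.+1%:R^-1 ^+ 2.
  move=> n; have [|phi tp lt] := dense (n.+1%:R^-1 ^+ 2); first by rewrite exprn_gt0// invr_gt0.
  by exists phi.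
have tp n := (phiP n).1.
pose r n : R := n.+1%:R^-1.
have r0 n : 0 < r n by rewrite invr_gt0.
have r1 n : r n <= 1 by rewrite invf_le1// ler1n.
pose d i n x := test_component i (phi n) x - component i u x.
have u2 i : L2H (component i u) by exact: Hplus_L2.
have t2 i n : L2H (test_component i (phi n)) by apply: test_L2; exact: test_test_component.
have d2 i n : L2H (d i n) by exact: L2B.
have bd i n : i <> Idth -> nsqH (d i n) <= r n ^+ 2 * r n ^+ 2.
  move=> ni; have [_ _ _ Nq] := sobolevP (sobolev_sub su (test_sobolev (tp n))).
  have : H1_norm (u \- phi n) ^+ 2 <= r n ^+ 2 * r n ^+ 2.
    rewrite -exprMn -expr2 ler_pXn2r ?nnegrE ?sqrtr_ge0 ?exprn_ge0 ?(ltW (r0 n))//.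
    exact: ltW (phiP n).2.
  rewrite Nq => h; apply: le_trans h.
  have s0 : nsqH (u \- phi n) = nsqH (d Ifun n) := nsqBC mu2 H _ _.
  have s1 : nsqH (fun x => weak_derivative e1 u x - 'D_e1 (phi n) x) = nsqH (d Idx n) := nsqBC mu2 H _ _.
  have s2 : nsqH (fun x => weak_derivative e2 u x - 'D_e2 (phi n) x) = nsqH (d Idy n) := nsqBC mu2 H _ _.
  rewrite s0 s1 s2.
  exact: (@component_le_sum (fun i => nsqH (d i n)) i (fun i => @nsq_ge0 _ _ _ mu2 H (d i n)) ni).
have mc n : measurable_fun H (cut n).
  by apply: continuous_measurable2; exact: (smooth_cut n 0%N).1.
(* Coefficients up to [(r n)^-1 = n + 1] are allowed: the squared error is at most [r n ^ 4], so the
   product still has squared norm at most [r n ^ 2]. *)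
have null_d (c : nat -> R * R -> R) i (K : nat -> R) : i <> Idth -> (forall n, measurable_fun H (c n)) ->
    (forall n x, `|c n x| <= K n) -> (forall n, 0 <= K n <= (r n)^-1) ->
    (forall n, L2H (fun x => c n x * d i n x)) /\ L2_null (fun n x => c n x * d i n x).
  move=> ni mcn cK K1.
  have K0 n : 0 <= K n by have /andP[] := K1 n.
  have h n := L2_mul_bounded (K0 n) (mcn n) (fun x _ => cK n x) (d2 i n).
  split; first by move=> n; case: (h n).
  apply: (@L2_null_le _ _ (fun n => 1 * r n ^+ 2)); last exact: harmonic_sq_cvg0.
  move=> n; apply: (le_trans (h n).2); rewrite mul1r.
  have /andP[k0 k1] := K1 n.
  apply: (@le_trans _ _ ((r n)^-1 ^+ 2 * (r n ^+ 2 * r n ^+ 2))).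
    apply: ler_pM; rewrite ?sqr_ge0//; [exact: (@nsq_ge0 _ _ _ mu2 H (d i n))| |exact: bd].
    by rewrite ler_pXn2r ?nnegrE ?invr_ge0 ?(ltW (r0 n)).
  by rewrite mulrA exprVn mulVf ?mul1r// expf_neq0// gt_eqF.
have null_u (c : nat -> R * R -> R) i : (forall n, measurable_fun H (c n)) ->
    (forall n x, `|c n x| <= 1) -> (forall x, c n x @[n --> \oo] --> (0 : R)) ->
    (forall n, L2H (fun x => c n x * component i u x)) /\ L2_null (fun n x => c n x * component i u x).
  move=> mcn c1 c0; split; last exact: L2_null_mul.
  by move=> n; have [] := L2_mul_bounded ler01 (mcn n) (fun x _ => c1 n x) (u2 i).
have rV n : (r n)^-1 = n.+1%:R by rewrite /r invrK.
have ge1 n : 0 <= (1 : R) <= (r n)^-1 by rewrite ler01 rV ler1n.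
have rle n : 0 <= r n <= (r n)^-1 by rewrite (ltW (r0 n)) (le_trans (r1 n))// rV ler1n.
have c_le n x : `|cut n x| <= 1 by rewrite gtr0_norm ?cut_gt0 ?cut_le1.
have A1 i : i <> Idth -> _ := fun ni => null_d cut i (fun=> 1) ni mc c_le ge1.
have A2 i := null_u (fun n x => cut n x - 1) i (fun n => measurable_funB (mc n) (measurable_cst _)).
have {}A2 i : (forall n, L2H (fun x => (cut n x - 1) * component i u x)) /\
    L2_null (fun n x => (cut n x - 1) * component i u x).
  apply: A2 => [n x|x].
    by have := cut_gt0 n x; have := cut_le1 n x => h1' h2'; rewrite ler0_norm; lra.
  by rewrite -[X in _ --> X](subrr (1 : R)); apply: cvgB; [exact: cut_cvg1|exact: cvg_cst].
have md n : measurable_fun H ('D_e1 (cut n)) /\ measurable_fun H ('D_e2 (cut n)).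
  exact: measurable_deriv_cut.
have B1 := null_d (fun n => 'D_e1 (cut n)) Ifun r (fun h => ltac:(discriminate h))
  (fun n => (md n).1) (fun n x => (cut_deriv_le n x).1) rle.
have B2 := null_d (fun n => 'D_e2 (cut n)) Ifun r (fun h => ltac:(discriminate h))
  (fun n => (md n).2) (fun n x => (cut_deriv_le n x).2) rle.
have to0 (F : nat -> R) : (forall n, `|F n| <= r n) -> F n @[n --> \oo] --> (0 : R).
  move=> Fr; apply/norm_cvg0P; apply: (@squeeze_cvgr _ _ _ _ (fun=> 0) r).
  - by near=> n; rewrite normr_ge0 /=.
  - exact: cvg_cst.
  - exact: cvg_harmonic.
have C1 := null_u (fun n => 'D_e1 (cut n)) Ifun (fun n => (md n).1)
  (fun n x => le_trans (cut_deriv_le n x).1 (r1 n)) (fun x => to0 _ (fun n => (cut_deriv_le n x).1)).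
have C2 := null_u (fun n => 'D_e2 (cut n)) Ifun (fun n => (md n).2)
  (fun n x => le_trans (cut_deriv_le n x).2 (r1 n)) (fun x => to0 _ (fun n => (cut_deriv_le n x).2)).
have n1 n : 0 <= (n.+1%:R : R) <= (r n)^-1 by rewrite rV ler0n lexx.
have mx n : measurable_fun H (fun x => cut n x * x.1) /\ measurable_fun H (fun x => cut n x * x.2).
  split; apply: measurable_funM; [exact: mc| |exact: mc|]; apply: measurable_funTS;
    [exact: measurable_fst|exact: measurable_snd].
have X1 := null_d (fun n x => cut n x * x.1) Idy (fun n => n.+1%:R : R) (fun h => ltac:(discriminate h))
  (fun n => (mx n).1) (fun n x => (cut_coord_le n x).1) n1.
have X2 := null_d (fun n x => cut n x * x.2) Idx (fun n => n.+1%:R : R) (fun h => ltac:(discriminate h))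
  (fun n => (mx n).2) (fun n x => (cut_coord_le n x).2) n1.
have add (a b : nat -> R * R -> R) : (forall n, L2H (a n)) /\ L2_null a ->
    (forall n, L2H (b n)) /\ L2_null b ->
    (forall n, L2H (fun x => a n x + b n x)) /\ L2_null (fun n x => a n x + b n x).
  by move=> [a2 a0] [b2 b0]; split; [move=> n; exact: L2D|exact: L2_nullD].
have scale (a : nat -> R * R -> R) (c : R) : (forall n, L2H (a n)) /\ L2_null a ->
    (forall n, L2H (fun x => c * a n x)) /\ L2_null (fun n x => c * a n x).
  by move=> [a2 a0]; split; [move=> n; exact: L2Z|exact: L2_nullZ].
have eqn (a b : nat -> R * R -> R) : (forall n, L2H (a n)) /\ L2_null a ->
    (forall n x, b n x = a n x) -> L2_null b.
  move=> [_ a0] ab; rewrite (_ : b = a)//.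
  by apply/funext => n; apply/funext => x; exact: ab.
exists (fun n x => cut n x * phi n x); split.
  by move=> n; apply: test_mul => //; exact: smooth_cut.
case.
- apply: (eqn _ _ (add _ _ (A1 Ifun (fun h => ltac:(discriminate h))) (A2 Ifun))) => n x.
  by rewrite /d /=; ring.
- apply: (eqn _ _ (add _ _ (add _ _ (A1 Idx (fun h => ltac:(discriminate h))) (A2 Idx)) (add _ _ B1 C1))) => n x.
  have [e _ _] := test_component_cut n (tp n).
  apply: (etrans (f_equal (fun F => F x - weak_derivative e1 u x) e)); rewrite /d /=.
  by move: ('D_e1 (cut n) x) ('D_e1 (phi n) x) (weak_derivative e1 u x) => a b c; ring.
- apply: (eqn _ _ (add _ _ (add _ _ (A1 Idy (fun h => ltac:(discriminate h))) (A2 Idy)) (add _ _ B2 C2))) => n x.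
  have [_ e _] := test_component_cut n (tp n).
  apply: (etrans (f_equal (fun F => F x - weak_derivative e2 u x) e)); rewrite /d /=.
  by move: ('D_e2 (cut n) x) ('D_e2 (phi n) x) (weak_derivative e2 u x) => a b c; ring.
- apply: (eqn _ _ (add _ _ (add _ _ X1 (scale _ (-1) X2)) (A2 Idth))) => n x.
  have [_ _ e] := test_component_cut n (tp n).
  apply: (etrans (f_equal (fun F => F x - dtheta u x) e)); rewrite /d /= /dth /dtheta.
  move: ('D_e1 (phi n) x) ('D_e2 (phi n) x) (weak_derivative e1 u x) (weak_derivative e2 u x) => a b a' b'.
  by ring.
Unshelve. all: by end_near. Qed.

End Density.

HB.lock Definition component_ip {R : realType} (i : component_index) (u v : R * R -> R) : R :=
  ip (lebesgue2 R) half_plane (component i u) (component i v).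

(** * The quadratic forms on H^+ and completeness *)

Section HplusForm.
Context {R : realType}.
Local Notation mu := (@lebesgue_measure R).
Local Notation mu2 := (lebesgue2 R).
Local Notation H := (@half_plane R).
Local Notation nsqH := (nsq mu2 H).
Local Notation ipH := (ip mu2 H).
Local Notation L2H := (L2 mu2 H).
Implicit Types (f g h u v w phi psi : R * R -> R) (x : R * R) (i : component_index).
Implicit Types (b c : R).
Let mH := @measurable_half_plane R.

(** The chosen derivatives are linear only almost everywhere. Approximation by test functions yields
    this for all four components at once, together with membership in H^+. *)
Lemma Hplus_lin u v c : Hplus u -> Hplus v ->
  Hplus (fun x => u x + c * v x) /\
  forall i, {ae mu2, forall x, H x ->
    component i (fun x => u x + c * v x) x = component i u x + c * component i v x}.
Proof.
move=> Hu Hv; have [phi [tp p0]] := Hplus_dense Hu; have [psi [ts s0]] := Hplus_dense Hv.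
have tL i (f : nat -> R * R -> R) n : (forall n, test_function (f n)) -> L2H (test_component i (f n)).
  by move=> tf; apply: test_L2; exact: test_test_component.
apply: (@Hplus_limit R (fun n x => phi n x + c * psi n x)
  (fun i x => component i u x + c * component i v x)).
- by move=> n; apply: test_add => //; exact: test_scale.
- by move=> i; apply: L2D => //; [exact: Hplus_L2|apply: L2Z => //; exact: Hplus_L2].
move=> i.
have dp n : L2H (fun x => test_component i (phi n) x - component i u x).
  by apply: L2B; [exact: mH|exact: tL|exact: Hplus_L2].
have ds n : L2H (fun x => test_component i (psi n) x - component i v x).
  by apply: L2B; [exact: mH|exact: tL|exact: Hplus_L2].
have K := L2_nullD dp (fun n => L2Z mH c (ds n)) (p0 i) (L2_nullZ c ds (s0 i)).
rewrite (_ : (fun n x => _) = (fun n x => (test_component i (phi n) x - component i u x) +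
   c * (test_component i (psi n) x - component i v x)))//.
apply/funext => n; rewrite (test_component_lin i c (tp n) (ts n)).
by apply/funext => x; rewrite mulrBr opprD addrACA.
Qed.

Lemma test_Hplus phi : test_function phi ->
  Hplus phi /\ forall i, {ae mu2, forall x, H x -> component i phi x = test_component i phi x}.
Proof.
move=> tp; apply: (@Hplus_limit R (fun _ => phi) (fun i => test_component i phi)) => // i.
  by apply: test_L2; exact: test_test_component.
apply: (@L2_null_le R _ (fun=> 0)); last exact: cvg_cst.
by move=> n; rewrite le_eqVlt (ae0_nsq mH) ?eqxx//; [apply: L2B => //; apply: test_L2; exact: test_test_component|
  apply: aeW => x _; rewrite subrr].
Qed.

Local Notation cip := component_ip.

Lemma cipC i u v : cip i u v = cip i v u.
Proof. by rewrite component_ip.unlock ipC. Qed.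

Lemma cip_nsq i u : cip i u u = nsqH (component i u).
Proof. by rewrite component_ip.unlock. Qed.

Lemma cip_ge0 i u : 0 <= cip i u u.
Proof. by rewrite cip_nsq; exact: nsq_ge0. Qed.

(** For [b = (lambda ^+ 2)^-1] and [c = q] this is the inner product behind [Hplus_norm]. Rescaling
    produces [c = lambda ^+ 2], which is why [c] is real and not boolean. *)
Definition form b c u v := cip Idx u v + cip Idy u v + b * cip Idth u v + c * cip Ifun u v.

Definition qform b c u := form b c u u.

Lemma qformE b c u : qform b c u = nsqH (component Idx u) + nsqH (component Idy u)
  + b * nsqH (component Idth u) + c * nsqH (component Ifun u).
Proof. by rewrite /qform /form !cip_nsq. Qed.

Lemma Hplus_normE lambda (q : bool) u : Hplus u ->
  Hplus_norm lambda q u = Num.sqrt (qform (lambda ^+ 2)^-1 q%:R u).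
Proof.
move=> Hu; rewrite qformE; apply: (f_equal Num.sqrt).
exact: (Rintegral_sqr4 mH _ _ (Hplus_L2 Idx Hu) (Hplus_L2 Idy Hu) (Hplus_L2 Idth Hu) (Hplus_L2 Ifun Hu)).
Qed.

Lemma formC b c u v : form b c u v = form b c v u.
Proof.
by rewrite /form (cipC Idx) (cipC Idy) (cipC Idth) (cipC Ifun).
Qed.

Lemma cip_lin i u v w c : Hplus u -> Hplus v -> Hplus w ->
  cip i (fun x => u x + c * v x) w = cip i u w + c * cip i v w.
Proof.
move=> Hu Hv Hw; have [Hl ae] := Hplus_lin c Hu Hv.
have lu := Hplus_L2 i Hu; have lv := Hplus_L2 i Hv; have lw := Hplus_L2 i Hw.
have cv := L2Z mH c lv.
rewrite component_ip.unlock -(ipZl mH c lv lw) -(ipDl mH lu cv lw).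
apply: (ae_eq_ip mH (Hplus_L2 i Hl) (L2D mH lu cv) lw lw (ae i)).
by apply: aeW.
Qed.

Lemma form_aux (b c t a1 a2 a3 a4 d1 d2 d3 d4 : R) :
  (a1 + t * d1) + (a2 + t * d2) + b * (a3 + t * d3) + c * (a4 + t * d4) =
  a1 + a2 + b * a3 + c * a4 + t * (d1 + d2 + b * d3 + c * d4).
Proof. ring. Qed.

Lemma form_linl b c u v w t : Hplus u -> Hplus v -> Hplus w ->
  form b c (fun x => u x + t * v x) w = form b c u w + t * form b c v w.
Proof.
move=> Hu Hv Hw; rewrite /form (cip_lin Idx t Hu Hv Hw) (cip_lin Idy t Hu Hv Hw).
rewrite (cip_lin Idth t Hu Hv Hw) (cip_lin Ifun t Hu Hv Hw).
exact: form_aux.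
Qed.

Lemma form_linr b c u v w t : Hplus u -> Hplus v -> Hplus w ->
  form b c w (fun x => u x + t * v x) = form b c w u + t * form b c w v.
Proof. by move=> Hu Hv Hw; rewrite formC (form_linl b c t Hu Hv Hw) !(formC b c _ w). Qed.

Lemma qform_lin b c u v t : Hplus u -> Hplus v ->
  qform b c (fun x => u x + t * v x) = qform b c u + 2 * t * form b c u v + t ^+ 2 * qform b c v.
Proof.
move=> Hu Hv; have [Hl _] := Hplus_lin t Hu Hv.
rewrite {1}/qform (form_linl b c t Hu Hv Hl) (form_linr b c t Hu Hv Hu) (form_linr b c t Hu Hv Hv).
rewrite (formC b c v u) -/(qform b c u) -/(qform b c v).
move: (qform b c u) (form b c u v) (qform b c v) => p q r; ring.
Qed.

Lemma qform_ge0 b c u : 0 <= b -> 0 <= c -> 0 <= qform b c u.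
Proof. by move=> b0 c0; rewrite /qform /form !addr_ge0 ?mulr_ge0 ?cip_ge0. Qed.

Lemma HplusD u v : Hplus u -> Hplus v -> Hplus (u \+ v).
Proof.
move=> Hu Hv; have [K _] := Hplus_lin 1 Hu Hv.
by rewrite (_ : u \+ v = (fun x => u x + 1 * v x))//; apply/funext => x; rewrite mul1r.
Qed.

Lemma HplusB u v : Hplus u -> Hplus v -> Hplus (u \- v).
Proof.
move=> Hu Hv; have [K _] := Hplus_lin (-1) Hu Hv.
by rewrite (_ : u \- v = (fun x => u x + (-1) * v x))//; apply/funext => x; rewrite mulN1r.
Qed.

Lemma HplusZ t u : Hplus u -> Hplus (fun x => t * u x).
Proof.
move=> Hu; have [K _] := Hplus_lin (t - 1) Hu Hu.
by rewrite (_ : (fun x => t * u x) = (fun x => u x + (t - 1) * u x))//; apply/funext => x; ring.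
Qed.

Lemma qformD b c u v : Hplus u -> Hplus v ->
  qform b c (u \+ v) = qform b c u + 2 * form b c u v + qform b c v.
Proof.
move=> Hu Hv; rewrite (_ : u \+ v = (fun x => u x + 1 * v x)); last by apply/funext => x; rewrite mul1r.
by rewrite (qform_lin b c 1 Hu Hv) mulr1 expr1n mul1r.
Qed.

Lemma qformB b c u v : Hplus u -> Hplus v ->
  qform b c (u \- v) = qform b c u - 2 * form b c u v + qform b c v.
Proof.
move=> Hu Hv; rewrite (_ : u \- v = (fun x => u x + (-1) * v x)); last by apply/funext => x; rewrite mulN1r.
by rewrite (qform_lin b c (-1) Hu Hv) sqrrN expr1n mul1r mulrN1 mulNr.
Qed.

Lemma form_scalel b c u v t : Hplus u -> Hplus v ->
  form b c (fun x => t * u x) v = t * form b c u v.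
Proof.
move=> Hu Hv; have := form_linl b c (t - 1) Hu Hu Hv.
rewrite (_ : (fun x => u x + (t - 1) * u x) = (fun x => t * u x)); last by apply/funext => x; ring.
by move=> ->; ring.
Qed.

Lemma qformZ b c u t : Hplus u -> qform b c (fun x => t * u x) = t ^+ 2 * qform b c u.
Proof.
move=> Hu; rewrite {1}/qform (form_scalel b c t Hu (HplusZ t Hu)) formC (form_scalel b c t Hu Hu).
by rewrite mulrA.
Qed.

Lemma nsq_cvg (a : nat -> R * R -> R) f : (forall n, L2H (a n)) -> L2H f ->
  L2_null (fun n x => a n x - f x) -> nsqH (a n) @[n --> \oo] --> nsqH f.
Proof.
move=> a2 f2 a0.
have d2 n : L2H (fun x => a n x - f x) by exact: L2B.
have -> : (fun n => nsqH (a n)) =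
    (fun n => nsqH (fun x => a n x - f x) + 2 * ipH (fun x => a n x - f x) f + nsqH f).
  apply/funext => n; rewrite -(nsqD mH (d2 n) f2); congr nsq.
  by apply/funext => x; rewrite subrK.
rewrite -[X in _ --> X]add0r; apply: cvgD; last exact: cvg_cst.
rewrite -[X in _ --> X]addr0; apply: cvgD; first exact: a0.
rewrite -[X in _ --> X](mulr0 2); apply: cvgMr; exact: L2_null_ip.
Qed.

Lemma poincare_Hplus u : Hplus u -> nsqH u <= pi ^+ 2 * nsqH (dtheta u).
Proof.
move=> Hu; have [phi [tp p0]] := Hplus_dense Hu.
have tL i n : L2H (test_component i (phi n)) by apply: test_L2; exact: test_test_component.
have c0 := nsq_cvg (tL Ifun) (Hplus_L2 Ifun Hu) (p0 Ifun).
have c3 := nsq_cvg (tL Idth) (Hplus_L2 Idth Hu) (p0 Idth).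
have c3' : pi ^+ 2 * nsqH (test_component Idth (phi n)) @[n --> \oo] --> pi ^+ 2 * nsqH (component Idth u).
  by apply: cvgMr.
apply: (ler_cvg_to c0 c3'); near=> n; exact: poincare_nsq (tp n).
Unshelve. all: by end_near. Qed.

Lemma component_le_all (a : component_index -> R) : (forall i, 0 <= a i) ->
  forall i, a i <= a Idx + a Idy + a Idth + a Ifun.
Proof.
move=> a0 i; have := a0 Ifun; have := a0 Idx; have := a0 Idy; have := a0 Idth.
by case: i; lra.
Qed.

(** Each component converges in L^2 by completeness, but the four limits must still be shown to be
    components of one function. *)
Lemma Hplus_complete (w : nat -> R * R -> R) : (forall n, Hplus (w n)) ->
  (forall e, 0 < e -> exists N, forall m n, (N <= m)%N -> (N <= n)%N ->
     qform 1 1 (w m \- w n) <= e) ->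
  exists2 v, Hplus v & qform 1 1 (w n \- v) @[n --> \oo] --> (0 : R).
Proof.
move=> Hw wC.
have le_q i f : Hplus f -> nsqH (component i f) <= qform 1 1 f.
  move=> Hf; rewrite /qform /form !mul1r -cip_nsq.
  exact: (component_le_all (fun j => cip_ge0 j f) i).
have sub2 i m n : {ae mu2, forall x, H x ->
    component i (w m \- w n) x = component i (w m) x - component i (w n) x}.
  have [_ /(_ i)] := Hplus_lin (-1) (Hw m) (Hw n).
  rewrite (_ : (fun x => w m x + -1 * w n x) = w m \- w n); last by apply/funext => x; rewrite mulN1r.
  by apply: ae_imp => x h Hx; rewrite (h Hx) mulN1r.
have nsub i f g : Hplus f -> L2H g -> {ae mu2, forall x, H x -> component i f x = g x} ->
    nsqH g = nsqH (component i f).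
  by move=> Hf Lg e; exact: (ae_eq_ip mH Lg (Hplus_L2 i Hf) Lg (Hplus_L2 i Hf) (ae_eq_sym e) (ae_eq_sym e)).
have LB i m n : L2H (fun x => component i (w m) x - component i (w n) x).
  by apply: L2B; [exact: mH|exact: Hplus_L2|exact: Hplus_L2].
have /choice[g gP] : forall i, exists g, L2H g /\ L2_null (fun n x => component i (w n) x - g x).
  move=> i; have [|g g2 g0] := L2_complete mH (fun n => Hplus_L2 i (Hw n)); last by exists g.
  move=> e e0; have [N HN] := wC e e0; exists N => m n Nm Nn.
  rewrite (nsub i _ _ (HplusB (Hw m) (Hw n)) (LB i m n) (sub2 i m n)).
  by apply: le_trans (HN m n Nm Nn); apply: le_q; exact: HplusB.
(* [w n] is replaced by a test function within [(n + 1)^-1] of it in every component, because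
   [Hplus_limit] speaks of test functions. *)
have /choice[phi phiP] : forall n : nat, exists phi, test_function phi /\ forall i,
    nsqH (fun x => test_component i phi x - component i (w n) x) <= n.+1%:R^-1.
  move=> n; have [phi [tp p0]] := Hplus_dense (Hw n).
  have e0 : 0 < (n.+1%:R^-1 : R) by rewrite invr_gt0.
  have lim0 i : \forall k \near \oo, nsqH (fun x => test_component i (phi k) x - component i (w n) x) < n.+1%:R^-1.
    exact: (cvgr_lt _ (p0 i)).
  have [N0 _ h0] := lim0 Ifun; have [N1 _ h1] := lim0 Idx.
  have [N2 _ h2] := lim0 Idy; have [N3 _ h3] := lim0 Idth.
  pose M := (N0 + N1 + N2 + N3)%N.
  exists (phi M); split => // i; apply: ltW; case: i.
  - by apply: (h0 M); rewrite /M /= -!addnA leq_addr.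
  - by apply: (h1 M); rewrite /M /= (addnC N0) -!addnA leq_addr.
  - by apply: (h2 M); rewrite /M /= (addnC _ N2) -!addnA leq_addr.
  - by apply: (h3 M); rewrite /M /= leq_addl.
have tp n : test_function (phi n) := (phiP n).1.
have tL i n : L2H (test_component i (phi n)) by apply: test_L2; exact: test_test_component.
have tw i n : L2H (fun x => test_component i (phi n) x - component i (w n) x).
  by apply: L2B; [exact: mH|exact: tL|exact: Hplus_L2].
have gL i : L2H (g i) := (gP i).1.
have wg i n : L2H (fun x => component i (w n) x - g i x).
  by apply: L2B; [exact: mH|exact: Hplus_L2|exact: gL].
have [Hv vE] : Hplus (g Ifun) /\ forall i, {ae mu2, forall x, H x -> component i (g Ifun) x = g i x}.
  apply: (Hplus_limit tp gL) => i.
  have n0 : L2_null (fun n x => test_component i (phi n) x - component i (w n) x).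
    apply: (@L2_null_le R _ (fun n => n.+1%:R^-1)); last exact: cvg_harmonic.
    by move=> n; exact: (phiP n).2.
  have := L2_nullD (tw i) (wg i) n0 (gP i).2.
  rewrite (_ : (fun n x => _) = (fun n x => test_component i (phi n) x - g i x))//.
  by apply/funext => n; apply/funext => x; rewrite addrA subrK.
exists (g Ifun) => //.
have E i n : cip i (w n \- g Ifun) (w n \- g Ifun) = nsqH (fun x => component i (w n) x - g i x).
  rewrite cip_nsq; apply/esym/(nsub i _ _ (HplusB (Hw n) Hv) (wg i n)).
  have [_ /(_ i)] := Hplus_lin (-1) (Hw n) Hv.
  rewrite (_ : (fun x => w n x + -1 * g Ifun x) = w n \- g Ifun); last by apply/funext => x; rewrite mulN1r.
  move=> h; apply: ae_imp2 h (vE i) => x h1 h2 Hx; rewrite (h1 Hx) (h2 Hx) mulN1r//.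
have -> : (fun n => qform 1 1 (w n \- g Ifun)) = (fun n =>
    nsqH (fun x => component Idx (w n) x - g Idx x) + nsqH (fun x => component Idy (w n) x - g Idy x) +
    1 * nsqH (fun x => component Idth (w n) x - g Idth x) + 1 * nsqH (fun x => component Ifun (w n) x - g Ifun x)).
  by apply/funext => n; rewrite /qform /form (E Idx) (E Idy) (E Idth) (E Ifun).
have z : (0 : R) = 0 + 0 + 1 * 0 + 1 * 0 by rewrite !mulr0 !addr0.
rewrite [X in _ --> X]z; apply: cvgD; last by apply: cvgMr; exact: (gP Ifun).2.
apply: cvgD; last by apply: cvgMr; exact: (gP Idth).2.
by apply: cvgD; [exact: (gP Idx).2|exact: (gP Idy).2].
Qed.

End HplusForm.

(** * Embedding of H^+ into L^p *)

Section HplusLp.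
Context {R : realType}.
Local Notation mu := (@lebesgue_measure R).
Local Notation mu2 := (lebesgue2 R).
Local Notation H := (@half_plane R).
Local Notation nsqH := (nsq mu2 H).
Local Notation L2H := (L2 mu2 H).
Local Notation LpH := (Lp mu2 H).
Local Notation pnpH := (pnp mu2 H).
Local Notation pnH := (pn mu2 H).
Implicit Types (f g h u v w phi psi : R * R -> R) (x : R * R) (i : component_index).
Implicit Types (p : R).
Let mH := @measurable_half_plane R.

Lemma normpow_continuous p : 0 < p -> continuous (fun t : R => `|t| `^ p).
Proof.
move=> p0 t; have [->|t0] := eqVneq t 0.
  rewrite /continuous_at normr0 powR0 ?gt_eqF//; apply/cvgrPdist_lt => e e0; near=> s.
  rewrite sub0r normrN ger0_norm ?powR_ge0//.
  have -> : e = (e `^ p^-1) `^ p by rewrite -powRrM mulVf ?gt_eqF// powRr1// ltW.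
  apply: gt0_ltr_powR => //; rewrite ?nnegrE ?powR_ge0//.
  near: s; exists (e `^ p^-1) => /=; first exact: powR_gt0.
  by move=> y; rewrite /ball_ /= sub0r normrN.
have nt : 0 < `|t| by rewrite normr_gt0.
have c := is_derive_continuous (is_derive1_powR p nt).
exact: (cvg_comp (fun s : R => `|s|) (fun r => r `^ p) (@norm_continuous _ _ t) c).
Unshelve. all: by end_near. Qed.

Lemma normpow_cvg p (a : nat -> R) (l : R) : 0 < p -> a n @[n --> \oo] --> l ->
  `|a n| `^ p @[n --> \oo] --> `|l| `^ p.
Proof. by move=> p0 al; have c := @normpow_continuous p p0 l; apply: (continuous_cvg _ c al). Qed.

(** The first term suffices where [|t| <= 1], the second elsewhere. This places a real exponent
    between 2 and an even integer. *)
Lemma powR_le_sq p k (t : R) : 2 <= p <= k.+1.*2%:R -> `|t| `^ p <= t ^+ 2 + (t ^+ k.+1) ^+ 2.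
Proof.
move=> /andP[p2 pk].
have e2 : t ^+ 2 = `|t| `^ 2%:R by rewrite powR_mulrn// real_normK// num_real.
have ek : (t ^+ k.+1) ^+ 2 = `|t| `^ k.+1.*2%:R.
  rewrite powR_mulrn// -exprM muln2 -[RHS]normrX ger0_norm// -muln2 exprM; exact: sqr_ge0.
have [t1|t1] := leP `|t| 1.
  apply: (@le_trans _ _ (t ^+ 2)); last by rewrite lerDl sqr_ge0.
  have [->|t0] := eqVneq t 0.
    by rewrite normr0 powR0 ?expr0n// gt_eqF//; lra.
  have -> : p = 2%:R + (p - 2) by lra.
  rewrite powRD; last by rewrite normr_eq0 t0 implybT.
  rewrite -e2 -[leRHS]mulr1; apply: ler_wpM2l; first exact: sqr_ge0.
  have := @ge0_ler_powR R (p - 2); rewrite subr_ge0 => /(_ p2 `|t| 1).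
  by rewrite powR1; apply; rewrite ?nnegrE.
apply: (@le_trans _ _ ((t ^+ k.+1) ^+ 2)); last by rewrite lerDr sqr_ge0.
by rewrite ek; apply: ler_powR => //; exact: ltW.
Qed.

Lemma Lp_interpolation p k f : 2 <= p <= k.+1.*2%:R -> L2H f -> L2H (fun x => f x ^+ k.+1) ->
  LpH p f /\ pnpH p f <= nsqH f + nsqH (fun x => f x ^+ k.+1).
Proof.
move=> pk f2 fk.
have mf := L2_measurable f2; have mk := L2_measurable fk.
have le : (\int[mu2]_(x in H) (`|f x| `^ p)%:E <= (nsqH f + nsqH (fun x => f x ^+ k.+1))%:E)%E.
  rewrite EFinD (nsqE mH f2) (nsqE mH fk) -ge0_integralD; last 5 first.
  - exact: mH.
  - by move=> x _; rewrite lee_fin sqr_ge0.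
  - by apply/measurable_EFinP; exact: measurable_funX.
  - by move=> x _; rewrite lee_fin sqr_ge0.
  - by apply/measurable_EFinP; exact: measurable_funX.
  apply: ge0_le_integral; [exact: mH|by move=> x _; rewrite lee_fin powR_ge0| | |].
  - by apply/measurable_EFinP; exact: measurable_normpow.
  - by apply/measurable_EFinP; apply: measurable_funD; exact: measurable_funX.
  - by move=> x _; rewrite lee_fin; exact: powR_le_sq.
have fp : LpH p f by split => //; apply: le_lt_trans le _; rewrite ltry.
by split => //; rewrite -lee_fin (pnpE mH fp).
Qed.

Lemma exists_power p : exists k : nat, p <= k.+1.*2%:R.
Proof.
exists (Num.truncn p); apply: ltW; apply: (lt_le_trans (truncnS_gt p)).
by rewrite ler_nat -addnn leq_addr.
Qed.

Lemma test_component_ip i phi : test_function phi ->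
  component_ip i phi phi = nsqH (test_component i phi).
Proof.
move=> tp; have [Hp ae] := test_Hplus tp.
have L1 := Hplus_L2 i Hp; have L2 := test_L2 (test_test_component i tp).
rewrite cip_nsq; exact: (ae_eq_ip mH L1 L2 L1 L2 (ae i) (ae i)).
Qed.

Lemma qform_test b c phi : test_function phi ->
  qform b c phi = nsqH ('D_e1 phi) + nsqH ('D_e2 phi) + b * nsqH (dth phi) + c * nsqH phi.
Proof.
move=> tp; rewrite /qform /form (test_component_ip Idx tp) (test_component_ip Idy tp).
by rewrite (test_component_ip Idth tp) (test_component_ip Ifun tp).
Qed.

Lemma pnp_test p k phi : 2 <= p <= k.+1.*2%:R -> test_function phi -> qform 1 0 phi <= 1 ->
  LpH p phi /\ pnpH p phi <= pi ^+ 2 * (1 + (k.+1)`!%:R ^+ 2).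
Proof.
move=> pk tp; rewrite (qform_test _ _ tp) mul0r addr0 mul1r => q1.
have [Lp le] := Lp_interpolation pk (test_L2 tp) (test_L2 (test_pow k tp)); split => //.
apply: (le_trans le).
have P := poincare_nsq tp; have S := sobolev_test k tp.
have n1 := @nsq_ge0 _ _ _ mu2 H ('D_e1 phi); have n2 := @nsq_ge0 _ _ _ mu2 H ('D_e2 phi).
have n3 := @nsq_ge0 _ _ _ mu2 H (dth phi); have n0 := @nsq_ge0 _ _ _ mu2 H phi.
have nk := @nsq_ge0 _ _ _ mu2 H (fun x => phi x ^+ k.+1).
move: (nsqH ('D_e1 phi)) (nsqH ('D_e2 phi)) (nsqH (dth phi)) (nsqH phi) (nsqH (fun x => phi x ^+ k.+1)) q1 P S n1 n2 n3 n0 nk.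
move=> a b c e m q1 P S n1 n2 n3 n0 nk {le}.
have pi2 : 0 <= (pi : R) ^+ 2 by exact: sqr_ge0.
have e1' : e <= pi ^+ 2.
  by apply: (le_trans P); rewrite -[leRHS]mulr1; apply: ler_wpM2l => //; lra.
have g1 : (a + b) ^+ k <= 1 by apply: exprn_ile1; lra.
have g0 : 0 <= (a + b) ^+ k by apply: exprn_ge0; lra.
have f0 : 0 <= ((k.+1)`!%:R : R) ^+ 2 by exact: sqr_ge0.
rewrite mulrDr mulr1; apply: lerD => //; apply: (le_trans S).
rewrite mulrC; apply: ler_pM => //; first exact: mulr_ge0.
by rewrite -[leRHS]mulr1; exact: ler_wpM2l.
Qed.

Lemma discriminant_le (A B C : R) : 0 <= C ->
  (forall t, 0 <= A + 2 * t * B + t ^+ 2 * C) -> B ^+ 2 <= A * C.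
Proof.
rewrite le_eqVlt => /predU1P[<-|C0] K.
  have [->|B0] := eqVneq B 0; first by rewrite expr0n mulr0.
  have := K (- (A + 1) / (2 * B)); rewrite mulr0 addr0.
  have -> : 2 * (- (A + 1) / (2 * B)) * B = - (A + 1) by field.
  lra.
have := K (- B / C).
have -> : A + 2 * (- B / C) * B + (- B / C) ^+ 2 * C = (A * C - B ^+ 2) / C.
  by field; rewrite gt_eqF.
by rewrite pmulr_lge0 ?invr_gt0// subr_ge0.
Qed.

Section Seminorm.
Variables b c : R.
Hypotheses (b0 : 0 <= b) (c0 : 0 <= c).

Definition qnorm u := Num.sqrt (qform b c u).

Lemma qnorm_ge0 u : 0 <= qnorm u. Proof. exact: sqrtr_ge0. Qed.

Lemma sqr_qnorm u : qnorm u ^+ 2 = qform b c u.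
Proof. by rewrite sqr_sqrtr// qform_ge0. Qed.

Lemma form_CS u v : Hplus u -> Hplus v -> form b c u v ^+ 2 <= qform b c u * qform b c v.
Proof.
move=> Hu Hv; apply: discriminant_le; first exact: qform_ge0.
by move=> t; rewrite -(qform_lin b c t Hu Hv) qform_ge0.
Qed.

Lemma form_le u v : Hplus u -> Hplus v -> `|form b c u v| <= qnorm u * qnorm v.
Proof.
move=> Hu Hv; rewrite -sqrtrM; last exact: qform_ge0.
by rewrite -sqrtr_sqr; apply: ler_wsqrtr; exact: form_CS.
Qed.

Lemma qnormZ t u : Hplus u -> qnorm (fun x => t * u x) = `|t| * qnorm u.
Proof. by move=> Hu; rewrite /qnorm (qformZ b c t Hu) sqrtrM ?sqr_ge0// sqrtr_sqr. Qed.

Lemma qnormD u v : Hplus u -> Hplus v -> qnorm (u \+ v) <= qnorm u + qnorm v.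
Proof.
move=> Hu Hv; rewrite -(ler_pXn2r (n := 2)) ?nnegrE ?addr_ge0 ?qnorm_ge0//.
rewrite sqr_qnorm (qformD b c Hu Hv) sqrrD !sqr_qnorm.
have := le_trans (ler_norm _) (form_le Hu Hv); lra.
Qed.

Lemma qnormBC u v : Hplus u -> Hplus v -> qnorm (u \- v) = qnorm (v \- u).
Proof.
move=> Hu Hv; apply: (f_equal Num.sqrt); rewrite (qformB b c Hu Hv) (qformB b c Hv Hu) (formC b c v u); lra.
Qed.

Lemma qnormB_le u v : Hplus u -> Hplus v -> `|qnorm u - qnorm v| <= qnorm (u \- v).
Proof.
move=> Hu Hv.
have := qnormD (HplusB Hu Hv) Hv; have := qnormD (HplusB Hv Hu) Hu.
rewrite (_ : (v \- u) \+ u = v); last by apply/funext => x /=; rewrite subrK.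
rewrite (_ : (u \- v) \+ v = u); last by apply/funext => x /=; rewrite subrK.
rewrite (qnormBC Hv Hu) ler_norml => h1 h2; apply/andP; split; lra.
Qed.

Lemma qnorm_cvg (w : nat -> R * R -> R) u : (forall n, Hplus (w n)) -> Hplus u ->
  qform b c (w n \- u) @[n --> \oo] --> (0 : R) -> qnorm (w n) @[n --> \oo] --> qnorm u.
Proof.
move=> Hw Hu lim; apply/subr_cvg0; apply/norm_cvg0P.
apply: (@squeeze_cvgr _ _ _ _ (fun=> 0) (fun n => qnorm (w n \- u))).
- by apply: nearW => n; apply/andP; split; [exact: normr_ge0|exact: (qnormB_le (Hw n) Hu)].
- exact: cvg_cst.
- rewrite -[X in _ --> X]sqrtr0; apply: (continuous_cvg _ _ lim); exact: sqrt_continuous.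
Unshelve. all: by end_near. Qed.

Lemma qform_cvg (w : nat -> R * R -> R) u : (forall n, Hplus (w n)) -> Hplus u ->
  qform b c (w n \- u) @[n --> \oo] --> (0 : R) -> qform b c (w n) @[n --> \oo] --> qform b c u.
Proof.
move=> Hw Hu lim; have K := qnorm_cvg Hw Hu lim.
rewrite -sqr_qnorm; under eq_fun do rewrite -sqr_qnorm.
by rewrite expr2; under eq_fun do rewrite expr2; apply: cvgM.
Qed.

End Seminorm.

Lemma qform_le b c b' c' u : b <= b' -> c <= c' -> qform b c u <= qform b' c' u.
Proof.
move=> bb cc; rewrite /qform /form; apply: lerD; last by apply: ler_wpM2r => //; exact: cip_ge0.
by apply: lerD => //; apply: ler_wpM2r => //; exact: cip_ge0.
Qed.

Lemma qform_poincare b c u : Hplus u -> 0 <= c -> qform b c u <= qform (b + c * pi ^+ 2) 0 u.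
Proof.
move=> Hu c0; have := poincare_Hplus Hu; rewrite -(cip_nsq Ifun) -(cip_nsq Idth).
by rewrite /qform /form => h; have := ler_wpM2l c0 h; nra.
Qed.

Lemma qform_scale_le b u : 1 <= b -> qform b 0 u <= b * qform 1 0 u.
Proof.
move=> b1; rewrite /qform /form !mul0r !addr0 mul1r.
have := cip_ge0 Idx u; have := cip_ge0 Idy u; have := cip_ge0 Idth u; nra.
Qed.

(** Poincare absorbs the mass term into the angular one. The form without mass thus dominates all
    the others, which is one half of the equivalence of norms; [qform10_le] is the other half. *)
Lemma qform_le10 b c u : Hplus u -> 0 <= b -> 0 <= c ->
  qform b c u <= (1 + b + c * pi ^+ 2) * qform 1 0 u.
Proof.
move=> Hu b0 c0; apply: (le_trans (qform_poincare b Hu c0)).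
have d0 : 0 <= b + c * pi ^+ 2 by rewrite addr_ge0// mulr_ge0// sqr_ge0.
have s1 : 1 <= 1 + b + c * pi ^+ 2 by lra.
by apply: le_trans (qform_scale_le u s1); apply: qform_le => //; lra.
Qed.

(** The strict inequality is inherited by late approximating test functions, to which [pnp_test]
    applies; Fatou carries their common bound over to [u]. *)
Lemma Hplus_Lp_small p k u : 2 <= p <= k.+1.*2%:R -> Hplus u -> qform 1 0 u < 1 ->
  LpH p u /\ pnpH p u <= pi ^+ 2 * (1 + (k.+1)`!%:R ^+ 2).
Proof.
move=> /[dup] pk /andP[p2 _] Hu u1; have [phi [tp p0]] := Hplus_dense Hu.
have Hp n : Hplus (phi n) := (test_Hplus (tp n)).1.
have tL i n : L2H (test_component i (phi n)) by apply: test_L2; exact: test_test_component.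
have lim i := nsq_cvg (tL i) (Hplus_L2 i Hu) (p0 i).
have qlim : qform 1 0 (phi n) @[n --> \oo] --> qform 1 0 u.
  rewrite qformE mul0r addr0 mul1r.
  under eq_fun do rewrite (qform_test 1 0 (tp _)) mul0r addr0 mul1r.
  by apply: cvgD; [apply: cvgD; [exact: (lim Idx)|exact: (lim Idy)]|exact: (lim Idth)].
have [N _ hN] := cvgr_lt _ qlim _ u1.
have [s hs sae] := L2_subseq_ae mH (tL Ifun) (Hplus_L2 Ifun Hu) (p0 Ifun).
set K := pi ^+ 2 * _.
have small n : LpH p (phi (s (N + n)%N)) /\ pnpH p (phi (s (N + n)%N)) <= K.
  apply: pnp_test => //; apply: ltW; apply: hN => /=.
  exact: leq_trans (leq_addr n N) (hs _).
have mu_ : measurable_fun H u := L2_measurable (Hplus_L2 Ifun Hu).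
have le : (\int[mu2]_(x in H) (`|u x| `^ p)%:E <= K%:E)%E.
  apply: (fatou_le mH (F := fun n x => `|phi (s (N + n)%N) x| `^ p)).
  - by move=> n; apply: measurable_normpow; case: (small n) => -[].
  - exact: measurable_normpow.
  - by move=> n x _; exact: powR_ge0.
  - apply: ae_imp sae => x h Hx; have := cvg_sub (leq_addl N) (h Hx).
    move=> {}h; have p1 : 0 < p by lra.
    exact: (@normpow_cvg p (fun n => phi (s (N + n)%N) x) (u x) p1 h).
  - by move=> n; rewrite -(pnpE mH (small n).1) lee_fin (small n).2.
have Lu : LpH p u by split => //; apply: le_lt_trans le _; rewrite ltry.
by split => //; rewrite -lee_fin (pnpE mH Lu).
Qed.

(** Homogeneity: [u] is divided by any [s] above its norm, and [s] then decreases to the norm. This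
    avoids dividing by a norm that may be 0. *)
Lemma sobolev_Hplus p : 2 <= p -> exists2 C : R, 0 < C &
  forall u, Hplus u -> LpH p u /\ pnH p u <= C * qnorm 1 0 u.
Proof.
move=> p2; have [k pk] := exists_power p.
have pk' : 2 <= p <= k.+1.*2%:R by apply/andP.
set K := pi ^+ 2 * (1 + (k.+1)`!%:R ^+ 2) : R.
have K0 : 0 < K by rewrite mulr_gt0// ?exprn_gt0 ?pi_gt0// addr_gt0// exprn_gt0// ltr0n fact_gt0.
exists (K `^ p^-1); first exact: powR_gt0.
move=> u Hu.
have key (s : R) : qnorm 1 0 u < s -> LpH p u /\ pnH p u <= K `^ p^-1 * s.
  move=> us; have s0 : 0 < s by apply: le_lt_trans us; exact: qnorm_ge0.
  have Hs := HplusZ s^-1 Hu.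
  have q1 : qform 1 0 (fun x => s^-1 * u x) < 1.
    rewrite (qformZ 1 0 _ Hu) -(sqr_qnorm ler01 (lexx 0)) exprVn mulrC ltr_pdivrMr ?exprn_gt0// mul1r.
    by rewrite ltr_pXn2r ?nnegrE ?qnorm_ge0 ?(ltW s0).
  have [Ls ps] := Hplus_Lp_small pk' Hs q1.
  have E : u = (fun x => s * (s^-1 * u x)).
    by apply/funext => x; rewrite mulrA divff ?mul1r// gt_eqF.
  have Lu : LpH p u by rewrite E; exact: (LpZ mH s Ls).1.
  split; first exact: Lu.
  rewrite E (pnZ mH _ _ Ls); last lra.
  rewrite (gtr0_norm s0) mulrC; apply: ler_wpM2r; first exact: ltW.
  rewrite pnE; apply: ge0_ler_powR => //; rewrite ?nnegrE ?pnp_ge0 ?(ltW K0)// invr_ge0; lra.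
have [Lu _] := key (qnorm 1 0 u + 1) (ltr_pwDr ltr01 (lexx _)).
split => //; apply/ler_addgt0Pr => e e0.
have C0 : 0 < K `^ p^-1 by exact: powR_gt0.
have [_] := key (qnorm 1 0 u + e / K `^ p^-1) (ltr_pwDr (divr_gt0 e0 C0) (lexx _)).
by rewrite mulrDr [X in _ + X]mulrC divfK// gt_eqF.
Qed.

End HplusLp.

Lemma ge0_integral_lin2 {d : measure_display} {T : measurableType d} {R : realType}
    (mu : {measure set T -> \bar R}) (D : set T) (a b : R) (f g : T -> R) :
  measurable D -> 0 <= a -> 0 <= b -> (forall x, D x -> 0 <= f x) -> (forall x, D x -> 0 <= g x) ->
  measurable_fun D f -> measurable_fun D g ->
  (\int[mu]_(x in D) (a * f x + b * g x)%:E =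
   a%:E * \int[mu]_(x in D) (f x)%:E + b%:E * \int[mu]_(x in D) (g x)%:E)%E.
Proof.
move=> mD a0 b0 f0 g0 mf mg; under eq_integral do rewrite EFinD.
rewrite ge0_integralD; last 5 first.
- exact: mD.
- by move=> x Dx; rewrite lee_fin mulr_ge0// f0.
- by apply/measurable_EFinP; exact: measurable_funM.
- by move=> x Dx; rewrite lee_fin mulr_ge0// g0.
- by apply/measurable_EFinP; exact: measurable_funM.
congr (_ + _)%E; under eq_integral do rewrite EFinM; rewrite ge0_integralZl_EFin//.
- by apply/measurable_EFinP.
- by apply/measurable_EFinP.
Qed.

(** * Estimates on a square grid *)

Section Grid.
Context {R : realType}.
Local Notation mu := (@lebesgue_measure R).
Local Notation mu2 := (lebesgue2 R).
Local Notation H := (@half_plane R).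
Local Notation plane := (measurableTypeR R * measurableTypeR R)%type.
Local Notation nsqH := (nsq mu2 H).
Local Notation pnpH := (pnp mu2 H).
Implicit Types (phi psi : R * R -> R) (x : R * R) (h : R) (i j : int).
Let mH := @measurable_half_plane R.

(** Half-open, so that the cells of a grid are disjoint. By [integral_rect_cell] the integrals equal
    those over the closed squares of the Poincare inequality. *)
Definition cell (a c h : R) : set plane := `[a, a + h[%classic `*` `[c, c + h[%classic.

Lemma measurable_cell a c h : measurable (cell a c h).
Proof. by apply: measurableX; exact: measurable_itv. Qed.

Lemma cell_sub_rect a c h : cell a c h `<=` rect a (a + h) c (c + h).
Proof.
move=> x [] /=; rewrite /rect !in_itv /= => /andP[? /ltW ?] /andP[? /ltW ?].
by split; rewrite /= in_itv /=; apply/andP.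
Qed.

Lemma integral_rect_cell (g : R * R -> \bar R) a c h : 0 < h -> measurable_fun setT g ->
  (forall x, (0 <= g x)%E) ->
  (\int[mu2]_(x in rect a (a + h)%R c (c + h)%R) g x = \int[mu2]_(x in cell a c h) g x)%E.
Proof.
move=> h0 mg g0.
pose N : set plane := [set a + h] `*` setT `|` setT `*` [set c + h].
have mN1 : measurable ([set a + h] `*` setT : set plane).
  by apply: measurableX; [exact: measurable_set1|exact: measurableT].
have mN2 : measurable (setT `*` [set c + h] : set plane).
  by apply: measurableX; [exact: measurableT|exact: measurable_set1].
have mN : measurable N by exact: measurableU.
have N1 : mu2 ([set a + h] `*` setT) = 0%E.
  rewrite product_measure1E; [|exact: measurable_set1|exact: measurableT].
  by rewrite [X in (X * _)%E](lebesgue_measure_set1 (a + h)) mul0e.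
have N2 : mu2 (setT `*` [set c + h]) = 0%E.
  rewrite product_measure1E; [|exact: measurableT|exact: measurable_set1].
  by rewrite [X in (_ * X)%E](lebesgue_measure_set1 (c + h)) mule0.
have N0 : mu2 N = 0%E.
  apply/eqP; rewrite eq_le measure_ge0 andbT.
  apply: le_trans (measureU2 _ mN1 mN2) _.
  by rewrite [X in (X + _)%E]N1 [X in (_ + X)%E]N2 adde0.
have mr := @measurable_rect R a (a + h) c (c + h).
rewrite (ge0_negligible_integral mN mr (measurable_funTS mg) (fun x _ => g0 x) N0).
rewrite (_ : rect a (a + h) c (c + h) `\` N = cell a c h)//.
apply/seteqP; split => x.
  move=> [[/=]]; rewrite !in_itv /= => /andP[x1 x2] /andP[x3 x4] nN.
  split; rewrite /= in_itv /= lt_neqAle ?x1 ?x2 ?x3 ?x4 andbT /=; apply/eqP => e; apply: nN.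
    by left.
  by right.
move=> cx; split; first exact: cell_sub_rect.
case: cx => /=; rewrite !in_itv /= => /andP[_ x1] /andP[_ x2] [[/= e _]|[/= _ e]].
  by rewrite e ltxx in x1.
by rewrite e ltxx in x2.
Qed.

Lemma floor_cell (t h : R) i : 0 < h ->
  (i%:~R * h <= t < i%:~R * h + h) = (Num.floor (t / h) == i).
Proof.
by move=> h0; rewrite floor_eq ler_pdivlMr// ltr_pdivrMr// intrD mulrDl mul1r.
Qed.

(** The plane is the countable disjoint union of the cells, so cellwise inequalities between
    nonnegative integrals add up. *)
Lemma grid_le h (F G : R * R -> \bar R) : 0 < h ->
  measurable_fun setT F -> measurable_fun setT G ->
  (forall x, (0 <= F x)%E) -> (forall x, (0 <= G x)%E) ->
  (forall i j, (\int[mu2]_(x in cell (i%:~R * h)%R (j%:~R * h)%R h) F x <=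
    \int[mu2]_(x in cell (i%:~R * h)%R (j%:~R * h)%R h) G x)%E) ->
  (\int[mu2]_x F x <= \int[mu2]_x G x)%E.
Proof.
move=> h0 mF mG F0 G0 le.
(* Enumerates the cells through the coding of pairs of integers; numbers that code no pair give the
   empty set. *)
pose Q (n : nat) : set plane :=
  if pickle_inv n is Some (i, j) then cell (i%:~R * h) (j%:~R * h) h else set0.
have mQ n : measurable (Q n).
  by rewrite /Q; case: pickle_inv => [[i j]|]; [exact: measurable_cell|exact: measurable0].
have cellP i j x : cell (i%:~R * h) (j%:~R * h) h x <->
    Num.floor (x.1 / h) = i /\ Num.floor (x.2 / h) = j.
  rewrite /cell /= !in_itv /= !floor_cell//; split.
    by move=> [/= /eqP e /eqP e'].
  by move=> [e e']; split; apply/eqP.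
have QT : \bigcup_n Q n = setT.
  apply/seteqP; split => // x _.
  exists (pickle (Num.floor (x.1 / h), Num.floor (x.2 / h))); [exact: I|].
  by rewrite /Q pickleK_inv; apply/cellP.
have tQ : trivIset setT Q.
  move=> m n _ _ [x []]; rewrite /Q.
  have Km := pickle_invK (T := (int * int)%type) m; have Kn := pickle_invK (T := (int * int)%type) n.
  case em : (pickle_inv m) Km => [[i j]|]//= Km; case en : (pickle_inv n) Kn => [[k l]|]//= Kn.
  by move=> /cellP[e e'] /cellP[f f']; rewrite -Km -Kn -e -e' f f'.
have dec (f : R * R -> \bar R) : measurable_fun setT f -> (forall x, (0 <= f x)%E) ->
    (\int[mu2]_x f x = \big[+%E/0%R]_(0 <= n <oo) \int[mu2]_(x in Q n) f x)%E.
  move=> mf f0; have := @ge0_integral_bigcup _ _ _ mu2 Q f mQ; rewrite QT => K.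
  exact: (K mf (fun x _ => f0 x) tQ).
rewrite (dec F mF F0) (dec G mG G0); apply: lee_nneseries => [n _ _|n _].
  by apply: integral_ge0 => x _; exact: F0.
rewrite /Q; case: pickle_inv => [[i j]|]; [exact: le|by rewrite !integral_set0].
Qed.


(* Where |t| > 2 |a| one has |t| <= 2 |t - a|, and AM-GM gives the last two terms. *)
Lemma interp_pointwise p (t a d : R) : 2 < p -> 0 < d ->
  `|t| `^ p <= (2 * `|a|) `^ (p - 2) * t ^+ 2 + d * `|t| `^ (2 * p - 2) + d^-1 * (t - a) ^+ 2.
Proof.
move=> p2 d0.
have d0' : 0 <= d by exact: ltW.
have dV : 0 <= d^-1 by rewrite invr_ge0.
have [t0|t0] := eqVneq t 0.
  rewrite t0 normr0 powR0 ?gt_eqF//; last lra.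
  by apply: addr_ge0; [apply: addr_ge0|]; apply: mulr_ge0; rewrite ?powR_ge0 ?sqr_ge0.
have nt : 0 < `|t| by rewrite normr_gt0.
have tE : t ^+ 2 = `|t| ^+ 2 by rewrite real_normK// num_real.
have [ta|ta] := leP `|t| (2 * `|a|).
  apply: (@le_trans _ _ ((2 * `|a|) `^ (p - 2) * t ^+ 2)); last first.
    by rewrite -addrA lerDl; apply: addr_ge0; apply: mulr_ge0; rewrite ?powR_ge0 ?sqr_ge0.
  have -> : `|t| `^ p = `|t| `^ (p - 2) * t ^+ 2.
    rewrite tE -powR_mulrn// -powRD ?subrK//.
    by rewrite normr_eq0 t0 implybT.
  apply: ler_wpM2r; first exact: sqr_ge0.
  by apply: ge0_ler_powR; rewrite ?nnegrE ?mulr_ge0//; lra.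
have key : t ^+ 2 <= 4 * (t - a) ^+ 2.
  have : `|t| <= 2 * `|t - a|.
    by have := ler_distD a t 0; rewrite subr0 subr0; lra.
  rewrite tE => h1; have -> : 4 * (t - a) ^+ 2 = (2 * `|t - a|) ^+ 2.
    by rewrite exprMn real_normK ?num_real//; ring.
  by rewrite ler_pXn2r ?nnegrE ?mulr_ge0.
have -> : `|t| `^ p = `|t| `^ (p - 1) * `|t|.
  rewrite -[X in _ * X]powRr1// -powRD ?subrK//.
  by rewrite normr_eq0 t0 implybT.
have -> : `|t| `^ (2 * p - 2) = (`|t| `^ (p - 1)) ^+ 2.
  by rewrite -powR_mulrn ?powR_ge0// -powRrM; congr (_ `^ _); lra.
apply: (@le_trans _ _ (d * (`|t| `^ (p - 1)) ^+ 2 + d^-1 * (t - a) ^+ 2)); last first.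
  by rewrite -addrA lerDr mulr_ge0 ?powR_ge0 ?sqr_ge0.
set s := `|t| `^ (p - 1).
have q : d^-1 * (4^-1 * `|t| ^+ 2) <= d^-1 * (t - a) ^+ 2.
  by apply: ler_wpM2l; [rewrite invr_ge0 ltW|rewrite -tE; lra].
apply: le_trans (lerD (lexx _) q).
have := sqr_ge0 (d * s - 2^-1 * `|t|).
have e : d * s ^+ 2 + d^-1 * (4^-1 * `|t| ^+ 2) - s * `|t| = d^-1 * (d * s - 2^-1 * `|t|) ^+ 2.
  by field; rewrite gt_eqF.
move=> sq; rewrite -subr_ge0 e mulr_ge0// invr_ge0; exact: ltW.
Qed.


Local Notation avg phi h i j := (average phi (i%:~R * h) (j%:~R * h) h).

(** On each cell [interp_pointwise] is used with the average over that cell, and [square_poincare]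
    turns the oscillation term into [h ^ 2] times the gradient. The L^p norm is therefore small once
    [d] is small, [h] is small relative to it, and all averages are small. *)
Lemma pnp_average_le phi p h (al d : R) : 2 < p -> 0 < h -> 0 < d -> test_function phi ->
  (forall i j, `|avg phi h i j| <= al) -> Lp mu2 H (2 * p - 2) phi ->
  pnpH p phi <= (2 * al) `^ (p - 2) * nsqH phi + d * pnpH (2 * p - 2) phi +
    d^-1 * (2 * h ^+ 2) * (nsqH ('D_e1 phi) + nsqH ('D_e2 phi)).
Proof.
move=> p2 h0 d0 tp avg_le Lq.
have al0 : 0 <= al by apply: le_trans (avg_le 0 0).
have cp := test_continuous tp; have [t1 t2] := test_deriv tp.
have c1 := test_continuous t1; have c2 := test_continuous t2.
set c := (2 * al) `^ (p - 2); set K := d^-1 * (2 * h ^+ 2).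
have c0 : 0 <= c by exact: powR_ge0.
have K0 : 0 <= K by rewrite !mulr_ge0 ?invr_ge0 ?sqr_ge0// ltW.
have msq (g : R * R -> R) : continuous g -> measurable_fun setT (fun x => g x ^+ 2).
  by move=> cg; apply: measurable_funX; exact: continuous_measurable2.
have mpow r : measurable_fun setT (fun x : R * R => `|phi x| `^ r).
  by apply: measurable_normpow; exact: continuous_measurable2.
have d0' : 0 <= d by exact: ltW.
have dV : 0 <= d^-1 by rewrite invr_ge0.
pose A x : R := c * phi x ^+ 2 + d * `|phi x| `^ (2 * p - 2).
pose B x : R := 'D_e1 phi x ^+ 2 + 'D_e2 phi x ^+ 2.
have mA : measurable_fun setT A.
  by apply: measurable_funD; apply: measurable_funM => //; exact: msq.
have mB : measurable_fun setT B by apply: measurable_funD; exact: msq.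
have A0 x : 0 <= A x by apply: addr_ge0; apply: mulr_ge0; rewrite ?powR_ge0 ?sqr_ge0.
have B0 x : 0 <= B x by apply: addr_ge0; exact: sqr_ge0.
have main : (\int[mu2]_x (`|phi x| `^ p)%:E <= \int[mu2]_x (A x + K * B x)%:E)%E.
  apply: (grid_le h0).
  - by apply/measurable_EFinP; exact: mpow.
  - by apply/measurable_EFinP; apply: measurable_funD => //; apply: measurable_funM.
  - by move=> x; rewrite lee_fin powR_ge0.
  - by move=> x; rewrite lee_fin; apply: addr_ge0; [exact: A0|apply: mulr_ge0; [exact: K0|exact: B0]].
  move=> i j; set a := i%:~R * h; set b := j%:~R * h.
  have mc := measurable_cell a b h.
  set m := average phi a b h.
  have mfm : measurable_fun setT (fun x => (phi x - m) ^+ 2).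
    by apply: (msq (fun x => phi x - m)) => x; apply: cvgB; [exact: cp|exact: cvg_cst].
  apply: (@le_trans _ _ (\int[mu2]_(x in cell a b h) (A x + d^-1 * (phi x - m) ^+ 2)%:E)%E).
    apply: ge0_le_integral; [exact: mc|by move=> x _; rewrite lee_fin powR_ge0| | |].
    - by apply/measurable_EFinP; apply: measurable_funTS; exact: mpow.
    - apply/measurable_EFinP; apply: measurable_funTS; apply: measurable_funD => //.
      by apply: measurable_funM.
    - move=> x _; rewrite lee_fin; apply: le_trans (interp_pointwise (phi x) m p2 d0) _.
      rewrite lerD2r lerD2r; apply: ler_wpM2r; first exact: sqr_ge0.
      apply: ge0_ler_powR; rewrite ?nnegrE ?mulr_ge0//; first lra.
      by apply: ler_wpM2l => //; exact: avg_le.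
  under eq_integral do rewrite EFinD.
  under [leRHS]eq_integral do rewrite EFinD.
  rewrite ge0_integralD; last 5 first.
  - exact: mc.
  - by move=> x _; rewrite lee_fin A0.
  - by apply/measurable_EFinP; exact: measurable_funTS.
  - by move=> x _; rewrite lee_fin; apply: mulr_ge0; [exact: dV|exact: sqr_ge0].
  - by apply/measurable_EFinP; apply: measurable_funTS; exact: measurable_funM.
  rewrite ge0_integralD; last 5 first.
  - exact: mc.
  - by move=> x _; rewrite lee_fin A0.
  - by apply/measurable_EFinP; exact: measurable_funTS.
  - by move=> x _; rewrite lee_fin; apply: mulr_ge0; [exact: K0|exact: B0].
  - by apply/measurable_EFinP; apply: measurable_funTS; exact: measurable_funM.
  apply: leeD => //.
  under eq_integral do rewrite EFinM.
  under [leRHS]eq_integral do rewrite EFinM.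
  rewrite ge0_integralZl_EFin; last 4 first.
  - exact: mc.
  - by move=> x _; rewrite lee_fin sqr_ge0.
  - by apply/measurable_EFinP; exact: measurable_funTS.
  - exact: dV.
  rewrite ge0_integralZl_EFin; last 4 first.
  - exact: mc.
  - by move=> x _; rewrite lee_fin; exact: B0.
  - by apply/measurable_EFinP; exact: measurable_funTS.
  - exact: K0.
  have SP := square_poincare a b h0 (test_smooth tp 1%N).
  have mr := @measurable_rect R a (a + h) b (b + h).
  have ha : a <= a + h by rewrite lerDl ltW.
  have hb : b <= b + h by rewrite lerDl ltW.
  have Lm : L2 mu2 (rect a (a + h) b (b + h)) (fun x => phi x - m).
    by apply: continuous_L2_rect => // x; apply: cvgB; [exact: cp|exact: cvg_cst].
  have L1 := continuous_L2_rect ha hb c1; have L2' := continuous_L2_rect ha hb c2.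
  move: SP; rewrite -lee_fin EFinM EFinD (nsqE mr Lm) (nsqE mr L1) (nsqE mr L2').
  rewrite -ge0_integralD; last 5 first.
  - exact: mr.
  - by move=> x _; rewrite lee_fin sqr_ge0.
  - by apply/measurable_EFinP; apply: measurable_funTS; exact: msq.
  - by move=> x _; rewrite lee_fin sqr_ge0.
  - by apply/measurable_EFinP; apply: measurable_funTS; exact: msq.
  rewrite (integral_rect_cell a b h0 (proj2 (measurable_EFinP _ _) mfm) (fun x => sqr_ge0 _)).
  have mBe : measurable_fun setT (fun x => ('D_e1 phi x ^+ 2)%:E + ('D_e2 phi x ^+ 2)%:E)%E.
    by apply/measurable_EFinP; exact: mB.
  rewrite (integral_rect_cell a b h0 mBe (fun x => B0 x)).
  move=> SP; rewrite /K EFinM -muleA; apply: lee_wpmul2l; first by rewrite lee_fin.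
  exact: SP.
have p22 : 2 <= p by exact: ltW.
have [C _ /(_ phi (test_Hplus tp).1)[Lpp _]] := sobolev_Hplus p22.
have z (f : R * R -> R) x : test_function f -> x.1 <= 0 -> f x = 0 by move=> tf; exact: test_half.
move: main; rewrite -[X in (X <= _)%E]int_half; last first.
  by move=> x x0; rewrite (z _ _ tp x0) normr0 powR0// gt_eqF//; lra.
rewrite -[X in (_ <= X)%E]int_half; last first.
  move=> x x0; rewrite /A /B (z _ _ tp x0) (z _ _ t1 x0) (z _ _ t2 x0) normr0 powR0.
    by rewrite !expr0n /= !addr0 !mulr0 !addr0.
  by rewrite gt_eqF//; lra.
rewrite -(pnpE mH Lpp) => main; rewrite -lee_fin; apply: (le_trans main).
have mHS (f : R * R -> R) : measurable_fun setT f -> measurable_fun H f.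
  by move=> mf; exact: measurable_funTS.
under eq_integral do rewrite -[A _]mul1r.
rewrite (ge0_integral_lin2 mu2 mH ler01 K0 (fun x _ => A0 x) (fun x _ => B0 x) (mHS _ mA) (mHS _ mB)).
rewrite (ge0_integral_lin2 mu2 mH c0 d0' (fun x _ => sqr_ge0 _) (fun x _ => powR_ge0 _ _)
  (mHS _ (msq _ cp)) (mHS _ (mpow _))).
have EB : (\int[mu2]_(x in H) (B x)%:E = (nsqH ('D_e1 phi) + nsqH ('D_e2 phi))%:E)%E.
  have := ge0_integral_lin2 mu2 mH ler01 ler01 (fun x _ => sqr_ge0 ('D_e1 phi x))
    (fun x _ => sqr_ge0 ('D_e2 phi x)) (mHS _ (msq _ c1)) (mHS _ (msq _ c2)).
  rewrite -(nsqE mH (test_L2 t1)) -(nsqE mH (test_L2 t2)) !mul1e -EFinD => <-.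
  by apply: eq_integral => x _; rewrite !mul1r.
by rewrite EB -(nsqE mH (test_L2 tp)) -(pnpE mH Lq) mul1e -!EFinM -!EFinD.
Qed.


End Grid.

(** * Compactness *)

Section Ultra.
Context {R : realType}.
Variable U : set_system nat.
Hypothesis (uU : UltraFilter U).

(** The interval [[-B, B]] is covered by finitely many intervals of length [e]; an ultrafilter
    selects one of them. Working with an ultrafilter replaces successive extraction of
    subsequences. *)
Lemma ultra_small (a : nat -> R) (B e : R) : (forall n, `|a n| <= B) -> 0 < e ->
  exists2 A, U A & forall m n, A m -> A n -> `|a m - a n| <= e.
Proof.
move=> aB e0.
have step k lo : U [set n | lo <= a n <= lo + k%:R * e] ->
    exists2 A, U A & forall m n, A m -> A n -> `|a m - a n| <= e.
  elim: k lo => [|k IH] lo Uk.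
    exists [set n | lo <= a n <= lo + 0%:R * e] => // m n /=; rewrite mul0r addr0.
    by move=> /andP[h1 h2] /andP[h3 h4]; rewrite ler_norml; apply/andP; split; lra.
  have [V|V] := in_ultra_setVsetC [set n | a n <= lo + e] uU.
    exists ([set n | lo <= a n <= lo + k.+1%:R * e] `&` [set n | a n <= lo + e]).
      exact: filterI.
    move=> m n [/= /andP[h1 _] h2] [/= /andP[h3 _] h4].
    by rewrite ler_norml; apply/andP; split; lra.
  apply: (IH (lo + e)); apply: filterS (filterI Uk V) => n [/= /andP[_ h1] /negP].
  rewrite -ltNge => /ltW ->; move: h1; rewrite -natr1 mulrDl mul1r; lra.
have [k kB] : exists k : nat, 2 * B / e <= k%:R.
  by exists (Num.truncn (2 * B / e)).+1; apply: ltW; exact: truncnS_gt.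
apply: (step k (- B)); apply: filterS filterT => n _ /=.
have := aB n; rewrite ler_norml => /andP[h1 h2]; apply/andP; split => //.
by move: kB; rewrite ler_pdivrMr// => h; lra.
Qed.

Lemma ultra_small_seq (T : eqType) (s : seq T) (a : T -> nat -> R) (B e : R) :
  (forall i n, `|a i n| <= B) -> 0 < e ->
  exists2 A, U A & forall i m n, i \in s -> A m -> A n -> `|a i m - a i n| <= e.
Proof.
move=> aB e0; elim: s => [|i s [A UA HA]]; first by exists setT => //; exact: filterT.
have [A' UA' HA'] := ultra_small (aB i) e0.
exists (A' `&` A); first exact: filterI.
move=> j m n; rewrite inE => /orP[/eqP->|js] [m1 m2] [n1 n2]; first exact: HA'.
exact: HA.
Qed.

End Ultra.

(** The intersections [B k] of the first sets [A j] still belong to [U]. As [U] refines the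
    neighbourhoods of infinity, each [B k] contains an index above any given one. *)
Lemma diagonal_subseq (P : nat -> nat -> nat -> Prop) (U : set_system nat) : ProperFilter U ->
  nbhs \oo `<=` U ->
  (forall k, exists2 A, U A & forall m n, A m -> A n -> P k m n) ->
  exists s : nat -> nat, {homo s : m n / (m < n)%N} /\
    forall k m n, (k <= m)%N -> (k <= n)%N -> P k (s m) (s n).
Proof.
move=> pU ooU H; have /choice[A AP] : forall k, exists A, U A /\ forall m n, A m -> A n -> P k m n.
  by move=> k; have [A UA PA] := H k; exists A.
pose B k := \bigcap_(j in [set j | (j <= k)%N]) A j.
have UB k : U (B k).
  elim: k => [|k IH].
    by apply: filterS (AP 0%N).1 => n An j /=; rewrite leqn0 => /eqP ->.
  apply: filterS (filterI IH (AP k.+1).1) => n [Bn An] j /=.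
  by rewrite leq_eqVlt => /predU1P[->//|]; rewrite ltnS; exact: Bn.
have /choice[f fP] : forall kN : nat * nat, exists n, (kN.2 <= n)%N /\ B kN.1 n.
  move=> [k N] /=.
  have UN : U [set n | (N <= n)%N] by apply: ooU; exists N.
  by have [n [h1 h2]] := filter_ex (filterI UN (UB k)); exists n.
pose s := fix s k := if k is j.+1 then f (k, (s j).+1) else f (0%N, 0%N).
have sB k : B k (s k) by case: k => [|k]; [exact: (fP (0%N, 0%N)).2|exact: (fP (k.+1, (s k).+1)).2].
have sS k : (s k < s k.+1)%N by exact: (fP (k.+1, (s k).+1)).1.
exists s; split; first by apply: homo_ltn => //; exact: ltn_trans.
move=> k m n km kn; apply: (AP k).2; [exact: (sB m)|exact: (sB n)].
Qed.

Definition near_cells (K : nat) : seq (int * int) :=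
  [seq (k%:Z - K%:Z, l%:Z - K%:Z) | k <- iota 0 (2 * K), l <- iota 0 (2 * K)].

Lemma near_cellsP (K : nat) (i j : int) : ~~ ((K <= `|i|)%N || (K <= `|j|)%N) -> (i, j) \in near_cells K.
Proof.
move=> near; apply/allpairsP; exists (`|(i + K%:Z)%R|%N, `|(j + K%:Z)%R|%N); split.
- by rewrite mem_iota /=; lia.
- by rewrite mem_iota /=; lia.
- by congr pair => /=; lia.
Qed.

Section Compactness.
Context {R : realType}.
Local Notation mu2 := (lebesgue2 R).
Local Notation H := (@half_plane R).
Local Notation nsqH := (nsq mu2 H).
Local Notation pnpH := (pnp mu2 H).
Implicit Types (phi psi u v : R * R -> R) (x : R * R) (h : R) (i j : int).
Let mH := @measurable_half_plane R.

Section Average.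
Variables (a c h : R).
Hypothesis h0 : 0 < h.
Let ha : a <= a + h. Proof. by rewrite lerDl ltW. Qed.
Let hc : c <= c + h. Proof. by rewrite lerDl ltW. Qed.
Let Q := rect a (a + h) c (c + h).
Let mQ := @measurable_rect R a (a + h) c (c + h).
Let one : R * R -> R := fun=> 1.
Let Lone : L2 mu2 Q one.
Proof. by apply: continuous_L2_rect => // x; exact: cvg_cst. Qed.

Lemma average_sub phi psi : continuous phi -> continuous psi ->
  average (fun x => phi x - psi x) a c h = average phi a c h - average psi a c h.
Proof.
move=> cp cs; have Lp := continuous_L2_rect ha hc cp; have Ls := continuous_L2_rect ha hc cs.
rewrite /average -mulrBr; congr (_ * _).
transitivity (ip mu2 Q (fun x => phi x + (-1) * psi x) one).
  by congr ip; apply/funext => x; rewrite mulN1r.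
by rewrite (ipDl mQ Lp (L2Z mQ _ Ls) Lone) (ipZl mQ _ Ls Lone) mulN1r.
Qed.

Lemma average_sq_le phi : continuous phi -> average phi a c h ^+ 2 * h ^+ 2 <= nsq mu2 Q phi.
Proof.
move=> cp; have Lp := continuous_L2_rect ha hc cp.
have h20 : 0 < h ^+ 2 by exact: exprn_gt0.
have := ip_CS mQ Lp Lone.
have -> : nsq mu2 Q one = h ^+ 2 by rewrite nsq_rect_cst// expr1n mul1r.
rewrite /average => K; rewrite exprMn -(ler_pM2r h20).
have -> : (h ^+ 2)^-1 ^+ 2 * ip mu2 (rect a (a + h) c (c + h)) phi (fun=> 1) ^+ 2 * h ^+ 2 * h ^+ 2 =
    ip mu2 (rect a (a + h) c (c + h)) phi (fun=> 1) ^+ 2.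
  by field; rewrite gt_eqF.
exact: K.
Qed.

Lemma average_sq_le_nsq phi : test_function phi -> average phi a c h ^+ 2 * h ^+ 2 <= nsqH phi.
Proof.
move=> tp; have cp := test_continuous tp; apply: (le_trans (average_sq_le cp)).
rewrite -lee_fin (nsqE mQ (continuous_L2_rect ha hc cp)) (nsq_test tp).
apply: ge0_subset_integral; [exact: mQ|exact: measurableT| |by move=> x _; rewrite lee_fin sqr_ge0|by []].
by apply/measurable_EFinP; apply: measurable_funX; exact: continuous_measurable2.
Qed.

(** By Jensen the squared average times [h ^ 2] is at most the integral of [phi ^ 2] over the
    square, and [far_test] applies with [2 * h] as a bound for the diameter. *)
Lemma average_far phi rho : test_function phi -> 0 < rho ->
  (forall x, Q x -> rho ^+ 2 <= x.1 ^+ 2 + x.2 ^+ 2) ->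
  average phi a c h ^+ 2 * h ^+ 2 <=
  2 * (2 * h / (rho * cos 1)) * (2 * nsqH phi + nsqH (dth phi)).
Proof.
move=> tp r0 Qr; have cp := test_continuous tp; apply: (le_trans (average_sq_le cp)).
have d0 : 0 < 2 * h by exact: mulr_gt0.
have Qd x y : Q x -> Q y -> (x.1 - y.1) ^+ 2 + (x.2 - y.2) ^+ 2 <= (2 * h) ^+ 2.
  move=> [/= + +] [/= + +]; rewrite !in_itv /= => /andP[? ?] /andP[? ?] /andP[? ?] /andP[? ?].
  have s1 : (x.1 - y.1) ^+ 2 <= h ^+ 2 by nra.
  have s2 : (x.2 - y.2) ^+ 2 <= h ^+ 2 by nra.
  by nra.
have F := far_test tp mQ d0 r0 Qd Qr.
rewrite -lee_fin (nsqE mQ (continuous_L2_rect ha hc cp)); apply: (le_trans F).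
rewrite [leRHS]EFinM; apply: lee_wpmul2l.
  by rewrite lee_fin !mulr_ge0 ?invr_ge0 ?mulr_ge0 ?(ltW h0) ?(ltW r0)// ltW// cos1_gt0.
have td := test_dth tp.
have mT : measurable (setT : set (measurableTypeR R * measurableTypeR R)) by exact: measurableT.
have ms (f : R * R -> R) : continuous f -> measurable_fun setT (fun x : R * R => f x ^+ 2).
  by move=> cf; apply: measurable_funX; exact: continuous_measurable2.
have h2 : 0 <= (2 : R) by [].
have K := ge0_integral_lin2 mu2 mT h2 ler01 (fun x _ => sqr_ge0 (phi x)) (fun x _ => sqr_ge0 (dth phi x))
  (ms _ cp) (ms _ (test_continuous td)).
rewrite EFinD EFinM (nsq_test tp) (nsq_test td) -[X in (_ <= _ + X)%E]mul1e -K.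
rewrite le_eqVlt; apply/orP; left; apply/eqP.
by apply: eq_integral => x _; rewrite mul1r.
Qed.

End Average.

(** One unit is lost in [K.-1] because of negative indices: cell [k] extends up to [(k + 1) * h],
    which is closer to 0 than [k * h]. *)
Lemma far_cell h (K : nat) i j (x : R * R) : 0 < h -> (0 < K)%N -> (K <= `|i|)%N || (K <= `|j|)%N ->
  rect (i%:~R * h) (i%:~R * h + h) (j%:~R * h) (j%:~R * h + h) x ->
  (K.-1%:R * h) ^+ 2 <= x.1 ^+ 2 + x.2 ^+ 2.
Proof.
move=> h0 K0 ij [/= + +]; rewrite !in_itv /= => x1 x2.
have key k (t : R) : (K <= `|k|)%N -> k%:~R * h <= t <= k%:~R * h + h -> (K.-1%:R * h) ^+ 2 <= t ^+ 2.
  move=> Kk /andP[t1 t2].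
  have r0 : 0 <= K.-1%:R * h by rewrite mulr_ge0// ltW.
  have [k0|k0] := leP 0 k.
    have : (K.-1%:R : R) <= k%:~R.
      by rewrite -(gez0_abs k0) -pmulrn ler_nat; lia.
    by move=> /(ler_wpM2r (ltW h0)) h2; rewrite ler_pXn2r ?nnegrE//; lra.
  have : k%:~R + 1 <= - (K.-1%:R : R).
    have -> : k%:~R + 1 = (k + 1)%:~R :> R by rewrite intrD.
    have -> : - (K.-1%:R : R) = (- (K.-1)%:Z)%:~R by rewrite mulrNz.
    by rewrite ler_int; lia.
  move=> /(ler_wpM2r (ltW h0)); rewrite mulrDl mul1r mulNr => h2.
  by rewrite -(sqrrN t) ler_pXn2r ?nnegrE//; lra.
case/orP: ij => [Ki|Kj].
  by apply: (le_trans (key _ _ Ki x1)); rewrite lerDl sqr_ge0.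
by apply: (le_trans (key _ _ Kj x2)); rewrite lerDr sqr_ge0.
Qed.

Lemma qformB_le b c u v : 0 <= b -> 0 <= c -> Hplus u -> Hplus v ->
  qform b c (u \- v) <= 2 * qform b c u + 2 * qform b c v.
Proof.
move=> b0 c0 Hu Hv; have := qform_ge0 (u \+ v) b0 c0.
rewrite (qformB b c Hu Hv) (qformD b c Hu Hv); lra.
Qed.

Lemma sum3_le (r s t N : R) : 0 <= r -> 0 <= s -> 0 <= t -> r + s + t <= N -> r + s <= N /\ t <= N.
Proof. by move=> *; split; lra. Qed.

Lemma test_bounds (f : R * R -> R) (N : R) : test_function f -> qform 1 0 f <= N ->
  [/\ nsqH f <= pi ^+ 2 * N, nsqH (dth f) <= N & nsqH ('D_e1 f) + nsqH ('D_e2 f) <= N].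
Proof.
move=> tf; rewrite (qform_test 1 0 tf) mul1r mul0r addr0 => q.
have P3 := poincare_nsq tf.
have n1 := @nsq_ge0 _ _ _ mu2 H ('D_e1 f); have n2 := @nsq_ge0 _ _ _ mu2 H ('D_e2 f).
have n3 := @nsq_ge0 _ _ _ mu2 H (dth f).
have [d12 d3] := sum3_le n1 n2 n3 q.
split; [|exact: d3|exact: d12].
by apply: (le_trans P3); apply: ler_wpM2l; [exact: sqr_ge0|exact: d3].
Qed.

Lemma rellich_aux (h al k q m : R) : 0 < h -> 0 < al -> 0 < k -> 0 < q -> 0 < m ->
  2 * (2 * h / (4 * q * m / (k * al ^+ 2 * h) * k)) * (q * m) = al ^+ 2 * h ^+ 2.
Proof. by move=> h0 a0 k0 q0 m0; field; rewrite !gt_eqF. Qed.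

(** The constants are tuned so that each of the three terms of [pnp_average_le] is at most [e / 4].
    The shifts [M + 1] and [P + 1] keep the denominators positive. *)
Lemma rellich_aux2 (e M P q s t g : R) : 0 < e -> 0 <= M -> 0 <= P -> 0 < q ->
  s <= q * (4 * M) -> t <= P -> g <= 4 * M ->
  e / (16 * (q * (M + 1))) * s + e / (4 * (P + 1)) * t +
  (e / (4 * (P + 1)))^-1 * (2 * (e / (4 * (P + 1)) * e / (32 * (M + 1)))) * g <= e.
Proof.
move=> e0 M0 P0 q0 sq tP gM.
have M1 : 0 < M + 1 by rewrite ltr_wpDl.
have P1 : 0 < P + 1 by rewrite ltr_wpDl.
have b1 : e / (16 * (q * (M + 1))) * s <= e / 4.
  apply: (@le_trans _ _ (e / (16 * (q * (M + 1))) * (q * (4 * (M + 1))))).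
    apply: ler_wpM2l; first by apply: ltW; apply: divr_gt0 => //; apply: mulr_gt0 => //; exact: mulr_gt0.
    by apply: (le_trans sq); apply: ler_wpM2l; [exact: ltW|lra].
  by rewrite le_eqVlt; apply/orP; left; apply/eqP; field; rewrite !gt_eqF.
have b2 : e / (4 * (P + 1)) * t <= e / 4.
  apply: (@le_trans _ _ (e / (4 * (P + 1)) * (P + 1))).
    by apply: ler_wpM2l; [apply: ltW; apply: divr_gt0 => //; exact: mulr_gt0|lra].
  by rewrite le_eqVlt; apply/orP; left; apply/eqP; field; rewrite gt_eqF.
have b3 : (e / (4 * (P + 1)))^-1 * (2 * (e / (4 * (P + 1)) * e / (32 * (M + 1)))) * g <= e / 4.
  have -> : (e / (4 * (P + 1)))^-1 * (2 * (e / (4 * (P + 1)) * e / (32 * (M + 1)))) = e / (16 * (M + 1)).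
    by field; rewrite !gt_eqF.
  apply: (@le_trans _ _ (e / (16 * (M + 1)) * (4 * (M + 1)))).
    by apply: ler_wpM2l; [apply: ltW; apply: divr_gt0 => //; exact: mulr_gt0|lra].
  by rewrite le_eqVlt; apply/orP; left; apply/eqP; field; rewrite gt_eqF.
lra.
Qed.

Lemma rellich_radius_gt0 (h al k q M : R) : 0 < h -> 0 < al -> 0 < k -> 0 < q -> 0 <= M ->
  0 < 4 * (2 * q + 1) * (4 * M + 1) / (k * al ^+ 2 * h).
Proof.
move=> h0 a0 k0 q0 M0; have q1 : 0 < 2 * q + 1 by lra.
have M1 : 0 < 4 * M + 1 by lra.
by rewrite divr_gt0// !mulr_gt0// exprn_gt0.
Qed.

Lemma rellich_aux3 (q M s t : R) : 0 < q -> 0 <= M -> s <= q * (4 * M) -> t <= 4 * M ->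
  2 * s + t <= (2 * q + 1) * (4 * M + 1).
Proof. by nra. Qed.

(** [pnp_average_le] is applied to differences of members of the sequence. Far from the origin their
    averages are small by [average_far], uniformly in the sequence. Only finitely many cells remain,
    and on these the ultrafilter makes the averages nearly constant. *)
Lemma rellich_ultra p (phi : nat -> R * R -> R) (M : R) (U : set_system nat) : UltraFilter U ->
  2 < p -> (forall n, test_function (phi n)) -> (forall n, qform 1 0 (phi n) <= M) ->
  forall e, 0 < e -> exists2 A, U A &
    forall m n, A m -> A n -> pnpH p (fun x => phi m x - phi n x) <= e.
Proof.
move=> uU p2 tp qM e e0.
have M0 : 0 <= M := le_trans (qform_ge0 (phi 0%N) ler01 (lexx 0)) (qM 0%N).
have Hp n : Hplus (phi n) := (test_Hplus (tp n)).1.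
have p22 : 2 <= 2 * p - 2 by lra.
have [C C0 CP] := sobolev_Hplus p22.
have qd m n : qform 1 0 (fun x => phi m x - phi n x) <= 4 * M.
  apply: (le_trans (qformB_le ler01 (lexx 0) (Hp m) (Hp n))).
  by have := qM m; have := qM n; lra.
have td m n : test_function (fun x => phi m x - phi n x) by exact: test_sub.
have Hd m n : Hplus (fun x => phi m x - phi n x) := (test_Hplus (td m n)).1.
pose P := (C * Num.sqrt (4 * M)) `^ (2 * p - 2).
have P0 : 0 <= P by exact: powR_ge0.
have Pd m n : pnpH (2 * p - 2) (fun x => phi m x - phi n x) <= P.
  have [_ le] := CP _ (Hd m n).
  rewrite -pn_pow; last by rewrite gt_eqF//; lra.
  apply: ge0_ler_powR; rewrite ?nnegrE ?pn_ge0 ?mulr_ge0 ?sqrtr_ge0 ?(ltW C0)//; first lra.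
  by apply: (le_trans le); apply: ler_wpM2l; [exact: ltW|apply: ler_wsqrtr; exact: qd].
have M1 : 0 < M + 1 by rewrite ltr_wpDl.
have P1 : 0 < P + 1 by rewrite ltr_wpDl.
(* The parameters depend on each other in this order: [d] tames the term with exponent [2 * p - 2],
   then [h] the gradient term. The bound [al] on the averages is fixed by the L^2 term, and [rho] is
   the distance beyond which [average_far] guarantees that bound. *)
pose d := e / (4 * (P + 1)).
have d0 : 0 < d by rewrite divr_gt0// mulr_gt0.
pose h := Num.sqrt (d * e / (32 * (M + 1))).
have hh : 0 < d * e / (32 * (M + 1)) by apply: divr_gt0; apply: mulr_gt0.
have h0 : 0 < h by rewrite sqrtr_gt0.
have hE : h ^+ 2 = d * e / (32 * (M + 1)) by rewrite sqr_sqrtr// ltW.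
have pi2 : 0 < (pi : R) ^+ 2 by rewrite exprn_gt0// pi_gt0.
pose be := (e / (16 * (pi ^+ 2 * (M + 1)))) `^ (p - 2)^-1.
have bb : 0 < e / (16 * (pi ^+ 2 * (M + 1))) by apply: divr_gt0 => //; apply: mulr_gt0 => //; exact: mulr_gt0.
have be0 : 0 < be by exact: powR_gt0.
have beE : be `^ (p - 2) = e / (16 * (pi ^+ 2 * (M + 1))).
  by rewrite -powRrM mulVf ?powRr1// ?(ltW bb)// gt_eqF//; lra.
pose al := be / 2.
have al0 : 0 < al by rewrite divr_gt0.
have al2 : 2 * al = be by rewrite /al mulrC divfK// pnatr_eq0.
have nsqM := test_bounds.
have k0 := @cos1_gt0 R.
pose rho := 4 * (2 * pi ^+ 2 + 1) * (4 * M + 1) / (cos 1 * al ^+ 2 * h).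
have rho0 : 0 < rho := rellich_radius_gt0 h0 al0 k0 pi2 M0.
(* The successor is taken twice because [far_cell] loses one unit and [K.-1] must still exceed
   [rho / h]. *)
pose K := (Num.truncn (rho / h)).+2.
have Krho : rho <= K.-1%:R * h.
  by rewrite -ler_pdivrMr//; apply: ltW; exact: truncnS_gt.
have far i j m n : (K <= `|i|)%N || (K <= `|j|)%N ->
    `|average (fun x => phi m x - phi n x) (i%:~R * h) (j%:~R * h) h| <= al.
  move=> ij.
  have Qr x : rect (i%:~R * h) (i%:~R * h + h) (j%:~R * h) (j%:~R * h + h) x -> rho ^+ 2 <= x.1 ^+ 2 + x.2 ^+ 2.
    move=> Qx; apply: le_trans (far_cell h0 _ ij Qx); last by [].
    have r1 : 0 <= rho by exact: ltW.
    have r2 : 0 <= K.-1%:R * h := le_trans r1 Krho.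
    by rewrite ler_pXn2r ?nnegrE.
  have F := average_far h0 (td m n) rho0 Qr.
  have [N1 N2 _] := nsqM _ _ (td m n) (qd m n).
  rewrite -(ler_pXn2r (n := 2)) ?nnegrE ?normr_ge0 ?(ltW al0)// real_normK ?num_real//.
  rewrite -(ler_pM2r (exprn_gt0 2 h0)); apply: (le_trans F).
  move: N1 N2; move: (nsqH _) (nsqH _) => s t N1 N2.
  have c1 : 0 <= 2 * (2 * h / (rho * cos 1)).
    by apply: ltW; apply: mulr_gt0 => //; apply: divr_gt0; exact: mulr_gt0.
  apply: (@le_trans _ _ (2 * (2 * h / (rho * cos 1)) * ((2 * pi ^+ 2 + 1) * (4 * M + 1)))).
    by apply: ler_wpM2l; [exact: c1|exact: rellich_aux3 pi2 M0 N1 N2].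
  rewrite le_eqVlt; apply/orP; left; apply/eqP; apply: rellich_aux; [exact: h0|exact: al0|exact: k0| |].
    by rewrite ltr_wpDl// mulr_ge0// ltW.
  by rewrite ltr_wpDl// mulr_ge0.
have bdd (ij : int * int) n : `|average (phi n) (ij.1%:~R * h) (ij.2%:~R * h) h| <= Num.sqrt (pi ^+ 2 * M) / h.
  have [N1 _ _] := nsqM _ _ (tp n) (qM n).
  rewrite ler_pdivlMr// -[leLHS]ger0_norm; last by rewrite mulr_ge0// ltW.
  rewrite -sqrtr_sqr; apply: ler_wsqrtr; rewrite exprMn real_normK ?num_real//.
  by apply: le_trans N1; exact: average_sq_le_nsq.
(* Bounded averages over the finitely many near cells, all made almost constant on a single set of
   the ultrafilter. *)
have [A UA HA] := @ultra_small_seq R U uU _ (near_cells K)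
  (fun ij n => average (phi n) (ij.1%:~R * h) (ij.2%:~R * h) h) (Num.sqrt (pi ^+ 2 * M) / h) al bdd al0.
exists A => // m n Am An.
have avg_le i j : `|average (fun x => phi m x - phi n x) (i%:~R * h) (j%:~R * h) h| <= al.
  have [|near] := boolP ((K <= `|i|)%N || (K <= `|j|)%N); first exact: far.
  rewrite average_sub//; try exact: test_continuous.
  by apply: (HA (i, j)) => //; exact: near_cellsP.
have Lq := (CP _ (Hd m n)).1.
apply: (le_trans (pnp_average_le p2 h0 d0 (td m n) avg_le Lq)).
have [N1 _ G4] := nsqM _ _ (td m n) (qd m n).
have Pm := Pd m n.
rewrite al2 beE hE; exact: rellich_aux2 e0 M0 P0 pi2 N1 Pm G4.
Qed.

Lemma rellich_test p (phi : nat -> R * R -> R) (M : R) : 2 < p ->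
  (forall n, test_function (phi n)) -> (forall n, qform 1 0 (phi n) <= M) ->
  exists s : nat -> nat, {homo s : m n / (m < n)%N} /\
    forall k m n, (k <= m)%N -> (k <= n)%N ->
      pnpH p (fun x => phi (s m) x - phi (s n) x) <= k.+1%:R^-1.
Proof.
move=> p2 tp qM; have [U [uU ooU]] := @ultraFilterLemma nat \oo _.
apply: (@diagonal_subseq (fun k m n => pnpH p (fun x => phi m x - phi n x) <= k.+1%:R^-1) U) => //.
move=> k; apply: (rellich_ultra uU p2 tp qM); by rewrite invr_gt0.
Qed.

End Compactness.

(** * Compactness in H^+ and the minimization problem *)

Section Variational.
Context {R : realType}.
Local Notation mu2 := (lebesgue2 R).
Local Notation H := (@half_plane R).
Local Notation nsqH := (nsq mu2 H).
Local Notation LpH := (Lp mu2 H).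
Local Notation pnpH := (pnp mu2 H).
Local Notation pnH := (pn mu2 H).
Implicit Types (phi psi u v w h : R * R -> R) (x : R * R) (p b c : R).
Let mH := @measurable_half_plane R.

Lemma Hplus_dense_qform u e : Hplus u -> 0 < e ->
  exists2 phi, test_function phi & qform 1 1 (u \- phi) < e.
Proof.
move=> Hu e0; have [phi [tp p0]] := Hplus_dense Hu.
have Hp n : Hplus (phi n) := (test_Hplus (tp n)).1.
have tL i n : L2 mu2 H (test_component i (phi n)) by apply: test_L2; exact: test_test_component.
have E i n : component_ip i (u \- phi n) (u \- phi n) =
    nsqH (fun x => test_component i (phi n) x - component i u x).
  have [_ /(_ i) h1] := Hplus_lin (-1) Hu (Hp n).
  have [_ /(_ i) h2] := test_Hplus (tp n).
  have L1 := Hplus_L2 i (HplusB Hu (Hp n)).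
  have L2' : L2 mu2 H (fun x => component i u x - test_component i (phi n) x).
    by apply: L2B; [exact: mH|exact: Hplus_L2|exact: tL].
  rewrite cip_nsq nsqBC.
  have ae : {ae mu2, forall x, H x -> component i (u \- phi n) x = component i u x - test_component i (phi n) x}.
    move: h1; rewrite (_ : (fun x => u x + -1 * phi n x) = u \- phi n); last by apply/funext => x; rewrite mulN1r.
    by move=> h1; apply: ae_imp2 h1 h2 => x k1 k2 Hx; rewrite (k1 Hx) (k2 Hx) mulN1r.
  exact: (ae_eq_ip mH L1 L2' L1 L2' ae ae).
have lim : qform 1 1 (u \- phi n) @[n --> \oo] --> (0 : R).
  have -> : (fun n => qform 1 1 (u \- phi n)) = (fun n =>
    nsqH (fun x => test_component Idx (phi n) x - component Idx u x) +
    nsqH (fun x => test_component Idy (phi n) x - component Idy u x) +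
    1 * nsqH (fun x => test_component Idth (phi n) x - component Idth u x) +
    1 * nsqH (fun x => test_component Ifun (phi n) x - component Ifun u x)).
    by apply/funext => n; rewrite /qform /form (E Idx) (E Idy) (E Idth) (E Ifun).
  have z : (0 : R) = 0 + 0 + 1 * 0 + 1 * 0 by rewrite !mulr0 !addr0.
  rewrite [X in _ --> X]z; apply: cvgD; last by apply: cvgMr; exact: (p0 Ifun).
  apply: cvgD; last by apply: cvgMr; exact: (p0 Idth).
  by apply: cvgD; [exact: (p0 Idx)|exact: (p0 Idy)].
have [N _ hN] := cvgr_lt _ lim _ e0.
by exists (phi N) => //; exact: (hN N (leqnn N)).
Qed.

Lemma pn_qnorm p : 2 <= p -> exists2 C : R, 0 < C &
  forall u, Hplus u -> pnH p u <= C * qnorm 1 0 u.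
Proof. by move=> p2; have [C C0 h] := sobolev_Hplus p2; exists C => // u /h[]. Qed.

Lemma Hplus_Lp p u : 2 <= p -> Hplus u -> LpH p u.
Proof. by move=> p2 Hu; have [C _ /(_ u Hu)[]] := sobolev_Hplus p2. Qed.

Lemma pnD p u v : 2 <= p -> Hplus u -> Hplus v -> pnH p (u \+ v) <= pnH p u + pnH p v.
Proof.
move=> p2 Hu Hv; have p1 : 1 <= p by lra.
exact: (LpD mH p1 (Hplus_Lp p2 Hu) (Hplus_Lp p2 Hv)).2.
Qed.

Lemma pnB p u v : 2 <= p -> Hplus u -> Hplus v -> `|pnH p u - pnH p v| <= pnH p (u \- v).
Proof.
move=> p2 Hu Hv; have p1 : 1 <= p by lra.
have h1 := (pnB_ge mH p1 (Hplus_Lp p2 Hu) (Hplus_Lp p2 Hv)).2.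
have h2 := (pnB_ge mH p1 (Hplus_Lp p2 Hv) (Hplus_Lp p2 Hu)).2.
rewrite pnBC in h2; rewrite ler_norml; apply/andP; split; last exact: h1.
by rewrite lerNl opprB; exact: h2.
Qed.

Lemma rellich_Hplus p (w : nat -> R * R -> R) (M : R) : 2 < p -> (forall n, Hplus (w n)) ->
  (forall n, qform 1 0 (w n) <= M) ->
  exists s : nat -> nat, {homo s : m n / (m < n)%N} /\
    forall e, 0 < e -> exists N, forall m n, (N <= m)%N -> (N <= n)%N ->
      pnH p (w (s m) \- w (s n)) <= e.
Proof.
move=> p2 Hw wM; have p22 : 2 <= p by exact: ltW.
have [C C0 CP] := pn_qnorm p22.
have /choice[phi phiP] : forall n : nat, exists phi, test_function phi /\
    qform 1 1 (w n \- phi) < n.+1%:R^-1 ^+ 2.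
  move=> n; have [|phi tp lt] := @Hplus_dense_qform (w n) (n.+1%:R^-1 ^+ 2) (Hw n).
    by rewrite exprn_gt0// invr_gt0.
  by exists phi.
have tp n := (phiP n).1; have Hp n : Hplus (phi n) := (test_Hplus (tp n)).1.
have d n : qnorm 1 0 (w n \- phi n) <= n.+1%:R^-1.
  rewrite -(ler_pXn2r (n := 2)) ?nnegrE ?qnorm_ge0 ?invr_ge0// sqr_qnorm//.
  by apply: ltW; apply: le_lt_trans (phiP n).2; apply: qform_le.
have pM n : qform 1 0 (phi n) <= 2 * M + 2.
  have E : phi n = w n \- (w n \- phi n) by apply/funext => x /=; rewrite opprB addrC subrK.
  rewrite E; apply: (le_trans (qformB_le ler01 (lexx 0) (Hw n) (HplusB (Hw n) (Hp n)))).
  have d2 : qform 1 0 (w n \- phi n) <= 1.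
    rewrite -(sqr_qnorm ler01 (lexx 0)); apply: exprn_ile1; first exact: qnorm_ge0.
    by apply: (le_trans (d n)); rewrite invf_le1// ler1n.
  by have := wM n; lra.
have [s [sm sP]] := rellich_test p2 tp pM.
exists s; split => // e e0.
pose r (k : nat) := 2 * (C * k.+1%:R^-1) + `|k.+1%:R^-1 : R| `^ p^-1.
have rlim : r k @[k --> \oo] --> (0 : R).
  have z : (0 : R) = 2 * (C * 0) + `|0 : R| `^ p^-1.
    by rewrite !mulr0 add0r normr0 powR0// invr_neq0// gt_eqF//; lra.
  rewrite [X in _ --> X]z; apply: cvgD.
    by apply: cvgMr; apply: cvgMr; exact: cvg_harmonic.
  by apply: normpow_cvg; [rewrite invr_gt0; lra|exact: cvg_harmonic].
have [N _ /(_ N (leqnn N)) /= hN] := cvgr_lt _ rlim _ e0.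
exists N => m n Nm Nn; apply: le_trans (ltW hN).
have ms k : (k <= s k)%N.
  by elim: k => // k IH; apply: (leq_ltn_trans IH); exact: sm.
have tail k : (N <= k)%N -> pnH p (w (s k) \- phi (s k)) <= C * N.+1%:R^-1.
  move=> Nk; apply: (le_trans (CP _ (HplusB (Hw _) (Hp _)))); apply: ler_wpM2l; first exact: ltW.
  apply: (le_trans (d _)); rewrite lef_pV2 ?posrE// ler_nat ltnS.
  exact: leq_trans Nk (ms k).
have E : w (s m) \- w (s n) = (w (s m) \- phi (s m)) \+
    ((phi (s m) \- phi (s n)) \- (w (s n) \- phi (s n))).
  by apply/funext => x /=; lra.
have H1 := HplusB (Hw (s m)) (Hp (s m)); have H2 := HplusB (Hp (s m)) (Hp (s n)).
have H3 := HplusB (Hw (s n)) (Hp (s n)).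
rewrite E; apply: (le_trans (pnD p22 H1 (HplusB H2 H3))).
have mid : pnH p (phi (s m) \- phi (s n)) <= `|N.+1%:R^-1 : R| `^ p^-1.
  rewrite pnE ger0_norm ?invr_ge0//; apply: ge0_ler_powR; rewrite ?nnegrE ?pnp_ge0 ?invr_ge0//; first lra.
  exact: sP.
have b3 : pnH p ((phi (s m) \- phi (s n)) \- (w (s n) \- phi (s n))) <=
    pnH p (phi (s m) \- phi (s n)) + pnH p (w (s n) \- phi (s n)).
  have p0 : 0 < p by exact: lt_trans p2.
  have := pnD p22 H2 (HplusZ (-1) H3); rewrite (pnZ mH (-1) p0 (Hplus_Lp p22 H3)).
  rewrite normrN1 mul1r.
  rewrite (_ : _ \+ _ = (phi (s m) \- phi (s n)) \- (w (s n) \- phi (s n)))//.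
  by apply/funext => x /=; rewrite mulN1r.
apply: (le_trans (lerD (tail m Nm) b3)).
apply: (le_trans (lerD (lexx _) (lerD mid (tail n Nn)))).
by rewrite /r mulr2n mulrDl !mul1r addrA addrAC.
Qed.

Lemma qform_null b c (w : nat -> R * R -> R) v : 0 <= b -> 0 <= c ->
  (forall n, Hplus (w n)) -> Hplus v ->
  qform 1 1 (w n \- v) @[n --> \oo] --> (0 : R) -> qform b c (w n \- v) @[n --> \oo] --> (0 : R).
Proof.
move=> b0 c0 Hw Hv lim; have K0 : 0 <= 1 + b + c * pi ^+ 2.
  by apply: addr_ge0; [exact: addr_ge0|apply: mulr_ge0 => //; exact: sqr_ge0].
apply: (@squeeze_cvgr _ _ _ _ (fun=> 0) (fun n => (1 + b + c * pi ^+ 2) * qform 1 1 (w n \- v))).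
- apply: nearW => n; apply/andP; split; first exact: qform_ge0.
  apply: (le_trans (qform_le10 (HplusB (Hw n) Hv) b0 c0)); apply: ler_wpM2l => //.
  exact: qform_le.
- exact: cvg_cst.
- by rewrite -[X in _ --> X](mulr0 (1 + b + c * pi ^+ 2)); apply: cvgMr.
Qed.

Lemma pn_cvg p (w : nat -> R * R -> R) v : 2 <= p -> (forall n, Hplus (w n)) -> Hplus v ->
  qform 1 1 (w n \- v) @[n --> \oo] --> (0 : R) -> pnH p (w n) @[n --> \oo] --> pnH p v.
Proof.
move=> p2 Hw Hv lim; have [C C0 CP] := pn_qnorm p2.
have lim0 := qform_null ler01 (lexx 0) Hw Hv lim.
apply/subr_cvg0; apply/norm_cvg0P.
apply: (@squeeze_cvgr _ _ _ _ (fun=> 0) (fun n => C * qnorm 1 0 (w n \- v))).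
- apply: nearW => n; apply/andP; split; first exact: normr_ge0.
  exact: (le_trans (pnB p2 (Hw n) Hv) (CP _ (HplusB (Hw n) Hv))).
- exact: cvg_cst.
- have z : (0 : R) = C * Num.sqrt 0 by rewrite sqrtr0 mulr0.
  rewrite [X in _ --> X]z; apply: cvgMr; apply: (continuous_cvg _ _ lim0); exact: sqrt_continuous.
Qed.

Section Level.
Variables (p b c : R).
Hypotheses (p2 : 2 < p) (b0 : 0 < b) (c0 : 0 <= c).
Let p22 : 2 <= p. Proof. exact: ltW. Qed.
Let p0 : 0 < p. Proof. exact: lt_trans p2. Qed.
Let b00 : 0 <= b. Proof. exact: ltW. Qed.
Local Notation Q := (qform b c).

Lemma qform10_le u : qform 1 0 u <= (1 + b^-1) * Q u.
Proof.
have bV : 0 < b^-1 by rewrite invr_gt0.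
have n1 := cip_ge0 Idx u; have n2 := cip_ge0 Idy u; have n3 := cip_ge0 Idth u; have n0 := cip_ge0 Ifun u.
rewrite /qform /form mul1r mul0r addr0.
have e : b^-1 * (b * component_ip Idth u u) = component_ip Idth u u by rewrite mulrA mulVf ?mul1r// gt_eqF.
rewrite mulrDl mul1r 3!mulrDr e.
have m1 := mulr_ge0 (ltW bV) n1; have m2 := mulr_ge0 (ltW bV) n2.
have m3 := mulr_ge0 b00 n3; have m4 := mulr_ge0 c0 n0; have m5 := mulr_ge0 (ltW bV) m4.
lra.
Qed.

Definition sphere := [set u | Hplus u /\ pnH p u = 1].

(** The minimal Sobolev quotient, that is, the best constant in [level_le]. Over an empty sphere the
    infimum has the value 0. *)
Definition level := inf [set Q u | u in sphere].

Let lb : lbound [set Q u | u in sphere] 0.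
Proof. by move=> _ [u _ <-]; exact: qform_ge0. Qed.

Lemma normalize u : Hplus u -> pnH p u != 0 -> sphere (fun x => (pnH p u)^-1 * u x).
Proof.
move=> Hu u0; split; first exact: HplusZ.
by rewrite (pnZ mH _ p0 (Hplus_Lp p22 Hu)) normfV ger0_norm ?pn_ge0// mulVf.
Qed.

Lemma level_le u : Hplus u -> level * pnH p u ^+ 2 <= Q u.
Proof.
move=> Hu; have [->|u0] := eqVneq (pnH p u) 0; first by rewrite expr0n mulr0 qform_ge0.
have su := normalize Hu u0.
have k : level <= Q (fun x => (pnH p u)^-1 * u x).
  by apply: ge_inf; [exists 0; exact: lb|exists (fun x => (pnH p u)^-1 * u x)].
move: k; rewrite (qformZ b c _ Hu) exprVn mulrC ler_pdivlMr//.
by rewrite exprn_gt0// lt_neqAle eq_sym u0 pn_ge0.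
Qed.

Lemma level_ge0 : 0 <= level.
Proof.
have [[y Sy]|S0] := pselect ([set Q u | u in sphere] !=set0).
  by apply: lb_le_inf; [exists y|exact: lb].
by rewrite /level (_ : [set Q u | u in sphere] = set0) ?inf0//; apply/seteqP; split => // y Sy; apply: S0; exists y.
Qed.

Hypothesis nonempty : sphere !=set0.

Lemma level_adherent : exists w : nat -> R * R -> R,
  (forall n, sphere (w n)) /\ Q (w n) @[n --> \oo] --> level.
Proof.
have hi : has_inf [set Q u | u in sphere].
  by split; [case: nonempty => u su; exists (Q u); exists u|exists 0; exact: lb].
have /choice[w wP] : forall n : nat, exists u, sphere u /\ Q u < level + n.+1%:R^-1.
  move=> n; have e0 : 0 < (n.+1%:R^-1 : R) by rewrite invr_gt0.
  by have [_ [u su <-] lt] := inf_adherent e0 hi; exists u.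
exists w; split; first by move=> n; exact: (wP n).1.
apply: (@squeeze_cvgr _ _ _ _ (fun=> level) (fun n => level + n.+1%:R^-1)).
- apply: nearW => n; apply/andP; split; last exact: ltW (wP n).2.
  have [Hw w1] := (wP n).1; have := level_le Hw; rewrite w1 expr1n mulr1; exact.
- exact: cvg_cst.
- rewrite -[X in _ --> X]addr0; apply: cvgD; [exact: cvg_cst|exact: cvg_harmonic].
Qed.

Lemma qform11_le u : Hplus u -> qform 1 1 u <= (1 + 1 + 1 * pi ^+ 2) * (1 + b^-1) * Q u.
Proof.
move=> Hu; apply: (le_trans (qform_le10 Hu ler01 ler01)); rewrite -mulrA.
apply: ler_wpM2l; last exact: qform10_le.
by rewrite mul1r addr_ge0// sqr_ge0.
Qed.

(** Put [d = pnH p (u \- v)]. Since [u + v = 2 * u - (u - v)], its L^p norm is at least [2 - d], so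
    [Q (u \+ v)] is at least [level * (4 - 4 * d)]. A minimizing sequence that is Cauchy in L^p is
    thus Cauchy for [Q], without any appeal to weak limits. *)
Lemma sphere_parallelogram u v : sphere u -> sphere v ->
  Q (u \- v) <= 2 * Q u + 2 * Q v - 4 * level + 4 * level * pnH p (u \- v).
Proof.
move=> [Hu u1] [Hv v1]; have Hs := HplusD Hu Hv; have Hd := HplusB Hu Hv.
have E : u \+ v = (fun x => 2 * u x) \- (u \- v) by apply/funext => x /=; lra.
have H2 := HplusZ 2 Hu.
have k1 := pnB p22 H2 Hd; rewrite -E (pnZ mH 2 p0 (Hplus_Lp p22 Hu)) u1 mulr1 (ger0_norm (ler0n R 2)) in k1.
(* Makes [2 - d] nonnegative, so that the lower bound can be squared. *)
have k2 : pnH p (u \- v) <= 2.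
  have := pnD p22 Hu (HplusZ (-1) Hv); rewrite (pnZ mH (-1) p0 (Hplus_Lp p22 Hv)) normrN1 mul1r u1 v1.
  by rewrite (_ : u \+ _ = u \- v)//; apply/funext => x /=; rewrite mulN1r.
have k3 := level_le Hs; have S0 := level_ge0.
have par : Q (u \- v) = 2 * Q u + 2 * Q v - Q (u \+ v).
  rewrite (qformB b c Hu Hv) (qformD b c Hu Hv); lra.
move: k1 k2 k3; rewrite par ler_norml => /andP[_ k1]; move: (pnH p (u \- v)) (pnH p (u \+ v)) k1 => d s k1 k2 k3.
have ss : (2 - d) ^+ 2 <= s ^+ 2.
  by rewrite ler_pXn2r ?nnegrE//; lra.
have := ler_wpM2l S0 ss; have d2 := mulr_ge0 S0 (sqr_ge0 d).
have -> : level * (2 - d) ^+ 2 = 4 * level - 4 * level * d + level * d ^+ 2 by ring.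
lra.
Qed.

Lemma minimizing_seq_cvg (w : nat -> R * R -> R) : (forall n, sphere (w n)) ->
  Q (w n) @[n --> \oo] --> level ->
  exists (s : nat -> nat) (v : R * R -> R), [/\ {homo s : m n / (m < n)%N},
    sphere v, Q v = level & qform 1 1 (w (s n) \- v) @[n --> \oo] --> (0 : R)].
Proof.
move=> sw Qw.
have lt1 : level < level + 1 by rewrite ltrDl.
have [N0 _ hN0] := cvgr_lt _ Qw _ lt1.
have bV : 0 < 1 + b^-1 by rewrite addr_gt0// invr_gt0.
have [|s0 [s0m s0C]] := @rellich_Hplus p (fun n => w (N0 + n)%N) ((1 + b^-1) * (level + 1)) p2
  (fun n => (sw _).1).
  move=> n; apply: (le_trans (qform10_le _)); apply: ler_wpM2l; first exact: ltW.
  by apply: ltW; apply: hN0; rewrite /= leq_addr.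
pose s n := (N0 + s0 n)%N.
have sm : {homo s : m n / (m < n)%N} by move=> m n mn; rewrite /s ltn_add2l; exact: s0m.
have ms k : (k <= s k)%N.
  by elim: k => // k IH; apply: (leq_ltn_trans IH); exact: sm.
have S0 := level_ge0.
set K := (1 + 1 + 1 * pi ^+ 2) * (1 + b^-1).
have K0 : 0 < K by rewrite mulr_gt0// mul1r ltr_wpDr// sqr_ge0.
have [|v Hv vlim] := @Hplus_complete R (fun n => w (s n)) (fun n => (sw _).1).
  (* [K] is the price of passing from [Q] to [qform 1 1]. The budget [e'] is shared between the
     excess of [Q] over the level and the L^p distance; [level + 1] keeps the denominator
     positive. *)
  move=> e e0; pose e' := e / K; have e'0 : 0 < e' by exact: divr_gt0.
  have d0 : 0 < e' / (8 * (level + 1)) by rewrite divr_gt0// mulr_gt0// ltr_wpDl.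
  have [N1 hN1] := s0C _ d0.
  have lt2 : level < level + e' / 8 by rewrite ltrDl divr_gt0.
  have [N2 _ hN2] := cvgr_lt _ Qw _ lt2.
  exists (maxn N1 N2) => m n; rewrite !geq_max => /andP[m1 m2] /andP[n1 n2].
  apply: (le_trans (qform11_le (HplusB (sw _).1 (sw _).1))); rewrite -/K mulrC -ler_pdivlMr//.
  apply: (le_trans (sphere_parallelogram (sw _) (sw _))).
  have qm := hN2 (s m) (leq_trans m2 (ms m)); have qn := hN2 (s n) (leq_trans n2 (ms n)).
  have dm := hN1 m n m1 n1; rewrite /= in qm qn dm; rewrite -/(s m) -/(s n) in dm.
  have := ler_wpM2l S0 dm.
  have : level * (e' / (8 * (level + 1))) <= e' / 8.
    have -> : level * (e' / (8 * (level + 1))) = (level / (level + 1)) * (e' / 8).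
      by field; rewrite gt_eqF// ltr_wpDl.
    apply: ler_piMl; first by rewrite divr_ge0// ltW.
    by rewrite ler_pdivrMr ?mul1r; lra.
  rewrite -/e'; lra.
exists s, v; split => //.
- split => //; have := pn_cvg p22 (fun n => (sw (s n)).1) Hv vlim.
  have -> : (fun n => pnH p (w (s n))) = (fun=> 1) by apply/funext => n; exact: (sw (s n)).2.
  by move=> h; apply: (cvg_unique (@Rhausdorff R) h); exact: cvg_cst.
- have Qlim := qform_null b00 c0 (fun n => (sw (s n)).1) Hv vlim.
  have := qform_cvg (ltW b0) c0 (fun n => (sw (s n)).1) Hv Qlim.
  have := cvg_sub ms Qw => h1 h2; exact: (cvg_unique (@Rhausdorff R) h2 h1).
Qed.

End Level.

End Variational.

(** * Ground states *)

Section ScalarCalculus.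
Context {R : realType}.
Implicit Types (p : R).

Lemma is_derive_eps (f : R -> R) (x l : R) : is_derive x 1 f l ->
  forall e, 0 < e -> exists2 d, 0 < d & forall y, `|y - x| < d ->
    `|f y - f x - l * (y - x)| <= e * `|y - x|.
Proof.
move=> [df <-] e e0.
have /cvgrPdist_le /(_ e e0) : h^-1 *: (f (h *: (1 : R) + x) - f x) @[h --> 0^'] --> 'D_1 f x.
  by apply: df.
move=> [d /= d0 hd]; exists d => // y yd.
have [->|yx] := eqVneq y x; first by rewrite !subrr mulr0 subr0 normr0 mulr0.
have yx0 : y - x != 0 by rewrite subr_eq0.
have := hd (y - x); rewrite /ball_ /= sub0r normrN => /(_ yd yx0).
have e1' : (y - x) *: (1 : R) + x = y by rewrite /GRing.scale /= mulr1 subrK.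
rewrite e1' /GRing.scale /= => h.
have n0 : 0 < `|y - x| by rewrite normr_gt0.
rewrite -(ler_pM2r n0) -normrM in h; apply: le_trans h.
by rewrite -normrN le_eqVlt; apply/orP; left; apply/eqP; congr `| _ |; field.
Qed.

(** With [A = Q u] and [B] the p-th power of the L^p norm of [u], it is the energy of [m * u]. With
    [A] the level and [B = 1], it is the least energy compatible with the L^p norm [m]. *)
Definition nehari_fun p (A B m : R) := 2^-1 * A * m ^+ 2 - p^-1 * B * m `^ p.

Lemma is_derive_nehari (p A B m : R) : p != 0 -> 0 < m ->
  is_derive m 1 (nehari_fun p A B) (A * m - B * m `^ (p - 1)).
Proof.
move=> p0 m0.
have h1 := is_derive_scale (2^-1 * A) (is_derive_pow 2 (is_derive_id m (1 : R))).
have h2 := is_derive_opp (is_derive_scale (p^-1 * B) (is_derive1_powR p m0)).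
have h := is_derive_add h1 h2.
have e : A * m - B * m `^ (p - 1) =
    2^-1 * A * (2%:R * m ^+ 1 * 1) + - (p^-1 * B * (p * m `^ (p - 1))).
  by rewrite expr1; field.
by rewrite e; exact: h.
Qed.

Lemma second_difference_aux (f x y A B M r : R) : r * (2 * M) <= r * (A + B) ->
  2^-1 * (x + 2 * f + y) - r * A + (2^-1 * (x - 2 * f + y) - r * B) -
  2 * (2^-1 * x - r * M) <= y.
Proof. by move=> h; lra. Qed.

Lemma two_sided_aux (e N x y z : R) : 0 <= N -> - (e / 2 * N) <= x - z ->
  - (e / 2 * N) <= y - z -> x + y - 2 * z <= N ^+ 2 -> N ^+ 2 <= e / 2 * N ->
  - (e * N) <= x - z <= e * N.
Proof.
move=> N0 h1 h2 h3 h4; have e1' : e * N = e / 2 * N + e / 2 * N by rewrite -mulrDl -splitr.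
have h5 : 0 <= e / 2 * N by apply: le_trans h4; exact: sqr_ge0.
by rewrite e1'; move: (e / 2 * N) (N ^+ 2) h1 h2 h3 h4 h5 => s t h1 h2 h3 h4 h5; apply/andP; split; lra.
Qed.

Lemma powR_midpoint (p a b m : R) : 1 <= p -> 0 <= a -> 0 <= b -> 0 <= m -> 2 * m <= a + b ->
  2 * m `^ p <= a `^ p + b `^ p.
Proof.
move=> p1 a0 b0 m0 le.
have K : (2^-1 * a + (1 - 2^-1) * b) `^ p <= 2^-1 * a `^ p + (1 - 2^-1) * b `^ p.
  by apply: (convex_powR p1 (Itv01 _ _)) => //=;
    rewrite ?inE/= ?in_itv/= ?andbT// ?invr_ge0// invf_le1 ?ler1n.
have mono : m `^ p <= (2^-1 * a + (1 - 2^-1) * b) `^ p.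
  by apply: ge0_ler_powR; rewrite ?nnegrE; lra.
by have := le_trans mono K; lra.
Qed.

End ScalarCalculus.

Section Energy.
Context {R : realType}.
Local Notation mu2 := (lebesgue2 R).
Local Notation H := (@half_plane R).
Local Notation LpH := (Lp mu2 H).
Local Notation pnpH := (pnp mu2 H).
Local Notation pnH := (pn mu2 H).
Implicit Types (u v w h : R * R -> R) (x : R * R).
Let mH := @measurable_half_plane R.

Variables (p lambda : R) (q : bool).
Hypotheses (p2 : 2 < p) (l0 : 0 < lambda).
Local Notation b := ((lambda ^+ 2)^-1).
Local Notation c := (q%:R : R).
Local Notation Q := (qform b c).
Local Notation S := (level p b c).
Local Notation E := (energy p lambda q).

Let p22 : 2 <= p. Proof. exact: ltW. Qed.
Let p0 : 0 < p. Proof. exact: lt_trans p2. Qed.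
Let p1 : 1 <= p. Proof. by apply: le_trans p22; rewrite ler1n. Qed.
Let pn0 : p != 0. Proof. by rewrite gt_eqF. Qed.
Let b0 : 0 < b. Proof. by rewrite invr_gt0 exprn_gt0. Qed.
Let c0 : 0 <= c. Proof. exact: ler0n. Qed.
Let b00 : 0 <= b. Proof. exact: ltW. Qed.

Lemma addf_subf u h : (u \+ h) \+ (u \- h) = (fun x => 2 * u x).
Proof. by apply/funext => x /=; ring. Qed.

Lemma energyE u : Hplus u -> E u = 2^-1 * Q u - p^-1 * pnH p u `^ p.
Proof.
move=> Hu; rewrite /energy (Hplus_normE lambda q Hu) (sqr_qnorm b00 c0).
by rewrite (pn_pow _ _ _ pn0) pnpI.
Qed.

Lemma pn_le_qnorm : exists2 C, 0 < C & forall u, Hplus u -> pnH p u <= C * qnorm b c u.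
Proof.
have [C C0 CP] := pn_qnorm p22.
have k0 : 0 < 1 + b^-1 by rewrite addr_gt0// invr_gt0.
exists (C * Num.sqrt (1 + b^-1)); first by rewrite mulr_gt0// sqrtr_gt0.
move=> u Hu; apply: (le_trans (CP u Hu)); rewrite -mulrA; apply: ler_wpM2l; first exact: ltW.
by rewrite -sqrtrM ?(ltW k0)//; apply: ler_wsqrtr; exact: qform10_le.
Qed.

(* The minimizers of Q on the L^p sphere, scaled onto the Nehari set. *)
Definition ground u := [/\ Hplus u, 0 < pnH p u, Q u = pnH p u `^ p & Q u = S * pnH p u ^+ 2].

Lemma ground_level u : ground u -> S = pnH p u `^ (p - 2).
Proof.
move=> [_ u0 e e']; have u2 : pnH p u ^+ 2 != 0 by rewrite expf_neq0// gt_eqF.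
apply: (mulIf u2); rewrite -e' e -powR_mulrn ?(ltW u0)// -powRD ?subrK//.
by rewrite gt_eqF// implybT.
Qed.

Lemma energy_ge_nehari w : Hplus w -> nehari_fun p S 1 (pnH p w) <= E w.
Proof.
move=> Hw; rewrite (energyE Hw) /nehari_fun mulr1 lerD2r -mulrA.
by apply: ler_wpM2l; [rewrite invr_ge0|exact: level_le].
Qed.

(** From below, the energy at [u + w] is at least [nehari_fun p S 1] at its L^p norm. That function
    is stationary at [m0], and the L^p norm is Lipschitz for the H^+ norm, so the loss is of smaller
    order than the norm of [w]. From above, the parallelogram identity and convexity of the p-th
    power bound the second difference of the energy by the squared norm of [h]; the lower bound at
    [u - h] then becomes an upper bound at [u + h]. *)
Lemma ground_critical u : ground u -> critical_point p lambda q u.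
Proof.
move=> gu; have [Hu u0 e e'] := gu; have SE := ground_level gu.
have [C C0 CP] := pn_le_qnorm.
set m0 := pnH p u.
have Eu : E u = nehari_fun p S 1 m0.
  by rewrite (energyE Hu) /nehari_fun mulr1 -mulrA -e'.
have D : is_derive m0 1 (nehari_fun p S 1) 0.
  have := is_derive_nehari S 1 pn0 u0; congr is_derive.
  rewrite mul1r SE -[X in _ * X - _]powRr1 ?(ltW u0)// -powRD; last by apply/implyP => _; exact: lt0r_neq0.
  by rewrite (_ : p - 2 + 1 = p - 1) ?subrr//; lra.
move=> eps eps0; pose eps' := eps / (2 * C).
have eps'0 : 0 < eps' by rewrite divr_gt0// mulr_gt0.
have [d d0 dP] := is_derive_eps D eps'0.
have low w : Hplus w -> Hplus (u \+ w) -> C * qnorm b c w < d ->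
    - (eps / 2 * qnorm b c w) <= E (u \+ w) - E u.
  move=> Hw Huw wd.
  have diff : `|pnH p (u \+ w) - m0| <= C * qnorm b c w.
    apply: (le_trans (pnB p22 Huw Hu)).
    rewrite (_ : (u \+ w) \- u = w); last by apply/funext => x /=; rewrite addrC addKr.
    exact: CP.
  have := dP _ (le_lt_trans diff wd); rewrite mul0r subr0 -Eu ler_norml => /andP[k1 _].
  have k2 := energy_ge_nehari Huw.
  have k3 : eps' * `|pnH p (u \+ w) - m0| <= eps / 2 * qnorm b c w.
    have -> : eps / 2 * qnorm b c w = eps' * (C * qnorm b c w).
      by rewrite /eps'; field; rewrite gt_eqF.
    by apply: ler_wpM2l => //; exact: ltW.
  apply: le_trans (lerD k2 (lexx (- E u))); apply: le_trans k1.
  by rewrite lerN2.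
(* The first entry keeps the change of the L^p norm below [d]; the second makes the squared norm of
   [h] at most [eps / 2] times the norm. *)
exists (Num.min (d / C) (eps / 2)).
  by rewrite lt_min !divr_gt0.
move=> h Hh; rewrite (Hplus_normE lambda q Hh) -/(qnorm b c h) lt_min => /andP[h1 h2].
have hC : C * qnorm b c h < d by rewrite mulrC -ltr_pdivlMr.
have Hp := HplusD Hu Hh; have Hm := HplusB Hu Hh; have HN := HplusZ (-1) Hh.
have EN : u \+ (fun x => -1 * h x) = u \- h by apply/funext => x /=; rewrite mulN1r.
have qN : qnorm b c (fun x => -1 * h x) = qnorm b c h by rewrite qnormZ// normrN1 mul1r.
have l1 := low h Hh Hp hC.
have l2 : - (eps / 2 * qnorm b c h) <= E (u \- h) - E u.
  by have := low _ HN; rewrite EN qN; apply.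
have mid : E (u \+ h) + E (u \- h) - 2 * E u <= qnorm b c h ^+ 2.
  rewrite (energyE Hp) (energyE Hm) (energyE Hu) (sqr_qnorm b00 c0).
  rewrite (qformD b c Hu Hh) (qformB b c Hu Hh).
  have tri : 2 * m0 <= pnH p (u \+ h) + pnH p (u \- h).
    have := pnD p22 Hp Hm.
    rewrite addf_subf.
    by rewrite (pnZ mH 2 p0 (Hplus_Lp p22 Hu)) (ger0_norm (ler0n R 2)).
  have cvx := powR_midpoint p1 (pn_ge0 _ _ _ _) (pn_ge0 _ _ _ _) (ltW u0) tri.
  have pV : 0 <= p^-1 by rewrite invr_ge0 ltW.
  have := ler_wpM2l pV cvx; rewrite -/m0.
  exact: second_difference_aux.
have N0 := qnorm_ge0 b c h.
have sq : qnorm b c h ^+ 2 <= eps / 2 * qnorm b c h.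
  by rewrite expr2; apply: ler_wpM2r => //; exact: ltW.
rewrite ler_norml; move: N0 l1 l2 mid sq; rewrite /qnorm.
move: (Num.sqrt _) (E (u \+ h)) (E (u \- h)) (E u) => N x y z.
exact: two_sided_aux.
Qed.

(** Criticality is tested in the direction [u] itself. The energy along the ray is a [nehari_fun],
    whose derivative at 1 is the difference of the two sides. *)
Lemma solution_nehari u : solution p lambda q u -> Q u = pnH p u `^ p.
Proof.
move=> [Hu cu].
set m := pnH p u; have m0 : 0 <= m by exact: pn_ge0.
have EZ t : E (fun x => t * u x) = nehari_fun p (Q u) (m `^ p) `|t|.
  rewrite (energyE (HplusZ t Hu)) (qformZ b c t Hu) (pnZ mH t p0 (Hplus_Lp p22 Hu)).
  rewrite powRM// /nehari_fun real_normK ?num_real//; ring.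
have D := is_derive_nehari (Q u) (m `^ p) pn0 ltr01.
rewrite powR1 !mulr1 in D.
apply/eqP; rewrite -subr_eq0 -normr_eq0 eq_le normr_ge0 andbT.
apply/ler_addgt0Pr => e e0; rewrite add0r.
set N := qnorm b c u; have N0 : 0 <= N by exact: qnorm_ge0.
have e20 : 0 < e / 2 by exact: divr_gt0.
have [d d0 dP] := is_derive_eps D e20.
(* [N + 1] stands in for [N], which is not known to be positive at this point. *)
have eN : 0 < e / (2 * (N + 1)) by rewrite divr_gt0// mulr_gt0// ltr_wpDl.
have [r r0 rP] := cu _ eN.
have [t [t0 t1 t2 t3]] : exists t, [/\ 0 < t, t <= 1 / 2, t <= d / 2 & t <= r / (2 * (N + 1))].
  exists (Num.min (1 / 2) (Num.min (d / 2) (r / (2 * (N + 1))))); split.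
  - by rewrite !lt_min !divr_gt0// mulr_gt0// ltr_wpDl.
  - by rewrite !ge_min lexx.
  - by rewrite !ge_min lexx ?orbT.
  - by rewrite !ge_min lexx ?orbT.
have td : t < d by apply: (le_lt_trans t2); rewrite ltr_pdivrMr// ltr_pMr// ltr1n.
have t1p : 0 < 1 + t by exact: addr_gt0.
have tN : t * N < r.
  apply: (@le_lt_trans _ _ (r / (2 * (N + 1)) * N)); first exact: ler_wpM2r.
  have N1 : 0 < 2 * (N + 1) by rewrite mulr_gt0// ltr_wpDl.
  by rewrite mulrAC ltr_pdivrMr// ltr_pM2l//; lra.
have := rP (fun x => t * u x) (HplusZ t Hu).
have nt : qnorm b c (fun x => t * u x) = t * N by rewrite qnormZ// (gtr0_norm t0).
rewrite (etrans (Hplus_normE lambda q (HplusZ t Hu)) nt) => /(_ tN).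
have -> : u \+ (fun x => t * u x) = (fun x => (1 + t) * u x).
  by apply/funext => x /=; rewrite mulrDl mul1r.
have -> : E u = nehari_fun p (Q u) (m `^ p) 1.
  have := EZ 1; rewrite normr1 => <-; congr energy; apply/funext => x; rewrite mul1r//.
rewrite EZ (gtr0_norm t1p).
rewrite -/N => k1.
have := dP (1 + t); rewrite addrC addKr gtr0_norm// => /(_ td) k2.
have k3 : e / (2 * (N + 1)) * (t * N) <= e / 2 * t.
  have -> : e / (2 * (N + 1)) * (t * N) = (e / 2 * t) * (N / (N + 1)).
    by field; rewrite gt_eqF// ltr_wpDl.
  rewrite -[leRHS]mulr1; apply: ler_wpM2l; first by rewrite mulr_ge0// ltW.
  by rewrite ler_pdivrMr ?mul1r; lra.
have k4 : `|(Q u - m `^ p) * t| <= e * t.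
  have := ler_normB (nehari_fun p (Q u) (m `^ p) (1 + t) - nehari_fun p (Q u) (m `^ p) 1)
    (nehari_fun p (Q u) (m `^ p) (1 + t) - nehari_fun p (Q u) (m `^ p) 1 - (Q u - m `^ p) * t).
  rewrite subKr => k5; apply: (le_trans k5); apply: (le_trans (lerD k1 k2)).
  by apply: (le_trans (lerD k3 (lexx _))); rewrite -mulrDl -splitr.
by rewrite normrM (gtr0_norm t0) ler_pM2r in k4.
Qed.

Lemma nontrivial_pn u : Hplus u -> nontrivial u -> 0 < pnH p u.
Proof.
move=> Hu nu; rewrite lt0r pn_ge0 andbT; apply/negP => /eqP z; apply: nu.
have Lu := Hplus_Lp p22 Hu; have mu_ : measurable_fun H u by case: Lu.
have P0 : pnpH p u = 0 by rewrite -(pn_pow _ _ _ pn0) z powR0.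
have : (\int[mu2]_(x in H) (`|u x| `^ p)%:E = 0)%E by rewrite -(pnpE mH Lu) P0.
have m : measurable_fun H (fun x => (`|u x| `^ p)%:E).
  by apply/measurable_EFinP; exact: measurable_normpow.
have [K _] := ae_eq_integral_abs mu2 mH m.
move=> i0; have : (\int[mu2]_(x in H) `|(`|u x| `^ p)%:E| = 0)%E.
  by rewrite -i0; apply: eq_integral => x _; rewrite /= ger0_norm ?powR_ge0.
move=> /K; apply: ae_imp => x h Hx; have [/powR_eq0_eq0/eqP] := h Hx.
by rewrite normr_eq0 => /eqP.
Qed.

Lemma pn_nontrivial u : Hplus u -> 0 < pnH p u -> nontrivial u.
Proof.
move=> Hu u0 z; have Lu := Hplus_Lp p22 Hu.
have L0 : LpH p (fun _ : R * R => 0 : R).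
  by have := Hplus_Lp p22 (HplusZ 0 Hu); under eq_fun do rewrite mul0r.
have e : pnpH p u = 0.
  rewrite (ae_eq_pnp mH Lu L0 z) pnpI; under eq_Rintegral do rewrite normr0 powR0//.
  by rewrite /Rintegral integral0.
by move: u0; rewrite pnE e powR0 ?ltxx// invr_neq0.
Qed.

Lemma solution_energy u : solution p lambda q u -> E u = (2^-1 - p^-1) * pnH p u `^ p.
Proof. by move=> su; rewrite (energyE su.1) (solution_nehari su) mulrBl. Qed.

Lemma half_gt_pinv : 0 < 2^-1 - p^-1.
Proof. by rewrite subr_gt0 ltf_pV2 ?posrE. Qed.

Lemma solution_level u : solution p lambda q u -> 0 < pnH p u -> S <= pnH p u `^ (p - 2).
Proof.
move=> su u0; have := level_le p2 b0 c0 su.1; rewrite (solution_nehari su).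
have u2 : 0 < pnH p u ^+ 2 by exact: exprn_gt0.
have -> : pnH p u `^ p = pnH p u `^ (p - 2) * pnH p u ^+ 2.
  rewrite -powR_mulrn ?(ltW u0)// -powRD ?subrK//.
  by apply/implyP => _; exact: lt0r_neq0.
by rewrite ler_pM2r.
Qed.

Lemma powR_lt_mono (r a m : R) : 0 < r -> 0 <= a -> 0 <= m -> a `^ r <= m `^ r -> a <= m.
Proof.
move=> r0 a0 m0 le; rewrite leNgt; apply/negP => ma.
have := gt0_ltr_powR r0 m0 a0 ma.
by rewrite ltNge le.
Qed.

Lemma ground_least u : ground u -> least_energy_solution p lambda q u.
Proof.
move=> gu; have [Hu u0 e e'] := gu.
have su : solution p lambda q u by split => //; exact: ground_critical.
split; [exact: su|exact: pn_nontrivial Hu u0|move=> w sw nw].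
have w0 := nontrivial_pn sw.1 nw.
rewrite (solution_energy su) (solution_energy sw).
apply: ler_wpM2l; first exact: ltW half_gt_pinv.
have k := solution_level sw w0; rewrite (ground_level gu) in k.
have r0 : 0 < p - 2 by rewrite subr_gt0.
have := powR_lt_mono r0 (ltW u0) (ltW w0) k.
by move=> h; apply: ge0_ler_powR => //; rewrite ?nnegrE ltW.
Qed.

(** On the sphere the Sobolev inequality gives [Q >= C ^- 2]. The element [u] ensures that the
    sphere is nonempty; otherwise the level would be 0. *)
Lemma level_gt0 u : Hplus u -> 0 < pnH p u -> 0 < S.
Proof.
move=> Hu u0; have [C C0 CP] := pn_le_qnorm.
have ne : sphere p !=set0.
  by exists (fun x => (pnH p u)^-1 * u x); apply: normalize => //; exact: lt0r_neq0.
have [w [sw wlim]] := level_adherent p2 b0 c0 ne.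
have C2 : 0 < C^-1 ^+ 2 by rewrite exprn_gt0// invr_gt0.
apply: (lt_le_trans C2); apply: (ler_cvg_to (cvg_cst _) wlim); apply: nearW => n.
have [Hw w1] := sw n; have := CP _ Hw; rewrite w1 => k.
rewrite -(sqr_qnorm b00 c0) exprVn -div1r ler_pdivrMr ?exprn_gt0// mulrC -exprMn.
by rewrite -[leLHS](expr1n _ 2); rewrite ler_pXn2r ?nnegrE// mulr_ge0 ?qnorm_ge0// ltW.
Qed.

Lemma ground_exists u : Hplus u -> 0 < pnH p u -> exists w, ground w.
Proof.
move=> Hu u0; have S0 := level_gt0 Hu u0.
have ne : sphere p !=set0.
  by exists (fun x => (pnH p u)^-1 * u x); apply: normalize => //; exact: lt0r_neq0.
have [w [sw wlim]] := level_adherent p2 b0 c0 ne.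
have [s [v [_ [Hv v1] Qv _]]] := minimizing_seq_cvg p2 b0 c0 sw wlim.
have r0 : p - 2 != 0 by rewrite subr_eq0 gt_eqF.
(* The factor for which [S * t ^ 2 = t ^ p], that is, the one placing a normalized minimizer on the
   Nehari set. *)
pose t := S `^ (p - 2)^-1.
have t0 : 0 < t by exact: powR_gt0.
have tE : t `^ (p - 2) = S by rewrite -powRrM mulVf// powRr1// ltW.
exists (fun x => t * v x).
have pt : pnH p (fun x => t * v x) = t by rewrite (pnZ mH t p0 (Hplus_Lp p22 Hv)) v1 mulr1 gtr0_norm.
rewrite /ground pt (qformZ b c t Hv) Qv; split; [exact: HplusZ|exact: t0| |exact: mulrC].
rewrite -tE -powR_mulrn ?(ltW t0)// -powRD.
  by congr (_ `^ _); rewrite addrC subrK.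
by apply/implyP => _; exact: lt0r_neq0.
Qed.

(** Comparison with an existing ground state [w] gives one inequality between the L^p norms, since
    the energy of a solution increases with its norm. The lower bound [solution_level] gives the
    other. With equal norms [u] attains the level as well. *)
Lemma least_ground u : least_energy_solution p lambda q u -> ground u.
Proof.
move=> [su nu le]; have Hu := su.1; have u0 := nontrivial_pn Hu nu.
have [w gw] := ground_exists Hu u0; have [sw nw _] := ground_least gw.
have w0 := nontrivial_pn sw.1 nw.
have r0 : 0 < p - 2 by rewrite subr_gt0.
have k1 : pnH p u <= pnH p w.
  have := le w sw nw; rewrite (solution_energy su) (solution_energy sw) (ler_pM2l half_gt_pinv).
  by apply: powR_lt_mono; rewrite ?(ltW u0) ?(ltW w0).
have k2 : pnH p w <= pnH p u.
  have := solution_level su u0; rewrite (ground_level gw).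
  by apply: powR_lt_mono; rewrite ?(ltW u0) ?(ltW w0).
have e : pnH p u = pnH p w by apply/eqP; rewrite eq_le k1.
have Qe := solution_nehari su; split; [exact: Hu|exact: u0|exact: Qe|].
rewrite Qe (ground_level gw) -e -powR_mulrn ?(ltW u0)// -powRD ?subrK//.
by apply/implyP => _; exact: lt0r_neq0.
Qed.

End Energy.

(** * Positivity *)

Section LogProfile.
Context {R : realType}.
Implicit Types (s t k : R).

(* With k -> oo, [log_profile (k * v)] blows up where v > 0.  Testing with
   [eta ^+ 2 * inv_profile (k * v)] controls its gradient independently of k,
   because [inv_profile / 2 <= dlog_profile <= inv_profile] on s >= 0. *)
Definition log_profile s : R := 2^-1 * ln (1 + (s + 1) ^+ 2).
Definition dlog_profile s : R := (s + 1) * (1 + (s + 1) ^+ 2)^-1.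
Definition inv_profile s : R := expR (- log_profile s).

Let base_gt0 t : 0 < 1 + t ^+ 2. Proof. by rewrite ltr_pwDl// sqr_ge0. Qed.

Lemma is_derive_log_profile s : is_derive s 1 log_profile (dlog_profile s).
Proof.
have h1 := is_derive_add (is_derive_id s (1 : R)) (is_derive_cst (1 : R) s (1 : R)).
have h2 := is_derive_add (is_derive_cst (1 : R) s (1 : R)) (is_derive_pow 2 h1).
have h3 := @is_derive_comp1 R _ (@ln R) (fun y : R => 1 + (y + 1) ^+ 2) s 1 _ _ (is_derive1_ln (base_gt0 (s + 1))) h2.
have h := is_derive_scale 2^-1 h3.
have e : dlog_profile s = 2^-1 * ((1 + (s + 1) ^+ 2)^-1 * (0 + 2%:R * (s + 1) ^+ 2.-1 * (1 + 0))).
  by rewrite /dlog_profile /= expr1 addr0 add0r mulr1; field; rewrite gt_eqF// base_gt0.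
by rewrite e; exact: h.
Qed.

Lemma is_derive_inv_profile s : is_derive s 1 inv_profile (- (dlog_profile s * inv_profile s)).
Proof.
have h1 := is_derive_opp (is_derive_log_profile s).
have h := @is_derive_comp1 R _ (@expR R) (fun y : R => - log_profile y) s 1 _ _ (is_derive_expR (- log_profile s)) h1.
have e : - (dlog_profile s * inv_profile s) = expR (- log_profile s) * - dlog_profile s.
  by rewrite mulrN mulrC.
by rewrite e; exact: h.
Qed.

Lemma inv_profile_gt0 s : 0 < inv_profile s. Proof. exact: expR_gt0. Qed.

Lemma inv_profile_sq s : inv_profile s ^+ 2 = (1 + (s + 1) ^+ 2)^-1.
Proof.
rewrite /inv_profile -expRM_natl -[RHS]lnK; last by rewrite posrE invr_gt0 base_gt0.
by rewrite lnV ?posrE ?base_gt0//; congr expR; rewrite /log_profile mulrN; congr (- _); field.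
Qed.

Lemma inv_profile_le1 s : inv_profile s <= 1.
Proof.
have := inv_profile_sq s; have := inv_profile_gt0 s => g0 e.
rewrite -(ler_pXn2r (n := 2)) ?nnegrE ?(ltW g0)// e expr1n invf_le1 ?base_gt0//.
by rewrite lerDl sqr_ge0.
Qed.

Lemma dlog_profile_sq s : dlog_profile s ^+ 2 <= inv_profile s ^+ 2.
Proof.
rewrite inv_profile_sq /dlog_profile exprMn [X in _ * X]expr2 mulrA -[leRHS]mul1r.
apply: ler_wpM2r; first by rewrite invr_ge0 ltW// base_gt0.
by rewrite ler_pdivrMr ?base_gt0// mul1r lerDr.
Qed.

Lemma norm_dlog_profile s : `|dlog_profile s| <= 1.
Proof.
have := dlog_profile_sq s; rewrite -(real_normK (num_real (dlog_profile s))) => h.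
rewrite -(ler_pXn2r (n := 2)) ?nnegrE// expr1n; apply: (le_trans h).
by apply: exprn_ile1; [exact: ltW (inv_profile_gt0 s)|exact: inv_profile_le1].
Qed.

(** After squaring, the claim is that [(s + 1) ^ 2] is at least a quarter of [1 + (s + 1) ^ 2],
    which holds for [s >= 0]. This is where nonnegativity of [v] enters the energy estimate. *)
Lemma dlog_profile_ge s : 0 <= s -> 2^-1 * inv_profile s <= dlog_profile s.
Proof.
move=> s0; have g0 := inv_profile_gt0 s.
have d0 : 0 <= dlog_profile s.
  apply: mulr_ge0; first exact: addr_ge0.
  by rewrite invr_ge0; exact: ltW.
have i0 : 0 <= 2^-1 * inv_profile s by apply: mulr_ge0 => //; exact: ltW.
rewrite -(ler_pXn2r (n := 2)) ?nnegrE//.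
rewrite exprMn inv_profile_sq /dlog_profile exprMn [X in _ <= _ * X]expr2 mulrA.
apply: ler_wpM2r; first by rewrite invr_ge0 ltW// base_gt0.
rewrite ler_pdivlMr ?base_gt0//; nra.
Qed.

Lemma log_profile_lip s t : `|log_profile s - log_profile t| <= `|s - t|.
Proof.
have [c [_ ->]] := MVT_any t s is_derive_log_profile.
by rewrite normrM -[leRHS]mul1r; apply: ler_wpM2r => //; exact: norm_dlog_profile.
Qed.

Lemma log_profile_large (T : R) s : expR T <= s -> T <= log_profile s.
Proof.
move=> Ts; have s0 : 0 < s by apply: lt_le_trans Ts; exact: expR_gt0.
have -> : T = 2^-1 * ln ((expR T) ^+ 2).
  by rewrite -expRM_natl expRK mulrA mulVf ?mul1r// pnatr_eq0.
apply: ler_wpM2l => //; rewrite ler_ln ?posrE ?exprn_gt0 ?expR_gt0 ?base_gt0//.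
have e0 := expR_ge0 T; nra.
Qed.

(** The argument [1 + (s + 1) ^ 2] of the logarithm is positive on the whole line. This matters
    because the test functions approximating a nonnegative [v] may take negative values. *)
Lemma class_C_log_profile n (f : R * R -> R) : class_C n f -> class_C n (fun x => log_profile (f x)).
Proof.
move=> cf; apply: class_C_mul; first exact: class_C_cst.
apply: class_C_ln; first by move=> x; exact: base_gt0.
apply: class_C_add; first exact: class_C_cst.
have cf1 : class_C n (fun x => f x + 1) by apply: class_C_add => //; exact: class_C_cst.
by under eq_fun do rewrite expr2; exact: class_C_mul.
Qed.

Lemma class_C_inv_profile n (f : R * R -> R) : class_C n f -> class_C n (fun x => inv_profile (f x)).
Proof. by move=> cf; apply: class_C_expR; apply: class_C_opp; exact: class_C_log_profile. Qed.

Lemma dlog_profile_continuous : continuous dlog_profile.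
Proof.
move=> s; apply: cvgM; first by apply: cvgD; [exact: cvg_id|exact: cvg_cst].
apply: cvgV; first by rewrite gt_eqF// base_gt0.
apply: cvgD; first exact: cvg_cst.
under eq_fun do rewrite expr2; rewrite expr2.
by apply: cvgM; apply: cvgD; [exact: cvg_id|exact: cvg_cst|exact: cvg_id|exact: cvg_cst].
Qed.

Lemma log_profile_continuous : continuous log_profile.
Proof. by move=> s; exact: is_derive_continuous (is_derive_log_profile s). Qed.

Lemma inv_profile_continuous : continuous inv_profile.
Proof. by move=> s; exact: is_derive_continuous (is_derive_inv_profile s). Qed.

End LogProfile.

Section AeNull.
Context {R : realType}.
Local Notation mu2 := (lebesgue2 R).
Local Notation H := (@half_plane R).
Local Notation L2H := (L2 mu2 H).
Implicit Types (f g : R * R -> R) (x : R * R).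
Let mH := @measurable_half_plane R.

Lemma L2_null_mul_ae (c : nat -> R * R -> R) (d f : R * R -> R) (K : R) : 0 < K ->
  (forall n, measurable_fun H (c n)) -> measurable_fun H d ->
  (forall n x, H x -> `|c n x| <= K) -> (forall x, H x -> `|d x| <= K) ->
  {ae mu2, forall x, H x -> c n x @[n --> \oo] --> d x} -> L2H f ->
  L2_null (fun n x => c n x * f x - d x * f x).
Proof.
move=> K0 mc md cK dK cd f2.
have cf n : L2H (fun x => c n x * f x - d x * f x).
  have [a _] := L2_mul_bounded (ltW K0) (mc n) (cK n) f2.
  have [b _] := L2_mul_bounded (ltW K0) md dK f2.
  exact: L2B.
have mn n : measurable_fun H (fun x => ((c n x * f x - d x * f x) ^+ 2)%:E).
  by apply/measurable_EFinP; apply: measurable_funX; case: (cf n).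
have cv : \forall x \ae mu2, H x -> ((c n x * f x - d x * f x) ^+ 2)%:E @[n --> \oo] --> (cst 0%E) x.
  apply: ae_imp cd => x h Hx; apply: cvg_EFin; first by near=> n.
  have e : (0 : R) = (d x * f x - d x * f x) ^+ 2 by rewrite subrr expr0n.
  rewrite [X in _ --> X]e; under eq_fun do rewrite /= expr2.
  rewrite expr2; have h1 : c n x * f x - d x * f x @[n --> \oo] --> d x * f x - d x * f x.
    by apply: cvgB; [apply: cvgMl; exact: h|exact: cvg_cst].
  by apply: cvgM.
have Kf := L2Z mH (2 * K) f2.
have bd : \forall x \ae mu2, forall n, H x ->
    (`|((c n x * f x - d x * f x) ^+ 2)%:E| <= ((2 * K * f x) ^+ 2)%:E)%E.
  apply: aeW => x n Hx; rewrite /= lee_fin ger0_norm ?sqr_ge0// -mulrBl !exprMn.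
  apply: ler_wpM2r; first exact: sqr_ge0.
  rewrite -exprMn -(real_normK (num_real (c n x - d x))).
  have h1 := ler_normB (c n x) (d x); have h2 := cK n x Hx; have h3 := dK x Hx.
  by rewrite ler_pXn2r ?nnegrE ?mulr_ge0 ?(ltW K0)//; lra.
have [_ _ C] := dominated_convergence mH mn (@measurable_cst _ _ _ _ _ _) cv (L2_integrable2 Kf) bd.
rewrite integral0 in C; rewrite /L2_null.
rewrite (_ : (fun n => _) = (fun n => fine (\int[mu2]_(x in H) ((c n x * f x - d x * f x) ^+ 2)%:E)%E)); last first.
  by apply/funext => n; rewrite -(nsqE mH (cf n)).
by have /fine_cvgP[_] := C.
Unshelve. all: by end_near. Qed.

End AeNull.

Lemma ip_ge0_ae {d : measure_display} {T : measurableType d} {R : realType}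
    (mu : {measure set T -> \bar R}) (D : set T) (f g : T -> R) : measurable D ->
  L2 mu D f -> L2 mu D g -> {ae mu, forall x, D x -> 0 <= f x * g x} -> 0 <= ip mu D f g.
Proof.
move=> mD f2 g2 fg.
have m1 : measurable_fun D (fun x => f x * g x).
  by apply: measurable_funM; [exact: (L2_measurable f2)|exact: (L2_measurable g2)].
rewrite ipE /Rintegral (@ae_eq_integral _ _ _ mu D (fun x => (`|f x * g x|)%:E))//.
- by apply: fine_ge0; apply: integral_ge0 => x _; rewrite lee_fin.
- exact/measurable_EFinP.
- by apply/measurable_EFinP; apply: measurableT_comp.
- by apply: ae_imp fg => x h Dx; rewrite ger0_norm ?h.
Qed.

(** * First variation in nonnegative directions *)

Section FirstVariation.
Context {R : realType}.
Local Notation mu2 := (lebesgue2 R).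
Local Notation H := (@half_plane R).
Local Notation nsqH := (nsq mu2 H).
Local Notation ipH := (ip mu2 H).
Local Notation L2H := (L2 mu2 H).
Local Notation pnpH := (pnp mu2 H).
Local Notation pnH := (pn mu2 H).
Implicit Types (f g h u v w phi psi eta : R * R -> R) (x : R * R) (i : component_index).
Implicit Types (p k : R).
Let mH := @measurable_half_plane R.

(** The difference is [c n * (f n - g)] plus [c n * g - d * g]: the first part is small because
    [c n] is bounded, the second by dominated convergence. *)
Lemma L2_null_mul2 (c : nat -> R * R -> R) (d : R * R -> R) (f : nat -> R * R -> R) (g : R * R -> R) (K : R) : 0 < K ->
  (forall n, measurable_fun H (c n)) -> measurable_fun H d ->
  (forall n x, H x -> `|c n x| <= K) -> (forall x, H x -> `|d x| <= K) ->
  {ae mu2, forall x, H x -> c n x @[n --> \oo] --> d x} ->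
  (forall n, L2H (f n)) -> L2H g -> L2_null (fun n x => f n x - g x) ->
  (forall n, L2H (fun x => c n x * f n x)) /\ L2_null (fun n x => c n x * f n x - d x * g x).
Proof.
move=> K0 mc md cK dK cd f2 g2 fg.
have fg2 n : L2H (fun x => f n x - g x) by apply: L2B.
have b1 n := L2_mul_bounded (ltW K0) (mc n) (cK n) (fg2 n).
have b2 n := (L2_mul_bounded (ltW K0) (mc n) (cK n) (f2 n)).1.
have b3 n := (L2_mul_bounded (ltW K0) (mc n) (cK n) g2).1.
have b4 := (L2_mul_bounded (ltW K0) md dK g2).1.
split; first exact: b2.
have n1 : L2_null (fun n x => c n x * (f n x - g x)).
  apply: (@L2_null_le _ _ (fun n => K ^+ 2 * nsqH (fun x => f n x - g x))).
    by move=> n; exact: (b1 n).2.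
  by rewrite -[X in _ --> X](mulr0 (K ^+ 2)); apply: cvgMr; exact: fg.
have n2 := L2_null_mul_ae K0 mc md cK dK cd g2.
have := L2_nullD (fun n => (b1 n).1) (fun n => L2B mH (b3 n) b4) n1 n2.
rewrite (_ : (fun n x => _) = (fun n x => c n x * f n x - d x * g x))//.
by apply/funext => n; apply/funext => x; rewrite mulrBr addrA subrK.
Qed.

Lemma Hplus_dense_ae v : Hplus v -> exists psi : nat -> R * R -> R,
  [/\ forall n, test_function (psi n),
      forall i, L2_null (fun n x => test_component i (psi n) x - component i v x) &
      {ae mu2, forall x, H x -> psi n x @[n --> \oo] --> v x}].
Proof.
move=> Hv; have [phi [tp p0]] := Hplus_dense Hv.
have tL n : L2H (phi n) by exact: test_L2 (tp n).
have [s hs sae] := L2_subseq_ae mH tL (Hplus_L2 Ifun Hv) (p0 Ifun).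
exists (fun n => phi (s n)); split; [by move=> n; exact: tp| |exact: sae].
move=> i; exact: (cvg_sub hs (p0 i)).
Qed.

Lemma pn_mono_ae p f g : 2 <= p -> Lp mu2 H p f -> Lp mu2 H p g ->
  {ae mu2, forall x, H x -> `|f x| <= `|g x|} -> pnH p f <= pnH p g.
Proof.
move=> p2 fp gp fg; rewrite !pnE; apply: ge0_ler_powR; rewrite ?nnegrE ?pnp_ge0//.
  by rewrite invr_ge0; lra.
rewrite -lee_fin (pnpE mH fp) (pnpE mH gp).
have [mf _] := fp; have [mg _] := gp.
apply: ae_ge0_le_integral; [exact: mH| | | | |].
- by move=> x _; rewrite lee_fin powR_ge0.
- by apply/measurable_EFinP; exact: measurable_normpow.
- by move=> x _; rewrite lee_fin powR_ge0.
- by apply/measurable_EFinP; exact: measurable_normpow.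
apply: ae_imp fg => x h Hx; rewrite lee_fin; apply: ge0_ler_powR; rewrite ?nnegrE ?h//; lra.
Qed.

Lemma first_order_ge0 (A B : R) : 0 <= B -> (forall t, 0 < t -> 0 <= 2 * t * A + t ^+ 2 * B) -> 0 <= A.
Proof.
move=> B0 h; rewrite leNgt; apply/negP => A0.
have t0 : 0 < - A / (B + 1) by rewrite divr_gt0 ?oppr_gt0//; lra.
have := h _ t0; set t := - A / (B + 1) in t0 *.
have e : A = - (t * (B + 1)) by rewrite /t divfK ?opprK// gt_eqF//; lra.
by rewrite e; nra.
Qed.

(* The first variation in a direction that does not decrease the L^p norm. *)
Lemma form_ge0 p b c v h : 2 < p -> 0 < b -> 0 <= c -> Hplus v ->
  qform b c v = level p b c * pnH p v ^+ 2 -> Hplus h ->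
  {ae mu2, forall x, H x -> 0 <= v x} -> (forall x, H x -> 0 <= h x) -> 0 <= form b c v h.
Proof.
move=> p2 b0 c0 Hv Qv Hh v0 h0.
apply: (@first_order_ge0 _ (qform b c h)); first by apply: qform_ge0 => //; exact: ltW.
move=> t t0; have [Hl _] := Hplus_lin t Hv Hh.
have le := level_le p2 b0 c0 Hl.
rewrite (qform_lin b c t Hv Hh) Qv in le.
have mono : pnH p v <= pnH p (fun x => v x + t * h x).
  apply: pn_mono_ae; [exact: ltW|exact: Hplus_Lp (ltW p2) Hv|exact: Hplus_Lp (ltW p2) Hl|].
  apply: ae_imp v0 => x k Hx; have vx := k Hx; have th := mulr_ge0 (ltW t0) (h0 x Hx).
  rewrite (ger0_norm vx) ger0_norm ?addr_ge0// lerDl//.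
have S0 := (level_ge0 p b0 c0).
have sq : pnH p v ^+ 2 <= pnH p (fun x => v x + t * h x) ^+ 2.
  by rewrite ler_pXn2r ?nnegrE ?pn_ge0.
have := ler_wpM2l S0 sq; lra.
Qed.

Lemma deriv_profile (eta psi : R * R -> R) k x (v : R * R) (a b : R) :
  is_derive x v eta a -> is_derive x v psi b ->
  is_derive x v (fun y => eta y * inv_profile (k * psi y) * eta y)
    (2 * (inv_profile (k * psi x) * (eta x * a)) -
     k * ((eta x ^+ 2 * (dlog_profile (k * psi x) * inv_profile (k * psi x))) * b)).
Proof.
move=> ha hb.
have h1 := @is_derive_comp1 R _ (@inv_profile R) (fun y : R * R => k * psi y) x v _ _ (is_derive_inv_profile (k * psi x)) (is_derive_scale k hb).
have h := is_derive_mul (is_derive_mul ha h1) ha.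
have -> : 2 * (inv_profile (k * psi x) * (eta x * a)) -
     k * ((eta x ^+ 2 * (dlog_profile (k * psi x) * inv_profile (k * psi x))) * b) =
  (a * inv_profile (k * psi x) + eta x * (- (dlog_profile (k * psi x) * inv_profile (k * psi x)) * (k * b))) * eta x
   + eta x * inv_profile (k * psi x) * a by ring.
exact: h.
Qed.

Lemma deriv_log_profile (psi : R * R -> R) k x (v : R * R) (b : R) :
  is_derive x v psi b ->
  is_derive x v (fun y => log_profile (k * psi y)) (dlog_profile (k * psi x) * (k * b)).
Proof.
by move=> hb; exact: (@is_derive_comp1 R _ (@log_profile R) (fun y : R * R => k * psi y) x v _ _ (is_derive_log_profile (k * psi x)) (is_derive_scale k hb)).
Qed.

Lemma test_component_profile i eta psi k x : i <> Ifun -> test_function eta -> test_function psi ->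
  test_component i (fun y => eta y * inv_profile (k * psi y) * eta y) x =
    2 * (inv_profile (k * psi x) * (eta x * test_component i eta x)) -
     k * ((eta x ^+ 2 * (dlog_profile (k * psi x) * inv_profile (k * psi x))) * test_component i psi x).
Proof.
move=> ni te tp; have [a1 a2] := test_is_derive x te; have [b1 b2] := test_is_derive x tp.
have h1 := deriv_profile k a1 b1; have h2 := deriv_profile k a2 b2.
have E1 := derive_val (is_derive := h1); have E2 := derive_val (is_derive := h2).
case: i ni => [[]//| | |] /= _; [exact: E1|exact: E2|]; rewrite /dth E1 E2.
move: (inv_profile _) (dlog_profile _) ('D_e1 eta x) ('D_e2 eta x) ('D_e1 psi x) ('D_e2 psi x) => *.
ring.
Qed.

Lemma test_profile eta psi k : test_function eta -> test_function psi ->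
  test_function (fun y => eta y * inv_profile (k * psi y) * eta y).
Proof.
move=> te tp; apply: (test_mul te) => n; apply: class_C_mul; first exact: test_smooth.
apply: class_C_inv_profile; apply: class_C_mul; first exact: class_C_cst.
exact: test_smooth.
Qed.

End FirstVariation.

(** * Energy estimate for the logarithm of a minimizer *)

Section Caccioppoli.
Context {R : realType}.
Local Notation mu2 := (lebesgue2 R).
Local Notation H := (@half_plane R).
Local Notation nsqH := (nsq mu2 H).
Local Notation ipH := (ip mu2 H).
Local Notation L2H := (L2 mu2 H).
Local Notation pnH := (pn mu2 H).
Implicit Types (f g h u v w phi psi eta : R * R -> R) (x : R * R) (i : component_index).
Implicit Types (p k : R).
Let mH := @measurable_half_plane R.

Lemma measurable_comp_scale (F : R -> R) k v : continuous F -> measurable_fun H v ->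
  measurable_fun H (fun x => F (k * v x)).
Proof.
move=> cF mv; apply: (measurableT_comp (continuous_measurable_fun cF)).
by apply: measurable_funM => //; exact: measurable_cst.
Qed.

Lemma cvg_comp_scale (F : R -> R) k (a : nat -> R) (l : R) : continuous F ->
  a n @[n --> \oo] --> l -> F (k * a n) @[n --> \oo] --> F (k * l).
Proof.
move=> cF al; have kl : k * a n @[n --> \oo] --> k * l by apply: cvgMr.
have c := cF (k * l); apply: (continuous_cvg _ c kl).
Qed.

Lemma profile_product_continuous : continuous (fun s : R => dlog_profile s * inv_profile s).
Proof.
by move=> s; apply: cvgM; [exact: dlog_profile_continuous|exact: inv_profile_continuous].
Qed.

Lemma norm_inv_profile (s : R) : `|inv_profile s| <= 1.
Proof. by rewrite gtr0_norm ?inv_profile_gt0 ?inv_profile_le1. Qed.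

Lemma norm_profile_product (s : R) : `|dlog_profile s * inv_profile s| <= 1.
Proof. by rewrite normrM mulr_ile1 ?norm_dlog_profile ?norm_inv_profile. Qed.

(* The components of the test function [eta ^+ 2 * inv_profile (k * v)]. *)
Definition cutoff_profile eta v k i : R * R -> R :=
  if i is Ifun then fun x => eta x * inv_profile (k * v x) * eta x else
  fun x => 2 * (inv_profile (k * v x) * (eta x * test_component i eta x)) -
     k * ((eta x ^+ 2 * (dlog_profile (k * v x) * inv_profile (k * v x))) * component i v x).

Section Bounds.
Variables (eta v : R * R -> R) (k C : R).
Hypotheses (te : test_function eta) (Hv : Hplus v) (C0 : 0 < C) (Ce : forall x, `|eta x| <= C).

Let mv : measurable_fun H v. Proof. exact: L2_measurable (Hplus_L2 Ifun Hv). Qed.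
Let me : measurable_fun H eta. Proof. exact: L2_measurable (test_L2 te). Qed.

Lemma L2_cutoff_test i : L2H (fun x => eta x * test_component i eta x).
Proof. by apply: test_L2; apply: test_mul; [exact: test_test_component|exact: test_smooth]. Qed.

Lemma measurable_weight (w : R * R -> R) : measurable_fun H w ->
  measurable_fun H (fun x => eta x ^+ 2 * (dlog_profile (k * w x) * inv_profile (k * w x))).
Proof.
move=> mw; apply: measurable_funM; first exact: measurable_funX.
exact: (measurable_comp_scale k profile_product_continuous mw).
Qed.

Lemma weight_le (s : R) x : `|eta x ^+ 2 * (dlog_profile s * inv_profile s)| <= C ^+ 2.
Proof.
rewrite normrM -[leRHS]mulr1; apply: ler_pM => //; last exact: norm_profile_product.
rewrite normrX ler_pXn2r ?nnegrE ?(ltW C0)//; exact: normr_ge0.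
Qed.

Lemma L2_cutoff_profile i : L2H (cutoff_profile eta v k i).
Proof.
have mi := measurable_comp_scale k (@inv_profile_continuous R) mv.
have A i' := (L2_mul_bounded ler01 mi (fun x _ => norm_inv_profile _) (L2_cutoff_test i')).1.
have B i' := (L2_mul_bounded (exprn_ge0 2 (ltW C0)) (measurable_weight mv)
  (fun x _ => weight_le _ x) (Hplus_L2 i' Hv)).1.
case: i; last 3 first.
- exact: (L2B mH (L2Z mH 2 (A Idx)) (L2Z mH k (B Idx))).
- exact: (L2B mH (L2Z mH 2 (A Idy)) (L2Z mH k (B Idy))).
- exact: (L2B mH (L2Z mH 2 (A Idth)) (L2Z mH k (B Idth))).
- rewrite /cutoff_profile; have := A Ifun.
  by rewrite (_ : (fun x => inv_profile (k * v x) * _) = (fun x => eta x * inv_profile (k * v x) * eta x))//;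
    apply/funext => x /=; ring.
Qed.

(** A chain rule in H^+. For test functions in place of [v] it is classical; the weights
    [inv_profile] and [dlog_profile * inv_profile] are bounded and continuous, so their products
    with L^2-convergent components converge. *)
Lemma cutoff_profile_Hplus : Hplus (cutoff_profile eta v k Ifun) /\
  forall i, {ae mu2, forall x, H x ->
    component i (cutoff_profile eta v k Ifun) x = cutoff_profile eta v k i x}.
Proof.
have [psi [tp p0 pae]] := Hplus_dense_ae Hv.
apply: (@Hplus_limit R (fun n y => eta y * inv_profile (k * psi n y) * eta y) (cutoff_profile eta v k)).
- by move=> n; exact: (test_profile k te (tp n)).
- exact: L2_cutoff_profile.
have mp n : measurable_fun H (psi n) := L2_measurable (test_L2 (tp n)).
have mi := measurable_comp_scale k (@inv_profile_continuous R) mv.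
have mpi n := measurable_comp_scale k (@inv_profile_continuous R) (mp n).
have tL i n : L2H (test_component i (psi n)) by apply: test_L2; exact: test_test_component.
have ci : {ae mu2, forall x, H x -> inv_profile (k * psi n x) @[n --> \oo] --> inv_profile (k * v x)}.
  by apply: ae_imp pae => x h Hx; apply: cvg_comp_scale; [exact: inv_profile_continuous|exact: h].
have cw : {ae mu2, forall x, H x ->
    eta x ^+ 2 * (dlog_profile (k * psi n x) * inv_profile (k * psi n x)) @[n --> \oo] -->
    eta x ^+ 2 * (dlog_profile (k * v x) * inv_profile (k * v x))}.
  apply: ae_imp pae => x h Hx; apply: cvgMr.
  exact: (@cvg_comp_scale (fun s : R => dlog_profile s * inv_profile s) k (fun n => psi n x) (v x) profile_product_continuous (h Hx)).
have A i := L2_null_mul_ae ltr01 mpi mi (fun n x _ => norm_inv_profile _) (fun x _ => norm_inv_profile _) ci (L2_cutoff_test i).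
have A2 i n := (L2_mul_bounded ler01 (mpi n) (fun x _ => norm_inv_profile _) (L2_cutoff_test i)).1.
have A3 i := (L2_mul_bounded ler01 mi (fun x _ => norm_inv_profile _) (L2_cutoff_test i)).1.
have B i := L2_null_mul2 (exprn_gt0 2 C0) (fun n => measurable_weight (mp n)) (measurable_weight mv)
  (fun n x _ => weight_le _ x) (fun x _ => weight_le _ x) cw (tL i) (Hplus_L2 i Hv) (p0 i).
have B3 i := (L2_mul_bounded (exprn_ge0 2 (ltW C0)) (measurable_weight mv)
  (fun x _ => weight_le _ x) (Hplus_L2 i Hv)).1.
have D i : L2_null (fun n x =>
    2 * (inv_profile (k * psi n x) * (eta x * test_component i eta x) - inv_profile (k * v x) * (eta x * test_component i eta x)) +
    (- k) * (eta x ^+ 2 * (dlog_profile (k * psi n x) * inv_profile (k * psi n x)) * test_component i (psi n) x -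
      eta x ^+ 2 * (dlog_profile (k * v x) * inv_profile (k * v x)) * component i v x)).
  have a2 n := L2B mH (A2 i n) (A3 i).
  have b2 n := L2B mH ((B i).1 n) (B3 i).
  exact: (L2_nullD (fun n => L2Z mH 2 (a2 n)) (fun n => L2Z mH (- k) (b2 n)) (L2_nullZ 2 a2 (A i)) (L2_nullZ (- k) b2 (B i).2)).
have E i : i <> Ifun -> L2_null (fun n x => test_component i (fun y => eta y * inv_profile (k * psi n y) * eta y) x -
    (2 * (inv_profile (k * v x) * (eta x * test_component i eta x)) -
     k * ((eta x ^+ 2 * (dlog_profile (k * v x) * inv_profile (k * v x))) * component i v x))).
  move=> ni; have := D i; congr L2_null; apply/funext => n; apply/funext => x.
  rewrite (test_component_profile k x ni te (tp n)).
  move: (inv_profile _) (inv_profile _) (dlog_profile _) (dlog_profile _) (test_component i _ x) (test_component i _ x) (component i v x) (eta x) => *.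
  by ring.
case; [|by apply: E|by apply: E|by apply: E].
have := A Ifun; congr L2_null; apply/funext => n; apply/funext => x; rewrite /cutoff_profile /=.
ring.
Qed.

End Bounds.

(** Young's inequality with weight [k]: the coefficient [k / 4] can be absorbed by the term [k / 2]
    produced by [dlog_profile_ge]. *)
Lemma absorb_aux (k a b s : R) : 0 < k -> s <= Num.sqrt a * Num.sqrt b -> 0 <= a -> 0 <= b ->
  2 * s <= k / 4 * a + 4 / k * b.
Proof.
move=> k0 sab a0 b0; rewrite -{1}(sqr_sqrtr a0) -{1}(sqr_sqrtr b0).
move: (Num.sqrt a) (Num.sqrt b) sab => x y sxy {a b a0 b0}.
have := sqr_ge0 (k / 2 * x - 2 * y) => h.
have e : k / 4 * x ^+ 2 + 4 / k * y ^+ 2 - 2 * (x * y) = k^-1 * (k / 2 * x - 2 * y) ^+ 2.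
  by field; rewrite gt_eqF.
have : 0 <= k^-1 * (k / 2 * x - 2 * y) ^+ 2 by rewrite mulr_ge0// invr_ge0 ltW.
by rewrite -e => h'; lra.
Qed.

(** With [f] the weighted derivative on the left, the pairing is [2 * ipH f] against the derivative
    of [eta], minus [k] times a pairing that [dlog_profile_ge] bounds below by [nsqH f / 2].
    [absorb_aux] uses up half of the resulting [k / 2 * nsqH f]. *)
Lemma caccioppoli_term eta v k i : test_function eta -> Hplus v -> 0 < k -> i <> Ifun ->
  {ae mu2, forall x, H x -> 0 <= v x} ->
  L2H (fun x => eta x * inv_profile (k * v x) * component i v x) /\
  ipH (component i v) (cutoff_profile eta v k i) <=
  4 / k * nsqH (test_component i eta) -
    k / 4 * nsqH (fun x => eta x * inv_profile (k * v x) * component i v x).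
Proof.
move=> te Hv k0 ni v0; have [C C0 Ce] := test_bounded te.
have mv : measurable_fun H v := L2_measurable (Hplus_L2 Ifun Hv).
have me : measurable_fun H eta := L2_measurable (test_L2 te).
have mi := measurable_comp_scale k (@inv_profile_continuous R) mv.
pose f x := eta x * inv_profile (k * v x) * component i v x.
pose W x := eta x ^+ 2 * (dlog_profile (k * v x) * inv_profile (k * v x)) * component i v x.
pose V x := eta x ^+ 2 * inv_profile (k * v x) ^+ 2 * component i v x.
have vL := Hplus_L2 i Hv.
have tL : L2H (test_component i eta) by apply: test_L2; exact: test_test_component.
have mei := measurable_funM me mi.
have eiC x : `|eta x * inv_profile (k * v x)| <= C.
  by rewrite normrM -[leRHS]mulr1; apply: ler_pM => //; exact: norm_inv_profile.
have fL : L2H f := (L2_mul_bounded (ltW C0) mei (fun x _ => eiC x) vL).1.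
have WL : L2H W := (L2_mul_bounded (exprn_ge0 2 (ltW C0)) (measurable_weight k te mv)
  (fun x _ => weight_le C0 Ce _ x) vL).1.
have VL : L2H V.
  have := (L2_mul_bounded (ltW C0) mei (fun x _ => eiC x) fL).1; congr (L2H).
  by apply/funext => x; rewrite /V /f /=; ring.
have TL := (L2_mul_bounded ler01 mi (fun x _ => norm_inv_profile _) (L2_cutoff_test te i)).1.
split; first exact: fL.
have -> : ipH (component i v) (cutoff_profile eta v k i) = 2 * ipH f (test_component i eta) - k * ipH (component i v) W.
  transitivity (ipH (component i v) (fun x => 2 * (inv_profile (k * v x) * (eta x * test_component i eta x)) + (- k) * W x)).
    by case: i ni @f @W @V vL tL fL WL VL TL => [[]//| | |] _ *; congr ip; apply/funext => x; rewrite mulNr.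
  rewrite (ipDr mH (L2Z mH 2 TL) (L2Z mH (- k) WL) vL) (ipZr mH 2 TL vL) (ipZr mH (- k) WL vL) mulNr.
  congr (2 * _ - _); rewrite !ipE; congr Rintegral; apply/funext => x; rewrite /f; ring.
have fV : nsqH f = ipH (component i v) V.
  by rewrite /nsq !ipE; congr Rintegral; apply/funext => x; rewrite /f /V; ring.
have WV : 0 <= ipH (component i v) (fun x => W x + (- 2^-1) * V x).
  apply: (ip_ge0_ae mH vL (L2D mH WL (L2Z mH _ VL))).
  apply: ae_imp v0 => x h Hx; have kv : 0 <= k * v x by rewrite mulr_ge0 ?(ltW k0)//; exact: h.
  have d := dlog_profile_ge kv; have i0 := inv_profile_gt0 (k * v x).
  have -> : component i v x * (W x + - 2^-1 * V x) =
    (eta x * component i v x) ^+ 2 * (inv_profile (k * v x) * (dlog_profile (k * v x) - 2^-1 * inv_profile (k * v x))).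
    by rewrite /W /V; ring.
  apply: mulr_ge0; first exact: sqr_ge0.
  by apply: mulr_ge0; [exact: ltW|rewrite subr_ge0].
rewrite (ipDr mH WL (L2Z mH _ VL) vL) (ipZr mH _ VL vL) -fV in WV.
have key := absorb_aux k0 (le_trans (ler_norm _) (ip_le mH fL tL)) (@nsq_ge0 _ _ _ mu2 H f) (@nsq_ge0 _ _ _ mu2 H (test_component i eta)).
rewrite -/f.
move: (nsqH f) (nsqH (test_component i eta)) (ipH f (test_component i eta)) (ipH (component i v) W) WV key.
move=> a b c e WV key; have := mulr_ge0 (ltW k0) WV; clear -key; lra.
Qed.

Lemma caccioppoli_aux (k a b c a' b' c' s1 s2 s3 : R) : 0 < k -> 0 <= c -> 0 <= s1 + s2 + s3 ->
  s1 <= 4 / k * a' - k / 4 * a -> s2 <= 4 / k * b' - k / 4 * b -> s3 <= 4 / k * c' - k / 4 * c ->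
  k ^+ 2 * (a + b) <= 16 * (a' + b' + c').
Proof.
move=> k0 n3 F T1 T2 T3.
have h : 0 <= 4 / k * (a' + b' + c') - k / 4 * (a + b).
  have := mulr_ge0 (ltW k0) n3; lra.
have := mulr_ge0 (ltW k0) h; rewrite mulrBr.
have -> : k * (4 / k * (a' + b' + c')) = 4 * (a' + b' + c') by field; rewrite gt_eqF.
have -> : k * (k / 4 * (a + b)) = k ^+ 2 * (a + b) / 4 by field.
lra.
Qed.

(** The sum of the three terms is nonnegative by [form_ge0]. The right side is independent of [k],
    while the left side dominates the gradient of [log_profile (k * v)] weighted by [eta], since
    [|dlog_profile| <= inv_profile]. *)
Lemma caccioppoli p eta v k : 2 < p -> test_function eta -> Hplus v -> 0 < k ->
  qform 1 0 v = level p 1 0 * pnH p v ^+ 2 ->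
  {ae mu2, forall x, H x -> 0 <= v x} ->
  k ^+ 2 * (nsqH (fun x => eta x * inv_profile (k * v x) * component Idx v x) +
    nsqH (fun x => eta x * inv_profile (k * v x) * component Idy v x)) <=
  16 * (nsqH (test_component Idx eta) + nsqH (test_component Idy eta) + nsqH (test_component Idth eta)).
Proof.
move=> p2 te Hv k0 Qv v0; have [C C0 Ce] := test_bounded te.
have [Hh hE] := cutoff_profile_Hplus k te Hv C0 Ce.
have h0 x : H x -> 0 <= cutoff_profile eta v k Ifun x.
  move=> _; rewrite /cutoff_profile mulrAC -expr2; apply: mulr_ge0; first exact: sqr_ge0.
  by apply: ltW; exact: inv_profile_gt0.
have F := form_ge0 p2 ltr01 (lexx 0) Hv Qv Hh v0 h0.
have cE i : component_ip i v (cutoff_profile eta v k Ifun) = ipH (component i v) (cutoff_profile eta v k i).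
  rewrite component_ip.unlock; apply: (ae_eq_ip mH (Hplus_L2 i Hv) (Hplus_L2 i Hv) (Hplus_L2 i Hh)).
  - exact: (L2_cutoff_profile k te Hv C0 Ce i).
  - exact: aeW.
  - exact: hE.
rewrite /form mul0r addr0 mul1r !cE in F.
have [_ T1] := caccioppoli_term te Hv k0 (i := Idx) ltac:(discriminate) v0.
have [_ T2] := caccioppoli_term te Hv k0 (i := Idy) ltac:(discriminate) v0.
have [_ T3] := caccioppoli_term te Hv k0 (i := Idth) ltac:(discriminate) v0.
have n3 := @nsq_ge0 _ _ _ mu2 H (fun x => eta x * inv_profile (k * v x) * component Idth v x).
exact: (caccioppoli_aux k0 n3 F T1 T2 T3).
Qed.

End Caccioppoli.

(** * Oscillation of the logarithm on squares *)

Section LogOscillation.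
Context {R : realType}.
Local Notation mu2 := (lebesgue2 R).
Local Notation H := (@half_plane R).
Local Notation plane := (measurableTypeR R * measurableTypeR R)%type.
Local Notation nsqH := (nsq mu2 H).
Local Notation L2H := (L2 mu2 H).
Local Notation pnH := (pn mu2 H).
Implicit Types (f g h u v w phi psi eta : R * R -> R) (x : R * R) (i : component_index).
Implicit Types (p k : R).
Let mH := @measurable_half_plane R.

Lemma nsq_sub_le (A B : set plane) f g : measurable A -> measurable B -> A `<=` B ->
  L2 mu2 A f -> L2 mu2 B g -> (forall x, A x -> `|f x| <= `|g x|) -> nsq mu2 A f <= nsq mu2 B g.
Proof.
move=> mA mB AB f2 g2 fg; have gA := L2_sub mA mB AB g2.
apply: (le_trans (nsq_le mA f2 gA fg)).
rewrite -lee_fin (nsqE mA gA) (nsqE mB g2); apply: ge0_subset_integral => //.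
- by apply/measurable_EFinP; apply: measurable_funX; exact: L2_measurable g2.
- by move=> x _; rewrite lee_fin sqr_ge0.
Qed.

Lemma norm_dlog_inv (s : R) : `|dlog_profile s| <= inv_profile s.
Proof.
rewrite -(ler_pXn2r (n := 2)) ?nnegrE//; last exact: ltW (inv_profile_gt0 s).
by rewrite real_normK ?num_real//; exact: dlog_profile_sq.
Qed.

(** A bump on a larger box whose left end [a / 2] is still positive. The bound [eta0] is the product
    of the values of the four factors at the edges of the square, each factor being monotone. *)
Lemma cutoff_on_square (a c h : R) : 0 < a -> 0 < h -> exists2 eta, test_function eta &
  exists2 eta0, 0 < eta0 & forall x, rect a (a + h) c (c + h) x -> eta0 <= eta x.
Proof.
move=> a0 h0; exists (bump 0 (a / 2) (a + h + 1) (c - 1) (c + h + 1)).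
  by apply: test_bump; rewrite divr_gt0.
have a2 : 0 < a / 2 by rewrite divr_gt0.
exists (flat_exp 0 (a / 2) * flat_exp 0 1 * (flat_exp 0 1 * flat_exp 0 1)).
  have e1 := flat_exp0_gt0 a2; have e2 := flat_exp0_gt0 (@ltr01 R).
  by apply: mulr_gt0; apply: mulr_gt0.
have g0 (t : R) : 0 <= flat_exp 0 t by exact: flat_exp_ge0.
move=> [s t] [] /=; rewrite !in_itv /= => /andP[s1 s2] /andP[t1 t2]; rewrite /bump /= !mul1r.
have m (r r' : R) : r <= r' -> flat_exp 0 r <= flat_exp 0 r' by move=> le; exact: flat_exp0_homo.
apply: ler_pM; rewrite ?mulr_ge0//; apply: ler_pM => //; apply: m; lra.
Qed.


Lemma norm_mul3 (r s t : R) : `|r * s * t| = `|r| * `|s| * `|t|. Proof. by rewrite !normrM. Qed.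

(** [square_poincare] requires a C^1 function, so it is applied to [G = log_profile (k * psi n)]
    with a test function [psi n] close to [v]. How close may depend on [k], but the resulting bound
    does not. The average of [G] serves as [m]. *)
Lemma log_oscillation p v (a c h : R) : 2 < p -> Hplus v ->
  qform 1 0 v = level p 1 0 * pnH p v ^+ 2 ->
  {ae mu2, forall x, H x -> 0 <= v x} -> 0 < a -> 0 < h ->
  exists B : R, forall k, 0 < k -> exists m : R,
    L2 mu2 (rect a (a + h) c (c + h)) (fun x => log_profile (k * v x) - m) /\
    nsq mu2 (rect a (a + h) c (c + h)) (fun x => log_profile (k * v x) - m) <= B.
Proof.
move=> p2 Hv Qv v0 a0 h0; have [eta te [eta0 eta00 etaQ]] := cutoff_on_square c a0 h0.
have [C C0 Ce] := test_bounded te.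
pose E := nsqH (test_component Idx eta) + nsqH (test_component Idy eta) + nsqH (test_component Idth eta).
(* The first 1 bounds the squared distance between [log_profile (k * v)] and [G]; the [+ 1] after
   [16 * E] is the slack in the gradient bound for the approximation. The outer factors 2 come from
   [nsqD_le]. *)
exists (2 * 1 + 2 * (2 * h ^+ 2 * ((eta0 ^+ 2)^-1 * (16 * E + 1)))) => k k0.
have cacc := caccioppoli p2 te Hv k0 Qv v0.
set Q := rect a (a + h) c (c + h).
have mQ : measurable (Q : set plane) by exact: measurable_rect.
have QH : Q `<=` H by exact: rect_half.
have [psi [tp p0 pae]] := Hplus_dense_ae Hv.
have mv : measurable_fun H v := L2_measurable (Hplus_L2 Ifun Hv).
have me : measurable_fun H eta := L2_measurable (test_L2 te).
have mp n : measurable_fun H (psi n) := L2_measurable (test_L2 (tp n)).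
have tL i n : L2H (test_component i (psi n)) by apply: test_L2; exact: test_test_component.
pose F i n x := eta x * dlog_profile (k * psi n x) * test_component i (psi n) x.
pose F0 i x := eta x * dlog_profile (k * v x) * component i v x.
have wC x s : `|eta x * dlog_profile s| <= C.
  by rewrite normrM -[leRHS]mulr1; apply: ler_pM => //; exact: norm_dlog_profile.
have mw w : measurable_fun H w -> measurable_fun H (fun x => eta x * dlog_profile (k * w x)).
  by move=> mw; apply: measurable_funM => //; exact: (measurable_comp_scale k (@dlog_profile_continuous R) mw).
have cw : {ae mu2, forall x, H x -> eta x * dlog_profile (k * psi n x) @[n --> \oo] --> eta x * dlog_profile (k * v x)}.
  apply: ae_imp pae => x hx Hx; apply: cvgMr.
  exact: (@cvg_comp_scale R (@dlog_profile R) k (fun n => psi n x) (v x) (@dlog_profile_continuous R) (hx Hx)).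
have FP i := L2_null_mul2 C0 (fun n => mw _ (mp n)) (mw _ mv) (fun n x _ => wC x _) (fun x _ => wC x _) cw
  (tL i) (Hplus_L2 i Hv) (p0 i).
have F0L i : L2H (F0 i) := (L2_mul_bounded (ltW C0) (mw _ mv) (fun x _ => wC x _) (Hplus_L2 i Hv)).1.
have FL i n : L2H (F i n) := (FP i).1 n.
have Fcvg i : nsqH (F i n) @[n --> \oo] --> nsqH (F0 i) := nsq_cvg (FL i) (F0L i) (FP i).2.
have F0le i : i <> Ifun -> nsqH (F0 i) <= nsqH (fun x => eta x * inv_profile (k * v x) * component i v x).
  move=> ni; have [fL _] := caccioppoli_term te Hv k0 ni v0.
  apply: (nsq_le mH (F0L i) fL) => x _; rewrite /F0 (norm_mul3 (eta x) (dlog_profile _)) (norm_mul3 (eta x) (inv_profile _)); apply: ler_wpM2r => //.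
  by apply: ler_wpM2l => //; rewrite (gtr0_norm (inv_profile_gt0 _)); exact: norm_dlog_inv.
have k2 : 0 <= k ^+ 2 by exact: sqr_ge0.
have lim1 : k ^+ 2 * (nsqH (F Idx n) + nsqH (F Idy n)) @[n --> \oo] --> k ^+ 2 * (nsqH (F0 Idx) + nsqH (F0 Idy)).
  by apply: cvgMr; apply: cvgD; exact: Fcvg.
have lt1 : k ^+ 2 * (nsqH (F0 Idx) + nsqH (F0 Idy)) < 16 * E + 1.
  apply: le_lt_trans (_ : 16 * E < _); last by rewrite ltrDl.
  apply: le_trans cacc; apply: ler_wpM2l => //.
  by apply: lerD; apply: F0le.
have [N1 _ hN1] := cvgr_lt _ lim1 _ lt1.
have lim2 : k ^+ 2 * nsqH (fun x => psi n x - v x) @[n --> \oo] --> (0 : R).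
  by rewrite -[X in _ --> X](mulr0 (k ^+ 2)); apply: cvgMr; exact: (p0 Ifun).
have [N2 _ hN2] := cvgr_lt _ lim2 _ (@ltr01 R).
(* Beyond [N1] the weighted gradient of the approximation obeys the estimate of [caccioppoli] up to
   1. Beyond [N2] the approximation is so close that the factor [k ^ 2], from the Lipschitz bound at
   scale [k], does no harm. *)
pose n := (N1 + N2)%N.
have B1 := hN1 n (leq_addr _ _); have B2 := hN2 n (leq_addl _ _).
rewrite /= in B1 B2.
pose G x := log_profile (k * psi n x).
have cG m : class_C m G.
  apply: class_C_log_profile; apply: class_C_mul; first exact: class_C_cst.
  exact: test_smooth (tp n) m.
have dG i : i = Idx \/ i = Idy -> [/\ continuous (test_component i G) &
    forall x, test_component i G x = dlog_profile (k * psi n x) * (k * test_component i (psi n) x)].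
  have [cG0 [_ [[c1 _] [c2 _]]]] := cG 1%N.
  by case=> ->; split; [exact: c1| |exact: c2|] => x;
    have [d1 d2] := test_is_derive x (tp n);
    [have e := deriv_log_profile k d1|have e := deriv_log_profile k d2]; have := derive_val (is_derive := e).
have aah : a <= a + h by rewrite lerDl ltW.
have cch : c <= c + h by rewrite lerDl ltW.
have dGL i (ii : i = Idx \/ i = Idy) : L2 mu2 Q (test_component i G).
  by apply: continuous_L2_rect => //; have [] := dG i ii.
have dGle i : i = Idx \/ i = Idy -> eta0 ^+ 2 * nsq mu2 Q (test_component i G) <= k ^+ 2 * nsqH (F i n).
  move=> ii; have [_ dGE] := dG i ii.
  rewrite -(nsqZ mQ _ (dGL i ii)) -(nsqZ mH _ (FL i n)).
  apply: (nsq_sub_le mQ mH QH (L2Z mQ _ (dGL i ii)) (L2Z mH _ (FL i n))) => x Qx.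
  rewrite dGE /F -[eta0 * _]mulr1 (norm_mul3 eta0 _ 1) (normrM (dlog_profile _)) (normrM k (_ * _)) (norm_mul3 (eta x)) (normrM k) normr1 mulr1 (gtr0_norm eta00).
  have -> : `|k| * (`|eta x| * `|dlog_profile (k * psi n x)| * `|test_component i (psi n) x|) =
    `|eta x| * (`|dlog_profile (k * psi n x)| * (`|k| * `|test_component i (psi n) x|)) by ring.
  apply: ler_wpM2r; first by rewrite !mulr_ge0.
  exact: le_trans (etaQ x Qx) (ler_norm _).
pose m := average G a c h.
have SP : nsq mu2 Q (fun x => G x - m) <= 2 * h ^+ 2 * ((eta0 ^+ 2)^-1 * (16 * E + 1)).
  apply: (le_trans (square_poincare a c h0 (cG 1%N))).
  apply: ler_wpM2l; first by rewrite mulr_ge0 ?sqr_ge0.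
  rewrite ler_pdivlMl ?exprn_gt0//.
  have := dGle Idx (or_introl erefl); have := dGle Idy (or_intror erefl).
  rewrite -/Q /= mulrDr => h1 h2; apply: (le_trans (lerD h2 h1)).
  by rewrite -mulrDr; exact: ltW.
exists m.
have GL : L2 mu2 Q (fun x => G x - m).
  apply: continuous_L2_rect => // x; apply: cvgB; last exact: cvg_cst.
  exact: (class_C_continuous (cG 0%N)).
have mlog : measurable_fun Q (fun x => log_profile (k * v x)).
  apply: measurable_funS (measurable_comp_scale k (@log_profile_continuous R) mv) => //.
have mG : measurable_fun Q G.
  apply: measurable_funS (measurable_comp_scale k (@log_profile_continuous R) (mp n)) => //.
have dvL : L2H (fun x => psi n x - v x) := L2B mH (tL Ifun n) (Hplus_L2 Ifun Hv).
have kvL := L2Z mH k dvL.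
have dle x : Q x -> `|log_profile (k * v x) - G x| <= `|k * (psi n x - v x)|.
  by move=> _; apply: (le_trans (log_profile_lip _ _)); rewrite -mulrBr !normrM distrC.
have DL : L2 mu2 Q (fun x => log_profile (k * v x) - G x).
  exact: (L2_dom mQ (measurable_funB mlog mG) (L2_sub mQ mH QH kvL) dle).
have D1 : nsq mu2 Q (fun x => log_profile (k * v x) - G x) <= 1.
  by apply: le_trans (ltW B2); rewrite -(nsqZ mH _ dvL); exact: (nsq_sub_le mQ mH QH DL kvL dle).
have E1 : (fun x => log_profile (k * v x) - m) = (fun x => (log_profile (k * v x) - G x) + (G x - m)).
  by apply/funext => x; rewrite addrA subrK.
rewrite E1; split; first exact: (L2D mQ DL GL).
apply: (le_trans (nsqD_le mQ DL GL)); apply: lerD.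
  exact: ler_wpM2l.
exact: ler_wpM2l.
Qed.

End LogOscillation.

Section Positivity.
Context {R : realType}.
Local Notation mu2 := (lebesgue2 R).
Local Notation H := (@half_plane R).
Local Notation plane := (measurableTypeR R * measurableTypeR R)%type.
Local Notation L2H := (L2 mu2 H).
Local Notation pnH := (pn mu2 H).
Implicit Types (f g h u v w : R * R -> R) (x : R * R).
Let mH := @measurable_half_plane R.

Lemma chebyshev_nsq (A Q : set plane) g (r : R) : measurable A -> measurable Q -> A `<=` Q ->
  L2 mu2 Q g -> 0 <= r -> (forall x, A x -> r <= `|g x|) ->
  ((r ^+ 2)%:E * mu2 A <= (nsq mu2 Q g)%:E)%E.
Proof.
move=> mA mQ AQ g2 r0 rg; have mg := L2_measurable g2.
rewrite -(integral_cst mu2 mA) (nsqE mQ g2).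
apply: (@le_trans _ _ (\int[mu2]_(x in A) (g x ^+ 2)%:E)%E).
  apply: ge0_le_integral => //.
  - by move=> x _; rewrite lee_fin sqr_ge0.
  - by apply/measurable_EFinP; apply: measurable_funX; exact: measurable_funS mg.
  - move=> x Ax; rewrite lee_fin -(real_normK (num_real (g x))).
    by rewrite ler_pXn2r ?nnegrE//; exact: rg.
apply: ge0_subset_integral => //.
- by apply/measurable_EFinP; exact: measurable_funX.
- by move=> x _; rewrite lee_fin sqr_ge0.
Qed.

Lemma null_ae (Z : set plane) : measurable Z -> mu2 Z = 0%E -> {ae mu2, forall x, ~ Z x}.
Proof. by move=> mZ Z0; exists Z; split => // x /= /contrapT. Qed.

Lemma large_gap (B d : R) : 0 < d -> exists2 r : R, 0 < r & B < r ^+ 2 * d.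
Proof.
move=> d0; exists (`|B| / d + 1); first by rewrite ltr_wpDl// divr_ge0// ltW.
apply: (le_lt_trans (ler_norm B)).
have e : `|B| = `|B| / d * d by rewrite divfK// gt_eqF.
rewrite {1}e ltr_pM2r//.
have : 0 <= `|B| / d by rewrite divr_ge0// ltW.
by move: (`|B| / d) => s s0; nra.
Qed.

Lemma square_scalar (N i : R) (x : R * R) :
  rect i (i + (2 * N - i)) (- N) (- N + (2 * N - i)) x <-> [/\ i <= x.1, x.1 <= 2 * N, - N <= x.2 & x.2 <= N - i].
Proof.
rewrite [i + _](_ : _ = 2 * N); last by rewrite addrCA subrr addr0.
rewrite [- N + _](_ : _ = N - i); last by rewrite addrA mulrDl mul1r addrA addNr add0r.
split; first by case=> /=; rewrite !in_itv /= => /andP[? ?] /andP[? ?].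
by case=> h1 h2 h3 h4; split; rewrite /= in_itv /=; apply/andP.
Qed.

Definition side n : R := 2 * n.+1%:R - n.+1%:R^-1.
(** With [N = n + 1] this is [[N^-1, 2 * N]] times [[- N, N - N^-1]]. The [side] is chosen so that
    these genuine squares increase and exhaust the half-plane. *)
Definition square n := rect n.+1%:R^-1 (n.+1%:R^-1 + side n) (- n.+1%:R) (- n.+1%:R + side n).

Lemma invS n : 0 < n.+1%:R^-1 :> R /\ n.+1%:R^-1 <= 1 :> R.
Proof. by rewrite invr_gt0 ltr0n invf_le1// ler1n. Qed.

Lemma square_aux1 (i N : R) : i <= 1 -> 1 <= N -> 0 < 2 * N - i.
Proof. lra. Qed.

Lemma square_aux2 (i N j M s t : R) : j <= s -> s <= 2 * M -> - M <= t -> t <= M - j ->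
  M <= N -> i <= j -> [/\ i <= s, s <= 2 * N, - N <= t & t <= N - i].
Proof. by move=> *; split; lra. Qed.

Lemma square_aux3 (i N j r s t : R) : s + r + j + 1 < N -> i <= 1 -> i <= s -> - t <= r -> t <= r ->
  0 < s -> 0 < j -> [/\ i <= s, s <= 2 * N, - N <= t & t <= N - i].
Proof. by move=> *; split; lra. Qed.

Lemma side_gt0 n : 0 < side n.
Proof.
have [_ i1] := invS n; have n1 : 1 <= n.+1%:R :> R by rewrite ler1n.
exact: square_aux1 i1 n1.
Qed.

Lemma square_mono m n : (m <= n)%N -> square m `<=` square n.
Proof.
move=> mn x /square_scalar[s1 s2 t1 t2]; apply/square_scalar.
have mn' : m.+1%:R <= n.+1%:R :> R by rewrite ler_nat.
have mni : n.+1%:R^-1 <= m.+1%:R^-1 :> R by rewrite lef_pV2 ?posrE.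
exact: square_aux2 s1 s2 t1 t2 mn' mni.
Qed.

Lemma square_cover x : H x -> exists n, square n x.
Proof.
case: x => s t; rewrite /half_plane /= => s0.
exists (Num.truncn (s + `|t| + s^-1 + 1)); apply/square_scalar => /=.
have := truncnS_gt (s + `|t| + s^-1 + 1); set n := Num.truncn _ => h.
have si : 0 < s^-1 by rewrite invr_gt0.
have [i0 i1] := invS n; have t0 := normr_ge0 t.
have ts : n.+1%:R^-1 <= s.
  rewrite -[leRHS]invrK lef_pV2 ?posrE ?ltr0n//.
  by move: h s0 si t0; move: (n.+1%:R) (s^-1) (`|t|); clear => N i r; lra.
have := ler_norm t; have := ler_norm (- t); rewrite normrN => t1 t2.
exact: square_aux3 h i1 ts t1 t2 s0 si.
Qed.

Lemma gap_low (r s t : R) : 0 < r -> s + r <= t -> r <= `|s - t|.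
Proof. by move=> r0 st; rewrite ler0_norm; lra. Qed.

Lemma gap_high (r s t y : R) : t < s + r -> s + 2 * r <= y -> r <= `|y - t|.
Proof. by move=> ts sy; rewrite ler_normr; apply/orP; left; lra. Qed.

Section Dichotomy.
Variables (p : R) (v : R * R -> R).
Hypotheses (p2 : 2 < p) (Hv : Hplus v) (Qv : qform 1 0 v = level p 1 0 * pnH p v ^+ 2).
Hypothesis v0 : {ae mu2, forall x, H x -> 0 <= v x}.

(** Suppose [Z], where [v = 0], and some [P m], where [v >= (m + 1)^-1], both have positive measure.
    For large [k] the values of [log_profile (k * v)] on the two sets are separated by [2 * r], so
    any constant [t] is at distance at least [r] from one of them. Chebyshev then contradicts the
    bound of [log_oscillation] once [r] is large. *)
Lemma dichotomy (a c h : R) : 0 < a -> 0 < h ->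
  {ae mu2, forall x, rect a (a + h) c (c + h) x -> v x = 0} \/
  {ae mu2, forall x, rect a (a + h) c (c + h) x -> 0 < v x}.
Proof.
move=> a0 h0; have [B hB] := log_oscillation c p2 Hv Qv v0 a0 h0.
move: hB; set Q := rect a (a + h) c (c + h) => hB.
have mQ : measurable (Q : set plane) by exact: measurable_rect.
have QH : Q `<=` H by exact: rect_half.
have aah : a <= a + h by rewrite lerDl ltW.
have cch : c <= c + h by rewrite lerDl ltW.
have mv : measurable_fun Q v by exact: measurable_funS (L2_measurable (Hplus_L2 Ifun Hv)).
pose Z : set plane := Q `&` v @^-1` [set 0].
pose P (m : nat) : set plane := Q `&` v @^-1` `[m.+1%:R^-1, +oo[%classic.
have mZ : measurable Z by exact: mv.
have mP m : measurable (P m) by exact: mv.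
have fin (A : set plane) : measurable A -> A `<=` Q -> mu2 A = (fine (mu2 A))%:E.
  move=> mA AQ; rewrite fineK// ge0_fin_numE//.
  apply: le_lt_trans (_ : mu2 Q < +oo)%E; first by apply: le_measure => //; rewrite inE.
  by rewrite /Q lebesgue2_rect// ltry.
have ZQ : Z `<=` Q by move=> x [].
have PQ m : P m `<=` Q by move=> x [].
have [Z0|Z0] := eqVneq (mu2 Z) 0%E.
  right; apply: ae_imp2 v0 (null_ae mZ Z0) => x h1 h2 Qx.
  rewrite lt_def (h1 (QH _ Qx)) andbT; apply/eqP => vx; apply: h2.
  by split.
left; have P0 m : mu2 (P m) = 0%E.
  apply/eqP/negP => /negP Pm.
  have z0 : 0 < fine (mu2 Z) by rewrite lt_def fine_ge0// andbT -eqe -(fin _ mZ ZQ).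
  have q0 : 0 < fine (mu2 (P m)) by rewrite lt_def fine_ge0// andbT -eqe -(fin _ (mP m) (PQ m)).
  have d0 : 0 < Num.min (fine (mu2 Z)) (fine (mu2 (P m))) by rewrite lt_min z0.
  have [r r0 Br] := large_gap B d0.
  (* [L0] is the value on [Z]. The factor [(m + 1) * expR T] lifts the values on [P m] to at least
     [T = L0 + 2 * r]. *)
  pose L0 := log_profile (0 : R); pose T := L0 + 2 * r.
  have k0 : 0 < m.+1%:R * expR T by rewrite mulr_gt0// expR_gt0.
  have [t [tL tB]] := hB _ k0.
  have cheb (A : set plane) : measurable A -> A `<=` Q -> Num.min (fine (mu2 Z)) (fine (mu2 (P m))) <= fine (mu2 A) ->
      (forall x, A x -> r <= `|log_profile (m.+1%:R * expR T * v x) - t|) -> False.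
    move=> mA AQ dA rA; have := chebyshev_nsq mA mQ AQ tL (ltW r0) rA.
    rewrite (fin _ mA AQ) -EFinM lee_fin => le1.
    have := ler_wpM2l (sqr_ge0 r) dA; move: (_ * Num.min _ _) Br => y Br le2.
    have := lt_le_trans Br (le_trans le2 (le_trans le1 tB)); by rewrite ltxx.
  have [tm|tm] := leP (L0 + r) t.
    apply: (cheb Z mZ ZQ); first by rewrite ge_min lexx.
    move=> x [_ /= vx]; rewrite vx mulr0; exact: gap_low.
  apply: (cheb (P m) (mP m) (PQ m)); first by rewrite ge_min lexx orbT.
  move=> x [_ /=]; rewrite in_itv /= andbT => vx.
  have : T <= log_profile (m.+1%:R * expR T * v x).
    apply: log_profile_large; rewrite mulrAC -[leLHS]mul1r; apply: ler_wpM2r; first exact: expR_ge0.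
    by rewrite -ler_pdivrMl// mulr1.
  by move=> Ty; exact: gap_high tm Ty.
have aeP : {ae mu2, forall x, forall m, ~ P m x} by apply: ae_foralln => m; exact: null_ae.
apply: ae_imp2 v0 aeP => x h1 h2 Qx; apply/eqP; rewrite eq_le h1 ?andbT; last exact: QH.
rewrite leNgt; apply/negP => vx; apply: (h2 (Num.truncn (v x)^-1)); split => //=.
rewrite in_itv /= andbT -[leRHS]invrK lef_pV2 ?posrE ?invr_gt0//.
by apply: ltW; exact: truncnS_gt.
Qed.

(** The squares are nested: if [v] is not null on one of them, the dichotomy makes it positive on
    all later ones, which cover the half-plane. Otherwise [v] is null on each square, hence
    everywhere. *)
Lemma ground_positive : nontrivial v -> positive_ae v.
Proof.
move=> nv; have dich n := dichotomy (- n.+1%:R) (invS n).1 (side_gt0 n).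
have [[N posN]|none] := pselect (exists N, ~ {ae mu2, forall x, square N x -> v x = 0}).
  have pos n : {ae mu2, forall x, square (N + n)%N x -> 0 < v x}.
    have [z|//] := dich (N + n)%N; exfalso; apply: posN.
    by apply: ae_imp z => x h sx; apply: h; apply: square_mono sx; exact: leq_addr.
  have := ae_foralln pos; apply: ae_imp => x h Hx; have [n sn] := square_cover Hx.
  by apply: (h n); apply: square_mono sn; exact: leq_addl.
exfalso; apply: nv.
have z n : {ae mu2, forall x, square n x -> v x = 0} by apply: contrapT => hn; apply: none; exists n.
have := ae_foralln z; apply: ae_imp => x h Hx; have [n sn] := square_cover Hx.
exact: (h n).
Qed.

End Dichotomy.
End Positivity.

(** * Rescaling and passage to the limit *)

Section Scaling.
Context {R : realType}.
Local Notation mu2 := (lebesgue2 R).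
Local Notation H := (@half_plane R).
Local Notation plane := (measurableTypeR R * measurableTypeR R)%type.
Local Notation nsqH := (nsq mu2 H).
Local Notation L2H := (L2 mu2 H).
Local Notation LpH := (Lp mu2 H).
Local Notation pnpH := (pnp mu2 H).
Local Notation pnH := (pn mu2 H).
Implicit Types (f g h u v w phi : R * R -> R) (x : R * R) (l : R) (i : component_index).
Let mH := @measurable_half_plane R.

Lemma mul_lty (r : R) (z : \bar R) : 0 < r -> (r%:E * z < +oo -> z < +oo)%E.
Proof. by move=> r0; case: z => [s| |]//=; rewrite ?ltry// mulry gtr0_sg// mul1e. Qed.

Definition dilate {T} l (f : R * R -> T) x := f (l * x.1, l * x.2).

Lemma half_plane_dilate l x : 0 < l -> H (l * x.1, l * x.2) <-> H x.
Proof. by move=> l0; rewrite /half_plane /= pmulr_rgt0. Qed.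

Lemma measurable_dilation l : measurable_fun setT (fun x : plane => (l * x.1, l * x.2) : plane).
Proof.
apply: measurable_fun_pair; apply: measurable_funM => //; by [exact: measurable_fst|exact: measurable_snd].
Qed.

Lemma restrict_dilate {T : pointedType} l (g : R * R -> T) x : 0 < l ->
  dilate l (g \_ H) x = ((dilate l g) \_ H) x.
Proof.
move=> l0; rewrite /dilate !patchE; have [h1 h2] := half_plane_dilate x l0.
case: ifPn; rewrite ?inE ?notin_setE => h; case: ifPn; rewrite ?inE ?notin_setE => h' //.
  by have := h1 h.
by have := h2 h'.
Qed.

Lemma integral_dilate_half l (g : R * R -> \bar R) : 0 < l -> measurable_fun H g ->
  (forall x, H x -> (0 <= g x)%E) ->
  ((l ^+ 2)%:E * \int[mu2]_(x in H) g (l * x.1, l * x.2)%R = \int[mu2]_(x in H) g x)%E.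
Proof.
move=> l0 mg g0.
have mr : measurable_fun setT (g \_ H) by exact/(measurable_restrictT _ mH).
have r0 x : (0 <= (g \_ H) x)%E by rewrite patchE; case: ifPn => //; rewrite inE => /g0.
have E : (fun x => dilate l (g \_ H) x) = (dilate l g) \_ H.
  by apply/funext => x; exact: restrict_dilate.
rewrite [in LHS]integral_mkcond [RHS]integral_mkcond -(integral_dilate2 l0 mr r0); congr (_ * _)%E.
by rewrite -/(dilate l g) -E.
Qed.

Lemma measurable_fun_dilate l f : 0 < l -> measurable_fun H f -> measurable_fun H (dilate l f).
Proof.
move=> l0 mf.
have mr : measurable_fun setT (f \_ H) by exact/(measurable_restrictT _ mH).
have E : (fun x => dilate l (f \_ H) x) = (dilate l f) \_ H.
  by apply/funext => x; exact: restrict_dilate.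
apply/(measurable_restrictT _ mH); rewrite -E; exact: (measurableT_comp mr (measurable_dilation l)).
Qed.

Lemma L2_dilate l f : 0 < l -> L2H f -> L2H (dilate l f) /\ nsqH (dilate l f) = (l ^+ 2)^-1 * nsqH f.
Proof.
move=> l0 [mf fi]; have l20 : 0 < l ^+ 2 by exact: exprn_gt0.
have md := measurable_fun_dilate l0 mf.
have msq : measurable_fun H (fun x => (f x ^+ 2)%:E) by apply/measurable_EFinP; exact: measurable_funX.
have E := integral_dilate_half l0 msq (fun x _ => ltac:(by rewrite lee_fin sqr_ge0)).
have fin : L2H (dilate l f).
  split; first exact: md.
  by have := fi; rewrite -E => /(mul_lty l20); apply.
have f2 : L2H f := conj mf fi.
split; first exact: fin.
apply: (mulfI (lt0r_neq0 l20)); rewrite mulrA divff ?mul1r; last exact: lt0r_neq0.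
apply: EFin_inj; rewrite EFinM (nsqE mH fin) (nsqE mH f2); exact: E.
Qed.

Lemma Lp_dilate p l f : 0 < l -> LpH p f -> LpH p (dilate l f) /\ pnpH p (dilate l f) = (l ^+ 2)^-1 * pnpH p f.
Proof.
move=> l0 [mf fi]; have l20 : 0 < l ^+ 2 by exact: exprn_gt0.
have md := measurable_fun_dilate l0 mf.
have msq : measurable_fun H (fun x => (`|f x| `^ p)%:E) by apply/measurable_EFinP; exact: measurable_normpow.
have E := integral_dilate_half l0 msq (fun x _ => ltac:(by rewrite lee_fin powR_ge0)).
have fin : LpH p (dilate l f).
  split; first exact: md.
  by have := fi; rewrite -E => /(mul_lty l20); apply.
have f2 : LpH p f := conj mf fi.
split; first exact: fin.
apply: (mulfI (lt0r_neq0 l20)); rewrite mulrA divff ?mul1r; last exact: lt0r_neq0.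
apply: EFin_inj; rewrite EFinM (pnpE mH fin) (pnpE mH f2); exact: E.
Qed.

Lemma ae_dilate l (P : R * R -> Prop) : 0 < l -> {ae mu2, forall x, P x} ->
  {ae mu2, forall x, P (l * x.1, l * x.2)}.
Proof.
move=> l0 [A [mA A0 PA]].
pose B : set plane := (fun x : plane => (l * x.1, l * x.2) : plane) @^-1` A.
have mB : measurable B by rewrite -[B]setTI; exact: measurable_dilation.
exists B; split => //; last by move=> x nP; exact: PA.
have mi : measurable_fun setT (fun x : plane => (\1_A x)%:E : \bar R) by apply/measurable_EFinP; exact: measurable_indic.
have := integral_dilate2 l0 mi (fun x => ltac:(by rewrite lee_fin)).
have -> : (\int[mu2]_x (\1_A x)%:E = 0)%E.
  by rewrite (integral_indic mu2 measurableT mA) setIT; exact: A0.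
have -> : (\int[mu2]_x (\1_A ((l * x.1)%R, (l * x.2)%R))%:E = mu2 B)%E.
  by rewrite -[B]setIT -(integral_indic mu2 measurableT mB).
move=> /eqP; rewrite mule_eq0 => /orP[|/eqP//].
by rewrite eqe expf_eq0 /= gt_eqF.
Qed.

(** Dilation multiplies the partial derivatives by [l] but commutes with the angular derivative,
    since its coefficients are homogeneous of degree one. *)
Definition dilate_weight l i : R := match i with Idx | Idy => l | _ => 1 end.

Lemma test_component_dilate i l kappa phi x : 0 < l -> test_function phi ->
  test_component i (fun y => kappa * dilate l phi y) x =
  kappa * dilate_weight l i * dilate l (test_component i phi) x.
Proof.
move=> l0 tp; have [d1 d2] := test_is_derive (l * x.1, l * x.2) tp.
have h1 := is_derive_scale kappa (is_derive_dilate d1).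
have h2 := is_derive_scale kappa (is_derive_dilate d2).
have E1 := derive_val (is_derive := h1); have E2 := derive_val (is_derive := h2).
case: i => /=; rewrite ?mulr1.
- by [].
- by rewrite E1 mulrA.
- by rewrite E2 mulrA.
- rewrite /dilate /dth /= E1 E2.
  by move: ('D_e1 phi _) ('D_e2 phi _) => *; ring.
Qed.

(** Test functions are dilated and passed to the limit by [Hplus_limit]; the factor [(l ^+ 2)^-1] is
    the Jacobian. *)
Lemma dilate_Hplus l kappa u : 0 < l -> Hplus u ->
  Hplus (fun x => kappa * dilate l u x) /\
  forall i, nsqH (component i (fun x => kappa * dilate l u x)) =
    (kappa * dilate_weight l i) ^+ 2 * ((l ^+ 2)^-1 * nsqH (component i u)).
Proof.
move=> l0 Hu; have [psi [tp p0]] := Hplus_dense Hu.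
have gL i : L2H (fun x => kappa * dilate_weight l i * dilate l (component i u) x).
  exact: (L2Z mH _ (L2_dilate l0 (Hplus_L2 i Hu)).1).
have tL i n : L2H (test_component i (psi n)) by apply: test_L2; exact: test_test_component.
have [Hw wE] : Hplus (fun x => kappa * dilate_weight l Ifun * dilate l (component Ifun u) x) /\
    forall i, {ae mu2, forall x, H x ->
      component i (fun x => kappa * dilate_weight l Ifun * dilate l (component Ifun u) x) x =
      kappa * dilate_weight l i * dilate l (component i u) x}.
  apply: (@Hplus_limit R (fun n x => kappa * dilate l (psi n) x)
    (fun i x => kappa * dilate_weight l i * dilate l (component i u) x)) => //.
    by move=> n; apply: test_scale; exact: test_dilate.
  move=> i; have d2 n := L2B mH (tL i n) (Hplus_L2 i Hu).
  apply: (@L2_null_le _ _ (fun n => (kappa * dilate_weight l i) ^+ 2 * ((l ^+ 2)^-1 *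
    nsqH (fun x => test_component i (psi n) x - component i u x)))).
    move=> n; have [a1 a2] := L2_dilate l0 (d2 n); rewrite -a2 -(nsqZ mH _ a1) le_eqVlt; apply/orP; left.
    apply/eqP; congr nsq; apply/funext => x; rewrite (test_component_dilate i kappa x l0 (tp n)).
    by rewrite /dilate mulrBr.
  rewrite -[X in _ --> X](mulr0 ((kappa * dilate_weight l i) ^+ 2)); apply: cvgMr.
  by rewrite -[X in _ --> X](mulr0 ((l ^+ 2)^-1)); apply: cvgMr; exact: p0.
rewrite (_ : (fun x => kappa * dilate_weight l Ifun * dilate l (component Ifun u) x) = (fun x => kappa * dilate l u x)) in Hw wE;
  last by apply/funext => x; rewrite mulr1.
split => // i.
have [a1 a2] := L2_dilate l0 (Hplus_L2 i Hu).
rewrite -a2 -(nsqZ mH _ a1).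
have K1 := Hplus_L2 i Hw; exact: (ae_eq_ip mH K1 (gL i) K1 (gL i) (wE i) (wE i)).
Qed.

Lemma qform_dilate_aux (b c l r m1 m2 m3 m4 n1 n2 n3 n4 : R) : 0 < l ->
  m1 = (r * l) ^+ 2 * ((l ^+ 2)^-1 * n1) -> m2 = (r * l) ^+ 2 * ((l ^+ 2)^-1 * n2) ->
  m3 = (r * 1) ^+ 2 * ((l ^+ 2)^-1 * n3) -> m4 = (r * 1) ^+ 2 * ((l ^+ 2)^-1 * n4) ->
  m1 + m2 + b * m3 + c * m4 = r ^+ 2 * (n1 + n2 + b * (l ^+ 2)^-1 * n3 + c * (l ^+ 2)^-1 * n4).
Proof. by move=> l0 -> -> -> ->; field; rewrite gt_eqF. Qed.

Lemma qform_dilate b c l kappa u : 0 < l -> Hplus u ->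
  qform b c (fun x => kappa * dilate l u x) = kappa ^+ 2 * qform (b * (l ^+ 2)^-1) (c * (l ^+ 2)^-1) u.
Proof.
move=> l0 Hu; have [_ E] := dilate_Hplus kappa l0 Hu.
rewrite (qformE b c) (qformE (b * _)).
exact: (@qform_dilate_aux b c l kappa _ _ _ _ _ _ _ _ l0 (E Idx) (E Idy) (E Idth) (E Ifun)).
Qed.

End Scaling.

Lemma rescale_aux {R : realType} (k s t a : R) : 0 < t ->
  k * (s * a ^+ 2) = k * s / t ^+ 2 * (t * a) ^+ 2.
Proof. by move=> t0; field; rewrite gt_eqF. Qed.

(** * Ground states under the rescaling *)

Section RescaledGround.
Context {R : realType}.
Local Notation mu2 := (lebesgue2 R).
Local Notation H := (@half_plane R).
Local Notation pnH := (pn mu2 H).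
Implicit Types (u v w : R * R -> R) (x : R * R).
Let mH := @measurable_half_plane R.

Variables (p l : R).
Hypotheses (p2 : 2 < p) (l0 : 0 < l).

Let kappa := l `^ (2 / (p - 2)).
Let tau := kappa * ((l ^+ 2)^-1) `^ p^-1.

Let l20 : 0 < l ^+ 2. Proof. exact: exprn_gt0. Qed.
Let p0 : 0 < p. Proof. by apply: lt_trans p2; rewrite ltr0n. Qed.
Let kappa0 : 0 < kappa. Proof. exact: powR_gt0. Qed.
Let tau0 : 0 < tau. Proof. by rewrite mulr_gt0// powR_gt0// invr_gt0. Qed.

(** The exponent [2 / (p - 2)] of the rescaling is the one with [kappa ^ (p - 2) = l ^ 2]; it lets
    the quadratic form and the p-th power of the L^p norm scale by the same factor [kappa ^ 2]. *)
Let kappa_pow : kappa `^ p = kappa ^+ 2 * l ^+ 2.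
Proof.
have n0 : p - 2 != 0 by rewrite subr_eq0 gt_eqF.
rewrite -{1}(subrK 2 p) addrC.
rewrite powRD; last by apply/implyP => _; exact: lt0r_neq0.
rewrite powR_mulrn ?(ltW kappa0)//; congr (_ * _).
by rewrite /kappa -powRrM divfK// powR_mulrn// ltW.
Qed.

Let tau_pow : tau `^ p = kappa ^+ 2.
Proof.
rewrite /tau powRM ?(ltW kappa0) ?powR_ge0// -powRrM mulVf ?gt_eqF// powRr1; last by rewrite invr_ge0 ltW.
by rewrite kappa_pow mulfK// gt_eqF.
Qed.

Lemma rescale_Hplus u : Hplus u -> Hplus (rescale p l u).
Proof. by move=> Hu; exact: (dilate_Hplus kappa l0 Hu).1. Qed.

Lemma qform_rescale u : Hplus u ->
  qform 1 (l ^+ 2) (rescale p l u) = kappa ^+ 2 * qform (l ^+ 2)^-1 1 u.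
Proof.
by move=> Hu; have := qform_dilate 1 (l ^+ 2) kappa l0 Hu; rewrite mul1r divff// gt_eqF.
Qed.

Lemma pn_rescale u : Hplus u -> pnH p (rescale p l u) = tau * pnH p u.
Proof.
move=> Hu; have Lu := Hplus_Lp (ltW p2) Hu; have [Ld E] := Lp_dilate l0 Lu.
transitivity (pnH p (fun x => kappa * dilate l u x)); first by [].
rewrite (pnZ mH kappa p0 Ld) (gtr0_norm kappa0) /tau -mulrA; congr (_ * _).
by rewrite !pnE E powRM// ?pnp_ge0// invr_ge0 ltW.
Qed.

Lemma rescale_onto w : Hplus w -> exists2 u, Hplus u & w = rescale p l u.
Proof.
move=> Hw; have li0 : 0 < l^-1 by rewrite invr_gt0.
exists (fun x => kappa^-1 * dilate l^-1 w x); first exact: (dilate_Hplus _ li0 Hw).1.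
apply/funext => -[s t]; rewrite /rescale /dilate /= !mulKf ?gt_eqF// mulrA divff ?mul1r//.
by rewrite gt_eqF.
Qed.

(** The rescaling is a bijection of H^+ that multiplies the L^p norm by [tau] and turns the form
    with parameters [(l ^+ 2)^-1] and 1 into [kappa ^ 2] times itself, read with parameters 1 and
    [l ^+ 2]. Minimizers of the Sobolev quotient thus correspond, and [tau ^ p = kappa ^ 2]
    preserves the Nehari identity. *)
Lemma rescale_ground u : ground p l true u ->
  [/\ Hplus (rescale p l u), 0 < pnH p (rescale p l u),
    qform 1 (l ^+ 2) (rescale p l u) = pnH p (rescale p l u) `^ p &
    qform 1 (l ^+ 2) (rescale p l u) = level p 1 (l ^+ 2) * pnH p (rescale p l u) ^+ 2].
Proof.
move=> [Hu u0 Eu Su]; have Hv := rescale_Hplus Hu.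
have v0 : 0 < pnH p (rescale p l u) by rewrite (pn_rescale Hu) mulr_gt0.
split; [exact: Hv|exact: v0| |].
  by rewrite (qform_rescale Hu) (pn_rescale Hu) powRM ?(ltW tau0) ?(ltW u0)// tau_pow -Eu.
pose S := level p (l ^+ 2)^-1 (true%:R).
have Sv : qform 1 (l ^+ 2) (rescale p l u) = kappa ^+ 2 * S / tau ^+ 2 * pnH p (rescale p l u) ^+ 2.
  rewrite (qform_rescale Hu) (pn_rescale Hu) (_ : qform _ 1 u = S * pnH p u ^+ 2)//.
  exact: rescale_aux.
have l1 := level_le p2 ltr01 (ltW l20) Hv.
have nz := normalize p2 Hv (lt0r_neq0 v0).
(* Every competitor for the rescaled level is itself a rescaling, so the original level bounds its
   form from below. *)
have l2 : kappa ^+ 2 * S / tau ^+ 2 <= level p 1 (l ^+ 2).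
  apply: lb_le_inf.
    by exists (qform 1 (l ^+ 2) (fun x => (pnH p (rescale p l u))^-1 * rescale p l u x)); eexists; first exact: nz.
  move=> _ [z [Hz z1] <-]; have [w Hw zw] := rescale_onto Hz.
  rewrite zw (qform_rescale Hw).
  have w1 : tau * pnH p w = 1 by rewrite -(pn_rescale Hw) -zw.
  have li0 : 0 < (l ^+ 2)^-1 by rewrite invr_gt0.
  have le := level_le p2 li0 ler01 Hw.
  have pw : pnH p w = tau^-1 by rewrite -[LHS](mulKf (lt0r_neq0 tau0)) w1 mulr1.
  rewrite -mulrA; apply: ler_wpM2l; first exact: sqr_ge0.
  by apply: le_trans le; rewrite pw exprVn.
apply/eqP; rewrite eq_le l1 andbT Sv; apply: ler_wpM2r => //; exact: sqr_ge0.
Qed.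

Lemma rescale_positive u : positive_ae u -> {ae mu2, forall x, H x -> 0 <= rescale p l u x}.
Proof.
move=> pu; apply: ae_imp (ae_dilate l0 pu) => x h Hx; rewrite /rescale; apply: mulr_ge0.
  exact: powR_ge0.
by apply: ltW; apply: h; exact/(half_plane_dilate _ l0).
Qed.

End RescaledGround.

Section Limit.
Context {R : realType}.
Local Notation mu2 := (lebesgue2 R).
Local Notation H := (@half_plane R).
Local Notation pnH := (pn mu2 H).
Local Notation nsqH := (nsq mu2 H).
Implicit Types (u v w : R * R -> R) (x : R * R) (p : R).
Let mH := @measurable_half_plane R.

Lemma qform_mass (b c : R) u : qform b c u = qform b 0 u + c * component_ip Ifun u u.
Proof. by rewrite /qform /form mul0r addr0. Qed.

(** [level p 1 0 <= qform 1 0 (w k) <= level p 1 (c k)] for every [k]. A fixed near-minimizer of the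
    massless problem, for which the mass term [c k] times its squared L^2 norm tends to 0, closes
    the chain from above. *)
Lemma minimizers_vanishing_mass p (c : nat -> R) (w : nat -> R * R -> R) : 2 < p ->
  (forall k, 0 <= c k) -> c k @[k --> \oo] --> (0 : R) -> (forall k, sphere p (w k)) ->
  (forall k, qform 1 (c k) (w k) = level p 1 (c k)) ->
  qform 1 0 (w k) @[k --> \oo] --> level p 1 0 /\ level p 1 (c k) @[k --> \oo] --> level p 1 0.
Proof.
move=> p2 c0 clim sw Ew.
have lo k : level p 1 0 <= qform 1 0 (w k).
  by have [Hw w1] := sw k; have := level_le p2 ltr01 (lexx 0) Hw; rewrite w1 expr1n mulr1.
have mid k : qform 1 0 (w k) <= level p 1 (c k) by rewrite -Ew; apply: qform_le.
have lim : level p 1 (c k) @[k --> \oo] --> level p 1 0.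
  have ne : sphere p !=set0 by exists (w 0%N).
  have [z [sz zlim]] := level_adherent p2 (@ltr01 R) (lexx 0) ne.
  apply/cvgrPdist_lt => e e0.
  have ze : level p 1 0 < level p 1 0 + e / 2 by rewrite ltrDl divr_gt0.
  have [N _ hN] := cvgr_lt _ zlim _ ze; have {hN} zN := hN N (leqnn N).
  have [Hz z1] := sz N.
  have cz : c k * component_ip Ifun (z N) (z N) @[k --> \oo] --> (0 : R).
    by rewrite -[X in _ --> X](mul0r (component_ip Ifun (z N) (z N))); apply: cvgMl.
  have e20 : 0 < e / 2 by rewrite divr_gt0.
  have [M _ hM] := cvgr_lt _ cz _ e20.
  exists M => // k Mk; have /= cM := hM k Mk.
  have up : level p 1 (c k) <= qform 1 (c k) (z N).
    by have := level_le p2 ltr01 (c0 k) Hz; rewrite z1 expr1n mulr1.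
  rewrite qform_mass in up; rewrite /= in zN.
  have low := le_trans (lo k) (mid k).
  rewrite /= ler0_norm ?subr_le0//; move: up zN cM; move: (level p 1 (c k)) (level p 1 0) (qform 1 0 (z N)) (_ * _).
  clear => a b q m; lra.
split => //; apply: (@squeeze_cvgr _ _ _ _ (fun=> level p 1 0) (fun k => level p 1 (c k))) => //; last exact: cvg_cst.
by near=> k; rewrite lo mid.
Unshelve. all: by end_near. Qed.

Lemma scale_cvg (t : nat -> R) (t0 : R) (w : nat -> R * R -> R) w0 : (forall n, Hplus (w n)) -> Hplus w0 ->
  t n @[n --> \oo] --> t0 -> qform 1 1 (w n \- w0) @[n --> \oo] --> (0 : R) ->
  qform 1 1 ((fun x => t n * w n x) \- (fun x => t0 * w0 x)) @[n --> \oo] --> (0 : R).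
Proof.
move=> Hw H0 tl wl.
have qn : qnorm 1 1 (w n \- w0) @[n --> \oo] --> (0 : R).
  by rewrite -[X in _ --> X]sqrtr0; apply: (continuous_cvg _ _ wl); exact: sqrt_continuous.
have bound n : qnorm 1 1 ((fun x => t n * w n x) \- (fun x => t0 * w0 x)) <=
    `|t n| * qnorm 1 1 (w n \- w0) + `|t n - t0| * qnorm 1 1 w0.
  have HB := HplusB (Hw n) H0.
  rewrite (_ : _ \- _ = (fun x => t n * (w n \- w0) x) \+ (fun x => (t n - t0) * w0 x)); last first.
    by apply/funext => x /=; rewrite mulrBr mulrBl addrA subrK.
  rewrite -(qnormZ 1 1 (t n) HB) -(qnormZ 1 1 (t n - t0) H0).
  exact: (qnormD ler01 ler01 (HplusZ _ HB) (HplusZ _ H0)).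
have lim : `|t n| * qnorm 1 1 (w n \- w0) + `|t n - t0| * qnorm 1 1 w0 @[n --> \oo] --> (0 : R).
  have z : (0 : R) = `|t0| * 0 + `|t0 - t0| * qnorm 1 1 w0 by rewrite subrr normr0 mul0r mulr0 addr0.
  rewrite [X in _ --> X]z; apply: cvgD.
    by apply: cvgM qn; apply: cvg_norm.
  by apply: cvgMl; apply: cvg_norm; apply: cvgB => //; exact: cvg_cst.
have qlim : qnorm 1 1 ((fun x => t n * w n x) \- (fun x => t0 * w0 x)) @[n --> \oo] --> (0 : R).
  apply: (squeeze_cvgr _ (cvg_cst (0 : R)) lim); near=> n; rewrite bound andbT; exact: qnorm_ge0.
have z : (0 : R) = 0 * 0 by rewrite mulr0.
rewrite [X in _ --> X]z; under eq_fun do rewrite -(sqr_qnorm ler01 ler01) expr2.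
exact: cvgM.
Unshelve. all: by end_near. Qed.

Lemma Hplus_cvg_qform (w : nat -> R * R -> R) v : (forall n, Hplus (w n)) -> Hplus v ->
  qform 1 1 (w n \- v) @[n --> \oo] --> (0 : R) -> Hplus_cvg w v.
Proof.
move=> Hw Hv lim; split => // lambda q l0.
have b0 : 0 <= (lambda ^+ 2)^-1 by rewrite invr_ge0 sqr_ge0.
have q0 : 0 <= q%:R :> R by exact: ler0n.
have K := qform_null b0 q0 Hw Hv lim.
have K2 : Num.sqrt (qform (lambda ^+ 2)^-1 q%:R (w n \- v)) @[n --> \oo] --> (0 : R).
  by rewrite -[X in _ --> X]sqrtr0; apply: (continuous_cvg _ _ K); exact: sqrt_continuous.
by under eq_fun do rewrite (Hplus_normE _ _ (HplusB (Hw _) Hv)); exact: K2.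
Qed.

(** Strong convergence gives almost everywhere convergence along a subsequence; only the weak
    inequality survives, hence the separate positivity argument. *)
Lemma limit_ge0 (w : nat -> R * R -> R) v : (forall n, Hplus (w n)) -> Hplus v ->
  (forall n, {ae mu2, forall x, H x -> 0 <= w n x}) ->
  qform 1 1 (w n \- v) @[n --> \oo] --> (0 : R) -> {ae mu2, forall x, H x -> 0 <= v x}.
Proof.
move=> Hw Hv w0 lim.
have null : L2_null (fun n x => w n x - v x).
  apply: (L2_null_le _ lim) => n; rewrite qformE !mul1r.
  by apply: (@le_trans _ _ (nsqH (component Ifun (w n \- v)))) => //; rewrite lerDr !addr_ge0// nsq_ge0.
have [s hs sae] := L2_subseq_ae mH (fun n => Hplus_L2 Ifun (Hw n)) (Hplus_L2 Ifun Hv) null.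
apply: ae_imp2 sae (ae_foralln w0) => x h1 h2 Hx.
by apply: (ler_cvg_to (cvg_cst (0 : R)) (h1 Hx)); near=> n; exact: h2.
Unshelve. all: by end_near. Qed.

(** The absolute value makes the right side continuous in [S] on the whole line, as [normpow_cvg]
    requires; the [S] of the statement is itself a power of [m], hence nonnegative. *)
Lemma nehari_scale p (S m : R) : 2 < p -> 0 < m -> S * m ^+ 2 = m `^ p -> m = `|S| `^ (p - 2)^-1.
Proof.
move=> p2 m0 e; have n0 : p - 2 != 0 by rewrite subr_eq0 gt_eqF.
have m2 : m ^+ 2 != 0 by rewrite expf_neq0// gt_eqF.
have -> : S = m `^ (p - 2).
  apply: (mulIf m2); rewrite e -(powR_mulrn _ (ltW m0)) -powRD ?subrK//.
  by apply/implyP => _; exact: lt0r_neq0.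
by rewrite ger0_norm ?powR_ge0// -powRrM mulfV// powRr1// ltW.
Qed.

Lemma scale_nehari p (S : R) : 2 < p -> 0 < S ->
  S * (S `^ (p - 2)^-1) ^+ 2 = (S `^ (p - 2)^-1) `^ p.
Proof.
move=> p2 S0; have n0 : p - 2 != 0 by rewrite subr_eq0 gt_eqF.
set m := S `^ _; have m0 : 0 < m by exact: powR_gt0.
have -> : S = m `^ (p - 2) by rewrite -powRrM mulVf// powRr1// ltW.
rewrite -(powR_mulrn _ (ltW m0)) -powRD ?subrK//.
by apply/implyP => _; exact: lt0r_neq0.
Qed.

End Limit.

Unset Implicit Arguments.

Theorem theorem1p6 (R : realType) (p : R) (lambda : nat -> R)
    (u : nat -> R * R -> R) :
  2 < p ->
  (forall k, 0 < lambda k <= 1) ->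
  lambda k @[k --> \oo] --> (0 : R) ->
  (forall k, least_energy_solution p (lambda k) true (u k)) ->
  (forall k, positive_ae (u k)) ->
  exists (sigma : nat -> nat) (v : R * R -> R),
    [/\ {homo sigma : m n / (m < n)%N},
        Hplus_cvg (fun k => rescale p (lambda (sigma k)) (u (sigma k))) v,
        least_energy_solution p 1 false v &
        positive_ae v].
Proof.
move=> p2 lb llim uls upos.
have l0 k : 0 < lambda k by have /andP[] := lb k.
pose c k := lambda k ^+ 2.
have c0 k : 0 <= c k by exact: sqr_ge0.
have clim : c k @[k --> \oo] --> (0 : R).
  have z : (0 : R) = 0 * 0 by rewrite mulr0.
  by rewrite [X in _ --> X]z /c; under eq_fun do rewrite expr2; exact: cvgM.
pose vk k := rescale p (lambda k) (u k).
have gk k := rescale_ground p2 (l0 k) (least_ground p2 (l0 k) (uls k)).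
have vpos k := rescale_positive p (l0 k) (upos k).
have Hv k : Hplus (vk k) by case: (gk k).
pose m k := pn (lebesgue2 R) half_plane p (vk k).
have m0 k : 0 < m k by case: (gk k).
(* The minimization argument works on the unit sphere of L^p; the norms [m k] are tracked separately
   and put back at the end. *)
pose w k := fun x => (m k)^-1 * vk k x.
have sw k : sphere p (w k) := normalize p2 (Hv k) (lt0r_neq0 (m0 k)).
have Qw k : qform 1 (c k) (w k) = level p 1 (c k).
  rewrite (qformZ 1 (c k) _ (Hv k)); have [_ _ _ ->] := gk k.
  by rewrite mulrCA exprVn mulVf ?mulr1// expf_neq0// gt_eqF.
have mE k : m k = `|level p 1 (c k)| `^ (p - 2)^-1.
  by apply: nehari_scale => //; have [_ _ <- ->] := gk k.
have [wlim Slim] := minimizers_vanishing_mass p2 c0 clim sw Qw.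
have [s [w0 [hs sw0 Qw0 slim]]] := minimizing_seq_cvg p2 ltr01 (lexx 0) sw wlim.
have [Hw0 w01] := sw0.
set S := level p 1 0 in wlim Slim Qw0 *.
(* The limit problem is the case [lambda = 1], [q = 0], whence the simplification of [1 ^+ 2] and
   its inverse. *)
have S0 : 0 < S.
  have := level_gt0 false p2 ltr01 Hw0; rewrite w01 => /(_ ltr01).
  by rewrite expr1n invr1.
pose m1 := S `^ (p - 2)^-1.
have m10 : 0 < m1 by exact: powR_gt0.
have sge n : (n <= s n)%N.
  by elim: n => // n IH; apply: leq_ltn_trans IH _; exact: hs.
have p20 : 0 < (p - 2)^-1 by rewrite invr_gt0 subr_gt0.
(* The Nehari identity determines [m k] from the level of the k-th problem, so convergence of the
   levels gives convergence of the norms. *)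
have mlim : m (s n) @[n --> \oo] --> m1.
  apply: (cvg_sub sge); rewrite /m1 -{1}(gtr0_norm S0).
  by under eq_fun do rewrite mE; exact: normpow_cvg.
pose v x := m1 * w0 x.
have HV : Hplus v := HplusZ m1 Hw0.
have vE k : vk k = (fun x => m k * w k x).
  by apply/funext => x; rewrite /w mulrA divff ?mul1r// gt_eqF.
have lim : qform 1 1 (vk (s n) \- v) @[n --> \oo] --> (0 : R).
  under eq_fun do rewrite vE.
  by apply: (scale_cvg (fun n => (sw (s n)).1) Hw0 mlim slim).
have pnv : pn (lebesgue2 R) half_plane p v = m1.
  have Lw := Hplus_Lp (ltW p2) Hw0.
  have p0 : 0 < p by apply: lt_trans p2; rewrite ltr0n.
  by rewrite /v (pnZ (@measurable_half_plane R) m1 p0 Lw) w01 mulr1 gtr0_norm.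
have Qv : qform 1 0 v = S * pn (lebesgue2 R) half_plane p v ^+ 2.
  by rewrite pnv (qformZ 1 0 _ Hw0) Qw0 mulrC.
have gv : ground p 1 false v.
  rewrite /ground expr1n invr1 (_ : false%:R = 0)//; split; [exact: HV|by rewrite pnv| |exact: Qv].
  by rewrite Qv pnv; exact: scale_nehari.
have v0 := limit_ge0 (fun n => Hv (s n)) HV (fun n => vpos (s n)) lim.
exists s, v; split; [exact: hs| | |].
- exact: (Hplus_cvg_qform (fun n => Hv (s n)) HV lim).
- exact: ground_least gv.
- by apply: (ground_positive p2 HV Qv v0); apply: (pn_nontrivial p2 HV); rewrite pnv.
Qed.
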